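(* Let $N\ge 2$, let $\beta>-1$, and let $\Omega\subset\mathbb{R}^N$ be a bounded connected open set whose boundary is Lipschitz if $\beta\ge 0$ and of class $C^1$ if $-1<\beta<0$. Then there exists a minimum of the problem $$\Lambda(\Omega,\beta)=\inf_{u\in BV(\Omega),\,u\not\equiv 0}J(u).$$ In particular, $$\Lambda(\Omega,\beta)=\ell(\Omega,\beta).$$ Moreover, if $v\in BV(\Omega)$ is a minimizer of this problem (i.e. $v\not\equiv0$ and $J(v)=\Lambda(\Omega,\beta)$), then $$\Lambda(\Omega,\beta)=R(\{v>t\},\beta)$$ for some $t\in\mathbb{R}$.
   Context: For $u\in BV(\Omega)$, $u\not\equiv0$, let $$J(u)=\frac{|Du|(\Omega)+\min(\beta,1)\int_{\partial\Omega}|u|\,d\mathcal{H}^{N-1}}{\int_\Omega|u|\,dx},$$ where $|Du|(\Omega)$ is the total variation of $u$ in $\Omega$ and, in the boundary integral, $u$ denotes the trace of $u$ on $\partial\Omega$. For $E\subseteq\Omega$ (of positive measure and finite perimeter in $\Omega$, so that $J(\chi_E)$ is defined), let $$R(E,\beta)=J(\chi_E)=\frac{P_\Omega(E)+\min(\beta,1)\,\mathcal{H}^{N-1}(\partial\Omega\cap\partial E)}{|E|},$$ where $\chi_E$ is the characteristic function of $E$, $P_\Omega(E)=|D\chi_E|(\Omega)$ is the perimeter of $E$ in $\Omega$, $|E|$ is the Lebesgue measure of $E$ and $\mathcal{H}^{N-1}$ is the $(N-1)$-dimensional Hausdorff measure. Let $$\ell(\Omega,\beta)=\inf_{E\sub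seteq\Omega}R(E,\beta).$$
   Formalization: In the last claim the minimizer v is assumed not to be ≤ 0 almost everywhere in Ω; without this it fails, e.g. for v = −χ_E with E the Cheeger set of a square Ω and β ≥ 1, where no set {v>t} attains Λ. *)

(* Defs.v *)
From HB Require Import structures.
From mathcomp Require Import all_boot all_order all_algebra.
From mathcomp Require Import all_classical all_reals all_analysis.

Set Implicit Arguments.
Unset Strict Implicit.
Unset Printing Implicit Defensive.

Import Order.TTheory GRing.Theory Num.Theory.
Import numFieldTopology.Exports numFieldNormedType.Exports.

Local Open Scope classical_set_scope.
Local Open Scope ring_scope.

(* The outer measure generated by the weights [w j] of the sets [c j]. The
   index [None] stands for the empty set, so that finite covers are allowed. *)
Section cover_outer.
Context {R : realType} {T J : Type}.
Variables (c : J -> set T) (w : J -> \bar R).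

Definition cover_set : option J -> set T := oapp c set0.

Definition cover_weight : option J -> \bar R := oapp w 0%E.

Definition cover_outer (X : set T) : \bar R :=
  ereal_inf [set (\sum_(0 <= k <oo) cover_weight (j k))%E
            | j in [set j : nat -> option J
                   | X `<=` \bigcup_k cover_set (j k)]].

Hypothesis w_ge0 : forall j, (0 <= w j)%E.

Local Open Scope ereal_scope.

Lemma cover_weight_ge0 j : 0 <= cover_weight j.
Proof. by case: j => /=. Qed.

Lemma cover_outer_ge0 X : 0 <= cover_outer X.
Proof.
apply: le_ereal_inf_tmp => _ [j _ <-].
by apply: nneseries_ge0 => *; exact: cover_weight_ge0.
Qed.

Lemma cover_outer0 : cover_outer set0 = 0.
Proof.
apply/eqP; rewrite eq_le cover_outer_ge0 andbT.
apply: ereal_inf_lbound; exists (fun=> None) => //.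
by rewrite eseries0.
Qed.

Lemma le_cover_outer : {homo cover_outer : A B / A `<=` B >-> A <= B}.
Proof.
move=> A B AB; apply: ereal_inf_le_tmp => _ [j jB <-].
by exists j => //; exact: subset_trans jB.
Qed.

Lemma cover_outer_sigma_subadditive : sigma_subadditive cover_outer.
Proof.
move=> A; have [[i ioo]|] := pselect (exists i, cover_outer (A i) = +oo).
  rewrite (eseries_pinfty _ _ ioo) ?leey// => n _.
  by rewrite -ltNye (lt_le_trans _ (cover_outer_ge0 _)).
rewrite -forallNE => Aoo.
suff add2e (e : {posnum R}) :
    cover_outer (\bigcup_n A n) <=
    \sum_(0 <= i <oo) cover_outer (A i) + e%:num%:E.
  by apply/lee_addgt0Pr => _/posnumP[].
rewrite (le_trans _ (epsilon_trick _ _ _))//; last first.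
  by move=> n; exact: cover_outer_ge0.
pose P n (j : nat -> option J) := A n `<=` \bigcup_k cover_set (j k) /\
  \sum_(0 <= k <oo) cover_weight (j k) <=
  cover_outer (A n) + (e%:num / (2 ^ n.+1)%:R)%:E.
have [G PG] : {G : nat -> nat -> option J & forall n, P n (G n)}.
  apply: (@choice _ _ P) => n; rewrite /P.
  have An_fin : cover_outer (A n) \is a fin_num.
    by rewrite ge0_fin_numE ?cover_outer_ge0// ltey; apply/eqP/Aoo.
  have en1 : (0 < e%:num / (2 ^ n.+1)%:R)%R by [].
  have [_ [j jA <-] /ltW jle] := lb_ereal_inf_adherent en1 An_fin.
  by exists j; split.
have wG_ge0 x : 0 <= (cover_weight \o uncurry G) x by exact: cover_weight_ge0.
apply: (@le_trans _ _ (\esum_(i in setT) (cover_weight \o uncurry G) i)).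
  apply: ereal_inf_lbound => /=.
  have /card_esym/ppcard_eqP[f] := card_nat2.
  exists (uncurry G \o f).
    move=> t [i _ Ait]; have [k _ Gt] := (PG i).1 _ Ait.
    by exists (f^-1%FUN (i, k)) => //=; rewrite invK ?inE.
  rewrite -(esum_pred_image (cover_weight \o uncurry G) _ xpredT)
    ?[fun=> _]set_true//.
  by rewrite image_eq.
rewrite (_ : esum _ _ =
    \sum_(0 <= i <oo) \sum_(0 <= k <oo) cover_weight (G i k)); last first.
  pose K : nat -> set (nat * nat) := fun i => [set (i, k) | k in setT].
  rewrite (_ : setT = \bigcup_k K k); last first.
    by rewrite predeqE => -[a b]; split => // _; exists a => //; exists b.
  rewrite esum_bigcupT /=; last 2 first.
    - apply/trivIsetP => i j _ _ ij.
      rewrite predeqE => -[n m] /=; split => //= -[] [_] _ [<-{n} _].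
      by move=> [m' _] [] /esym/eqP; rewrite (negbTE ij).
    - by move=> /= [n m]; exact: cover_weight_ge0.
  rewrite -(image_id [set: nat]) -fun_true esum_pred_image//; last first.
    by move=> n _; apply: esum_ge0 => *; exact: wG_ge0.
  apply: eq_eseriesr => /= j _.
  rewrite -(esum_pred_image (cover_weight \o uncurry G) (pair j) predT)/=; last 2 first.
    - by move=> n _; exact: cover_weight_ge0.
    - by move=> ? ? _ _; exact: (@can_inj _ _ _ snd).
  by congr esum; rewrite predeqE => -[a b]; split; move=> [i _ <-]; exists i.
apply: lee_nneseries => n *; last exact: (PG n).2.
by apply: nneseries_ge0 => m *; exact: (wG_ge0 (n, m)).
Qed.

End cover_outer.

(* The norm of ['rV[R]_N] in the library is the sup norm; it is used below only
   through the topology, boundedness and the Lipschitz property it induces. *)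
Section euclidean.
Context {R : realType} {N : nat}.
Implicit Types (x y : 'rV[R]_N) (r : R) (A : set 'rV[R]_N).

Definition enorm x : R := Num.sqrt (\sum_i x 0 i ^+ 2).

Definition eball x r : set 'rV[R]_N := [set y | enorm (y - x) < r].

Definition diam A : \bar R :=
  ereal_sup [set (enorm (p.1 - p.2))%:E | p in A `*` A].

Definition frontier A : set 'rV[R]_N := closure A `\` interior A.

End euclidean.

Section lebesgue_outer.
Context {R : realType} {N : nat}.

Definition box (ab : 'rV[R]_N * 'rV[R]_N) : set 'rV[R]_N :=
  [set x | forall i, ab.1 0 i <= x 0 i <= ab.2 0 i].

Definition box_volume (ab : 'rV[R]_N * 'rV[R]_N) : \bar R :=
  (\prod_i Num.max 0 (ab.2 0 i - ab.1 0 i))%:E.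

Lemma box_volume_ge0 ab : (0 <= box_volume ab)%E.
Proof. by rewrite lee_fin prodr_ge0// => i _; rewrite le_max lexx. Qed.

Definition lebesgue_outer : set 'rV[R]_N -> \bar R :=
  cover_outer box box_volume.

HB.instance Definition _ := isOuterMeasure.Build R 'rV[R]_N lebesgue_outer
  (cover_outer0 box box_volume_ge0) (cover_outer_ge0 box box_volume_ge0)
  (@le_cover_outer _ _ _ box box_volume)
  (cover_outer_sigma_subadditive box box_volume_ge0).

End lebesgue_outer.

Section hausdorff_outer.
Context {R : realType} {N : nat} (s : nat).

(* The normalization is the volume of the unit ball of R^s divided by 2^s. *)
Definition hausdorff_weight (delta : R) (C : set 'rV[R]_N) : \bar R :=
  if (diam C <= delta%:E)%E then
    (lebesgue_outer (eball (0 : 'rV[R]_s) 1) * ((fine (diam C) / 2) ^+ s)%:E)%E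
  else +oo%E.

Lemma hausdorff_weight_ge0 delta C : (0 <= hausdorff_weight delta C)%E.
Proof.
rewrite /hausdorff_weight; case: ifP => // _.
rewrite mule_ge0 ?outer_measure_ge0// lee_fin exprn_ge0// divr_ge0//.
have [->|/set0P[x Cx]] := eqVneq C set0.
  by rewrite /diam setX0 image_set0 ereal_sup0.
apply: fine_ge0; apply: le_ereal_sup_tmp; exists 0%E => //.
exists (x, x) => //=; rewrite subrr /enorm big1 ?sqrtr0// => i _.
by rewrite mxE expr0n.
Qed.

Definition hausdorff_delta (delta : R) : set 'rV[R]_N -> \bar R :=
  cover_outer id (hausdorff_weight delta).

Definition hausdorff_outer (A : set 'rV[R]_N) : \bar R :=
  ereal_sup [set hausdorff_delta delta A | delta in [set d | 0 < d]].

Lemma hausdorff_outer_ge0 A : (0 <= hausdorff_outer A)%E.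
Proof.
apply: le_ereal_sup_tmp; exists (hausdorff_delta 1 A); first by exists 1 => //=.
exact/cover_outer_ge0/hausdorff_weight_ge0.
Qed.

Lemma hausdorff_outer0 : hausdorff_outer set0 = 0%E.
Proof.
apply/eqP; rewrite eq_le hausdorff_outer_ge0 andbT.
apply: ge_ereal_sup => _ [d _ <-].
by rewrite /hausdorff_delta cover_outer0//; exact: hausdorff_weight_ge0.
Qed.

Lemma le_hausdorff_outer :
  {homo hausdorff_outer : A B / A `<=` B >-> (A <= B)%E}.
Proof.
move=> A B AB; apply: ge_ereal_sup => _ [d d0 <-].
apply: le_ereal_sup_tmp; exists (hausdorff_delta d B); first by exists d.
exact: le_cover_outer.
Qed.

Lemma hausdorff_outer_sigma_subadditive : sigma_subadditive hausdorff_outer.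
Proof.
move=> F; apply: ge_ereal_sup => _ [d d0 <-].
apply: (le_trans (cover_outer_sigma_subadditive id (hausdorff_weight_ge0 d) F)).
apply: lee_nneseries => [n _ _|n _].
  exact/cover_outer_ge0/hausdorff_weight_ge0.
by apply: ereal_sup_ubound; exists d.
Qed.

HB.instance Definition _ := isOuterMeasure.Build R 'rV[R]_N hausdorff_outer
  hausdorff_outer0 hausdorff_outer_ge0 le_hausdorff_outer
  hausdorff_outer_sigma_subadditive.

End hausdorff_outer.

(* Both measures live on the sigma-algebra of Caratheodory measurable sets,
   which for the first one is that of the Lebesgue measurable sets. *)
Definition leb {R : realType} {N : nat} :
  set (caratheodory_type (@lebesgue_outer R N)) -> \bar R := lebesgue_outer.

HB.instance Definition _ (R : realType) (N : nat) :=
  isMeasure.Build _ _ R (@leb R N)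
    (caratheodory_measure0 (@lebesgue_outer R N))
    (caratheodory_measure_ge0 (mu := @lebesgue_outer R N))
    (@caratheodory_measure_sigma_additive _ _ (@lebesgue_outer R N)).

Definition haus {R : realType} {N : nat} (s : nat) :
  set (caratheodory_type (@hausdorff_outer R N s)) -> \bar R :=
  hausdorff_outer s.

Arguments haus {R N} s _.

HB.instance Definition _ (R : realType) (N s : nat) :=
  isMeasure.Build _ _ R (@haus R N s)
    (caratheodory_measure0 (@hausdorff_outer R N s))
    (caratheodory_measure_ge0 (mu := @hausdorff_outer R N s))
    (@caratheodory_measure_sigma_additive _ _ (@hausdorff_outer R N s)).

Section regularity.
Context {R : realType}.

Definition C1 (V W : normedModType R) (f : V -> W) : Prop :=
  (forall x, differentiable f x) /\ (forall v, continuous (fun x => 'D_v f x)).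

(* Up to a change of orthonormal coordinates, [Omega] is near each boundary
   point the part of the space lying strictly above the graph of a function of
   [N.-1] variables satisfying [P]. *)
Definition graph_boundary {N : nat} (P : ('rV[R]_(N.-1) -> R) -> Prop)
    (Omega : set 'rV[R]_N) : Prop :=
  forall x, frontier Omega x ->
    exists (r : R) (Q : 'M[R]_N) (i : 'I_N) (g : 'rV[R]_(N.-1) -> R),
      [/\ 0 < r, Q *m Q^T = 1%:M, P g &
          forall y, eball x r y ->
            (Omega y <-> g (col' i (y *m Q)) < (y *m Q) 0 i)].

Definition lipschitz_boundary {N : nat} (Omega : set 'rV[R]_N) : Prop :=
  graph_boundary (fun g => lipschitz g) Omega.

Definition C1_boundary {N : nat} (Omega : set 'rV[R]_N) : Prop :=
  graph_boundary (fun g => C1 g) Omega.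

End regularity.

Section bounded_variation.
Context {R : realType} {N : nat} (Omega : set 'rV[R]_N).
Implicit Types (u : 'rV[R]_N -> R) (E : set 'rV[R]_N).

Definition divergence (phi : 'rV[R]_N -> 'rV[R]_N) (x : 'rV[R]_N) : R :=
  \sum_i ('D_(delta_mx 0 i) phi x) 0 i.

Definition test_field (phi : 'rV[R]_N -> 'rV[R]_N) : Prop :=
  [/\ C1 phi,
      exists2 K, compact K /\ K `<=` Omega & forall x, ~ K x -> phi x = 0 &
      forall x, enorm (phi x) <= 1].

Definition total_var u : \bar R :=
  ereal_sup [set (\int[leb]_(x in Omega) (u x * divergence phi x)%:E)%E
            | phi in test_field].

Definition in_BV u : Prop :=
  leb.-integrable Omega (EFin \o u) /\ (total_var u < +oo)%E.

Definition nonzero u : Prop := ~ {ae leb, forall x, Omega x -> u x = 0}.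

(* For [u] in BV of a bounded Lipschitz domain such a [c] exists, and is unique,
   at almost every boundary point for the (N-1)-dimensional Hausdorff measure;
   [trace] is 0 at points where there is none. *)
Definition is_trace u (x : 'rV[R]_N) (c : R) : Prop :=
  ((r ^- N)%:E * \int[leb]_(y in Omega `&` eball x r) (`|u y - c|)%:E)%E
    @[r --> 0^'+] --> 0%E.

Definition trace u (x : 'rV[R]_N) : R := xget 0 (is_trace u x).

Variable beta : R.

Definition J u : \bar R :=
  ((total_var u + (Num.min beta 1)%:E *
      \int[haus N.-1]_(x in frontier Omega) (`|trace u x|)%:E)
   / \int[leb]_(x in Omega) (`|u x|)%:E)%E.

Definition Lambda : \bar R :=
  ereal_inf [set J u | u in [set u | in_BV u /\ nonzero u]].

(* [J] is even, so that opposites of minimizers are minimizers. *)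
Definition is_minimizer u : Prop :=
  [/\ in_BV u, nonzero u & J u = Lambda].

Definition admissible E : Prop :=
  [/\ E `<=` Omega, lebesgue_outer.-cara.-measurable E, (0 < leb E)%E &
      (total_var (\1_E : 'rV[R]_N -> R) < +oo)%E].

(* The trace of [\1_E] is itself an indicator, and the boundary integral in [J]
   is the Hausdorff measure of the part of the boundary that [E] touches. *)
Definition Rquot E : \bar R := J (\1_E : 'rV[R]_N -> R).

Definition ell : \bar R := ereal_inf [set Rquot E | E in admissible].

End bounded_variation.

(* Main.v *)
(* The functional is studied on C1 functions only: a function of bounded
   variation is the strict limit of C1 functions (mollify it after a small inward
   translation, patch by patch), and the traces of such a sequence form a Cauchy
   sequence for the Hausdorff measure, whose limit is the trace (Vitali covering
   and a weak-type estimate).  For C1 functions everything rests on the inequality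
   int_{bd Omega} |w| <= M^{N-1} int_{collar} |grad w| + C int_Omega |w|,
   which is proved by sweeping tubes over almost flat pieces of the boundary, so
   that only upper bounds of the Hausdorff measure are needed.  The constant M can
   be taken arbitrarily close to 1: by continuity of the normal if the boundary is
   C1, and off a subset of small measure if it is Lipschitz, where gradients of
   C1 approximations with almost minimal Dirichlet energy replace Rademacher's
   theorem.  Since |min(beta, 1)| <= 1, with strict inequality when beta < 0, the
   boundary term cannot spoil the lower semicontinuity of the energy.  Averaging
   over small inward translated balls gives compactness in L1, hence a minimizer.
   Finally, for v of class C1 the energy is additive along v = T v + (v - T v)
   when T and id - T are nondecreasing; taking for T a truncation at height h and
   letting h tend to 0, T v / h tends to the indicator of {v > 0}, so that the
   superlevel set at t = 0 of any minimizer is again minimal. *)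

Require Import Defs.
From HB Require Import structures.
From mathcomp Require Import all_boot all_order all_algebra.
From mathcomp Require Import all_classical all_reals all_analysis.
From mathcomp Require Import measurable_realfun ring lra zify.
Set Implicit Arguments.
Unset Strict Implicit.
Unset Printing Implicit Defensive.
Import Order.TTheory GRing.Theory Num.Theory.
Import numFieldTopology.Exports numFieldNormedType.Exports.
Import HBSimple.
Local Open Scope classical_set_scope.
Local Open Scope ring_scope.

(** Lower semicontinuity is where the two parts of the energy interact. One compactly supported test
    field whose pairing with [u] is within [e] of the total variation controls, in a fixed collar,
    the gradient mass of every C1 function close to [u] in L1: it is at most the excess of its total
    gradient mass over that pairing. Along strict approximations the excess is small, so their
    difference from a sequence of bounded energy has a trace bounded by [M ^+ n] times the variation
    lost in the limit, and a factor near 1 lets that loss pay for the boundary term. The sign of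
    [b = min(beta, 1)] decides what may be thrown away: if [b >= 0], the approximating traces on a
    small exceptional piece [V] enter with a favourable sign; if [b < 0] they do not, whence [V]
    must be empty and the boundary C1. For superlevel sets, [energy - lam * mass] is nonnegative on
    C1 functions, adds up over a truncation and its complement, and almost vanishes on an
    approximation of the minimizer, so it almost vanishes on the truncation. Rescaling to height 1
    divides by [h / 2], so the approximation error is taken of order [h ^+ 2]. *)

Notation lmble A := (measurable (A : set (caratheodory_type lebesgue_outer))).

(** * Outer measures generated by covers *)

Section cover_outer_theory.
Context {R : realType} {T J : Type} (c : J -> set T) (w : J -> \bar R).
Local Open Scope ereal_scope.

Lemma cover_outer_le (j : nat -> option J) (X : set T) :
  X `<=` \bigcup_k cover_set c (j k) ->
  cover_outer c w X <= \sum_(0 <= k <oo) cover_weight w (j k).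
Proof. by move=> h; apply: ereal_inf_lbound; exists j. Qed.

Lemma le_cover_outerP (X : set T) (y : \bar R) :
  (forall j, X `<=` \bigcup_k cover_set c (j k) ->
    y <= \sum_(0 <= k <oo) cover_weight w (j k)) ->
  y <= cover_outer c w X.
Proof. by move=> h; apply: le_ereal_inf_tmp => _ [j jX <-]; exact: h. Qed.

Lemma cover_outer_le1 (j : J) (X : set T) : (forall j, 0 <= w j) ->
  X `<=` c j -> cover_outer c w X <= w j.
Proof.
move=> w0 h; apply: (le_trans (@cover_outer_le
  (fun k => if k is 0%N then Some j else None) X _)).
  by move=> x Xx; exists 0%N => //=; exact: h.
rewrite (nneseries_split 0 1)//; last by move=> k _; exact: cover_weight_ge0.
rewrite big_nat_recl//= big_nil adde0 add0n eseries0 ?adde0//.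
by case.
Qed.

End cover_outer_theory.

(** * Borel sets and boxes *)

Section borel_caratheodory.
Context {R : realType} {n : nat} (mu : {outer_measure set 'rV[R]_n -> \bar R}).
Hypothesis halfspace_mble : forall (i : 'I_n) (c : R),
  measurable ([set x : 'rV[R]_n | x 0 i <= c] : set (caratheodory_type mu)).
Implicit Types (x y : 'rV[R]_n) (A : set 'rV[R]_n).

(** The outer measure [mu] is kept abstract: once closed half-spaces are measurable, so are all
    Borel sets. This is used for Lebesgue measure and for Hausdorff measure alike. *)
Lemma coord_cmble_fun (i : 'I_n) :
  measurable_fun setT ((fun x => x 0 i) : caratheodory_type mu -> R).
Proof.
apply: (measurability _ (RGenOInfty.measurableE R)) => // _ [_ [c ->] <-].
rewrite setTI (_ : _ @^-1` _ = ~` [set x : 'rV[R]_n | x 0 i <= c]).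
  exact/measurableC/halfspace_mble.
apply/seteqP; split=> x /=; rewrite in_itv/= andbT ltNge; first by move=> /negP.
by move=> h; apply/negP.
Qed.

Lemma ballE x (r : R) : 0 < r -> ball x r = \bigcap_(i in [set: 'I_n]) [set y | `|x 0 i - y 0 i| < r].
Proof.
move=> r0; apply/seteqP; split=> y.
  by move=> [_ h] i _ /=; exact: (h 0 i).
by move=> h; split => // i j; rewrite (ord1 i); exact: h.
Qed.

Lemma ball_cmble x (r : R) : measurable (ball x r : set (caratheodory_type mu)).
Proof.
have [r0|r0] := ltP 0 r; last first.
  rewrite (_ : ball _ _ = set0); first exact: measurable0.
  by apply/seteqP; split=> // y [] /lt_geF; rewrite r0.
rewrite ballE//; apply: fin_bigcap_measurable => // i _.
rewrite (_ : measurable _ = measurable (setT `&` (fun y : caratheodory_type mu => y 0 i) @^-1`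
   `]x 0 i - r, (x 0 i + r)[%classic)).
  by apply: coord_cmble_fun => //; exact: measurable_itv.
congr measurable; rewrite setTI; apply/seteqP; split=> y /=; rewrite in_itv/= ltr_distlC; lra.
Qed.

Definition ratv (q : 'rV[rat]_n) : 'rV[R]_n := map_mx ratr q.

Lemma ratv_dense x (e : R) : 0 < e -> exists q, ball (ratv q) e x.
Proof.
move=> e0; have h i : exists q : rat, `|ratr q - x 0 i| < e.
  have /rat_in_itvoo[q] : x 0 i - e < x 0 i + e by rewrite ltrBlDr -addrA ltrDl addr_gt0.
  rewrite in_itv/= => qe; exists q; rewrite ltr_distlC; lra.
have [f fP] := choice h; exists (\row_i f i).
by split => // i j; rewrite (ord1 i) !mxE; exact: fP.
Qed.

Lemma open_rat_balls A : open A ->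
  A = \bigcup_(p in [set p : 'rV[rat]_n * nat | ball (ratv p.1) p.2.+1%:R^-1 `<=` A])
        ball (ratv p.1) p.2.+1%:R^-1.
Proof.
move=> oA; apply/seteqP; split=> [x Ax|x [p /= pA /pA]//].
have /nbhs_ballP[e /= e0 eA] := open_nbhs_nbhs (conj oA Ax).
have [k ke] : exists k, k.+1%:R^-1 < e / 2.
  have := near_infty_natSinv_lt (PosNum (divr_gt0 e0 (@ltr0n R 2))).
  by move=> [k _ /(_ k)] /(_ (leqnn _)) /= h; exists k.
have [q qx] := @ratv_dense x k.+1%:R^-1 (ltac:(by rewrite invr_gt0)).
exists (q, k) => //= y qy; apply: eA.
apply: (@le_ball _ _ _ (k.+1%:R^-1 + k.+1%:R^-1)); first by move: ke; set t := _^-1; lra.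
by apply: ball_triangle qy; exact: ball_sym.
Qed.

Lemma open_cmble A : open A -> measurable (A : set (caratheodory_type mu)).
Proof.
move=> /open_rat_balls ->; rewrite bigcup_mkcond.
apply: countable_bigcupT_measurable => [|p]; first exact: countableP.
by case: ifPn => _; [exact: ball_cmble|exact: measurable0].
Qed.

Lemma closed_cmble A : closed A -> measurable (A : set (caratheodory_type mu)).
Proof. by move=> cA; rewrite -(setCK A); apply/measurableC/open_cmble/closed_openC. Qed.

Lemma compact_cmble A : compact A -> measurable (A : set (caratheodory_type mu)).
Proof. by move=> cA; apply: closed_cmble; apply: compact_closed cA; exact: norm_hausdorff. Qed.

Lemma cont_cmble_fun (f : 'rV[R]_n -> R) (D : set 'rV[R]_n) : continuous f ->
  measurable_fun (D : set (caratheodory_type mu)) f.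
Proof.
move=> cf mD; apply: (measurability _ (RGenOpens.measurableE R)) => // _ [_ [a [b ->]] <-].
apply: measurableI => //; apply: open_cmble.
by apply: open_comp => // x _; exact: cf.
Qed.

End borel_caratheodory.

Section lebesgue_boxes.
Context {R : realType} {n : nat}.
Implicit Types (x y a b : 'rV[R]_n) (A X : set 'rV[R]_n).

Definition set_coord x (i : 'I_n) (c : R) : 'rV[R]_n :=
  \row_j (if j == i then c else x 0 j).

(** Caratheodory's criterion on covers: the hyperplane cuts a box into two boxes whose volumes add
    up. [f] lowers the upper corner to [c], [g] raises the lower one; the [max 0] in [box_volume]
    takes care of the boxes that become empty. *)
Lemma halfspace_lmble (i : 'I_n) (c : R) :
  lmble [set x : 'rV[R]_n | x 0 i <= c].
Proof.
apply: le_caratheodory_measurable => X.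
pose f (o : option ('rV[R]_n * 'rV[R]_n)) :=
  omap (fun ab => (ab.1, set_coord ab.2 i (Num.min (ab.2 0 i) c))) o.
pose g (o : option ('rV[R]_n * 'rV[R]_n)) :=
  omap (fun ab => (set_coord ab.1 i (Num.max (ab.1 0 i) c), ab.2)) o.
apply: le_cover_outerP => j jX.
have w0 := @cover_weight_ge0 R _ box_volume (@box_volume_ge0 R n).
have -> : (\sum_(0 <= k <oo) cover_weight box_volume (j k) =
  \sum_(0 <= k <oo) cover_weight box_volume (f (j k)) +
  \sum_(0 <= k <oo) cover_weight box_volume (g (j k)))%E.
  rewrite -nneseriesD; [|by move=> *; exact: w0..].
  apply: eq_eseriesr => k _; case: (j k) => [[a b]|]/=; last by rewrite adde0.
  rewrite /box_volume/= -EFinD; congr (_%:E).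
  rewrite (bigD1 i)//= [X in _ = X + _](bigD1 i)//= [X in _ = _ + X](bigD1 i)//=.
  rewrite !mxE eqxx.
  rewrite (@eq_bigr _ _ _ _ _ _ (fun j0 => Num.max 0
     ((set_coord b i (Num.min (b 0 i) c)) 0 j0 - a 0 j0))
     (fun j0 => Num.max 0 (b 0 j0 - a 0 j0))); last first.
    by move=> k0 k0i; rewrite mxE (negbTE k0i).
  rewrite (@eq_bigr _ _ _ _ _ _ (fun j0 => Num.max 0
     (b 0 j0 - (set_coord a i (Num.max (a 0 i) c)) 0 j0))
     (fun j0 => Num.max 0 (b 0 j0 - a 0 j0))); last first.
    by move=> k0 k0i; rewrite mxE (negbTE k0i).
  rewrite -mulrDl; congr (_ * _).
  by rewrite !maxEle !minEle; repeat (case: ifPn => //); lra.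
apply: leeD; apply: cover_outer_le => x [Xx /= xc].
  have [k _ xk] := jX _ Xx; exists k => //; move: xk.
  case: (j k) => [[a b]|]//= h i0; rewrite mxE; have := h i0 => /=.
  case: eqP => [->|//] /andP[-> /=]; rewrite le_min => ->.
  exact: xc.
have [k _ xk] := jX _ Xx; exists k => //; move: xk.
case: (j k) => [[a b]|]//= h i0; rewrite mxE; have := h i0 => /=.
case: eqP => [->|//] /andP[h1 ->]; rewrite ge_max h1/= andbT.
by rewrite leNgt; apply/negP => /ltW.
Qed.

Lemma coord_lmble_fun (i : 'I_n) :
  measurable_fun setT ((fun x => x 0 i) : caratheodory_type (@lebesgue_outer R n) -> R).
Proof. exact: (coord_cmble_fun halfspace_lmble). Qed.

Lemma open_lmble A : open A -> lmble A.
Proof. exact: (open_cmble halfspace_lmble). Qed.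

Lemma closed_lmble A : closed A -> lmble A.
Proof. exact: (closed_cmble halfspace_lmble). Qed.

Lemma compact_lmble A : compact A -> lmble A.
Proof. exact: (compact_cmble halfspace_lmble). Qed.

Lemma cont_lmble_fun (f : 'rV[R]_n -> R) (D : set 'rV[R]_n) : continuous f ->
  measurable_fun (D : set (caratheodory_type (@lebesgue_outer R n))) f.
Proof. exact: (cont_cmble_fun halfspace_lmble). Qed.

Lemma box_lmble (ab : 'rV[R]_n * 'rV[R]_n) : lmble (box ab).
Proof.
apply: closed_lmble; rewrite (_ : box ab = \bigcap_(i in [set: 'I_n]) ((fun x => x 0 i) @^-1` `[ab.1 0 i, ab.2 0 i]%classic)).
  apply: closed_bigI => i _; apply: closed_comp => [x _|]; first exact: coord_continuous.
  exact: interval_closed.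
by apply/seteqP; split=> [x h i _|x h i]/=; rewrite ?in_itv/=; [exact: h|have := h i I; rewrite /= in_itv].
Qed.

End lebesgue_boxes.

Section generic_measure.
Context d (T : measurableType d) {R : realType} (mu : {measure set T -> \bar R}).
Local Open Scope ereal_scope.

Lemma measurable_scaled_indic (c : R) (A : set T) : measurable A ->
  measurable_fun setT (fun x => (c * \1_A x)%:E).
Proof.
by move=> mA; apply/measurable_EFinP; apply: measurable_funM => //; exact: measurable_indic.
Qed.

Lemma integral_scaled_indic (c : R) (A : set T) : measurable A -> (0 <= c)%R ->
  \int[mu]_x (c * \1_A x)%:E = c%:E * mu A.
Proof.
move=> mA c0; under eq_integral do rewrite EFinM.
rewrite ge0_integralZl//=; first by rewrite integral_indic// setIT.
by apply/measurable_EFinP; exact: measurable_indic.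
Qed.

Lemma ge0_markov (D : set T) (f : T -> \bar R) (c : R) : measurable D -> measurable_fun D f ->
  (forall x, D x -> 0 <= f x) -> (0 < c)%R ->
  c%:E * mu (D `&` [set x | c%:E <= f x]) <= \int[mu]_(x in D) f x.
Proof.
move=> mD mf f0 c0; have := @le_integral_comp_abse _ _ _ mu D mD f c id (@measurable_id _ _ _).
move=> /(_ (fun r h => h) (fun _ _ _ _ h => h) mf c0) /=.
rewrite (_ : _ `&` _ = D `&` [set x | c%:E <= f x]); last first.
  by apply/seteqP; split=> x [Dx /=]; rewrite gee0_abs// ?f0.
move=> /le_trans; apply; rewrite le_eqVlt; apply/orP; left; apply/eqP.
by apply: eq_integral => x; rewrite inE => Dx; rewrite gee0_abs ?f0.
Qed.

End generic_measure.

Section box_volumes.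
Context {R : realType}.
Local Open Scope ereal_scope.

(* Integrating the pointwise bound one coordinate at a time. *)
Lemma weighted_box_cover n (c0 : R) (a0 b0 : 'I_n -> R) (c : nat -> R) (a b : nat -> 'I_n -> R) :
  (forall k, 0 <= c k)%R ->
  (forall x : 'I_n -> R, (c0 * \prod_i (a0 i <= x i <= b0 i)%R%:R)%:E <=
     \sum_(0 <= k <oo) (c k * \prod_i (a k i <= x i <= b k i)%R%:R)%:E) ->
  (c0 * \prod_i Num.max 0 (b0 i - a0 i))%:E <=
     \sum_(0 <= k <oo) (c k * \prod_i Num.max 0 (b k i - a k i))%:E.
Proof.
elim: n c0 a0 b0 c a b => [|n IH] c0 a0 b0 c a b c_ge0 h.
  (* In dimension 0 there is a single point, and the pointwise hypothesis at it is the claim. *)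
  have := h (fun=> 0%R); rewrite !big_ord0; under eq_eseriesr do rewrite big_ord0.
  by move=> /le_trans; apply; under [leRHS]eq_eseriesr do rewrite big_ord0.
have {}IH t : (c0 * (a0 ord0 <= t <= b0 ord0)%R%:R * \prod_(i < n) Num.max 0 (b0 (lift ord0 i) - a0 (lift ord0 i)))%:E <=
     \sum_(0 <= k <oo) (c k * (a k ord0 <= t <= b k ord0)%R%:R * \prod_(i < n) Num.max 0 (b k (lift ord0 i) - a k (lift ord0 i)))%:E.
  apply: IH => [k|x]; first by rewrite mulr_ge0.
  (* The point with first coordinate [t] and remaining coordinates [x]; the factor of the first
     coordinate is absorbed into the weights. *)
  have := h (fun i => oapp x t (unlift ord0 i)).
  rewrite big_ord_recl unlift_none/= mulrA.
  under eq_bigr do rewrite liftK/=.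
  move=> /le_trans; apply.
  apply: lee_nneseries => [k _ _|k _].
    by rewrite lee_fin mulr_ge0// prodr_ge0.
  rewrite big_ord_recl unlift_none/= mulrA.
  by under eq_bigr do rewrite liftK/=.
have ind (u v : R) : (fun t => (u <= t <= v)%R%:R) = \1_(`[u, v]%classic) :> (R -> R).
  by apply/funext => t; rewrite indicE mem_setE in_itv.
have mi (u v k w : R) : measurable_fun setT (fun t => (k * (u <= t <= v)%R%:R * w)%:E).
  apply/measurable_EFinP; apply: measurable_funM => //; apply: measurable_funM => //.
  by rewrite ind; apply: measurable_indic; exact: measurable_itv.
have intE (k u v w : R) : (0 <= k)%R -> (0 <= w)%R -> \int[lebesgue_measure]_t (k * (u <= t <= v)%R%:R * w)%:E =
   (k * (Num.max 0 (v - u) * w))%:E.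
  move=> k0 w0; under eq_integral => t _.
    rewrite mulrAC (_ : (u <= t <= v)%R%:R = \1_(`[u, v]%classic) t); last by rewrite -ind.
    over.
  rewrite (@integral_scaled_indic _ _ _ lebesgue_measure (k * w) `[u, v]%classic (measurable_itv _)) ?mulr_ge0//.
  transitivity ((k * w)%:E * lebesgue_measure ([set` `[u, v]] : set R)); first by [].
  rewrite lebesgue_measure_itv/= lte_fin (mulrC (Num.max _ _)) mulrA [in RHS]EFinM.
  by congr (_ * _); rewrite maxEle subr_ge0; case: ltgtP => // ->; rewrite subrr.
have [c00|c00] := leP 0%R c0; last first.
  apply: (@le_trans _ _ 0); last first.
    by apply: nneseries_ge0 => k _ _; rewrite lee_fin mulr_ge0// prodr_ge0// => i _; rewrite le_max lexx.
  by rewrite lee_fin nmulr_rle0// prodr_ge0// => i _; rewrite le_max lexx.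
have p0 (u v : 'I_n.+1 -> R) : (0 <= \prod_(i < n) Num.max 0 (v (lift ord0 i) - u (lift ord0 i)))%R.
  by rewrite prodr_ge0// => i _; rewrite le_max lexx.
rewrite big_ord_recl -intE//.
under eq_eseriesr do rewrite big_ord_recl -intE//.
rewrite -integral_nneseries//; last 2 first.
- by move=> k; exact: mi.
- by move=> k t _; rewrite lee_fin !mulr_ge0.
apply: ge0_le_integral => //=.
- by move=> t _; rewrite lee_fin !mulr_ge0.
- exact: mi.
- by apply: ge0_emeasurable_sum => [k t _ _|k _]; [rewrite lee_fin !mulr_ge0|exact: mi].
Qed.

(** The content is that no countable cover is cheaper than the box itself: the indicator of the box
    is dominated by the sum of those of the cover, and such a pointwise bound integrates to a bound
    on volumes. *)
Lemma lebesgue_outer_box n (ab : 'rV[R]_n * 'rV[R]_n) : lebesgue_outer (box ab) = box_volume ab.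
Proof.
apply/eqP; rewrite eq_le; apply/andP; split.
  by apply: cover_outer_le1 => //; exact: box_volume_ge0.
apply: le_cover_outerP => j jb.
(* An absent box has weight 0, so the corners chosen for it do not matter. *)
pose c k : R := if j k is Some _ then 1%R else 0%R.
pose a k i : R := if j k is Some u then u.1 0%R i else 0%R.
pose b k i : R := if j k is Some u then u.2 0%R i else 0%R.
have c0 k : (0 <= c k)%R by rewrite /c; case: (j k).
apply: (@le_trans _ _ (\sum_(0 <= k <oo) (c k * \prod_i Num.max 0 (b k i - a k i))%:E)).
  rewrite /box_volume -[X in X%:E]mul1r.
  apply: weighted_box_cover => // x; rewrite mul1r.
  have nn0 k : (0 <= (c k * \prod_i (a k i <= x i <= b k i)%R%:R)%:E) by rewrite lee_fin mulr_ge0// prodr_ge0.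
  have [/forallP xb|] := boolP [forall i, (ab.1 0 i <= x i <= ab.2 0 i)%R]; last first.
    rewrite negb_forall => /existsP[i xi]; rewrite (bigD1 i)//= (negbTE xi) mul0r.
    exact: nneseries_ge0.
  have [|k _ jk] := jb (\row_i x i); first by move=> i; rewrite mxE.
  apply: (@le_trans _ _ (c k * \prod_i (a k i <= x i <= b k i)%R%:R)%:E); last first.
    by rewrite (nneseriesD1 (n := k))//= leeDl// nneseries_ge0.
  rewrite lee_fin big1; last by move=> i _; rewrite xb.
  move: jk; rewrite /c /a /b; case: (j k) => [[u v]|]//= h.
  by rewrite big1 ?mulr1// => i _; have := h i; rewrite mxE => ->.
apply: lee_nneseries => k *.
  by rewrite lee_fin mulr_ge0// prodr_ge0// => i _; rewrite le_max lexx.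
rewrite /c /a /b; case: (j k) => [[u v]|]/=; first by rewrite mul1r.
by rewrite mul0r.
Qed.

(** Half of Fubini's theorem, for an arbitrary set [A] and an arbitrary function [k]. Given a cover
    of the region by boxes, [S y] adds the heights of the boxes that lie over [y]; it is measurable
    and at least [tau] on [A], because the vertical segment over [y] is covered. Markov's inequality
    applies to the measurable superset [E] of [A]. *)
Lemma lebesgue_outer_tube n (i : 'I_n.+1) (A : set 'rV[R]_n) (k : 'rV[R]_n -> R) (tau : R) : (0 < tau)%R ->
  lebesgue_outer A * tau%:E <=
  lebesgue_outer [set x : 'rV[R]_n.+1 | A (col' i x) /\ (k (col' i x) < x ord0 i < k (col' i x) + tau)%R].
Proof.
move=> tau0; apply: le_cover_outerP => j jS.
pose J : nat -> 'rV[R]_n -> \bar R := fun m y => if j m is Some ab then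
   (Num.max 0 (ab.2 0%R i - ab.1 0%R i) * \1_(box (col' i ab.1, col' i ab.2)) y)%:E else 0.
have J0 m y : 0 <= J m y.
  rewrite /J; case: (j m) => // ab; rewrite lee_fin mulr_ge0// ?indicE//.
  by rewrite le_max lexx.
have mJ m : measurable_fun setT (J m : caratheodory_type (@lebesgue_outer R n) -> \bar R).
  rewrite /J; case: (j m) => [ab|]; last exact: measurable_cst.
  exact/measurable_scaled_indic/box_lmble.
have intJ m : \int[leb]_y J m y = cover_weight box_volume (j m).
  rewrite /J; case: (j m) => [ab|]/=; last by rewrite integral0.
  rewrite integral_scaled_indic ?le_max ?lexx//; last exact: box_lmble.
  rewrite -[X in _ * X]/(lebesgue_outer _) lebesgue_outer_box /box_volume -EFinM/=; congr (_%:E).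
  rewrite [RHS](bigD1_ord i)//=; congr (_ * _)%R.
  by apply: eq_bigr => l _; rewrite !mxE.
pose S (y : 'rV[R]_n) := \sum_(0 <= m <oo) J m y.
have mS : measurable_fun setT (S : caratheodory_type lebesgue_outer -> \bar R).
  exact: ge0_emeasurable_sum.
have -> : \sum_(0 <= m <oo) cover_weight box_volume (j m) = \int[leb]_y S y.
  rewrite integral_nneseries//; by apply: eq_eseriesr => m _; rewrite intJ.
pose E := [set y | tau%:E <= S y].
have AE : A `<=` E.
  move=> y Ay; rewrite /E/=.
  pose f t : 'rV[R]_n.+1 := \row_l (oapp (fun l' => y ord0 l') t (unlift i l)).
  have fi t : f t ord0 i = t by rewrite mxE unlift_none.
  have fc t : col' i (f t) = y by apply/rowP => l; rewrite !mxE liftK.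
  have -> : tau%:E = lebesgue_measure `]k y, (k y + tau)%R[%classic.
    by rewrite lebesgue_measure_itv/= lte_fin ltrDl tau0 -EFinB addrAC subrr add0r.
  pose F m := if j m is Some ab then if y \in box (col' i ab.1, col' i ab.2) then `[ab.1 0%R i, ab.2 0%R i]%classic else set0 else set0.
  apply: (@le_trans _ _ (\sum_(0 <= m <oo) lebesgue_measure (F m))).
    apply: measure_sigma_subadditive => //.
    - by move=> m; rewrite /F; case: (j m) => // ab; case: ifP.
    - move=> t /=; rewrite in_itv/= => kt.
      have [|m _] := jS (f t); first by rewrite /= fc fi.
      move=> jm; exists m => //; rewrite /F; move: jm; case: (j m) => [ab|]//= jm.
      case: ifPn => [_|]; first by rewrite /= in_itv/=; have := jm i; rewrite fi.
      rewrite notin_setE; case=> l /=; rewrite !mxE; have := jm (lift i l).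
      by rewrite [f t _ _]mxE liftK.
  apply: lee_nneseries => // m _; rewrite /F /J; case: (j m) => [ab|]; last by rewrite measure0.
  rewrite indicE; case: ifP => _; last by rewrite mulr0 measure0.
  rewrite mulr1 lebesgue_measure_itv/= lte_fin -EFinB.
  by case: ifPn => h; rewrite lee_fin le_max ?lexx// orbT.
apply: (@le_trans _ _ (leb E * tau%:E)).
  by apply: lee_wpmul2r; [rewrite lee_fin ltW|exact: le_outer_measure].
have mE : lmble (E : set 'rV[R]_n).
  rewrite /E -[X in measurable X]setTI.
  by apply: emeasurable_fun_c_infty => //; exact: measurableT.
have := @ge0_markov _ _ R leb setT S tau measurableT mS.
rewrite setTI muleC; apply => // y _; exact: nneseries_ge0.
Qed.
End box_volumes.

Lemma open_finI (T : topologicalType) (I : finType) (F : I -> set T) :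
  (forall i, open (F i)) -> open (\bigcap_(i in [set: I]) F i).
Proof.
move=> oF; rewrite openE => x Fx; rewrite /interior.
have : \forall y \near x, forall i, F i y.
  by apply: filter_forall => i; apply: open_nbhs_nbhs; split => //; exact: Fx.
by apply: filterS => y h i _.
Qed.

(** * Lebesgue measure of homotheties and dyadic cubes *)

Section outer_regularity.
Context {R : realType} {n : nat}.
Implicit Types (x y v : 'rV[R]_n) (A : set 'rV[R]_n).
Local Open Scope ereal_scope.

Definition homothety (r : R) v x := (r *: x + v)%R.

Lemma lebesgue_outer_homothety_le (r : R) v A : (0 < r)%R ->
  lebesgue_outer (homothety r v @^-1` A) <= (r ^- n)%:E * lebesgue_outer A.
Proof.
move=> r0; have rn0 : (0 < r ^+ n)%R by rewrite exprn_gt0.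
rewrite lee_pdivlMl//; apply: le_cover_outerP => j jA; rewrite -lee_pdivlMl//.
pose h (ab : 'rV[R]_n * 'rV[R]_n) := (r^-1 *: (ab.1 - v), r^-1 *: (ab.2 - v))%R.
rewrite -nneseriesZl//; last by move=> *; apply: cover_weight_ge0 => ?; exact: box_volume_ge0.
apply: (@le_trans _ _ (\sum_(0 <= k <oo) cover_weight box_volume (omap h (j k)))).
  apply: cover_outer_le => x /jA[k _ kx]; exists k => //; move: kx.
  case: (j k) => [[a b]|]//= kx i; have := kx i; rewrite /homothety/= !mxE.
  by rewrite ler_pdivrMl// ler_pdivlMl// lerBlDr lerBrDr.
apply: lee_nneseries => [k _ _|k _]; first by apply: cover_weight_ge0 => ?; exact: box_volume_ge0.
case: (j k) => [[a b]|]/=; last by rewrite mule0.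
rewrite /box_volume/= -EFinM lee_fin -exprVn.
rewrite -[n in (_ ^+ n)%R]card_ord -prodr_const -big_split/=.
rewrite le_eqVlt; apply/orP; left; apply/eqP; apply: eq_bigr => i _; rewrite !mxE.
by rewrite -mulrBr opprB addrA subrK maxr_pMr ?mulr0// invr_ge0 ltW.
Qed.

Lemma lebesgue_outer_homothety (r : R) v A : (0 < r)%R ->
  lebesgue_outer (homothety r v @^-1` A) = (r ^- n)%:E * lebesgue_outer A.
Proof.
move=> r0; apply/eqP; rewrite eq_le lebesgue_outer_homothety_le//=.
have rn0 : (0 < r ^+ n)%R by rewrite exprn_gt0.
rewrite lee_pdivrMl//.
have ri0 : (0 < r^-1)%R by rewrite invr_gt0.
have := @lebesgue_outer_homothety_le r^-1 (- (r^-1 *: v))%R (homothety r v @^-1` A) ri0.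
rewrite -comp_preimage (_ : _ \o _ = id); last first.
  by apply/funext => x; rewrite /homothety/= scalerBr !scalerA mulfV ?gt_eqF// !scale1r subrK.
by rewrite preimage_id exprVn invrK.
Qed.

Lemma lebesgue_outer_shift v A : lebesgue_outer [set x | A (x + v)%R] = lebesgue_outer A.
Proof.
have := lebesgue_outer_homothety v A ltr01; rewrite expr1n invr1 mul1e => <-; congr lebesgue_outer.
by apply/seteqP; split => x; rewrite /homothety/= scale1r.
Qed.

Lemma lmble_preimage (f g : 'rV[R]_n -> 'rV[R]_n) (c : R) A : (0 < c)%R ->
  cancel f g -> cancel g f ->
  (forall B, lebesgue_outer (f @^-1` B) = c%:E * lebesgue_outer B) ->
  lmble A -> lmble (f @^-1` A).
Proof.
move=> c0 fg gf fc mA; apply: le_caratheodory_measurable => X.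
have XE : X = f @^-1` (g @^-1` X) by apply/seteqP; split => x; rewrite /= fg.
rewrite (_ : X `&` _ = f @^-1` (g @^-1` X `&` A)) ?[in RHS]preimage_setI -?XE//.
rewrite (_ : X `&` ~` _ = f @^-1` (g @^-1` X `&` ~` A)) ?[in RHS]preimage_setI -?XE//.
rewrite [X in X + _]fc [X in _ + X]fc -ge0_muleDr ?outer_measure_ge0//.
by rewrite -(mA (g @^-1` X)) -fc -XE.
Qed.

Lemma shift_lmble v A : lmble A -> lmble [set x | A (x + v)%R].
Proof.
apply: (@lmble_preimage (fun x => x + v)%R (fun x => x - v)%R 1%R) => //.
- by move=> x; rewrite addrK.
- by move=> x; rewrite subrK.
- by move=> B; rewrite mul1e; exact: lebesgue_outer_shift.
Qed.

Lemma shift_lmble_fun v : measurable_fun setT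
  ((fun x => x + v)%R : caratheodory_type (@lebesgue_outer R n) -> caratheodory_type (@lebesgue_outer R n)).
Proof. by move=> _ A mA; rewrite setTI; exact: shift_lmble. Qed.

Lemma open_cover_box (ab : 'rV[R]_n * 'rV[R]_n) (e : R) : (0 < e)%R ->
  exists U, [/\ open U, box ab `<=` U & lebesgue_outer U <= box_volume ab + e%:E].
Proof.
move=> e0; pose p (d : R) := (\prod_i Num.max 0 ((ab.2 0 i + d) - (ab.1 0 i - d)))%R.
have pc : p d @[d --> 0%R] --> p 0%R.
  apply: cvg_big => [|i _]; first exact: mul_continuous.
  apply: (@continuous_max _ _ (fun=> 0%R) (fun d => (ab.2 0 i + d) - (ab.1 0 i - d))%R); first exact: cvg_cst.
  by apply: cvgB; [apply: cvgD; [exact: cvg_cst|exact: cvg_id]|apply: cvgB; [exact: cvg_cst|exact: cvg_id]].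
have [d d0 pd] : exists2 d : R, (0 < d)%R & (p d <= p 0 + e)%R.
  have /cvgrPdist_le/(_ e e0) := pc.
  move=> /nbhs_ballP[d /= d0 h]; exists (d / 2)%R; first by rewrite divr_gt0.
  have := h (d/2)%R; rewrite /ball/= sub0r normrN gtr0_norm ?divr_gt0//.
  have -> : (d / 2 < d)%R by lra.
  by move=> /(_ isT); rewrite ler_distlC => /andP[].
exists (\bigcap_(i in [set: 'I_n]) ((fun x => x ord0 i) @^-1` `](ab.1 0 i - d)%R, (ab.2 0 i + d)%R[%classic)); split.
- apply: open_finI => i.
  by apply: open_comp; [move=> x _; exact: coord_continuous|exact: interval_open].
- move=> x bx i _ /=; have := bx i; rewrite in_itv/=; lra.
- pose b' := ((\row_i (ab.1 0 i - d))%R, (\row_i (ab.2 0 i + d))%R) : 'rV[R]_n * 'rV[R]_n.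
  apply: (@le_trans _ _ (box_volume b')).
    apply: cover_outer_le1; first exact: box_volume_ge0.
    by move=> x h i; have := h i I; rewrite /= in_itv/= !mxE => /andP[/ltW -> /ltW ->].
  rewrite /box_volume -EFinD lee_fin.
  move: pd; rewrite /p (eq_bigr (fun i => Num.max 0 (b'.2 0 i - b'.1 0 i))%R); last by move=> i _; rewrite !mxE.
  by rewrite [X in (_ <= X + _)%R -> _](eq_bigr (fun i => Num.max 0 (ab.2 0 i - ab.1 0 i))%R)// => i _; rewrite addr0 subr0.
Qed.

Lemma lebesgue_outer_open A (e : R) : (0 < e)%R ->
  exists U, [/\ open U, A `<=` U & lebesgue_outer U <= lebesgue_outer A + e%:E].
Proof.
move=> e0; have [Aoo|Afin] := eqVneq (lebesgue_outer A) +oo.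
  by exists setT; split => //; [exact: openT|rewrite Aoo addye ?leey].
have Af : lebesgue_outer A \is a fin_num by rewrite ge0_fin_numE ?ltey// outer_measure_ge0.
have e20 : (0 < e / 2)%R by rewrite divr_gt0.
have [_ [j jA <-] /ltW jle] := lb_ereal_inf_adherent e20 Af.
have w0 k := cover_weight_ge0 (@box_volume_ge0 R n) (j k).
have h k : exists U, [/\ open U, cover_set box (j k) `<=` U & lebesgue_outer U <= cover_weight box_volume (j k) + (e / 2 / (2 ^ k.+1)%:R)%:E].
  case: (j k) => [ab|]/=; first by apply: open_cover_box; rewrite divr_gt0.
  exists set0; split => //.
  by rewrite outer_measure0 add0e lee_fin divr_ge0// ltW.
have [U UP] := choice h; exists (\bigcup_k U k); split.
- by apply: bigcup_open => k _; case: (UP k).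
- by move=> x /jA[k _ kx]; exists k => //; case: (UP k) => _ + _; exact.
- apply: (le_trans (outer_measure_sigma_subadditive _ _)).
  apply: (@le_trans _ _ (\sum_(0 <= k <oo) (cover_weight box_volume (j k) + (e / 2 / (2 ^ k.+1)%:R)%:E))).
    by apply: lee_nneseries => [k _ _|k _]; [exact: outer_measure_ge0|case: (UP k)].
  apply: (le_trans (epsilon_trick _ _ _)) => //; first exact: ltW.
  rewrite [e in leRHS]splitr EFinD addeA; exact: leeD.
Qed.

End outer_regularity.

Section dyadic.
Context {R : realType} {n : nat}.
Implicit Types (x y v : 'rV[R]_n) (A : set 'rV[R]_n).

Definition dyadic_floor (k : nat) x : 'rV[int]_n := \row_i Num.floor (2 ^+ k * x 0 i).

(** Cubes are fibres of [dyadic_floor], so that the cubes of one generation are disjoint and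
    exhaustive by construction. *)
Definition dyadic_cube k (z : 'rV[int]_n) := [set x | dyadic_floor k x = z].

Lemma dyadic_cubeP k z x : dyadic_cube k z x <->
  forall i, (z 0 i)%:~R <= 2 ^+ k * x 0 i < (z 0 i + 1)%:~R.
Proof.
split=> [<- i|h]; first by rewrite mxE; exact: floor_itv.
by apply/rowP => i; rewrite mxE; apply: floor_def; exact: h.
Qed.

Lemma dyadic_cube_lmble k z : lmble (dyadic_cube k z).
Proof.
rewrite (_ : dyadic_cube k z = \bigcap_(i in [set: 'I_n])
  ((fun x => x 0 i) @^-1` `[2 ^- k * (z 0 i)%:~R, (2 ^- k * (z 0 i + 1)%:~R)[%classic)).
  apply: fin_bigcap_measurable => // i _; rewrite -[X in measurable X]setTI.
  by apply: coord_lmble_fun => //; exact: measurable_itv.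
have k0 : 0 < 2 ^+ k :> R by rewrite exprn_gt0.
apply/seteqP; split=> [x /dyadic_cubeP h i _ /=|x h].
  by rewrite in_itv/= ler_pdivrMl// ltr_pdivlMl.
apply/dyadic_cubeP => i; have := h i I.
by rewrite /= in_itv/= ler_pdivrMl// ltr_pdivlMl.
Qed.

Lemma dyadic_cube_shift k z : dyadic_cube k z = [set x | dyadic_cube k 0 (x - 2 ^- k *: map_mx intr z)].
Proof.
have k0 : 2 ^+ k != 0 :> R by rewrite expf_neq0.
by apply/seteqP; split=> [x /dyadic_cubeP h|x /dyadic_cubeP h]; apply/dyadic_cubeP => i;
  have := h i; rewrite !mxE mulrBr mulrA mulfV// mul1r add0r -[1%:~R]/(1%R) intrD /=; lra.
Qed.

Lemma dyadic_cube_split k : dyadic_cube k 0 =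
  \bigcup_(e in [set: {ffun 'I_n -> bool}]) dyadic_cube k.+1 (\row_i (e i)%:Z).
Proof.
apply/seteqP; split=> [x /dyadic_cubeP h|x [e _ /dyadic_cubeP h]].
  exists [ffun i => 1 <= 2 ^+ k.+1 * x 0 i] => //.
  apply/dyadic_cubeP => i; have := h i; rewrite !mxE !ffunE exprS.
  by case: (leP 1 (2 * 2 ^+ k * x 0 i)) => /=; rewrite ?intrD -?[1%:~R]/(1%R) -?[0%:~R]/(0%R); lra.
apply/dyadic_cubeP => i; have := h i; rewrite !mxE exprS.
by case: (e i) => /=; rewrite ?intrD -?[1%:~R]/(1%R) -?[0%:~R]/(0%R); lra.
Qed.

(** Half-open cubes are neither open nor closed, but this form survives preimages by continuous
    maps. *)
Lemma dyadic_cube_closed_open k z : exists F U : set 'rV[R]_n,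
  [/\ closed F, open U & dyadic_cube k z = F `&` U].
Proof.
pose g (i : 'I_n) (x : 'rV[R]_n) : R := 2 ^+ k * x 0 i.
have cg i : continuous (g i).
  by move=> x; apply: (@continuous_comp _ _ _ (fun x : 'rV[R]_n => x 0 i) (fun t => 2 ^+ k * t)); [exact: coord_continuous|exact: mulrl_continuous].
exists (\bigcap_(i in [set: 'I_n]) (g i @^-1` `[(z 0 i)%:~R, +oo[%classic)).
exists (\bigcap_(i in [set: 'I_n]) (g i @^-1` `]-oo, (z 0 i + 1)%:~R[%classic)).
split.
- by apply: closed_bigI => i _; apply: closed_comp => [x _|]; [exact: cg|exact: interval_closed].
- apply: open_finI => i.
  by apply: open_comp => // x _; exact: cg.
- apply/seteqP; split=> [x /dyadic_cubeP h|x [h1 h2]].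
    by split=> i _; have /andP[] := h i; rewrite /= in_itv/= ?andbT.
  apply/dyadic_cubeP => i; have := h1 i I; have := h2 i I.
  by rewrite /= !in_itv/= andbT => -> ->.
Qed.

Lemma dyadic_cube_preimage_lmble (f : 'rV[R]_n -> 'rV[R]_n) k z : continuous f ->
  lmble (f @^-1` dyadic_cube k z).
Proof.
move=> cf; have [F [U [cF oU ->]]] := dyadic_cube_closed_open k z.
rewrite preimage_setI; apply: measurableI.
  by apply: closed_lmble; apply: closed_comp => // x _; exact: cf.
by apply: open_lmble; apply: open_comp => // x _; exact: cf.
Qed.

Definition dyadic_inner k A := \bigcup_(z in [set z | dyadic_cube k z `<=` A]) dyadic_cube k z.

(** Doubling a real number turns its integer part [a] into [2 * a] or [2 * a + 1]. *)
Lemma dyadic_cube_child k x : dyadic_cube k.+1 (dyadic_floor k.+1 x) `<=` dyadic_cube k (dyadic_floor k x).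
Proof.
move=> y /dyadic_cubeP hy; have /dyadic_cubeP hx : dyadic_cube k (dyadic_floor k x) x by [].
apply/dyadic_cubeP => i; have := hy i; have := hx i; rewrite !mxE.
set a := Num.floor (2 ^+ k * x 0 i); set b := Num.floor (2 ^+ k.+1 * x 0 i).
move=> /andP[a1 a2] /andP[b1 b2].
have : (b%:~R : R) <= 2 ^+ k.+1 * x 0 i < (b + 1)%:~R by rewrite floor_itv.
move=> /andP[b3 b4].
have ab : (2 * a <= b)%R by rewrite real_floor_ge_int ?num_real// intrM exprS; lra.
have ba : (b < 2 * a + 2)%R by rewrite real_floor_lt_int ?num_real// intrD intrM exprS; move: a2; rewrite intrD; lra.
have ba1 : (b + 1 <= 2 * a + 2)%R by lia.
have := ab; rewrite -(ler_int R) intrM => ab'.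
have := ba1; rewrite -(ler_int R) !intrD intrM => ba'.
move: b1 b2; rewrite exprS !intrD; lra.
Qed.

Lemma dyadic_inner_nondecreasing A : nondecreasing_seq (dyadic_inner ^~ A).
Proof.
apply/nondecreasing_seqP => k; apply/subsetPset => x [z /= zA zx].
exists (dyadic_floor k.+1 x) => //= y yx; apply: zA.
by rewrite -zx; apply: (dyadic_cube_child yx).
Qed.

Lemma dyadic_cube_ball k (z : 'rV[int]_n) (x : 'rV[R]_n) (e : R) : 2 ^- k < e -> dyadic_cube k z x ->
  dyadic_cube k z `<=` ball x e.
Proof.
move=> ke /dyadic_cubeP hx y /dyadic_cubeP hy.
have k0 : 0 < 2 ^+ k :> R by rewrite exprn_gt0.
rewrite ballE; last by rewrite (lt_trans _ ke)// invr_gt0.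
move=> i _ /=; have := hx i; have := hy i => h1 h2; apply: le_lt_trans ke.
rewrite -[leRHS]mulr1 ler_pdivlMl// -{1}(gtr0_norm k0) -normrM mulrBr ler_norml.
by move: h1 h2; rewrite intrD; lra.
Qed.

Lemma pow2_small (e : R) : 0 < e -> exists k, 2 ^- k < e.
Proof.
move=> e0; have h := @cvg_geometric R 1 2^-1 _.
have /cvgrPdist_lt/(_ e e0) : (fun k => 2 ^- k : R) @ \oo --> 0.
  have -> : (fun k => 2 ^- k : R) = geometric 1 2^-1.
    by apply/funext => k; rewrite /= mul1r exprVn.
  by apply: cvg_geometric; rewrite gtr0_norm ?invr_gt0// invf_lt1 ?ltr1n.
move=> [k _ /(_ k (leqnn k))]; rewrite sub0r normrN gtr0_norm; first by exists k.
by rewrite invr_gt0 exprn_gt0.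
Qed.

Lemma open_dyadic_inner A : open A -> \bigcup_k dyadic_inner k A = A.
Proof.
move=> oA; apply/seteqP; split=> [x [k _ [z zA /zA]]//|x Ax].
have /nbhs_ballP[e /= e0 eA] := open_nbhs_nbhs (conj oA Ax).
have [k ke] := pow2_small e0; exists k => //.
exists (dyadic_floor k x) => //= y yx; apply: eA.
exact: dyadic_cube_ball yx.
Qed.

End dyadic.

Section linear_image.
Context {R : realType} {n : nat} (f : 'rV[R]_n -> 'rV[R]_n).
Hypothesis f_cont : continuous f.
Hypothesis f_inv : forall v A,
  lebesgue_outer (f @^-1` [set x | A (x + v)]) = lebesgue_outer (f @^-1` A).
Let m (A : set 'rV[R]_n) := lebesgue_outer (f @^-1` A).
Local Open Scope ereal_scope.

(** The pulled-back measure [m] is translation invariant, so the [2 ^ n] children of a cube have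
    equal mass, and [k] subdivisions give the factor [(2 ^+ k) ^+ n]. *)
Lemma dyadic_cube_scale k z : m (dyadic_cube 0 0) = ((2 ^+ k) ^+ n)%:E * m (dyadic_cube k z).
Proof.
have inv j z' : m (dyadic_cube j z') = m (dyadic_cube j 0).
  by rewrite /m (dyadic_cube_shift j z'); exact: (f_inv (- _)%R (dyadic_cube j 0)).
rewrite inv => {z}.
elim: k => [|k ->]; first by rewrite expr0 expr1n mul1e.
rewrite exprS exprMn mulrC EFinM -muleA; congr (_ * _).
rewrite {1}/m dyadic_cube_split preimage_bigcup.
rewrite -[LHS]/(leb _) measure_fin_bigcup//; last 3 first.
- exact: finite_finset.
- apply/trivIsetP => e e' _ _ ee'; apply/seteqP; split=> // x [/= h1 h2].
  have /rowP h := etrans (esym h1) h2.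
  by move/eqP: ee'; apply; apply/ffunP => i; have := h i; rewrite !mxE; case: (e i); case: (e' i).
- by move=> e _; exact: dyadic_cube_preimage_lmble.
rewrite (eq_fsbigr (fun=> m (dyadic_cube k.+1 0))); last by move=> e _; exact: inv.
rewrite (fsbigE (enum {: {ffun 'I_n -> bool}})) ?enum_uniq//; last by move=> e; rewrite /= mem_enum.
rewrite big_const_seq (eq_count (a2 := xpredT)); last by move=> e; rewrite in_setT.
rewrite count_predT -cardE card_ffun card_bool card_ord.
rewrite (_ : (2 ^+ n)%R = ((2 ^ n)%N%:R : R)); last by rewrite natrX.
elim: (2 ^ n)%N => [|j IHj]; first by rewrite mul0e.
rewrite /= IHj -natr1 EFinD ge0_muleDl// ?lee_fin// mul1e addeC//.
Qed.

End linear_image.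

Section dyadic_unit.
Context {R : realType} {n : nat}.
Local Open Scope ereal_scope.

(** The half-open unit cube is compared with the closed one, whose volume is known: they differ by
    [n] faces, which are boxes of volume 0. *)
Lemma lebesgue_outer_dyadic01 : lebesgue_outer (dyadic_cube 0 0 : set 'rV[R]_n) = 1.
Proof.
have vol1 : box_volume (0%R : 'rV[R]_n, const_mx 1%R : 'rV[R]_n) = 1.
  by rewrite /box_volume/= big1// => i _; rewrite !mxE subr0; apply/max_idPr.
apply/eqP; rewrite eq_le; apply/andP; split.
  rewrite -vol1; apply: cover_outer_le1; first exact: box_volume_ge0.
  move=> x /dyadic_cubeP h i; have := h i; rewrite !mxE expr0 mul1r add0r /=.
  by move=> /andP[-> /ltW].
(* The finite family of faces is padded with empty sets into a sequence, the form required by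
   countable subadditivity. *)
pose F i : set 'rV[R]_n := if insub i is Some i' then box (set_coord 0%R i' 1, const_mx 1%R) else set0.
have F0 i : lebesgue_outer (F i) = 0.
  rewrite /F; case: insubP => [i' _ _|_]; last by rewrite outer_measure0.
  rewrite lebesgue_outer_box /box_volume (bigD1 i')//= !mxE eqxx subrr maxxx mul0r //.
rewrite -vol1 -lebesgue_outer_box.
apply: (@le_trans _ _ (lebesgue_outer (dyadic_cube 0 0 `|` \bigcup_i F i))).
  apply: le_outer_measure => x bx; have [/existsP[i xi]|/negP nex] := boolP [exists i, x 0%R i == 1%R].
    right; exists (val i) => //; rewrite /F valK => l /=; have := bx l; rewrite !mxE.
    by case: eqP => [->|_]//; rewrite (eqP xi) lexx.
  left; apply/dyadic_cubeP => i; have := bx i; rewrite !mxE expr0 mul1r add0r /= => /andP[-> h].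
  by rewrite lt_neqAle h andbT; apply/negP => xi; apply: nex; apply/existsP; exists i.
apply: (le_trans (outer_measureU2 _ _ _)); rewrite -[leRHS]adde0 leeD2l//.
apply: (le_trans (outer_measure_sigma_subadditive _ _)).
by rewrite eseries0// => i _ _; exact: F0.
Qed.

Lemma lebesgue_outer_dyadic k z :
  ((2 ^+ k) ^+ n)%:E * lebesgue_outer (dyadic_cube k z : set 'rV[R]_n) = 1.
Proof.
have := @dyadic_cube_scale R n id (fun x => cvg_id) (fun v A => lebesgue_outer_shift v A) k z.
by rewrite !preimage_id lebesgue_outer_dyadic01.
Qed.

End dyadic_unit.

Section linear_image_open.
Context {R : realType} {n : nat} (f : 'rV[R]_n -> 'rV[R]_n).
Hypothesis f_cont : continuous f.
Hypothesis f_inv : forall v A,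
  lebesgue_outer (f @^-1` [set x | A (x + v)]) = lebesgue_outer (f @^-1` A).
Let m (A : set 'rV[R]_n) := lebesgue_outer (f @^-1` A).
Local Open Scope ereal_scope.

(** Uniqueness of translation-invariant measures, on open sets: both sides agree on dyadic cubes,
    hence on the countable disjoint unions [dyadic_inner k U], and these increase to [U]. *)
Lemma lebesgue_outer_open_preimage U : m (dyadic_cube 0 0) < +oo -> open U -> m U = m (dyadic_cube 0 0) * lebesgue_outer U.
Proof.
move=> c_fin oU; set c := m _ in c_fin *.
have c0 : 0 <= c by exact: outer_measure_ge0.
have cf : c \is a fin_num by rewrite ge0_fin_numE.
have idc : continuous (@id 'rV[R]_n) by move=> x; exact: cvg_id.
have [G [GE Gm Gt]] : exists G : nat -> nat -> set 'rV[R]_n, [/\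
    forall k, dyadic_inner k U = \bigcup_i G k i,
    forall k i, G k i = set0 \/ exists z, G k i = dyadic_cube k z &
    forall k (f' : 'rV[R]_n -> 'rV[R]_n), trivIset setT (fun i => f' @^-1` G k i)].
  (* The test [pickle z == i] keeps every cube at one index only, which makes the sequence
     disjoint. *)
  pose G k i : set 'rV[R]_n := if (unpickle i : option 'rV[int]_n) is Some z then
     if `[< dyadic_cube k z `<=` U >] && (pickle z == i) then dyadic_cube k z else set0 else set0.
  exists G; split => [k|k i|k f'].
  - apply/seteqP; split=> [x [z /= zU zx]|x [i _]].
      exists (pickle z) => //; rewrite /G pickleK eqxx andbT.
      by have /asboolP -> : dyadic_cube k z `<=` U by [].
    rewrite /G; case: unpickle => // z; case: ifP => // /andP[/asboolP zU _] zx.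
    by exists z.
  - by rewrite /G; case: unpickle => [z|]; [case: ifP => _; [right; exists z|left]|left].
  - apply/trivIsetP => i j _ _ ij; apply/seteqP; split => // x [].
    rewrite /preimage/= /G; case: unpickle => // z; case: ifP => // /andP[_ /eqP zi] zx.
    case: unpickle => // z'; case: ifP => // /andP[_ /eqP zj] z'x.
    by move/eqP: ij; apply; rewrite -zi -zj -zx -z'x.
have mG k i (f' : 'rV[R]_n -> 'rV[R]_n) : continuous f' -> lmble (f' @^-1` G k i).
  case: (Gm k i) => [->|[z ->]] cf'; last exact: dyadic_cube_preimage_lmble.
  by rewrite preimage_set0; exact: measurable0.
have inner k : m (dyadic_inner k U) = c * lebesgue_outer (dyadic_inner k U).
  rewrite GE /m preimage_bigcup.
  rewrite -[LHS]/(leb _) -[X in _ * X]/(leb _) !measure_bigcup//; last 3 first.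
  - by move=> i _; exact: (mG k i id).
  - exact: (Gt k id).
  - by move=> i _; exact: mG.
  rewrite -(fineK cf) -nneseriesZl ?fine_ge0//.
  apply: eq_eseriesr => i _; rewrite fineK//.
  case: (Gm k i) => [->|[z ->]]; first by rewrite preimage_set0 !measure0 mule0.
  rewrite -[LHS]/(m _) -[X in _ * X]/(lebesgue_outer _) -[LHS]mule1 -(lebesgue_outer_dyadic k z).
  by rewrite muleA (muleC (m _)) /c /m (dyadic_cube_scale f_cont f_inv k z).
have nd (f' : 'rV[R]_n -> 'rV[R]_n) : nondecreasing_seq (fun k => f' @^-1` dyadic_inner k U).
  move=> i j ij; apply/subsetPset => x; rewrite /preimage/=.
  by have /subsetPset h := dyadic_inner_nondecreasing U ij; exact: h.
have mI (f' : 'rV[R]_n -> 'rV[R]_n) : continuous f' -> forall k, lmble (f' @^-1` dyadic_inner k U).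
  by move=> cf' k; rewrite GE preimage_bigcup; apply: bigcupT_measurable => i; exact: mG.
have cv (f' : 'rV[R]_n -> 'rV[R]_n) : continuous f' ->
    leb (f' @^-1` dyadic_inner k U) @[k --> \oo] --> lebesgue_outer (f' @^-1` U).
  move=> cf'; have := @nondecreasing_cvg_mu _ _ _ leb _ (mI f' cf') _ (nd f').
  rewrite -preimage_bigcup open_dyadic_inner//; apply.
  by apply: open_lmble; apply: open_comp => // x _; exact: cf'.
have := cv f f_cont; rewrite (_ : (fun _ => _) = (fun k => c * leb (id @^-1` dyadic_inner k U))); last first.
  by apply/funext => k; exact: inner.
have h : c * leb (id @^-1` dyadic_inner k U) @[k --> \oo] --> c * lebesgue_outer U.
  by apply: cvgeZl => //; exact: (cv id idc).
by move=> h'; exact: (cvg_unique _ h' h).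
Qed.

End linear_image_open.

(** * Euclidean norm and rotations *)

Section euclidean_norm.
Context {R : realType} {n : nat}.
Implicit Types x y v : 'rV[R]_n.

Definition dot x y : R := \sum_i x 0 i * y 0 i.

Lemma dotC x y : dot x y = dot y x.
Proof. by apply: eq_bigr => i _; rewrite mulrC. Qed.

Lemma dotDl x y z : dot (x + y) z = dot x z + dot y z.
Proof. by rewrite /dot -big_split/=; apply: eq_bigr => i _; rewrite mxE mulrDl. Qed.

Lemma dotZl (a : R) x y : dot (a *: x) y = a * dot x y.
Proof. by rewrite /dot mulr_sumr; apply: eq_bigr => i _; rewrite mxE mulrA. Qed.

Lemma dotDr x y z : dot z (x + y) = dot z x + dot z y.
Proof. by rewrite dotC dotDl !(dotC z). Qed.

Lemma dotZr (a : R) x y : dot x (a *: y) = a * dot x y.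
Proof. by rewrite dotC dotZl dotC. Qed.

Lemma dotNl x y : dot (- x) y = - dot x y.
Proof. by rewrite -scaleN1r dotZl mulN1r. Qed.

Lemma dotNr x y : dot x (- y) = - dot x y.
Proof. by rewrite dotC dotNl dotC. Qed.

Lemma dotBl x y z : dot (x - y) z = dot x z - dot y z.
Proof. by rewrite dotDl dotNl. Qed.

Lemma dot_ge0 x : 0 <= dot x x.
Proof. by apply: sumr_ge0 => i _; rewrite -expr2 sqr_ge0. Qed.

Lemma enormE x : enorm x = Num.sqrt (dot x x).
Proof. by rewrite /enorm /dot; congr Num.sqrt; apply: eq_bigr => i _; rewrite expr2. Qed.

Lemma enorm_ge0 x : 0 <= enorm x.
Proof. by rewrite enormE sqrtr_ge0. Qed.

Lemma enorm_sqr x : enorm x ^+ 2 = dot x x.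
Proof. by rewrite enormE sqr_sqrtr// dot_ge0. Qed.

Lemma enorm0 : enorm (0 : 'rV[R]_n) = 0.
Proof. by rewrite enormE /dot big1 ?sqrtr0// => i _; rewrite mxE mul0r. Qed.

Lemma dot_eq0 x : dot x x = 0 -> x = 0.
Proof.
move/eqP; rewrite psumr_eq0; last by move=> i _; rewrite -expr2 sqr_ge0.
move/allP => h; apply/rowP => i; rewrite mxE.
by have := h i (mem_index_enum i); rewrite mulf_eq0 orbb => /eqP.
Qed.

Lemma dot_CS x y : dot x y ^+ 2 <= dot x x * dot y y.
Proof.
have [y0|y0] := eqVneq (dot y y) 0.
  by rewrite (dot_eq0 y0) /dot big1 ?expr0n ?mulr_ge0 ?sumr_ge0// => i _; rewrite ?mxE ?mulr0// -expr2 sqr_ge0.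
have yp : 0 < dot y y by rewrite lt_def y0 dot_ge0.
have := dot_ge0 (dot y y *: x - dot x y *: y).
rewrite dotBl !dotDr !dotNr !dotZl !dotZr (dotC y x) => h.
have : 0 <= dot y y * (dot x x * dot y y - dot x y ^+ 2) by move: h; rewrite expr2; nra.
by rewrite pmulr_rge0// subr_ge0.
Qed.

Lemma dot_le x y : `|dot x y| <= enorm x * enorm y.
Proof.
rewrite -(@ler_pXn2r _ 2)// ?nnegrE ?mulr_ge0 ?enorm_ge0//.
by rewrite exprMn !enorm_sqr real_normK ?num_real// dot_CS.
Qed.

Lemma enormD x y : enorm (x + y) <= enorm x + enorm y.
Proof.
rewrite -(@ler_pXn2r _ 2)// ?nnegrE ?addr_ge0 ?enorm_ge0//.
rewrite sqrrD !enorm_sqr dotDl !dotDr (dotC y x).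
have := dot_le x y; rewrite ler_norml => /andP[_]; lra.
Qed.

Lemma enormZ (a : R) x : enorm (a *: x) = `|a| * enorm x.
Proof. by rewrite !enormE dotZl dotZr mulrA -expr2 sqrtrM ?sqr_ge0// sqrtr_sqr. Qed.

Lemma enormN x : enorm (- x) = enorm x.
Proof. by rewrite -scaleN1r enormZ normrN1 mul1r. Qed.

Lemma enormBC x y : enorm (x - y) = enorm (y - x).
Proof. by rewrite -enormN opprB. Qed.

Lemma enorm_triangle y x z : enorm (x - z) <= enorm (x - y) + enorm (y - z).
Proof. by apply: le_trans (enormD _ _); rewrite addrA subrK. Qed.

Lemma enorm_eq0 x : enorm x = 0 -> x = 0.
Proof. by move=> h; apply: dot_eq0; rewrite -enorm_sqr h expr0n. Qed.

Lemma coord_le_enorm x i : `|x 0 i| <= enorm x.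
Proof.
rewrite -(@ler_pXn2r _ 2)// ?nnegrE ?enorm_ge0// enorm_sqr real_normK ?num_real//.
by rewrite /dot (bigD1 i)//= -expr2 lerDl sumr_ge0// => j _; rewrite -expr2 sqr_ge0.
Qed.

Lemma norm_le_enorm x : `|x| <= enorm x.
Proof.
rewrite [leLHS]/Num.norm/= mx_normrE; apply/bigmax_leP; split; first exact: enorm_ge0.
by move=> [i j] _ /=; rewrite (ord1 i); exact: coord_le_enorm.
Qed.

Lemma coord_le_norm x i : `|x 0 i| <= `|x|.
Proof.
rewrite [leRHS]/Num.norm/= mx_normrE.
by apply/bigmax_geP; right; exists (0, i).
Qed.

Lemma enorm_le_coord x (c : R) : 0 <= c -> (forall i, `|x 0 i| <= c) -> enorm x <= n%:R * c.
Proof.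
move=> c0 h; rewrite -(@ler_pXn2r _ 2)// ?nnegrE ?mulr_ge0 ?enorm_ge0// enorm_sqr.
apply: (@le_trans _ _ (\sum_(i < n) c ^+ 2)).
  apply: ler_sum => i _; rewrite -expr2 -real_normK ?num_real//.
  by rewrite ler_pXn2r ?nnegrE.
rewrite sumr_const card_ord -[leLHS]mulr_natl exprMn ler_wpM2r ?sqr_ge0//.
by rewrite -natrX ler_nat; case: n => // k; rewrite expnS expn1 leq_pmulr.
Qed.

Lemma enorm_le_norm x : enorm x <= n%:R * `|x|.
Proof. by apply: enorm_le_coord => // i; exact: coord_le_norm. Qed.

Lemma subr_continuous x : continuous (fun y => y - x).
Proof.
by move=> y; apply: (@cvgB R 'rV[R]_n _ (nbhs y) (nbhs_filter y) id (fun=> x) y x); [exact: cvg_id|exact: cvg_cst].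
Qed.

Lemma enorm_continuous : continuous (@enorm R n).
Proof.
move=> x; apply/(@cvgrPdist_le _ _ _ (nbhs x) (nbhs_filter x)) => e e0.
have d0 : 0 < e / n.+1%:R by rewrite divr_gt0.
apply/nbhs_ballP; exists (e / n.+1%:R) => //= y.
rewrite -ball_normE/= => xy; apply: (@le_trans _ _ (enorm (x - y))).
  rewrite ler_norml; have := enormD (x - y) y; have := enormD (y - x) x.
  by rewrite !subrK (enormBC y); lra.
apply: (le_trans (enorm_le_norm _)); apply: (@le_trans _ _ (n.+1%:R * `|x - y|)).
  by rewrite ler_wpM2r// ler_nat.
by rewrite mulrC -ler_pdivlMr// ltW.
Qed.

Lemma eball_open x r : open (eball x r).
Proof.
rewrite (_ : eball x r = (fun y => enorm (y - x)) @^-1` `]-oo, r[%classic).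
  apply: open_comp => // y _; apply: (@continuous_comp _ _ _ (fun y => y - x)); last exact: enorm_continuous.
  exact: subr_continuous.
by apply/seteqP; split=> y /=; rewrite in_itv.
Qed.

Lemma closed_eball_closed x r : closed [set y | enorm (y - x) <= r].
Proof.
rewrite (_ : [set y | _] = (fun y => enorm (y - x)) @^-1` `]-oo, r]%classic).
  apply: closed_comp => [y _|]; last exact: interval_closed.
  apply: (@continuous_comp _ _ _ (fun y => y - x)); last exact: enorm_continuous.
  exact: subr_continuous.
by apply/seteqP; split=> y /=; rewrite in_itv.
Qed.

Lemma eball_ball x r : eball x r `<=` ball x r.
Proof.
move=> y; rewrite /eball/= -ball_normE/= => h; rewrite distrC.
exact: le_lt_trans (norm_le_enorm _) h.
Qed.

Lemma ball_eball x r : 0 < r -> ball x (r / n.+1%:R) `<=` eball x r.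
Proof.
move=> r0 y; rewrite -ball_normE/= distrC => h.
apply: (le_lt_trans (enorm_le_norm _)).
rewrite ltr_pdivlMr// in h; apply: le_lt_trans h.
by rewrite mulrC ler_wpM2l// ler_nat.
Qed.

Lemma nbhs_eball x (A : set 'rV[R]_n) : nbhs x A <-> exists2 r, 0 < r & eball x r `<=` A.
Proof.
split=> [/nbhs_ballP[r /= r0 rA]|[r r0 rA]].
  by exists r => //; apply: subset_trans rA; exact: eball_ball.
apply/nbhs_ballP; exists (r / n.+1%:R) => /=; first by rewrite divr_gt0.
by apply: subset_trans rA; exact: ball_eball.
Qed.

Lemma bounded_enorm (A : set 'rV[R]_n) : bounded_set A -> exists2 M, 0 < M & forall x, A x -> enorm x <= M.
Proof.
move=> [M [Mr h]]; exists (n.+1%:R * (`|M| + 1)) => [|x Ax]; first by rewrite mulr_gt0// ltr_wpDl.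
have /(_ x Ax) /= xM := h (`|M| + 1) (ltac:(by rewrite ltr_pwDr// ler_norm)).
apply: (le_trans (enorm_le_norm _)); apply: ler_pM => //.
by rewrite ler_nat.
Qed.

Lemma enorm_bounded (A : set 'rV[R]_n) (M : R) : (forall x, A x -> enorm x <= M) -> bounded_set A.
Proof.
move=> h; exists M; split; first exact: num_real.
move=> y My x Ax /=; apply: (le_trans (norm_le_enorm _)); apply: (le_trans (h _ Ax)).
exact: ltW.
Qed.

Lemma continuous_rV (T : topologicalType) (f : T -> 'rV[R]_n) :
  (forall i, continuous (fun x : T => f x 0 i)) -> continuous f.
Proof.
move=> h x; apply/cvg_ballP => e e0.
have : \forall y \near x, forall i, `|f x 0 i - f y 0 i| < e.
  by apply: filter_forall => i; have /cvgrPdist_lt/(_ e e0) := h i x.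
apply: filterS => y hy; rewrite ballE// => i _ /=; exact: hy.
Qed.

End euclidean_norm.

Section rotation.
Context {R : realType} {n : nat}.
Implicit Types (x y v : 'rV[R]_n) (Q : 'M[R]_n).

Lemma mulmx_continuous (k : nat) (Q : 'M[R]_(n, k)) : continuous (fun x : 'rV[R]_n => x *m Q).
Proof.
apply: continuous_rV => i.
rewrite (_ : (fun x => _) = (fun x : 'rV[R]_n => \sum_j x 0 j * Q j i)); last by apply/funext => x; rewrite mxE.
apply: (@continuous_big _ _ +%R 0 xpredT) => [|j _ x]; first exact: add_continuous.
apply: (@continuous_comp _ _ _ (fun x : 'rV[R]_n => x 0 j) (fun t => t * Q j i)); first exact: coord_continuous.
exact: mulrr_continuous.
Qed.

Lemma dot_mulmx Q x y : Q *m Q^T = 1%:M -> dot (x *m Q) (y *m Q) = dot x y.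
Proof.
have dotE u v : dot u v = (u *m v^T) 0 0 :> R by rewrite !mxE; apply: eq_bigr => i _; rewrite mxE.
by move=> QQ; rewrite !dotE trmx_mul mulmxA -(mulmxA x) QQ mulmx1.
Qed.

Lemma enorm_mulmx Q x : Q *m Q^T = 1%:M -> enorm (x *m Q) = enorm x.
Proof. by move=> QQ; rewrite !enormE dot_mulmx. Qed.

Lemma orthogonal_trmx Q : Q *m Q^T = 1%:M -> Q^T *m Q = 1%:M.
Proof. exact: mulmx1C. Qed.

Local Open Scope ereal_scope.

Lemma lebesgue_outer_bounded (A : set 'rV[R]_n) : bounded_set A -> lebesgue_outer A < +oo.
Proof.
move=> /bounded_enorm[M M0 AM].
pose b := (const_mx (- M)%R : 'rV[R]_n, const_mx M : 'rV[R]_n).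
apply: (@le_lt_trans _ _ (box_volume b)); last exact: ltry.
apply: cover_outer_le1; first exact: box_volume_ge0.
move=> x /AM xM i; rewrite !mxE -ler_norml; exact: le_trans (coord_le_enorm _ _) xM.
Qed.

Lemma lebesgue_outer_open_gt0 (U : set 'rV[R]_n) : open U -> U !=set0 -> 0 < lebesgue_outer U.
Proof.
move=> oU [x Ux]; have /nbhs_ballP[e /= e0 eU] := open_nbhs_nbhs (conj oU Ux).
have [k ke] := pow2_small e0.
have hx : dyadic_cube k (dyadic_floor k x) x by [].
apply: (@lt_le_trans _ _ (lebesgue_outer (dyadic_cube k (dyadic_floor k x)))); last first.
  apply: le_outer_measure; apply: subset_trans eU; exact: dyadic_cube_ball hx.
have := @lebesgue_outer_dyadic R n k (dyadic_floor k x).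
rewrite lt0e outer_measure_ge0 andbT => h; apply/eqP => h0.
by move: h; rewrite h0 mule0 => /eqP; rewrite eq_sym onee_eq0.
Qed.

Lemma eball_bounded x (r : R) : bounded_set (eball x r).
Proof.
apply: (@enorm_bounded _ _ _ (enorm x + r)%R) => y; rewrite /eball/= => h.
by have := enormD (y - x)%R x; rewrite subrK; lra.
Qed.

(** By uniqueness a rotation multiplies the measure of open sets by a constant. The unit ball is
    rotation invariant and has positive finite measure, so the constant is 1. *)
Lemma lebesgue_outer_rotation_open Q (U : set 'rV[R]_n) : Q *m Q^T = 1%:M -> open U ->
  lebesgue_outer [set x | U (x *m Q)] = lebesgue_outer U.
Proof.
move=> QQ; pose f x := x *m Q.
have cf : continuous f by exact: mulmx_continuous.
have fi v (A : set 'rV[R]_n) : lebesgue_outer (f @^-1` [set x | A (x + v)%R]) = lebesgue_outer (f @^-1` A).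
  rewrite -(lebesgue_outer_shift (v *m Q^T) (f @^-1` A)); congr lebesgue_outer.
  apply/seteqP; split => x; rewrite /f/= mulmxDl -mulmxA (orthogonal_trmx QQ) mulmx1 //.
have c_fin : lebesgue_outer (f @^-1` dyadic_cube 0 0) < +oo.
  apply: lebesgue_outer_bounded; apply: (@enorm_bounded _ _ _ (n%:R * 1)%R) => x /dyadic_cubeP h.
  rewrite -(enorm_mulmx _ QQ); apply: enorm_le_coord => // i.
  have := h i; rewrite !mxE expr0 mul1r add0r -[1%:~R]/(1%R) -[0%:~R]/(0%R) => h'.
  by rewrite ler_norml; move: h'; lra.
have key V : open V -> lebesgue_outer (f @^-1` V) = lebesgue_outer (f @^-1` dyadic_cube 0 0) * lebesgue_outer V.
  exact: lebesgue_outer_open_preimage.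
move=> oU; rewrite -[LHS]/(lebesgue_outer (f @^-1` U)) key//.
have := key _ (@eball_open R n 0%R 1%R).
have -> : f @^-1` eball 0%R 1%R = eball 0%R 1%R.
  by apply/seteqP; split => x; rewrite /f /eball/= !subr0 enorm_mulmx.
have B0 : 0 < lebesgue_outer (eball (0 : 'rV[R]_n)%R 1%R).
  by apply: lebesgue_outer_open_gt0; [exact: eball_open|exists 0%R; rewrite /eball/= subr0 enorm0].
have Boo : lebesgue_outer (eball (0 : 'rV[R]_n)%R 1%R) < +oo.
  by apply: lebesgue_outer_bounded; exact: eball_bounded.
move=> h; suff -> : lebesgue_outer (f @^-1` dyadic_cube 0 0) = 1 by rewrite mul1e.
have : 0 <= lebesgue_outer (f @^-1` dyadic_cube 0 0) by exact: outer_measure_ge0.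
move: h Boo B0 c_fin.
case: (lebesgue_outer (f @^-1` _)) => [c| |]//; case: (lebesgue_outer _) => [b| |]//.
rewrite -EFinM => -[h] _; rewrite lte_fin => b0 _ _; congr EFin.
by apply: (mulIf (lt0r_neq0 b0)); rewrite mul1r.
Qed.

(** Outer regularity extends one inequality from open sets to all sets; the other one is the same
    inequality for the inverse rotation [Q^T]. *)
Lemma lebesgue_outer_rotation Q (A : set 'rV[R]_n) : Q *m Q^T = 1%:M ->
  lebesgue_outer [set x | A (x *m Q)] = lebesgue_outer A.
Proof.
have le (P : 'M[R]_n) (B : set 'rV[R]_n) : P *m P^T = 1%:M -> lebesgue_outer [set x | B (x *m P)] <= lebesgue_outer B.
  move=> PP; apply/lee_addgt0Pr => e e0.
  have [U [oU BU Ue]] := lebesgue_outer_open B e0.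
  apply: le_trans Ue; rewrite -(lebesgue_outer_rotation_open PP oU).
  by apply: le_outer_measure => x /BU.
move=> QQ; apply/eqP; rewrite eq_le le//=.
have QT : Q^T *m Q^T^T = 1%:M by rewrite trmxK orthogonal_trmx.
apply: le_trans (le _ _ QT); apply: le_outer_measure => x Ax /=.
by rewrite -mulmxA orthogonal_trmx// mulmx1.
Qed.

End rotation.

(** * Upper bounds for the Hausdorff measure *)

Section hausdorff_measurable.
Context {R : realType} {n s : nat}.
Implicit Types (A B X : set 'rV[R]_n).
Local Open Scope ereal_scope.
Let H := @hausdorff_outer R n s.

Lemma diam_ge (C : set 'rV[R]_n) x y : C x -> C y -> (enorm (x - y))%:E <= diam C.
Proof. by move=> Cx Cy; apply: ereal_sup_ubound; exists (x, y). Qed.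

Lemma diam_le (C : set 'rV[R]_n) (d : R) :
  (forall x y, C x -> C y -> enorm (x - y) <= d)%R -> diam C <= d%:E.
Proof. by move=> h; apply: ge_ereal_sup => _ [[x y] [/= Cx Cy] <-]; rewrite lee_fin h. Qed.

Lemma hausdorff_delta_le (d d' : R) A : (d <= d')%R ->
  hausdorff_delta s d' A <= hausdorff_delta s d A.
Proof.
move=> dd; apply: le_cover_outerP => j jA; apply: (le_trans (cover_outer_le _ jA)).
apply: lee_nneseries => [k _ _|k _]; first by apply: cover_weight_ge0 => C; exact: hausdorff_weight_ge0.
case: (j k) => [C|]//=; rewrite /hausdorff_weight.
case: ifPn => h1; case: ifPn => h2 //; first by rewrite leey.
by move: h1; rewrite (le_trans h2)// lee_fin.
Qed.

Lemma hausdorff_outer_ge (d : R) A : (0 < d)%R -> hausdorff_delta s d A <= H A.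
Proof. by move=> d0; apply: ereal_sup_ubound; exists d. Qed.

Lemma hausdorff_outer_le A (c : \bar R) :
  (forall d : R, (0 < d)%R -> hausdorff_delta s d A <= c) -> H A <= c.
Proof. by move=> h; apply: ge_ereal_sup => _ [d /= d0 <-]; exact: h. Qed.

Lemma ereal_sup_add_le (S T : set \bar R) (c : \bar R) : S !=set0 -> T !=set0 ->
  (forall u, S u -> 0 <= u) -> (forall u, T u -> 0 <= u) ->
  (forall u v, S u -> T v -> u + v <= c) -> ereal_sup S + ereal_sup T <= c.
Proof.
move=> [u0 Su0] [v0 Tv0] S0 T0 h.
have [->|coo] := eqVneq c +oo; first by rewrite leey.
have cf : c \is a fin_num.
  rewrite ge0_fin_numE ?ltey//; apply: le_trans (h _ _ Su0 Tv0).
  by apply: adde_ge0; [exact: S0|exact: T0].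
have fS u : S u -> u \is a fin_num.
  move=> Su; rewrite ge0_fin_numE ?S0//; apply: (@le_lt_trans _ _ c); last by rewrite ltey.
  by apply: le_trans (h _ _ Su Tv0); rewrite leeDl// T0.
have e2 u : S u -> ereal_sup T <= c - u.
  move=> Su; apply: ge_ereal_sup => v Tv; rewrite leeBrDr ?fS// addeC; exact: h.
have fT : ereal_sup T \is a fin_num.
  rewrite ge0_fin_numE; last by apply: le_trans (ereal_sup_ubound Tv0); exact: T0.
  by apply: (le_lt_trans (e2 _ Su0)); rewrite ltey_eq fin_numB cf fS.
rewrite -leeBrDr//; apply: ge_ereal_sup => u Su; rewrite leeBrDr// addeC -leeBrDr ?fS//.
exact: e2.
Qed.

(** A covering set of diameter below [e] cannot meet both [A] and [B], so a fine cover of the union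
    splits into a cover of each. *)
Lemma hausdorff_outer_separated A B (e : R) : (0 < e)%R ->
  (forall x y, A x -> B y -> e <= enorm (x - y))%R -> H A + H B <= H (A `|` B).
Proof.
move=> e0 sep.
have key (d : R) : (0 < d < e)%R ->
    hausdorff_delta s d A + hausdorff_delta s d B <= hausdorff_delta s d (A `|` B).
  move=> /andP[d0 de]; apply: le_cover_outerP => j jAB.
  have w0 o : 0 <= cover_weight (@hausdorff_weight R n s d) o.
    by apply: cover_weight_ge0 => C; exact: hausdorff_weight_ge0.
  pose p (E : set 'rV[R]_n) k := if `[< (cover_set id (j k) `&` E) !=set0 >] then j k else None.
  have cov (E : set 'rV[R]_n) : E `<=` A `|` B -> E `<=` \bigcup_k cover_set id (p E k).
    move=> EAB x Ex; have [k _ kx] := jAB _ (EAB _ Ex); exists k => //; rewrite /p.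
    by case: asboolP => // -[]; exists x.
  apply: (@le_trans _ _ (\sum_(0 <= k <oo) cover_weight (hausdorff_weight s d) (p A k) +
      \sum_(0 <= k <oo) cover_weight (hausdorff_weight s d) (p B k))).
    by apply: leeD; apply: cover_outer_le; apply: cov => x; [left|right].
  rewrite -nneseriesD//; apply: lee_nneseries => [k _ _|k _]; first exact: adde_ge0.
  rewrite /p; case: asboolP => [[x [Cx Ax]]|_]; last by rewrite add0e; case: ifP => _ //; exact: w0.
  case: asboolP => [[y [Cy By]]|_]; last by rewrite adde0.
  move: Cx Cy; case: (j k) => [C|]//= Cx Cy; rewrite /hausdorff_weight ifF ?leey//.
  apply/negbTE; rewrite -ltNge; apply: lt_le_trans (diam_ge Cx Cy); rewrite lte_fin.
  exact: lt_le_trans de (sep _ _ Ax By).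
apply: ereal_sup_add_le.
- by exists (hausdorff_delta s 1 A); exists 1%R => /=.
- by exists (hausdorff_delta s 1 B); exists 1%R => /=.
- by move=> _ [d _ <-]; apply: cover_outer_ge0; exact: hausdorff_weight_ge0.
- by move=> _ [d _ <-]; apply: cover_outer_ge0; exact: hausdorff_weight_ge0.
- move=> _ _ [d /= d0 <-] [d' /= d'0 <-].
  pose m := (Num.min (Num.min d d') (e / 2))%R.
  have m0 : (0 < m < e)%R.
    by rewrite !lt_min d0 d'0 divr_gt0//= gt_min orbC ltr_pdivrMr// ltr_pMr// ltr1n.
  apply: (@le_trans _ _ (hausdorff_delta s m A + hausdorff_delta s m B)).
    by apply: leeD; apply: hausdorff_delta_le; rewrite !ge_min lexx ?orbT.
  apply: (le_trans (key _ m0)); apply: hausdorff_outer_ge; by case/andP: m0.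
Qed.

(* Caratheodory's criterion: [H] is additive on sets at positive distance. *)
Lemma lipschitz_sublevel_hmble (g : 'rV[R]_n -> R) :
  (forall x y, g x - g y <= enorm (x - y))%R ->
  measurable ([set x | g x <= 0]%R : set (caratheodory_type H)).
Proof.
move=> glip; apply: le_caratheodory_measurable => X.
rewrite -![X in X + _]/(H _) -![X in _ + X]/(H _) -[leRHS]/(H X).
have [->|Xoo] := eqVneq (H X) +oo; first by rewrite leey.
have Xfin : H X \is a fin_num by rewrite ge0_fin_numE ?ltey// outer_measure_ge0.
pose r k : R := (k.+1%:R^-1)%R.
have r0 k : (0 < r k)%R by rewrite invr_gt0.
have rS k m : (k < m)%N -> (r m < r k)%R by move=> km; rewrite ltf_pV2 ?posrE// ltr_nat.
pose S k := X `&` [set x | r k < g x]%R.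
pose Z k := X `&` [set x | r k.+1 < g x <= r k]%R.
have sep A B (u v : R) : (forall x, A x -> g x <= u)%R -> (forall x, B x -> v < g x)%R -> (u < v)%R -> H A + H B <= H (A `|` B).
  move=> hA hB uv; apply: (@hausdorff_outer_separated _ _ (v - u)%R); first by rewrite subr_gt0.
  move=> x y Ax By; have := glip y x; rewrite enormBC; have := hA _ Ax; have := hB _ By; lra.
have SX k : H (X `&` [set x | g x <= 0]%R) + H (S k) <= H X.
  apply: (@le_trans _ _ (H ((X `&` [set x | g x <= 0]%R) `|` S k))).
    by apply: (@sep _ _ 0%R (r k)) => // x [].
  by apply: le_outer_measure => x [[]|[]].
(* Shells whose indices have the same parity are at positive distance from one another, hence
   additive. Both subseries are bounded by [H X], so the tail of the series of shells can be made
   small. *)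
have half b m : \sum_(0 <= i < m.+1) H (Z (i.*2 + b)%N) <= H (X `&` [set x | r (m.*2 + b).+1 < g x]%R).
  elim: m => [|m IH].
    by rewrite big_nat1; apply: le_outer_measure => x [Xx /= /andP[h _]].
  rewrite big_nat_recr//= addeC; apply: (le_trans (leeD2l _ IH)).
  apply: (@le_trans _ _ (H (Z (m.+1.*2 + b)%N `|` (X `&` [set x | r (m.*2 + b).+1 < g x]%R)))).
    apply: (@sep _ _ (r (m.+1.*2 + b)%N) (r (m.*2 + b).+1)) => [x [_ /andP[]]//|x []//|].
    by apply: rS; rewrite doubleS.
  apply: le_outer_measure => x [[Xx /andP[h _]]|[Xx /= h]]; split => //=.
  by apply: lt_trans h; apply: rS; rewrite doubleS !addSn !ltnS.
have H0 A : 0 <= H A by exact: outer_measure_ge0.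
have half' b m : \sum_(0 <= i < m) H (Z (i.*2 + b)%N) <= H X.
  case: m => [|m]; first by rewrite big_nil.
  by apply: (le_trans (half b m)); apply: le_outer_measure => x [].
have even m : \sum_(0 <= k < m.*2) H (Z k) =
    \sum_(0 <= i < m) H (Z (i.*2 + 0)%N) + \sum_(0 <= i < m) H (Z (i.*2 + 1)%N).
  elim: m => [|m IH]; first by rewrite !big_nil adde0.
  rewrite doubleS !big_nat_recr//= IH addn0 addn1 -!addeA; congr (_ + _).
  by rewrite addeCA.
have sum_fin : \sum_(0 <= k <oo) H (Z k) < +oo.
  apply: (@le_lt_trans _ _ (H X + H X)); last by rewrite ltey_eq fin_numD Xfin.
  apply: lime_le; first exact: is_cvg_nneseries.
  apply: nearW => m; apply: (@le_trans _ _ (\sum_(0 <= k < m.*2) H (Z k))).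
    by apply: lee_sum_nneg_natr => //; rewrite -addnn leq_addr.
  by rewrite even; exact: leeD.
apply/lee_addgt0Pr => e e0.
have [k tail] : exists k, \sum_(k <= j <oo) H (Z j) <= e%:E.
  have := nneseries_tail_cvg sum_fin (fun k _ => H0 (Z k)).
  move=> /fine_cvgP[[k1 _ fk]] /cvgrPdist_le/(_ e e0)[k2 _ h].
  exists (maxn k1 k2); have f1 := fk _ (leq_maxl k1 k2); have := h _ (leq_maxr k1 k2).
  rewrite /= sub0r normrN => h'; rewrite -(fineK f1) lee_fin; apply: le_trans h'; exact: ler_norm.
apply: (@le_trans _ _ (H (X `&` [set x | g x <= 0]%R) + (H (S k) + e%:E))); last first.
  by rewrite addeA leeD2r.
apply: leeD2l.
apply: (@le_trans _ _ (H (S k `|` \bigcup_j Z (j + k)%N))).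
  apply: le_outer_measure => x [Xx /= /negP]; rewrite -ltNge => gx.
  have [gk|gk] := ltP (r k) (g x); first by left.
  right; have [m hm] : exists m, (r m < g x)%R.
    have [m _ hm] := near_infty_natSinv_lt (PosNum gx).
    by exists m; exact: (hm m (leqnn m)).
  have ex : exists m, (r m < g x)%R by exists m.
  have [i ri imin] := ex_minnP ex.
  have ki : (k < i)%N by rewrite ltnNge; apply/negP => ik; move: gk; rewrite leNgt (le_lt_trans _ ri)// lef_pV2 ?posrE// ler_nat.
  case: i ri imin ki => // i ri imin ki; exists (i - k)%N => //.
  rewrite subnK; last by rewrite -ltnS.
  split => //; apply/andP; split; first exact: ri.
  by rewrite leNgt; apply/negP => /imin; rewrite ltnn.
apply: (le_trans (outer_measureU2 _ _ _)); apply: leeD => //.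
have := outer_measure_sigma_subadditive H (fun j => Z (j + k)%N).
rewrite (@nneseries_addn R (fun j => H (Z j)) k)// => /le_trans; exact.
Qed.

Lemma halfspace_hmble (i : 'I_n) (c : R) :
  measurable ([set x : 'rV[R]_n | (x ord0 i <= c)%R] : set (caratheodory_type H)).
Proof.
rewrite (_ : [set x | _] = [set x : 'rV[R]_n | x ord0 i - c <= 0]%R); last first.
  by apply/seteqP; split=> x /=; rewrite subr_le0.
apply: lipschitz_sublevel_hmble => x y; rewrite opprB addrA subrK.
by have := coord_le_enorm (x - y)%R i; rewrite !mxE ler_norml => /andP[_].
Qed.

Lemma hausdorff_outer_rotation (Q : 'M[R]_n) (A : set 'rV[R]_n) : Q *m Q^T = 1%:M ->
  H [set x | A (x *m Q)] = H A.
Proof.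
have diam_rot (P : 'M[R]_n) (C : set 'rV[R]_n) : P *m P^T = 1%:M -> diam [set x | C (x *m P)] = diam C.
  move=> PP; congr ereal_sup; apply/seteqP; split => [_ [[x y] [/= Cx Cy] <-]|_ [[x y] [/= Cx Cy] <-]].
    exists (x *m P, y *m P) => //=; by rewrite -mulmxBl enorm_mulmx.
  have PT : P^T *m P = 1%:M by exact: orthogonal_trmx.
  exists (x *m P^T, y *m P^T) => /=; first by rewrite -!mulmxA PT !mulmx1.
  by rewrite -mulmxBl enorm_mulmx// trmxK.
have le (P : 'M[R]_n) (B : set 'rV[R]_n) : P *m P^T = 1%:M -> H [set x | B (x *m P)] <= H B.
  move=> PP; apply: hausdorff_outer_le => d d0; apply: le_trans (hausdorff_outer_ge _ d0).
  apply: le_cover_outerP => j jB.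
  pose f (C : set 'rV[R]_n) := [set x | C (x *m P)].
  apply: (@le_trans _ _ (\sum_(0 <= k <oo) cover_weight (hausdorff_weight s d) (omap f (j k)))).
    by apply: cover_outer_le => x /jB[k _ kx]; exists k => //; move: kx; case: (j k).
  apply: lee_nneseries => [k _ _|k _]; first by apply: cover_weight_ge0 => C; exact: hausdorff_weight_ge0.
  by case: (j k) => [C|]//=; rewrite /hausdorff_weight diam_rot.
move=> QQ; apply/eqP; rewrite eq_le le//=.
have QT : Q^T *m Q^T^T = 1%:M by rewrite trmxK orthogonal_trmx.
apply: le_trans (le _ _ QT); apply: le_outer_measure => x Ax /=.
by rewrite -mulmxA orthogonal_trmx// mulmx1.
Qed.

End hausdorff_measurable.

Lemma measure_bigcupT d (T : measurableType d) (R : realType) (mu : {measure set T -> \bar R})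
    (F : nat -> set T) : (forall i, measurable (F i)) -> trivIset setT F ->
  (mu (\bigcup_i F i) = \sum_(0 <= i <oo) mu (F i))%E.
Proof. by move=> mF tF; rewrite measure_semi_bigcup//; exact: bigcupT_measurable. Qed.

(** * Decomposition of open sets into dyadic cubes *)

Section whitney.
Context {R : realType} {n : nat}.

(** The maximal dyadic cubes contained in [U], among those of generation at least [k0]. The lower
    bound on the generation keeps the cubes as small as desired. *)
Lemma open_dyadic_partition (U : set 'rV[R]_n) (k0 : nat) : open U ->
  exists Q : nat -> option (nat * 'rV[int]_n),
   [/\ forall i k z, Q i = Some (k, z) -> (k0 <= k)%N,
       trivIset setT (fun i => oapp (fun p => dyadic_cube p.1 p.2) (set0 : set 'rV[R]_n) (Q i)) &
       \bigcup_i oapp (fun p => dyadic_cube p.1 p.2) set0 (Q i) = U].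
Proof.
move=> oU.
pose good (k : nat) (x : 'rV[R]_n) := dyadic_cube k (dyadic_floor k x) `<=` U.
have goodS k x : good k x -> good k.+1 x.
  by move=> g; apply: subset_trans g; exact: dyadic_cube_child.
have good_le k m x : (k <= m)%N -> good k x -> good m x.
  by move=> km gk; rewrite -(subnK km); elim: (m - k)%N => // i; rewrite addSn; exact: goodS.
have floor_eq k (x y : 'rV[R]_n) : dyadic_floor k.+1 x = dyadic_floor k.+1 y -> dyadic_floor k x = dyadic_floor k y.
  by move=> h; have := @dyadic_cube_child R n k y x; apply.
(* Generation [k] is the first one, from [k0] on, whose cube around [x] fits in [U]. *)
pose W k x := good k x /\ (k = k0 \/ ~ good k.-1 x).
have Weq k x y : (k0 <= k)%N -> dyadic_floor k x = dyadic_floor k y -> W k x -> W k y.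
  move=> kk h [gx hx]; split; first by move: gx; rewrite /good h.
  have [->|/eqP kk0] := eqVneq k k0; first by left.
  case: hx => // hx; right; move: hx; rewrite /good.
  case: k kk h gx kk0 => [|k] kk h gx kk0; first by move: kk0 kk; rewrite leqn0 => + /eqP.
  by rewrite /= (floor_eq _ _ _ h).
pose Q i : option (nat * 'rV[int]_n) := if (unpickle i : option (nat * 'rV[int]_n)) is Some p then
  if `[< (k0 <= p.1)%N /\ pickle p = i /\ dyadic_cube p.1 p.2 `<=` W p.1 >] then Some p else None else None.
have QP i p : Q i = Some p -> (k0 <= p.1)%N /\ pickle p = i /\ dyadic_cube p.1 p.2 `<=` W p.1.
  by rewrite /Q; case: unpickle => // p'; case: asboolP => // h [<-].
exists Q; split.
- by move=> i k z /QP[].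
- apply/trivIsetP => i j _ _ ij; apply/seteqP; split => // x.
  case Qi : (Q i) => [[k z]|]; last by case.
  case Qj : (Q j) => [[k' z']|]; last by case.
  move=> [/= xi xj]; have [/= k1 [e1 w1]] := QP _ _ Qi; have [/= k2 [e2 w2]] := QP _ _ Qj.
  have [g1 h1] := w1 _ xi; have [g2 h2] := w2 _ xj.
  have kk : k = k'.
    have [kk|kk|//] := ltngtP k k'.
      case: h2 => [k'0|]; first by move: kk; rewrite k'0 ltnNge k1.
      by case; apply: good_le g1; case: (k') kk.
    case: h1 => [k'0|]; first by move: kk; rewrite k'0 ltnNge k2.
    by case; apply: good_le g2; case: (k) kk.
  move/eqP: ij; apply; rewrite -e1 -e2 -kk; congr (pickle (_, _)).
  by rewrite -xi -xj kk.
- apply/seteqP; split=> [x [i _]|x Ux].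
    case Qi : (Q i) => [[k z]|]//= zx; have [_ [_ w]] := QP _ _ Qi.
    by have [g _] := w _ zx; apply: g.
  have [k gk] : exists k, good k x.
    have /nbhs_ballP[e /= e0 eA] := open_nbhs_nbhs (conj oU Ux).
    have [k ke] := pow2_small e0; exists k => y yx; apply: eA.
    by apply: dyadic_cube_ball yx.
  have ex : exists m, `[< good (k0 + m)%N x >].
    by exists k; apply/asboolP; apply: good_le gk; exact: leq_addl.
  have [m /asboolP gm mmin] := ex_minnP ex.
  pose p := ((k0 + m)%N, dyadic_floor (k0 + m) x).
  have Wx : W (k0 + m)%N x.
    split => //; case: m gm mmin {p} => [|m] gm mmin; first by left; rewrite addn0.
    by right; rewrite addnS /= => /asboolP /mmin; rewrite ltnn.
  exists (pickle p) => //; rewrite /Q pickleK; case: asboolP => //=; case; split; first exact: leq_addr.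
  split => // y; rewrite /dyadic_cube/= => yx.
  apply: Weq Wx => //; exact: leq_addr.
Qed.

End whitney.

Section ball_filling.
Context {R : realType} {n N : nat} (A : set 'rV[R]_n) (f : 'rV[R]_n -> 'rV[R]_N) (M delta : R).
Hypothesis M_gt0 : 0 < M.
Hypothesis f_lip : forall x y, A x -> A y -> enorm (f x - f y) <= M * enorm (x - y).
Hypothesis delta_gt0 : 0 < delta.
Local Open Scope ereal_scope.
Let Psi (U : set 'rV[R]_n) := hausdorff_delta n delta (f @` (A `&` U)).
Let L := @lebesgue_outer R n.

Lemma lebesgue_outer_eball x (r : R) : (0 < r)%R ->
  L (eball x r) = L (eball 0%R 1%R) * (r ^+ n)%:E.
Proof.
move=> r0; have := lebesgue_outer_homothety x (eball x r) r0.
have -> : homothety r x @^-1` eball x r = eball 0%R 1%R.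
  apply/seteqP; split => y; rewrite /homothety /eball/= addrK subr0 enormZ gtr0_norm//.
    by rewrite gtr_pMr.
  by rewrite gtr_pMr.
rewrite /L => ->; rewrite muleAC -EFinM mulVf ?mul1e//.
by rewrite expf_neq0// gt_eqF.
Qed.

Lemma hausdorff_delta_sigma_subadditive (B : nat -> set 'rV[R]_n) U : U `<=` \bigcup_i B i ->
  Psi U <= \sum_(0 <= i <oo) Psi (B i).
Proof.
move=> UB.
have := cover_outer_sigma_subadditive id (@hausdorff_weight_ge0 R N n delta) (fun i => f @` (A `&` B i)).
apply: le_trans; by apply: le_cover_outer => _ [x [Ax /UB[i _ Bx]] <-]; exists i => //; exists x.
Qed.

(** The image has diameter at most [2 * M * r], so it can serve as its own cover. With the
    normalization of the Hausdorff weight its cost is the volume of a ball of radius [M * r],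
    without any dimensional loss. *)
Lemma hausdorff_delta_eball x (r : R) U : (0 < r)%R -> (2 * M * r <= delta)%R ->
  (forall y, U y -> enorm (y - x) <= r)%R -> Psi U <= (M ^+ n)%:E * L (eball x r).
Proof.
move=> r0 Mr Ur; set C := f @` (A `&` U).
have diamC : diam C <= (2 * M * r)%:E.
  apply: diam_le => _ _ [u [Au /Ur Uu] <-] [v [Av /Ur Uv] <-].
  apply: (le_trans (f_lip Au Av)); rewrite (mulrC 2%R) -mulrA ler_pM2l//.
  by apply: (le_trans (enorm_triangle x _ _)); rewrite (enormBC x v); lra.
apply: (@le_trans _ _ (hausdorff_weight n delta C)).
  by apply: cover_outer_le1; first exact: hausdorff_weight_ge0.
rewrite /hausdorff_weight (le_trans diamC) ?lee_fin//.
rewrite lebesgue_outer_eball// muleCA -EFinM -exprMn.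
apply: lee_wpmul2l; first exact: outer_measure_ge0.
rewrite lee_fin; have Mr0 : (0 <= M * r)%R by rewrite mulr_ge0 ?ltW.
have : (fine (diam C) / 2 <= M * r)%R.
  rewrite ler_pdivrMr// mulrC mulrA; move: diamC; case: (diam C) => [c| |]//=.
  by move=> _; rewrite -mulrA mulr_ge0.
have [c0|c0] := leP 0%R (fine (diam C)).
  by move=> h; apply: lerXn2r => //; rewrite ?nnegrE// divr_ge0.
(* The supremum over an empty set of distances is [-oo], which [fine] sends to 0; a negative [fine]
   is therefore impossible. *)
have : diam C = -oo \/ 0 <= diam C.
  have [->|/set0P[y Cy]] := eqVneq C set0.
    by left; rewrite /diam setX0 image_set0 ereal_sup0.
  right; apply: le_trans (diam_ge Cy Cy); rewrite subrr lee_fin; exact: enorm_ge0.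
case=> [E|/fine_ge0]; last by rewrite leNgt c0.
by move: c0; rewrite E /= ltxx.
Qed.

Lemma lebesgue_outer_dyadicE k (z : 'rV[int]_n) : L (dyadic_cube k z) = ((2 ^- k) ^+ n)%:E.
Proof.
have k0 : (0 < (2 ^+ k) ^+ n :> R)%R by rewrite !exprn_gt0.
have := @lebesgue_outer_dyadic R n k z; rewrite -/(L _) exprVn.
move=> /(congr1 (fun x => (((2 ^+ k) ^+ n)^-1)%:E * x)); rewrite mule1 muleA -EFinM mulVf ?gt_eqF// mul1e //.
Qed.

Let b1 : R := fine (L (eball 0%R 1%R)).

Lemma lebesgue_outer_eball1_gt0 : 0 < L (eball (0 : 'rV[R]_n)%R 1%R).
Proof.
apply: lebesgue_outer_open_gt0; first exact: eball_open.
by exists 0%R; rewrite /eball/= subr0 enorm0.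
Qed.

Lemma lebesgue_outer_eball1_fin : L (eball (0 : 'rV[R]_n)%R 1%R) = b1%:E.
Proof.
rewrite fineK// ge0_fin_numE ?outer_measure_ge0//.
by apply: lebesgue_outer_bounded; exact: eball_bounded.
Qed.

Lemma eball1_volume_gt0 : (0 < b1)%R.
Proof. by rewrite -lte_fin -lebesgue_outer_eball1_fin lebesgue_outer_eball1_gt0. Qed.

Lemma mesh_small (c : R) : (0 < c)%R -> exists k0, forall k, (k0 <= k)%N -> (c * 2 ^- k <= delta)%R.
Proof.
move=> c0; have [k0 hk] := pow2_small (divr_gt0 delta_gt0 c0).
exists k0 => k kk; rewrite mulrC -ler_pdivlMr//; apply: le_trans (ltW hk).
by rewrite lef_pV2 ?posrE ?exprn_gt0// ler_eXn2l// ltr1n.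
Qed.

(** A first finite constant, from which the improvement below can start: each cube is enclosed in a
    ball about its lower corner. The radius uses [n.+1] rather than [n] so as to stay positive in
    dimension 0. *)
Lemma hausdorff_delta_crude : exists C : R, forall U, open U -> Psi U <= C%:E * L U.
Proof.
exists (M ^+ n * b1 * n.+1%:R ^+ n)%R => U oU.
have [k0 hk] := @mesh_small (2 * M * n.+1%:R)%R (mulr_gt0 (mulr_gt0 (ltr0Sn R _) M_gt0) (ltr0Sn R _)).
have [Q [Qk Qt QU]] := open_dyadic_partition k0 oU.
pose q i := oapp (fun p => dyadic_cube p.1 p.2) (set0 : set 'rV[R]_n) (Q i).
apply: (le_trans (@hausdorff_delta_sigma_subadditive q U _)); first by rewrite -QU.
have C0 : (0 <= M ^+ n * b1 * n.+1%:R ^+ n)%R by rewrite !mulr_ge0 ?exprn_ge0// ltW// eball1_volume_gt0.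
have mq i : lmble (q i).
  by rewrite /q; case: (Q i) => [[k z]|]/=; [exact: dyadic_cube_lmble|exact: measurable0].
have <- : \sum_(0 <= i <oo) L (q i) = L U by rewrite -[in RHS]QU -[RHS]/(leb _) measure_bigcupT.
rewrite -nneseriesZl//; last by move=> i _; exact: outer_measure_ge0.
apply: lee_nneseries => [i _ _|i _].
  by apply: cover_outer_ge0; exact: hausdorff_weight_ge0.
rewrite /q; case Qi : (Q i) => [[k z]|]/=.
  have kk := Qk _ _ _ Qi.
  pose c : 'rV[R]_n := (\row_i ((z 0 i)%:~R * 2 ^- k))%R.
  have r0 : (0 < n.+1%:R * 2 ^- k :> R)%R by rewrite mulr_gt0// invr_gt0 exprn_gt0.
  apply: (le_trans (@hausdorff_delta_eball c (n.+1%:R * 2 ^- k)%R _ r0 _ _)).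
  - by rewrite mulrA; exact: hk.
  - move=> y /dyadic_cubeP hy; apply: (@le_trans _ _ (n%:R * 2 ^- k)%R); last first.
      by rewrite ler_wpM2r ?ler_nat// invr_ge0 exprn_ge0.
    apply: enorm_le_coord => [|j]; first by rewrite invr_ge0 exprn_ge0.
    have k20 : (0 < 2 ^+ k :> R)%R by rewrite exprn_gt0.
    rewrite -(ler_pM2l k20) mulfV ?gt_eqF// -{1}(gtr0_norm k20) -normrM !mxE mulrBr.
    rewrite mulrCA mulfV ?gt_eqF// mulr1 ler_norml; have := hy j; rewrite intrD; lra.
  - rewrite lebesgue_outer_eball// lebesgue_outer_eball1_fin lebesgue_outer_dyadicE -!EFinM lee_fin.
    by rewrite exprMn !mulrA.
rewrite /L outer_measure0 mule0 /Psi setI0 image_set0 /hausdorff_delta cover_outer0//.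
exact: hausdorff_weight_ge0.
Qed.

Let bound (a : R) := forall U, open U -> L U < +oo -> Psi U <= a%:E * L U.

(** The fraction of [U] that is certainly filled: a concentric ball of radius one quarter of the
    side occupies [b1 * 4 ^- n] of its cube, and finitely many cubes already carry half of [U]. The
    cap at one half spares an upper bound on [b1]. *)
Let theta : R := Num.min (b1 * 4 ^- n / 2)%R (2^-1)%R.

(* Disjoint dyadic cubes fill [U]; each contains a ball that carries a fixed
   fraction of its volume and on which the constant [M ^+ n] is already available. *)
Lemma hausdorff_delta_improve (a : R) : (M ^+ n <= a)%R -> bound a ->
  bound (a - (a - M ^+ n) * theta)%R.
Proof.
move=> Ma ba U oU Uoo.
have [k0 hk] := @mesh_small (2 * M)%R (mulr_gt0 (ltr0Sn R _) M_gt0).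
have [Q [Qk Qt QU]] := open_dyadic_partition k0 oU.
pose q i := oapp (fun p => dyadic_cube p.1 p.2) (set0 : set 'rV[R]_n) (Q i).
pose c (p : nat * 'rV[int]_n) : 'rV[R]_n := (\row_i (((p.2 0 i)%:~R + 2^-1) * 2 ^- p.1))%R.
pose F i := oapp (fun p => [set y | enorm (y - c p) <= 2 ^- p.1 / 4])%R (set0 : set 'rV[R]_n) (Q i).
have Fq i : F i `<=` q i.
  rewrite /F /q; case: (Q i) => [[k z]|]//= y yc; apply/dyadic_cubeP => j.
  have := le_trans (coord_le_enorm _ j) yc; rewrite !mxE/=.
  have k20 : (0 < 2 ^+ k :> R)%R by rewrite exprn_gt0.
  rewrite -(ler_pM2l k20) -{1}(gtr0_norm k20) -normrM mulrBr mulrCA mulfV ?gt_eqF// mulr1.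
  by rewrite mulrA mulfV ?gt_eqF// ler_norml intrD -[1%:~R]/(1%R); lra.
have mq i : lmble (q i).
  by rewrite /q; case: (Q i) => [[k z]|]/=; [exact: dyadic_cube_lmble|exact: measurable0].
have cF i : closed (F i).
  by rewrite /F; case: (Q i) => [p|]/=; [exact: closed_eball_closed|exact: closed0].
have LF i : (b1 * 4 ^- n)%:E * L (q i) <= L (F i) /\ Psi (F i) <= (M ^+ n)%:E * L (F i).
  rewrite /F /q; case Qi : (Q i) => [[k z]|]/=; last first.
    rewrite /L outer_measure0 !mule0; split => //.
    by rewrite /Psi setI0 image_set0 /hausdorff_delta cover_outer0//; exact: hausdorff_weight_ge0.
  have r0 : (0 < 2 ^- k / 4 :> R)%R by rewrite divr_gt0// invr_gt0 exprn_gt0.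
  have eF : L (eball (c (k, z)) (2 ^- k / 4)) <= L [set y | enorm (y - c (k, z)) <= 2 ^- k / 4]%R.
    by apply: le_outer_measure => y /ltW.
  split.
    apply: le_trans eF; rewrite lebesgue_outer_eball// lebesgue_outer_eball1_fin lebesgue_outer_dyadicE.
    by rewrite -!EFinM lee_fin [((2 ^- k / 4) ^+ n)%R]exprMn [(4^-1 ^+ n)%R]exprVn mulrAC mulrA.
  apply: (@le_trans _ _ ((M ^+ n)%:E * L (eball (c (k, z)) (2 ^- k / 4)))); last first.
    by apply: lee_wpmul2l => //; rewrite lee_fin ltW// exprn_gt0.
  apply: hausdorff_delta_eball => //.
  apply: le_trans (hk k (Qk _ _ _ Qi)); rewrite ler_pM2l ?mulr_gt0//.
  by rewrite ler_pdivrMr// ler_peMr ?invr_ge0 ?exprn_ge0// ler1n.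
have L0 B : 0 <= L B by exact: outer_measure_ge0.
have Ufin : L U \is a fin_num by rewrite ge0_fin_numE.
have sumQ : \sum_(0 <= i <oo) L (q i) = L U.
  by rewrite -[in RHS]QU -[RHS]/(leb _) measure_bigcupT.
(* Finitely many balls are kept so that their union [E] is closed: the remainder [U \ E] is open
   again and the bound with constant [a] applies to it. *)
have [m hm] : exists m, (2^-1)%:E * L U <= \sum_(0 <= i < m) L (q i).
  have [U0|U0] := eqVneq (L U) 0; first by exists 0%N; rewrite U0 mule0 big_nil.
  have Ugt : 0 < L U by rewrite lt0e U0 L0.
  have : (2^-1)%:E * L U < \sum_(0 <= i <oo) L (q i).
    rewrite sumQ -(fineK Ufin) -EFinM lte_fin gtr_pMl ?invf_lt1 ?ltr1n//.
    by rewrite -lte_fin fineK.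
  rewrite ltNge => /negP h; apply: contrapT => /forallNP hn; apply: h.
  apply: lime_le; first by apply: is_cvg_nneseries.
  by apply: nearW => m; rewrite leNgt; apply/negP => /ltW; exact: hn.
pose G i := if (i < m)%N then F i else set0.
pose E := \bigcup_i G i.
have cE : closed E.
  rewrite (_ : E = \bigcup_(i in `I_m) F i); first by apply: closed_bigcup.
  apply/seteqP; split=> [x [i _]|x [i /= im Fx]]; rewrite /G; first by case: ifPn => // im Fx; exists i.
  by exists i => //; rewrite /G im.
have EU : E `<=` U.
  move=> x [i _]; rewrite /G; case: ifP => // _ /Fq qx; rewrite -QU; by exists i.
have mG i : lmble (G i) by rewrite /G; case: ifP => _; [exact: closed_lmble|exact: measurable0].
have tG : trivIset setT G.
  apply/trivIsetP => i j _ _ ij; apply/seteqP; split => // x [].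
  rewrite /G; case: ifP => // _ /Fq qi; case: ifP => // _ /Fq qj.
  by have /trivIsetP/(_ i j I I ij) := Qt; rewrite -subset0 => /(_ x); apply; split.
have LE : L E = \sum_(0 <= i <oo) L (G i).
  by rewrite -[LHS]/(leb _) measure_bigcupT.
have EV : (theta)%:E * L U <= L E.
  have th0 : (0 <= b1 * 4 ^- n)%R by rewrite mulr_ge0 ?ltW ?eball1_volume_gt0// invr_ge0 exprn_ge0.
  apply: (@le_trans _ _ ((b1 * 4 ^- n)%:E * ((2^-1)%:E * L U))).
    by rewrite muleA -EFinM; apply: lee_wpmul2r => //; rewrite lee_fin ge_min lexx.
  apply: (le_trans (lee_wpmul2l _ hm)); rewrite ?lee_fin//.
  rewrite ge0_sume_distrr//.
  rewrite LE; apply: (le_trans _ (nneseries_lim_ge m _)); last by move=> *; exact: L0.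
  rewrite !big_mkord; apply: lee_sum => i _.
  by rewrite /G ltn_ord; have [] := LF i.
have oU' : open (U `\` E) by rewrite setDE; apply: openI => //; exact: closed_openC.
have LUE : L U = L (U `\` E) + L E.
  rewrite -[in LHS](setDUK EU) setUC -[LHS]/(leb _) measureU//; last by rewrite setDKI.
  - exact: open_lmble.
  - exact: closed_lmble.
have PU : Psi U <= Psi (U `\` E) + (M ^+ n)%:E * L E.
  pose B i := if i is i'.+1 then G i' else U `\` E.
  apply: (le_trans (@hausdorff_delta_sigma_subadditive B U _)).
    move=> x Ux; have [[i _ Gx]|nE] := pselect (E x); first by exists i.+1.
    by exists 0%N.
  have P0 C : 0 <= Psi C by apply: cover_outer_ge0; exact: hausdorff_weight_ge0.
  rewrite (nneseries_split 0 1)//.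
  rewrite add0n big_nat1 leeD2l// LE -nneseriesZl//.
  rewrite -(@nneseries_addn R (fun i => Psi (B i)) 1%N)//.
  apply: lee_nneseries => [i _ _|i _]; first exact: P0.
  rewrite addn1 /= /G; case: ifP => _; first by have [] := LF i.
  rewrite /L outer_measure0 mule0 /Psi setI0 image_set0 /hausdorff_delta cover_outer0//.
  exact: hausdorff_weight_ge0.
have UEoo : L (U `\` E) < +oo by apply: le_lt_trans Uoo; rewrite LUE leeDl.
have Efin : L E \is a fin_num.
  by rewrite ge0_fin_numE//; apply: le_lt_trans Uoo; rewrite LUE leeDr.
have UEfin : L (U `\` E) \is a fin_num by rewrite ge0_fin_numE.
apply: (le_trans PU); apply: (le_trans (leeD2r _ (ba _ oU' UEoo))).
move: EV; rewrite LUE -(fineK Efin) -(fineK UEfin); set u := fine _; set e := fine _.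
have -> : u%:E + e%:E = (u + e)%:E by [].
rewrite -EFinM lee_fin => h.
rewrite -EFinM -[(M ^+ n)%:E * _]EFinM -[X in _ <= X]EFinM -[X in X <= _]EFinD lee_fin.
have : (0 <= (a - M ^+ n) * (e - theta * (u + e)))%R by rewrite mulr_ge0 ?subr_ge0.
lra.
Qed.

(** The infimum [a] of the admissible constants above [M ^+ n] is admissible too. The improvement
    step would lower it by a fixed fraction of [a - M ^+ n], so it equals [M ^+ n]. *)
Lemma hausdorff_delta_open U : open U -> L U < +oo -> Psi U <= (M ^+ n)%:E * L U.
Proof.
have [C hC] := hausdorff_delta_crude.
pose S := [set a | M ^+ n <= a /\ bound a]%R.
have bound_mono a a' : (a <= a')%R -> bound a -> bound a'.
  move=> aa ba V oV Voo; apply: (le_trans (ba _ oV Voo)); apply: lee_wpmul2r; last by rewrite lee_fin.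
  exact: outer_measure_ge0.
have S0 : S !=set0.
  exists (Num.max C (M ^+ n))%R; split; first by rewrite le_max lexx orbT.
  apply: (@bound_mono C); first by rewrite le_max lexx.
  by move=> V oV _; exact: hC.
have lbS : has_lbound S by exists (M ^+ n)%R => a [].
have hS : has_inf S by split.
pose a := inf S.
have Ma : (M ^+ n <= a)%R by apply: lb_le_inf => // x [].
have ba : bound a.
  move=> V oV Voo; have Vf : L V \is a fin_num by rewrite ge0_fin_numE ?outer_measure_ge0.
  apply/lee_addgt0Pr => e e0; set v := fine (L V).
  have v0 : (0 <= v)%R by rewrite fine_ge0// outer_measure_ge0.
  have e'0 : (0 < e / (v + 1))%R by rewrite divr_gt0// ltr_wpDl.
  have [a' [Ma' ba'] a'lt] := inf_adherent e'0 hS.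
  apply: (le_trans (ba' _ oV Voo)); rewrite -(fineK Vf) -!EFinM -EFinD lee_fin -/v.
  have : (a' * v <= (a + e / (v + 1)) * v)%R by rewrite ler_wpM2r// ltW.
  move=> /le_trans; apply; rewrite mulrDl lerD2l// mulrAC ler_pdivrMr ?ltr_wpDl//.
  by rewrite ler_pM2l//; lra.
have th0 : (0 < theta)%R by rewrite lt_min !invr_gt0 !divr_gt0 ?eball1_volume_gt0 ?exprn_gt0 ?ltr0n//= mulr_gt0 ?eball1_volume_gt0// invr_gt0 exprn_gt0.
have th1 : (theta <= 2^-1)%R by rewrite ge_min lexx orbT.
have aS : S (a - (a - M ^+ n) * theta)%R.
  split; last exact: hausdorff_delta_improve.
  have : (0 <= (a - M ^+ n) * (1 - theta))%R by rewrite mulr_ge0 ?subr_ge0//; lra.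
  lra.
have := ge_inf lbS aS; rewrite lerBrDr -lerBrDl subrr pmulr_lle0// subr_le0 => aM.
by move=> oU Uoo; exact: (bound_mono _ _ aM ba).
Qed.

End ball_filling.

(** The sharp constant [M ^+ n] is the point: a cover by cubes would lose a dimensional factor, and
    the boundary estimates could then not have a constant close to 1. Outer regularity passes from
    open sets to arbitrary [A]. *)
Lemma hausdorff_outer_lipschitz_image {R : realType} {n N : nat} (A : set 'rV[R]_n)
    (f : 'rV[R]_n -> 'rV[R]_N) (M : R) : 0 < M ->
  (forall x y, A x -> A y -> enorm (f x - f y) <= M * enorm (x - y)) ->
  (hausdorff_outer n (f @` A) <= (M ^+ n)%:E * lebesgue_outer A)%E.
Proof.
move=> M0 flip; have [->|Aoo] := eqVneq (lebesgue_outer A) +oo%E.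
  by rewrite gt0_muley ?leey// lte_fin exprn_gt0.
apply: hausdorff_outer_le => d d0; apply/lee_addgt0Pr => e e0.
have Mn0 : 0 < M ^+ n by rewrite exprn_gt0.
have [U [oU AU Ue]] := lebesgue_outer_open A (divr_gt0 e0 Mn0).
have Uoo : (lebesgue_outer U < +oo)%E.
  by apply: (le_lt_trans Ue); rewrite lte_add_pinfty// ?ltry// ltey.
have := @hausdorff_delta_open R n N A f M d M0 flip d0 U oU Uoo.
rewrite (setIidl AU) => /le_trans; apply.
apply: (le_trans (lee_wpmul2l _ Ue)); first by rewrite lee_fin ltW.
rewrite ge0_muleDr ?outer_measure_ge0// ?lee_fin ?divr_ge0 ?(ltW e0) ?(ltW Mn0)//.
by rewrite leeD2l// -EFinM lee_fin mulrCA mulfV ?gt_eqF// mulr1.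
Qed.

(** * Flat sets and the tubes over them *)

Section flat_sets.
Context {R : realType}.

(** [Q] is the Householder reflection in the hyperplane orthogonal to [e - v], which exchanges the
    two unit vectors. *)
Lemma orthogonal_extension n (e v : 'rV[R]_n) : dot e e = 1 -> dot v v = 1 ->
  exists Q : 'M[R]_n, Q *m Q^T = 1%:M /\ e *m Q = v.
Proof.
move=> ee vv; have [->|ev] := eqVneq e v.
  by exists 1%:M; rewrite trmx1 !mulmx1.
have [w wE] : exists w, w = e - v by exists (e - v).
pose c := 2 / dot w w.
have w0 : dot w w != 0.
  by apply: contra ev => /eqP /dot_eq0 /eqP; rewrite wE subr_eq0.
have dotE (x y : 'rV[R]_n) : x *m y^T = (dot x y)%:M.
  by apply/matrixP => i j; rewrite !ord1 !mxE eqxx mulr1n; apply: eq_bigr => k _; rewrite mxE.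
have ww : dot w w = 2 * (1 - dot e v).
  by rewrite wE dotBl !dotDr !dotNr ee vv (dotC v e); ring.
have ew : dot e w = dot w w / 2.
  by rewrite ww wE dotDr dotNr ee; field.
pose Q : 'M[R]_n := 1%:M - c *: (w^T *m w).
have QT : Q^T = Q by rewrite /Q linearB/= linearZ/= trmx1 trmx_mul trmxK.
have wwww : w^T *m w *m (w^T *m w) = dot w w *: (w^T *m w).
  by rewrite mulmxA -(mulmxA w^T) dotE mul_mx_scalar scalemxAl.
exists Q; split.
  rewrite QT /Q mulmxBl mul1mx mulmxBr mulmx1 -scalemxAl -scalemxAr wwww !scalerA.
  have -> : c * c * dot w w = c + c by rewrite /c; field.
  by rewrite scalerDl opprB addrK subrK.
rewrite /Q mulmxBr mulmx1 -scalemxAr mulmxA dotE mul_scalar_mx scalerA ew.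
have -> : c * (dot w w / 2) = 1 by rewrite /c; field.
by rewrite scale1r wE opprB addrC subrK.
Qed.

Definition normal_proj n (nu z : 'rV[R]_n) := z - dot z nu *: nu.

Definition tube n (nu : 'rV[R]_n) (S : set 'rV[R]_n) (tau : R) :=
  [set z | exists x s, [/\ S x, 0 < s < tau & z = x + s *: nu]].

Let e0 n : 'rV[R]_n.+1 := delta_mx 0 ord0.

Lemma dot_e0 n (z : 'rV[R]_n.+1) : dot z (e0 n) = z 0 0.
Proof.
rewrite /dot (bigD1 ord0)//= mxE !eqxx mulr1 big1 ?addr0// => i i0.
by rewrite mxE (negbTE i0) andbF mulr0.
Qed.

(** Flatness says that the projection along the axis is injective on [S] with an [M]-Lipschitz
    inverse [f]. So [S] is a Lipschitz image of its shadow [A], while the tube contains the region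
    of height [tau] above the graph of [f] over [A]. *)
Lemma hausdorff_flat_axis n (S : set 'rV[R]_n.+1) (M tau : R) : 0 < M -> 0 < tau ->
  (forall x y, S x -> S y -> enorm (x - y) <= M * enorm (normal_proj (e0 n) (x - y))) ->
  (hausdorff_outer n S * tau%:E <= (M ^+ n)%:E * lebesgue_outer (tube (e0 n) S tau))%E.
Proof.
move=> M0 tau0 flat.
have projE (z : 'rV[R]_n.+1) : enorm (normal_proj (e0 n) z) = enorm (col' ord0 z).
  rewrite !enormE; congr Num.sqrt; rewrite /dot big_ord_recl /normal_proj dot_e0.
  rewrite !mxE !eqxx mulr1 subrr mul0r add0r; apply: eq_bigr => i _.
  by rewrite !mxE /= mulr0 subr0.
pose A := col' ord0 @` S.
have inj x y : S x -> S y -> col' ord0 x = col' ord0 y -> x = y.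
  move=> Sx Sy xy; apply/eqP; rewrite -subr_eq0; apply/eqP/enorm_eq0/le_anti.
  rewrite enorm_ge0 andbT; apply: le_trans (flat _ _ Sx Sy) _.
  rewrite projE (_ : col' _ _ = 0) ?enorm0 ?mulr0//.
  by rewrite linearB/= xy subrr.
have hf a : exists x, A a -> S x /\ col' ord0 x = a.
  by have [[x Sx <-]|nA] := pselect (A a); [exists x|exists 0].
have [f fP] := choice hf.
have SE : S = f @` A.
  apply/seteqP; split=> [x Sx|_ [a Aa <-]]; last by case: (fP a Aa).
  have Ax : A (col' ord0 x) by exists x.
  exists (col' ord0 x) => //; have [Sf fx] := fP _ Ax; exact: inj.
have flip a b : A a -> A b -> enorm (f a - f b) <= M * enorm (a - b).
  move=> Aa Ab; have [Sa fa] := fP _ Aa; have [Sb fb] := fP _ Ab.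
  by apply: (le_trans (flat _ _ Sa Sb)); rewrite projE linearB/= fa fb.
have := hausdorff_outer_lipschitz_image M0 flip; rewrite -SE => h.
apply: (@le_trans _ _ ((M ^+ n)%:E * lebesgue_outer A * tau%:E)%E).
  by apply: lee_wpmul2r => //; rewrite lee_fin ltW.
rewrite -muleA; apply: lee_wpmul2l; first by rewrite lee_fin exprn_ge0// ltW.
apply: (le_trans (lebesgue_outer_tube ord0 A (fun a => f a 0 0) tau0)).
apply: le_outer_measure => z [/= Az /andP[z1 z2]].
have [Sz fz] := fP _ Az.
exists (f (col' ord0 z)), (z 0 0 - f (col' ord0 z) 0 0); split => //.
  by rewrite subr_gt0 z1 ltrBlDl z2.
apply/rowP => i; rewrite !mxE eqxx/=.
case: (unliftP ord0 i) => [j ->|->]; last by rewrite eqxx mulr1 addrC subrK.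
have /rowP/(_ j) := fz; rewrite !mxE => ->.
by rewrite mulr0 addr0.
Qed.

Lemma hausdorff_flat n (S : set 'rV[R]_n.+1) (nu : 'rV[R]_n.+1) (M tau : R) : 0 < M -> 0 < tau ->
  enorm nu = 1 ->
  (forall x y, S x -> S y -> enorm (x - y) <= M * enorm (normal_proj nu (x - y))) ->
  (hausdorff_outer n S * tau%:E <= (M ^+ n)%:E * lebesgue_outer (tube nu S tau))%E.
Proof.
move=> M0 tau0 nu1 flat.
have ee : dot (e0 n) (e0 n) = 1 by rewrite dot_e0 mxE !eqxx.
have vv : dot nu nu = 1 by rewrite -enorm_sqr nu1 expr1n.
have [Q [QQ eQ]] := orthogonal_extension ee vv.
have QT : Q^T *m Q = 1%:M by exact: orthogonal_trmx.
rewrite -(hausdorff_outer_rotation S QQ) -(lebesgue_outer_rotation (tube nu S tau) QQ).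
have -> : [set x | tube nu S tau (x *m Q)] = tube (e0 n) [set x | S (x *m Q)] tau.
  apply/seteqP; split=> [z [x [s [Sx s0 zE]]]|z [x [s [/= Sx s0 ->]]]].
    exists (x *m Q^T), s; split => //=; first by rewrite -mulmxA QT mulmx1.
    have -> : z = (z *m Q) *m Q^T by rewrite -mulmxA QQ mulmx1.
    by rewrite zE mulmxDl -eQ -scalemxAl -mulmxA QQ mulmx1.
  by exists (x *m Q), s; split => //; rewrite mulmxDl -scalemxAl eQ.
apply: hausdorff_flat_axis => // x y /= Sx Sy.
have := flat _ _ Sx Sy; rewrite -mulmxBl enorm_mulmx//.
rewrite /normal_proj -eQ dot_mulmx// scalemxAl -mulmxBl enorm_mulmx//.
Qed.

End flat_sets.

From mathcomp Require Import finmap.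

Section compact_covers.
Context {R : realType} {n : nat}.
Implicit Types (x y h : 'rV[R]_n) (K : set 'rV[R]_n).

Lemma compact_eball_cover K (r : 'rV[R]_n -> R) : compact K -> (forall x, K x -> 0 < r x) ->
  exists s : seq 'rV[R]_n, (forall x, x \in s -> K x) /\
    (forall y, K y -> exists2 x, x \in s & eball x (r x) y).
Proof.
rewrite compact_cover => cK r0.
have [|y Ky|D DK KD] := cK _ K (fun x => eball x (r x)).
- by move=> x _; exact: eball_open.
- by exists y => //; rewrite /eball/= subrr enorm0 r0.
exists (enum_fset D); split=> [x xD|y /KD[x /= xD yx]]; last by exists x.
by apply/set_mem; exact: DK.
Qed.

(** Only [x] is confined to [B]; [y] may leave it. Translations and difference quotients near the
    edge of a domain need this form. *)
Lemma enorm_unif_continuous (f : 'rV[R]_n -> R) (B : set 'rV[R]_n) (e : R) :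
  continuous f -> bounded_set B -> 0 < e ->
  exists2 d, 0 < d & forall x y, B x -> enorm (y - x) < d -> `|f y - f x| <= e.
Proof.
move=> cf /bounded_enorm[M M0 BM] e0.
pose K := [set x : 'rV[R]_n | enorm (x - 0) <= M].
have cK : compact K.
  apply: bounded_closed_compact; last exact: closed_eball_closed.
  by apply: (@enorm_bounded _ _ _ M) => x; rewrite /K/= subr0.
have h x : exists r, 0 < r /\ forall y, enorm (y - x) < r -> `|f y - f x| <= e / 2.
  have /cvgrPdist_le/(_ (e / 2)) := cf x; rewrite divr_gt0// => /(_ isT) /nbhs_eball[r r0 rA].
  by exists r; split => // y yr; rewrite distrC; exact: rA.
have [r rP] := choice h.
have [|s [sK sc]] := compact_eball_cover (r := fun x => r x / 2) cK.
  by move=> x _; rewrite divr_gt0//; case: (rP x).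
pose d := \big[Num.min/1]_(x <- s) (r x / 2).
have d0 : 0 < d by apply: lt_bigmin => // x _; rewrite divr_gt0//; case: (rP x).
exists d => // x y Bx yx; have [|c cs xc] := sc x; first by rewrite /K/= subr0; exact: BM.
have dc : d <= r c / 2 by rewrite /d; apply: ge_bigmin_seq.
have [r0 hc] := rP c.
have h1 := hc x; have h2 := hc y; rewrite /eball/= in xc.
have := enorm_triangle x y c; move=> tri.
have {}h1 : `|f x - f c| <= e / 2 by apply: h1; lra.
have {}h2 : `|f y - f c| <= e / 2 by apply: h2; lra.
rewrite (_ : f y - f x = (f y - f c) - (f x - f c)); last by ring.
by apply: (le_trans (ler_normB _ _)); lra.
Qed.

Lemma continuous_bounded (f : 'rV[R]_n -> R) (B : set 'rV[R]_n) : continuous f -> bounded_set B ->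
  exists2 M, 0 < M & forall x, B x -> `|f x| <= M.
Proof.
move=> cf bB; have /bounded_enorm[M M0 BM] := bB.
pose K := [set x : 'rV[R]_n | enorm (x - 0) <= M].
have cK : compact K.
  apply: bounded_closed_compact; last exact: closed_eball_closed.
  by apply: (@enorm_bounded _ _ _ M) => x; rewrite /K/= subr0.
have : compact (f @` K) by apply: continuous_compact => //; exact: continuous_subspaceT.
move=> /compact_bounded[c [_ hc]].
exists (`|c| + 1) => [|x Bx]; first by rewrite ltr_wpDl.
apply: (hc (`|c| + 1)); first by rewrite ltr_pwDr// ler_norm.
by exists x => //; rewrite /K/= subr0; exact: BM.
Qed.

End compact_covers.

(** * C1 functions *)

Section C1_calculus.
Context {R : realType} {n : nat}.
Implicit Types (x y v h : 'rV[R]_n) (w f g : 'rV[R]_n -> R).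

Definition grad w x : 'rV[R]_n := \row_i 'D_(delta_mx 0 i) w x.

(** The bridge from first-order expansions in the Euclidean norm to differentiability for the sup
    norm of the matrix space; the two norms differ by a factor at most [n.+1]. *)
Lemma differentiable_dot w x (a : 'rV[R]_n) :
  (forall e, 0 < e -> exists2 d, 0 < d & forall h, enorm h < d ->
    `|w (x + h) - w x - dot h a| <= e * enorm h) ->
  differentiable w x /\ forall v, 'D_v w x = dot v a.
Proof.
move=> H.
have dot_lin : linear (fun h => dot h a : R) by move=> c u v; rewrite dotDl dotZl.
pose lm := GRing.isLinear.Build _ _ _ _ _ dot_lin.
pose df : {linear 'rV[R]_n -> R} := HB.pack (fun h => dot h a : R) lm.
have cdf : continuous df.
  apply: (@continuous_big _ _ +%R 0 xpredT) => [|j _ y]; first exact: add_continuous.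
  apply: (@continuous_comp _ _ _ (fun y : 'rV[R]_n => y 0 j) (fun t => t * a 0 j)); first exact: coord_continuous.
  exact: mulrr_continuous.
have expand : w \o shift x = cst (w x) + df +o_ (0 : 'rV[R]_n) id.
  apply/eqaddoP => e e0.
  have en0 : 0 < e / n.+1%:R by rewrite divr_gt0.
  have [d d0 hd] := H _ en0.
  apply/nbhs_eball; exists d => // h; rewrite /eball/= subr0 => hd'.
  have := hd h hd'; rewrite !fctE /= opprD addrA (addrC h x) => /le_trans; apply.
  rewrite -mulrA ler_pM2l// mulrC ler_pdivrMr//; apply: (le_trans (enorm_le_norm _)).
  by rewrite mulrC ler_wpM2l// ler_nat.
have dE : 'd w x = df :> ('rV[R]_n -> R) by exact: diff_unique.
have dw : differentiable w x by apply/diff_locallyP; rewrite dE.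
by split => // v; rewrite deriveE// dE.
Qed.

Lemma derive_grad w x v : differentiable w x -> 'D_v w x = dot v (grad w x).
Proof.
move=> dw; rewrite deriveE// {1}(row_sum_delta v) linear_sum/=.
by apply: eq_bigr => i _; rewrite linearZ/= mxE deriveE.
Qed.

Lemma C1_cont w : C1 w -> continuous w.
Proof. by move=> [dw _] x; exact: differentiable_continuous. Qed.

Lemma C1_derive w v x : C1 w -> 'D_v w x = dot v (grad w x).
Proof. by move=> [dw _]; exact: derive_grad. Qed.

Lemma grad_coord_cont w (i : 'I_n) : C1 w -> continuous (fun x => grad w x 0 i).
Proof.
move=> [_ cw]; rewrite (_ : (fun x => _) = (fun x => 'D_(delta_mx 0 i) w x)) //.
by apply/funext => x; rewrite mxE.
Qed.

Lemma grad_cont w : C1 w -> continuous (grad w).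
Proof. by move=> cw; apply: continuous_rV => i; exact: grad_coord_cont. Qed.

Lemma enorm_grad_cont w : C1 w -> continuous (fun x => enorm (grad w x)).
Proof.
by move=> cw x; apply: (@continuous_comp _ _ _ (grad w)); [exact: grad_cont|exact: enorm_continuous].
Qed.

Lemma C1_of_grad w (a : 'rV[R]_n -> 'rV[R]_n) : (forall i, continuous (fun x => a x 0 i)) ->
  (forall x v, differentiable w x /\ 'D_v w x = dot v (a x)) -> C1 w /\ grad w = a.
Proof.
move=> ca H; split; first split.
- by move=> x; case: (H x 0).
- move=> v; rewrite (_ : (fun x => _) = (fun x => dot v (a x))); last by apply/funext => x; case: (H x v).
  apply: (@continuous_big _ _ +%R 0 xpredT) => [|j _ y]; first exact: add_continuous.
  apply: (@continuous_comp _ _ _ (fun y : 'rV[R]_n => a y 0 j) (fun t => v 0 j * t)); first exact: ca.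
  exact: mulrl_continuous.
- apply/funext => x; apply/rowP => i; rewrite mxE; have [_ ->] := H x (delta_mx 0 i).
  rewrite /dot (bigD1 i)//= mxE !eqxx mul1r big1 ?addr0// => j ji.
  by rewrite mxE (negbTE ji) andbF mul0r.
Qed.

Lemma rcontD (T : topologicalType) (f g : T -> R) : continuous f -> continuous g -> continuous (fun x : T => f x + g x).
Proof. by move=> cf cg x; exact: (cvgD (cf x) (cg x)). Qed.

Lemma rcontN (T : topologicalType) (f : T -> R) : continuous f -> continuous (fun x : T => - f x).
Proof. by move=> cf x; exact: (cvgN (cf x)). Qed.

Lemma rcontM (T : topologicalType) (f g : T -> R) : continuous f -> continuous g -> continuous (fun x : T => f x * g x).
Proof. by move=> cf cg x; exact: (cvgM (cf x) (cg x)). Qed.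

Lemma C1D f g : C1 f -> C1 g -> C1 (fun x => f x + g x) /\ grad (fun x => f x + g x) = (fun x => grad f x + grad g x).
Proof.
move=> cf cg; apply: C1_of_grad.
  move=> i; rewrite (_ : (fun x => _) = (fun x => grad f x 0 i + grad g x 0 i)); last by apply/funext => y; rewrite mxE.
  by apply: rcontD; exact: grad_coord_cont.
move=> x v; have [df _] := cf; have [dg _] := cg; split; first exact: differentiableD.
by rewrite (@deriveD _ _ _ f g x v (diff_derivable (df x)) (diff_derivable (dg x))) !C1_derive// dotDr.
Qed.

Lemma C1N f : C1 f -> C1 (fun x => - f x) /\ grad (fun x => - f x) = (fun x => - grad f x).
Proof.
move=> cf; apply: C1_of_grad.
  move=> i; rewrite (_ : (fun x => _) = (fun x => - grad f x 0 i)); last by apply/funext => y; rewrite mxE.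
  by apply: rcontN; exact: grad_coord_cont.
move=> x v; have [df _] := cf; split; first exact: differentiableN.
by rewrite (@deriveN _ _ _ f x v (diff_derivable (df x))) C1_derive// dotNr.
Qed.

Lemma C1M f g : C1 f -> C1 g -> C1 (fun x => f x * g x) /\
  grad (fun x => f x * g x) = (fun x => f x *: grad g x + g x *: grad f x).
Proof.
move=> cf cg; apply: C1_of_grad.
  move=> i; rewrite (_ : (fun x => _) = (fun x => f x * grad g x 0 i + g x * grad f x 0 i)); last first.
    by apply/funext => y; rewrite mxE [X in X + _]mxE [X in _ + X]mxE.
  by apply: rcontD; apply: rcontM; (try exact: grad_coord_cont); exact: C1_cont.
move=> x v; have [df _] := cf; have [dg _] := cg; split; first exact: differentiableM.
by rewrite (@deriveM _ _ f g x v (diff_derivable (df x)) (diff_derivable (dg x))) !C1_derive// dotDr !dotZr.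
Qed.

Lemma grad_cst (c : R) x : grad (fun=> c) x = 0.
Proof. by apply/rowP => i; rewrite !mxE derive_cst. Qed.

Lemma C1_cst (c : R) : C1 ((fun=> c) : 'rV[R]_n -> R).
Proof.
split; first by move=> x; exact: differentiable_cst.
move=> v; rewrite (_ : 'D_v _ = (fun=> 0)); first exact: cst_continuous.
by apply/funext => x; rewrite derive_cst.
Qed.

Lemma C1_coord i : C1 (fun x : 'rV[R]_n => x 0 i) /\ grad (fun x => x 0 i) = (fun=> delta_mx 0 i).
Proof.
apply: C1_of_grad => [j|x v]; first exact: cst_continuous.
have dE h : dot h (delta_mx 0 i) = h 0 i.
  rewrite /dot (bigD1 i)//= mxE !eqxx mulr1 big1 ?addr0// => j ji.
  by rewrite mxE (negbTE ji) andbF mulr0.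
have [|dw ->//] := @differentiable_dot (fun x => x 0 i) x (delta_mx 0 i).
move=> e e0; exists 1 => // h _.
by rewrite dE mxE (addrC (x 0 i)) addrK subrr normr0 mulr_ge0 ?enorm_ge0 ?(ltW e0).
Qed.

Lemma C1Z (c : R) f : C1 f -> C1 (fun x => c * f x) /\ grad (fun x => c * f x) = (fun x => c *: grad f x).
Proof.
move=> cf; have [h1 h2] := C1M (C1_cst c) cf; split => //; rewrite h2.
by apply/funext => x; rewrite grad_cst scaler0 addr0.
Qed.

Lemma C1_comp (T T' : R -> R) f : (forall t : R, is_derive t 1 T (T' t)) -> continuous T' -> C1 f ->
  C1 (fun x => T (f x)) /\ grad (fun x => T (f x)) = (fun x => T' (f x) *: grad f x).
Proof.
move=> dT cT' cf; have [df _] := cf; apply: C1_of_grad.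
  move=> i; rewrite (_ : (fun x => _) = (fun x => T' (f x) * grad f x 0 i)); last by apply/funext => y; rewrite mxE.
  apply: rcontM; last exact: grad_coord_cont.
  by move=> x; apply: continuous_comp; [exact: C1_cont|exact: cT'].
move=> x v.
have dTf : differentiable T (f x) by apply/derivable1_diffP; case: (dT (f x)).
split; first exact: (@differentiable_comp _ _ _ _ f T x (df x) dTf).
rewrite (@deriveE _ _ _ (T \o f) x v); last exact: differentiable_comp.
rewrite (@diff_comp _ _ _ _ f T x (df x) dTf)/= diff1E// derive1E.
by have -> := derive_val (is_derive := dT (f x)); rewrite -deriveE// C1_derive// dotZr mulrC.
Qed.

Lemma C1_mean_value w x h : C1 w -> exists2 t, 0 <= t <= 1 & w (x + h) - w x = dot h (grad w (x + t *: h)).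
Proof.
move=> cw; pose g (t : R) := w (x + t *: h).
have dg (t : R) : is_derive t 1 g (dot h (grad w (x + t *: h))).
  have gE : (fun k : R => k^-1 *: ((g \o shift t) (k *: 1) - g t)) =
            (fun k => k^-1 *: ((w \o shift (x + t *: h)) (k *: h) - w (x + t *: h))).
    apply/funext => k; rewrite /g /= [k *: 1]mulr1 scalerDl addrA (addrC x).
    by rewrite -!addrA.
  have [dw _] := cw.
  apply: DeriveDef; first by rewrite /derivable gE; exact: (diff_derivable (dw _)).
  by rewrite -C1_derive// /derive gE.
have cg : {within `[0, 1], continuous g}.
  by apply: derivable_within_continuous => t _; case: (dg t).
have [c] := MVT (@ltr01 R) (fun t _ => dg t) cg.
rewrite in_itv/= => /andP[c0 c1]; rewrite subr0 mulr1 /g scale1r scale0r addr0 => ->.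
by exists c => //; rewrite !ltW.
Qed.

Lemma C1_unif_diff w (B : set 'rV[R]_n) (e : R) : C1 w -> bounded_set B -> 0 < e ->
  exists2 d, 0 < d & forall x h, B x -> enorm h < d -> `|w (x + h) - w x - dot h (grad w x)| <= e * enorm h.
Proof.
move=> cw bB e0.
have h i : exists d, 0 < d /\ forall x y, B x -> enorm (y - x) < d -> `|grad w y 0 i - grad w x 0 i| <= e / n.+1%:R.
  have [|d d0 hd] := enorm_unif_continuous (grad_coord_cont (i := i) cw) bB (e := e / n.+1%:R).
    by rewrite divr_gt0.
  by exists d.
have [d dP] := choice h.
exists (\big[Num.min/1]_i d i); first by apply: lt_bigmin => // i _; case: (dP i).
move=> x k Bx kd; have [t t01 ->] := C1_mean_value x k cw.
rewrite -dotNr -dotDr mulrC; apply: (le_trans (dot_le _ _)).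
rewrite ler_wpM2l ?enorm_ge0//.
apply: (@le_trans _ _ (n%:R * (e / n.+1%:R))).
  apply: enorm_le_coord => [|i]; first by rewrite divr_ge0// ltW.
  rewrite !mxE; have [_] := dP i; move=> /(_ x (x + t *: k) Bx); rewrite !mxE; apply.
  rewrite (addrC x) addrK enormZ; case/andP: t01 => t0 t1; rewrite ger0_norm//.
  apply: (@le_lt_trans _ _ (enorm k)); first by rewrite ler_piMl ?enorm_ge0.
  apply: (lt_le_trans kd); exact: bigmin_le.
by rewrite mulrCA ger_pMr// ler_pdivrMr// mul1r ler_nat.
Qed.

End C1_calculus.

(** * Real-valued integrals *)

Section real_integrals.
Context d (T : measurableType d) {R : realType} (mu : {measure set T -> \bar R}).
Implicit Types (D U : set T) (f g : T -> R).

Definition rintegrable D f := mu.-integrable D (EFin \o f).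

Lemma rintegrableS U D f : measurable U -> measurable D -> D `<=` U -> rintegrable U f -> rintegrable D f.
Proof. by move=> mU mD DU; exact: integrableS. Qed.

Lemma eq_rintegrable D f g : measurable D -> (forall x, D x -> f x = g x) -> rintegrable D f -> rintegrable D g.
Proof. by move=> mD fg; apply: eq_integrable => // x; rewrite in_setE /= => /fg ->. Qed.

Lemma rintegrableD D f g : measurable D -> rintegrable D f -> rintegrable D g -> rintegrable D (fun x => f x + g x).
Proof. by move=> mD hf hg; exact: (integrableD mD hf hg). Qed.

Lemma rintegrableB D f g : measurable D -> rintegrable D f -> rintegrable D g -> rintegrable D (fun x => f x - g x).
Proof. by move=> mD hf hg; exact: (integrableB mD hf hg). Qed.

Lemma rintegrableN D f : measurable D -> rintegrable D f -> rintegrable D (fun x => - f x).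
Proof. by move=> mD hf; exact: (integrableN hf). Qed.

Lemma rintegrableZ D (c : R) f : measurable D -> rintegrable D f -> rintegrable D (fun x => c * f x).
Proof. by move=> mD hf; exact: (integrableZl mD c hf). Qed.

Lemma rintegrable_norm D f : measurable D -> rintegrable D f -> rintegrable D (fun x => `|f x|).
Proof. by move=> mD hf; exact: integrable_norm. Qed.

Lemma rintegrable_sum D (I : Type) (s : seq I) (f : I -> T -> R) : measurable D ->
  (forall i, rintegrable D (f i)) -> rintegrable D (fun x => \sum_(i <- s) f i x).
Proof.
move=> mD h; rewrite /rintegrable (_ : _ \o _ = (fun x => \sum_(i <- s) (EFin \o f i) x)%E).
  by apply: integrable_sum => // i _; exact: h.
by apply/funext => x; rewrite sumEFin.
Qed.

Lemma rintegrable_mfun D f : rintegrable D f -> measurable_fun D f.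
Proof. by move=> /integrableP[/measurable_EFinP]. Qed.

Lemma le_rintegrable D f g : measurable D -> measurable_fun D f ->
  (forall x, D x -> `|f x| <= g x) -> rintegrable D g -> rintegrable D f.
Proof.
move=> mD mf fg; apply: le_integrable => //; first exact/measurable_EFinP.
by move=> x Dx; rewrite lee_fin (le_trans (fg x Dx))// ler_norm.
Qed.

Lemma rintegrableM D f g (c : R) : measurable D -> rintegrable D f -> measurable_fun D g ->
  (forall x, D x -> `|g x| <= c) -> rintegrable D (fun x => f x * g x).
Proof.
move=> mD hf mg gc.
apply: (@le_rintegrable _ _ (fun x => c * `|f x|)) => //.
- by apply: measurable_funM => //; exact: rintegrable_mfun.
- by move=> x Dx; rewrite normrM mulrC ler_wpM2r// gc.
- by apply: rintegrableZ => //; exact: rintegrable_norm.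
Qed.

Lemma Rintegral_sum D (I : Type) (s : seq I) (f : I -> T -> R) : measurable D ->
  (forall i, rintegrable D (f i)) ->
  \int[mu]_(x in D) (\sum_(i <- s) f i x) = \sum_(i <- s) \int[mu]_(x in D) f i x.
Proof.
move=> mD h; elim: s => [|i s IH].
  by rewrite big_nil (@eq_Rintegral _ _ _ mu D (fun=> 0)) ?Rintegral_cst ?mul0r// => x _; rewrite big_nil.
rewrite big_cons -IH -RintegralD//; [|exact: h|exact: rintegrable_sum].
by apply: eq_Rintegral => x _; rewrite big_cons.
Qed.

Lemma Rintegral_EFin D f : measurable D -> rintegrable D f ->
  (\int[mu]_(x in D) (f x)%:E)%E = (\int[mu]_(x in D) f x)%:E.
Proof. by move=> mD hf; rewrite /Rintegral fineK//; exact: integrable_fin_num. Qed.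

Lemma Rintegral_count U f (Ds : nat -> set T) (m : nat) (K : R) : measurable U -> rintegrable U f ->
  (forall x, U x -> 0 <= f x) -> (forall i, measurable (Ds i)) -> (forall i, Ds i `<=` U) ->
  (forall x, U x -> \sum_(i <- iota 0 m) (x \in Ds i)%:R <= K) ->
  \sum_(i <- iota 0 m) \int[mu]_(x in Ds i) f x <= K * \int[mu]_(x in U) f x.
Proof.
move=> mU hf f0 mD DU hK.
have fD i : rintegrable U (f \_ (Ds i)).
  apply: (@le_rintegrable _ _ (fun x => `|f x|)) => //; last exact: rintegrable_norm.
    apply/measurable_restrict => //.
    by apply: measurable_funS (rintegrable_mfun hf) => //; exact: subIsetl.
  by move=> x Ux; rewrite patchE; case: ifP => // _; rewrite normr0.
have -> : \sum_(i <- iota 0 m) \int[mu]_(x in Ds i) f x =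
          \int[mu]_(x in U) (\sum_(i <- iota 0 m) (f \_ (Ds i)) x).
  rewrite Rintegral_sum//; apply: eq_bigr => i _.
  by rewrite -Rintegral_mkcondr (setIidr (DU i)).
rewrite -RintegralZl//; apply: le_Rintegral => //.
- exact: rintegrable_sum.
- exact: rintegrableZ.
- move=> x Ux; apply: (@le_trans _ _ ((\sum_(i <- iota 0 m) (x \in Ds i)%:R) * f x)); last first.
    by rewrite ler_wpM2r ?f0 ?hK.
  rewrite mulr_suml ler_sum// => i _; rewrite patchE.
  by case: ifP => _; rewrite ?mul1r ?mul0r.
Qed.

Lemma Rintegral_subset D U f : measurable D -> measurable U -> rintegrable U f ->
  (forall x, U x -> 0 <= f x) -> D `<=` U -> \int[mu]_(x in D) f x <= \int[mu]_(x in U) f x.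
Proof.
move=> mD mU hf f0 DU; have := @Rintegral_count U f (fun=> D) 1 1 mU hf f0 (fun=> mD) (fun=> DU).
by rewrite mul1r big_seq1; apply => x _; rewrite big_seq1; case: (_ \in _).
Qed.

Lemma Rintegral_le_norm D f : measurable D -> rintegrable D f ->
  `|\int[mu]_(x in D) f x| <= \int[mu]_(x in D) `|f x|.
Proof. by move=> mD hf; exact: le_normr_Rintegral. Qed.

Lemma Rintegral_setD D U f : measurable D -> measurable U -> D `<=` U -> rintegrable U f ->
  \int[mu]_(x in U) f x = \int[mu]_(x in D) f x + \int[mu]_(x in U `\` D) f x.
Proof.
move=> mD mU DU hf; rewrite -{1}(setDUK DU) Rintegral_setU//; first exact: measurableD.
  by rewrite setDUK.
by apply/disj_setPS => x [] ? [].
Qed.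

Lemma Rintegral_dominated D (f_ : nat -> T -> R) f g : measurable D ->
  (forall k, measurable_fun D (f_ k)) -> measurable_fun D f ->
  {ae mu, forall x, D x -> f_ k x @[k --> \oo] --> f x} -> rintegrable D g ->
  (forall k x, D x -> `|f_ k x| <= g x) ->
  rintegrable D f /\ forall e, 0 < e -> exists N, forall k, (N <= k)%N ->
    \int[mu]_(x in D) `|f_ k x - f x| <= e.
Proof.
move=> mD mf_ mf cf hg fg.
have [] := @dominated_convergence _ _ R mu D mD (fun k => EFin \o f_ k) (EFin \o f) (EFin \o g).
- by move=> k; exact/measurable_EFinP.
- exact/measurable_EFinP.
- by apply: filterS cf => x h Dx; apply: cvg_EFin; [exact: nearW|exact: h].
- exact: hg.
- by apply: aeW => x Dx k; rewrite lee_fin fg.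
move=> fi /fine_cvgP[_ /cvgrPdist_le h] _; split => // e e0.
have [N _ hN] := h e e0; exists N => k Nk; have := hN k Nk.
by rewrite /= sub0r normrN; apply: le_trans; exact: ler_norm.
Qed.

End real_integrals.

Section lebesgue_integrals.
Context {R : realType} {n : nat}.
Implicit Types (D U : set 'rV[R]_n) (f g w : 'rV[R]_n -> R) (v : 'rV[R]_n).
Local Notation leb := (@leb R n).

Definition bmeas D := lmble D /\ bounded_set D.

Lemma bmeasS D U : lmble D -> D `<=` U -> bmeas U -> bmeas D.
Proof.
move=> mD DU [_ bU]; split; first exact: mD.
by have [M M0 h] := bounded_enorm bU; apply: (@enorm_bounded _ _ _ M) => x /DU /h.
Qed.

Lemma cont_integrable D f : bmeas D -> continuous f -> rintegrable leb D f.
Proof.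
move=> [mD bD] cf; apply: measurable_bounded_integrable => //.
- exact: lebesgue_outer_bounded.
- exact: cont_lmble_fun.
- have [M M0 hM] := continuous_bounded cf bD.
  exists M; split; first exact: num_real.
  by move=> y My x Dx; apply: le_trans (hM x Dx) _; exact: ltW.
Qed.

Definition lmfun (f : 'rV[R]_n -> R) :=
  measurable_fun (setT : set (caratheodory_type (@lebesgue_outer R n))) f.

Lemma ge0_integral_shift v f : lmfun f -> (forall x, 0 <= f x) ->
  (\int[leb]_x (f (x + v)%R)%:E)%E = (\int[leb]_x (f x)%:E)%E.
Proof.
move=> mf f0.
have := @ge0_integral_pushforward _ _ _ _ R _ (@shift_lmble_fun R n v) leb setT (EFin \o f) measurableT.
move=> h; transitivity (\int[pushforward leb ((fun x => (x + v)%R) : caratheodory_type lebesgue_outer -> caratheodory_type lebesgue_outer)]_(y in setT) (EFin \o f) y)%E; last first.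
  apply: eq_measure_integral => [|? A mA _]; first exact: shift_lmble_fun.
  by rewrite /pushforward; exact: lebesgue_outer_shift.
have {}h := h ((measurable_EFinP _ _).2 mf) (fun y _ => (f0 y : (0 <= (f y)%:E)%E)).
by rewrite h preimage_setT.
Qed.

Lemma Rintegral_shift_ge0 v f : lmfun f -> (forall x, 0 <= f x) ->
  \int[leb]_(x in setT) f (x + v) = \int[leb]_(x in setT) f x.
Proof. by move=> mf f0; rewrite /Rintegral ge0_integral_shift. Qed.

Lemma Rintegral_supp D f : (forall x, ~ D x -> f x = 0) ->
  \int[leb]_(x in setT) f x = \int[leb]_(x in D) f x.
Proof.
move=> f0; rewrite [RHS]Rintegral_mkcond; apply: eq_Rintegral => x _.
by rewrite patchE; case: ifPn => // /negP; rewrite in_setE => /f0.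
Qed.

Lemma lmfun_shift v f : lmfun f -> lmfun (fun x => f (x + v)).
Proof. by move=> mf; apply: (measurableT_comp mf); exact: shift_lmble_fun. Qed.

Lemma lmfunM f g : lmfun f -> lmfun g -> lmfun (fun x => f x * g x).
Proof. by move=> mf mg; exact: measurable_funM. Qed.

Lemma lmfunD f g : lmfun f -> lmfun g -> lmfun (fun x => f x + g x).
Proof. by move=> mf mg; exact: measurable_funD. Qed.

Lemma lmfun_norm f : lmfun f -> lmfun (fun x => `|f x|).
Proof. by move=> mf; exact: measurableT_comp. Qed.

Lemma shift_rintegrable v f : rintegrable leb setT f -> rintegrable leb setT (fun x => f (x + v)).
Proof.
move=> /integrableP[/measurable_EFinP mf fi]; apply/integrableP; split.
  by apply/measurable_EFinP; exact: lmfun_shift.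
rewrite (_ : integral _ _ _ = \int[leb]_x `|(f x)%:E|)%E//.
by apply: (@ge0_integral_shift v (fun x => `|f x|)) => //; exact: lmfun_norm.
Qed.

Lemma Rintegral_shift v f : rintegrable leb setT f -> \int[leb]_x f (x + v) = \int[leb]_x f x.
Proof.
move=> hf; have mf := rintegrable_mfun hf.
have dec g : rintegrable leb setT g -> \int[leb]_x g x = \int[leb]_x (`|g x| + g x) - \int[leb]_x `|g x|.
  move=> hg; rewrite -RintegralB//; [|by apply: rintegrableD => //; exact: rintegrable_norm|exact: rintegrable_norm].
  by apply: eq_Rintegral => x _; rewrite addrAC subrr add0r.
rewrite (dec _ (shift_rintegrable v hf)) (dec _ hf).
rewrite (@Rintegral_shift_ge0 v (fun x => `|f x| + f x)).
- by rewrite (@Rintegral_shift_ge0 v (fun x => `|f x|))//; exact: lmfun_norm.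
- by apply: lmfunD => //; exact: lmfun_norm.
- by move=> x; have := lerNnormlW (lexx `|f x|); lra.
Qed.

Lemma cont_mfun f : continuous f -> lmfun f.
Proof. exact: cont_lmble_fun. Qed.

Lemma rcont_norm f : continuous f -> continuous (fun x => `|f x|).
Proof. by move=> cf x; apply: (@continuous_comp _ _ _ f (fun t : R => `|t|)); [exact: cf|exact: norm_continuous]. Qed.

Lemma rcont_shift v f : continuous f -> continuous (fun x : 'rV[R]_n => f (x + v)).
Proof.
move=> cf x; apply: (@continuous_comp _ _ _ (fun x : 'rV[R]_n => x + v)); last exact: cf.
by have := @subr_continuous R n (- v) x; rewrite opprK.
Qed.

(** All true indices lie between the least one, [a], and [a + q]; the extra 1 counts [a] itself. The
    lemma bounds the number of sample points of a line in a set of given width. *)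
Lemma sum_bool_le (b : pred nat) (m : nat) (q : R) : 0 <= q ->
  (forall i j, (i <= j)%N -> b i -> b j -> (j - i)%:R <= q) ->
  \sum_(i <- iota 0 m) (b i)%:R <= q + 1.
Proof.
move=> q0 h.
have -> : \sum_(i <- iota 0 m) (b i)%:R = (size (seq.filter b (iota 0 m)))%:R :> R.
  elim: (iota 0 m) => [|i s IH]; first by rewrite big_nil.
  by rewrite big_cons IH /=; case: (b i) => /=; [rewrite -[in RHS]natr1 addrC|rewrite add0r].
have [/hasP[i0 _ bi0]|/hasPn nb] := boolP (has b (iota 0 m)); last first.
  rewrite (_ : seq.filter _ _ = [::]) ?addr_ge0//.
  by apply/eqP; rewrite -[_ == _]negbK -has_filter; apply/hasPn.
have ex : exists i, b i by exists i0.
have [a ba amin] := ex_minnP ex.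
have fl0 : (0 <= Num.floor q)%R by rewrite floor_ge0.
pose k := `|Num.floor q|%N.
have kq : k%:R <= q :> R.
  by have := ge_floor q; rewrite -{1}(gez0_abs fl0).
have sub : {subset seq.filter b (iota 0 m) <= iota a k.+1}.
  move=> i; rewrite mem_filter mem_iota => /andP[bi _].
  rewrite mem_iota amin//= addnS ltnS -leq_subLR.
  have := h a i (amin _ bi) ba bi => ia.
  by rewrite -lez_nat /k gez0_abs// floor_ge_int.
have /uniq_leq_size/(_ sub) : uniq (seq.filter b (iota 0 m)) by rewrite filter_uniq// iota_uniq.
rewrite size_iota -(ler_nat R) => /le_trans; apply.
by rewrite -natr1 lerD2r.
Qed.

Lemma cont_dot_grad w (nu : 'rV[R]_n) : C1 w -> continuous (fun x => `|dot nu (grad w x)|).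
Proof.
move=> Cw; rewrite (_ : (fun x => _) = (fun x => `|'D_nu w x|)); first by apply: rcont_norm; have [_] := Cw; exact.
by apply/funext => x; rewrite C1_derive.
Qed.

Lemma Rintegral_diffquot w U (nu : 'rV[R]_n) (e : R) : C1 w -> bmeas U -> 0 < e ->
  exists2 d, 0 < d & forall s, 0 < s < d -> \int[leb]_(x in U) `|w (x + s *: nu) - w x| <=
    s * (\int[leb]_(x in U) `|dot nu (grad w x)| + e).
Proof.
move=> Cw bU e0; have [mU bUU] := bU.
have cw : continuous w by exact: C1_cont.
pose V := fine (leb U).
have V0 : 0 <= V by apply: fine_ge0; exact: measure_ge0.
(* The pointwise error [s * e' * enorm nu], integrated over [U], then costs at most [s * e]. *)
pose e' := e / (V + 1) / (1 + enorm nu).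
have ne0 : 0 <= enorm nu by exact: enorm_ge0.
have e'0 : 0 < e' by rewrite /e' divr_gt0 ?divr_gt0//; lra.
have [dl dl0 hdl] := C1_unif_diff Cw bUU e'0.
exists (dl / (1 + enorm nu)) => [|s /andP[s0 hs]]; first by rewrite divr_gt0//; lra.
have snu : enorm (s *: nu) < dl.
  rewrite enormZ ger0_norm ?(ltW s0)//.
  move: hs; rewrite ltr_pdivlMr; last by lra.
  by apply: le_lt_trans; rewrite mulrDr mulr1 lerDr ltW.
have cst_int (c : R) : rintegrable leb U (fun=> c) by apply: cont_integrable => //; exact: cst_continuous.
have cdw := cont_dot_grad (nu := nu) Cw.
apply: (@le_trans _ _ (\int[leb]_(x in U) (s * `|dot nu (grad w x)| + s * (e' * enorm nu)))).
  apply: le_Rintegral => //.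
  - by apply: cont_integrable => //; apply: rcont_norm; apply: rcontD; [exact: rcont_shift|exact: rcontN].
  - by apply: rintegrableD => //; apply: rintegrableZ => //; exact: cont_integrable.
  - move=> x Ux; have := hdl x (s *: nu) Ux snu.
    rewrite dotZl enormZ (ger0_norm (ltW s0)) => hx.
    set dd := dot _ _ in hx *; rewrite -[w _ - w x](subrK (s * dd)).
    apply: (le_trans (ler_normD _ _)); rewrite addrC normrM (ger0_norm (ltW s0)).
    by rewrite lerD2l (mulrCA s).
rewrite RintegralD//; last by apply: rintegrableZ => //; exact: cont_integrable.
rewrite RintegralZl//; last exact: cont_integrable.
rewrite Rintegral_cst// -/V mulrDr lerD2l -mulrA ler_wpM2l ?(ltW s0)//.
  have h1 : V / (V + 1) <= 1 by rewrite ler_pdivrMr; lra.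
  have h2 : enorm nu / (1 + enorm nu) <= 1 by rewrite ler_pdivrMr; lra.
  have -> : e' * enorm nu * V = e * (enorm nu / (1 + enorm nu) * (V / (V + 1))) by rewrite /e'; ring.
  by rewrite ler_piMr ?(ltW e0)// mulr_ile1// divr_ge0//; lra.
by apply: rintegrableZ => //; exact: cont_integrable.
Qed.

(* Here [a] plays the role of [Sum_i 1_{D_i} / kappa_i] for sets [D_i] of width
   [kappa_i] in the direction [nu]. *)
Lemma Rintegral_tube a D U w (nu : 'rV[R]_n) (A K h : R) : C1 w -> bmeas D -> bmeas U -> lmfun a ->
  (forall x, 0 <= a x <= A) -> (forall x, ~ D x -> a x = 0) -> 0 <= K -> 0 < h ->
  (forall x s, D x -> 0 <= s <= h -> U (x + s *: nu)) ->
  (forall x s m, 0 < s -> (\sum_(i <- iota 0 m) a (x - (i%:R * s) *: nu)) * s <= K + A * s) ->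
  \int[leb]_(x in D) (a x * `|w x|) <=
  K * (\int[leb]_(x in U) `|dot nu (grad w x)| + h^-1 * \int[leb]_(x in U) `|w x|).
Proof.
move=> Cw bD bU ma aA a0 K0 h0 DU hK.
have [mD _] := bD; have [mU bUU] := bU.
have A0 : 0 <= A by have /andP[] := aA 0 => /le_trans; apply.
have cw : continuous w by exact: C1_cont.
have cN : continuous (fun x => `|w x|) by exact: rcont_norm.
have cdw := cont_dot_grad (nu := nu) Cw.
set I1 := \int[leb]_(x in U) `|dot nu (grad w x)|; set I2 := \int[leb]_(x in U) `|w x|.
set I0 := \int[leb]_(x in D) _.
have I1_0 : 0 <= I1 by apply: Rintegral_ge0.
have I2_0 : 0 <= I2 by apply: Rintegral_ge0.
have intaf E b f : bmeas E -> lmfun b -> (forall x, 0 <= b x <= A) -> continuous f -> rintegrable leb E (fun x => b x * f x).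
  move=> bE mb bA cf; rewrite (_ : (fun x => _) = (fun x => f x * b x)); last by apply/funext => x; rewrite mulrC.
  apply: (@rintegrableM _ _ _ _ _ _ _ A); [exact: bE.1|exact: cont_integrable|exact: measurable_funS mb|].
  by move=> x _; have /andP[b0 b1] := bA x; rewrite ger0_norm.
(* The segment of length [h] is cut into [m] steps. At each point [|w x|] is at most the average of
   [|w|] over the [m] further points plus the sum of the increments; translating back turns the
   weights into samples of [a] along lines, which the counting hypothesis bounds. *)
have key m s : (0 < m)%N -> s = h / m%:R ->
    I0 <= (K + A * s) * (s^-1 * \int[leb]_(x in U) `|w (x + s *: nu) - w x| + h^-1 * I2).
  move=> m0 sE; have mR : 0 < m%:R :> R by rewrite ltr0n.
  have s0 : 0 < s by rewrite sE divr_gt0.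
  pose g x := `|w (x + s *: nu) - w x|.
  have cg : continuous g by apply: rcont_norm; apply: rcontD; [exact: rcont_shift|exact: rcontN].
  have cnt (c : nat) f : continuous f -> (forall x, 0 <= f x) -> (c <= 1)%N ->
      \sum_(i <- iota 0 m) \int[leb]_(x in D) (a x * f (x + ((i + c)%:R * s) *: nu)) <=
      (K / s + A) * \int[leb]_(x in U) f x.
    move=> cf f0 c1.
    have mas i : lmfun (fun x => a (x - ((i + c)%:R * s) *: nu)) by exact: lmfun_shift.
    have -> : \sum_(i <- iota 0 m) \int[leb]_(x in D) (a x * f (x + ((i + c)%:R * s) *: nu)) =
        \sum_(i <- iota 0 m) \int[leb]_(x in U) (a (x - ((i + c)%:R * s) *: nu) * f x).
      rewrite !big_seq; apply: eq_bigr => i; rewrite mem_iota add0n => /= im.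
      set v := _ *: nu.
      rewrite -(Rintegral_supp (f := fun x => a x * f (x + v))); last by move=> x /a0 ->; rewrite mul0r.
      have := @Rintegral_shift_ge0 v (fun x => a (x - v) * f x).
      under eq_Rintegral do rewrite addrK.
      move=> ->; last 2 first.
      - by apply: lmfunM; [exact: mas|exact: cont_mfun].
      - by move=> x; have /andP[? _] := aA (x - v); rewrite mulr_ge0.
      apply: Rintegral_supp => x nU; rewrite a0 ?mul0r// => Dx; apply: nU.
      have := DU _ ((i + c)%:R * s) Dx; rewrite subrK; apply.
      rewrite mulr_ge0 ?(ltW s0)//= sE mulrA ler_pdivrMr// mulrC ler_wpM2l ?(ltW h0)//.
      rewrite ler_nat; move: c1 im; clear; by case: c => [|[|]]// _ im; rewrite ?addn0 ?addn1// ltnW.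
    rewrite -Rintegral_sum//; last by move=> i; apply: intaf => // x; exact: aA.
    rewrite -RintegralZl//; last exact: cont_integrable.
    apply: le_Rintegral => //.
    - by apply: rintegrable_sum => // i; apply: intaf => // x; exact: aA.
    - by apply: rintegrableZ => //; exact: cont_integrable.
    move=> x _; rewrite -mulr_suml ler_wpM2r//.
    rewrite -(ler_pM2r s0) mulrDl divfK ?gt_eqF//.
    have := hK (x - (c%:R * s) *: nu) s m s0; congr (_ * _ <= _).
    by apply: eq_bigr => i _; rewrite -addrA -opprD -scalerDl -mulrDl natrD (addrC c%:R).
  have c1 := cnt 1%N _ cN (fun x => normr_ge0 _) (leqnn _).
  have c2 := cnt 0%N _ cg (fun x => normr_ge0 _) (leq0n _).
  have mono x : m%:R * `|w x| <= \sum_(i <- iota 0 m) `|w (x + ((i + 1)%:R * s) *: nu)| +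
      m%:R * \sum_(i <- iota 0 m) g (x + ((i + 0)%:R * s) *: nu).
    have tel j : `|w x| <= `|w (x + (j%:R * s) *: nu)| + \sum_(i <- iota 0 j) g (x + ((i + 0)%:R * s) *: nu).
      elim: j => [|j IH]; first by rewrite mul0r scale0r addr0 big_nil addr0.
      rewrite (_ : iota 0 j.+1 = iota 0 j ++ [:: j]); last by rewrite -addn1 iotaD add0n.
      rewrite big_cat/= big_seq1 addn0 [X in _ <= _ + X]addrC addrA.
      apply: (le_trans IH); rewrite lerD2r /g.
      have -> : x + (j.+1%:R * s) *: nu = x + (j%:R * s) *: nu + s *: nu.
        by rewrite -addrA -scalerDl -natr1 mulrDl mul1r.
      set u := w (x + (j%:R * s) *: nu); set u' := w _.
      by have := ler_normB u' (u' - u); rewrite opprB addrCA subrr addr0.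
    have tel' j : (j < m)%N -> `|w x| <= `|w (x + ((j + 1)%:R * s) *: nu)| + \sum_(i <- iota 0 m) g (x + ((i + 0)%:R * s) *: nu).
      move=> jm; apply: (le_trans (tel (j + 1)%N)); rewrite lerD2l.
      rewrite -[X in _ <= \sum_(i <- iota 0 X) _](subnKC (_ : j + 1 <= m)%N); last by rewrite addn1.
      by rewrite [iota 0 (j + 1 + _)]iotaD big_cat/= lerDl sumr_ge0// => i _; exact: normr_ge0.
    apply: (@le_trans _ _ (\sum_(i <- iota 0 m) (`|w (x + ((i + 1)%:R * s) *: nu)| +
       \sum_(i <- iota 0 m) g (x + ((i + 0)%:R * s) *: nu)))).
      rewrite -{1}(size_iota 0 m) -sum1_size natr_sum mulr_suml big_seq [leRHS]big_seq.
      by apply: ler_sum => i; rewrite mem_iota add0n mul1r => /= im; exact: tel'.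
    by rewrite big_split/= lerD2l big_const_seq count_predT size_iota iter_addr_0 mulr_natl.
  have cs f (c : nat) i : continuous f -> continuous (fun x : 'rV[R]_n => f (x + ((i + c)%:R * s) *: nu)).
    by move=> cf; exact: rcont_shift.
  have intD f : continuous f -> rintegrable leb D (fun x => a x * f x) by move=> cf; exact: intaf.
  have i1 : rintegrable leb D (fun x => \sum_(i <- iota 0 m) (a x * `|w (x + ((i + 1)%:R * s) *: nu)|)).
    by apply: rintegrable_sum => // i; apply: intD; exact: (cs (fun x => `|w x|)).
  have i2 : rintegrable leb D (fun x => \sum_(i <- iota 0 m) (a x * g (x + ((i + 0)%:R * s) *: nu))).
    by apply: rintegrable_sum => // i; apply: intD; exact: (cs g).
  have : m%:R * I0 <= (K / s + A) * I2 + m%:R * ((K / s + A) * \int[leb]_(x in U) g x).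
    apply: (@le_trans _ _ (\int[leb]_(x in D) (\sum_(i <- iota 0 m) (a x * `|w (x + ((i + 1)%:R * s) *: nu)|) +
      m%:R * \sum_(i <- iota 0 m) (a x * g (x + ((i + 0)%:R * s) *: nu))))).
      rewrite /I0 -RintegralZl//; last by apply: intD.
      apply: le_Rintegral => //; first by apply: rintegrableZ => //; exact: intD.
      - by apply: rintegrableD => //; exact: rintegrableZ.
      - move=> x _; have /andP[ax _] := aA x.
        by rewrite -!mulr_sumr mulrCA (mulrCA _ (a x)) -mulrDr ler_wpM2l.
    rewrite RintegralD//; last exact: rintegrableZ.
    rewrite RintegralZl// !Rintegral_sum//; last 2 first.
    - by move=> i; apply: intD; exact: (cs g).
    - by move=> i; apply: intD; exact: (cs (fun x => `|w x|)).
    by rewrite lerD// ler_wpM2l// (ltW mR).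
  rewrite /g => hm; rewrite -(ler_pM2l mR); apply: (le_trans hm); rewrite le_eqVlt; apply/orP; left; apply/eqP.
  have -> : h = m%:R * s by rewrite sE mulrCA mulfV ?mulr1// gt_eqF.
  by field; rewrite !gt_eqF.
(* As the step tends to 0, the sampling error [A * s] disappears and the increments become
   directional derivatives. *)
have lim e : 0 < e -> I0 <= (K + e) * (I1 + e + h^-1 * I2).
  move=> e0; have [dl dl0 hdl] := Rintegral_diffquot nu Cw bU e0.
  pose q := Num.min dl (e / (A + 1)).
  have q0 : 0 < q by rewrite lt_min dl0 divr_gt0//; lra.
  have [m m0 hm] : exists2 m, (0 < m)%N & h / m%:R < q.
    exists (Num.truncn (h / q)).+1 => //; rewrite ltr_pdivrMr ?ltr0n// mulrC -ltr_pdivrMr//.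
    exact: truncnS_gt.
  set s := h / m%:R in hm; have s0 : 0 < s by rewrite divr_gt0 ?ltr0n.
  apply: (le_trans (key m s m0 erefl)).
  have As : A * s <= e.
    have : s <= e / (A + 1) by rewrite (le_trans (ltW hm))// ge_min lexx orbT.
    by rewrite ler_pdivlMr ?ltr_wpDl// => /(le_trans _); apply; rewrite mulrDr mulr1 mulrC lerDl ltW.
  have I2h : 0 <= h^-1 * I2 by rewrite mulr_ge0// invr_ge0 ltW.
  have hdls := hdl s _; set Ig := \int[leb]_(x in U) _ in hdls *.
  have Ig0 : 0 <= Ig by apply: Rintegral_ge0.
  apply: ler_pM; [|by rewrite addr_ge0// mulr_ge0// invr_ge0 ltW|by rewrite lerD2l|].
    by rewrite addr_ge0// mulr_ge0// ltW.
  rewrite lerD2r mulrC ler_pdivrMr// mulrC; apply: hdls.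
  by rewrite s0 (lt_le_trans hm)// ge_min lexx.
rewrite /= in lim.
set I3 := h^-1 * I2 in lim *; have I3_0 : 0 <= I3 by rewrite mulr_ge0// invr_ge0 ltW.
apply/ler_addgt0Pr => e e0.
pose d := Num.min 1 (e / (K + I1 + I3 + 1)).
have d0 : 0 < d by rewrite lt_min ltr01 divr_gt0//; lra.
have d1 : d <= 1 by rewrite ge_min lexx.
have de : d * (K + I1 + I3 + 1) <= e by rewrite -ler_pdivlMr ?ge_min ?lexx ?orbT//; lra.
have := lim d d0; have := mulr_ge0 (ltW d0) (_ : 0 <= 1 - d); nra.
Qed.

(** The displacement is cut into [m] equal steps. Translation invariance brings every step back to
    an increment of size [1 / m] integrated over [U], and the [m] factors [1 / m] add up to 1. *)
Lemma Rintegral_translate w D U (v : 'rV[R]_n) : C1 w -> bmeas D -> bmeas U ->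
  (forall x t, D x -> 0 <= t <= 1 -> U (x + t *: v)) ->
  \int[leb]_(x in D) `|w (x + v) - w x| <= \int[leb]_(x in U) `|dot v (grad w x)|.
Proof.
move=> Cw bD bU DU; have [mD _] := bD; have [mU _] := bU.
have cw : continuous w by exact: C1_cont.
apply/ler_addgt0Pr => e e0; have [dl dl0 hdl] := Rintegral_diffquot v Cw bU e0.
have [m m0 hm] : exists2 m, (0 < m)%N & m%:R^-1 < dl.
  exists (Num.truncn (dl^-1)).+1 => //.
  by rewrite -ltf_pV2 ?posrE ?invr_gt0 ?ltr0n// invrK truncnS_gt.
set s := m%:R^-1 in hm; have s0 : 0 < s by rewrite invr_gt0 ltr0n.
have ms : m%:R * s = 1 by rewrite mulfV// pnatr_eq0 -lt0n.
pose g x := `|w (x + s *: v) - w x|.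
have cg : continuous g by apply: rcont_norm; apply: rcontD; [exact: rcont_shift|exact: rcontN].
have cgi i : continuous (fun x : 'rV[R]_n => g (x + (i%:R * s) *: v)) by exact: rcont_shift.
apply: (@le_trans _ _ (\int[leb]_(x in D) \sum_(i <- iota 0 m) g (x + (i%:R * s) *: v))).
  apply: le_Rintegral => //.
  - by apply: cont_integrable => //; apply: rcont_norm; apply: rcontD; [exact: rcont_shift|exact: rcontN].
  - by apply: rintegrable_sum => // i; exact: cont_integrable.
  - move=> x _; rewrite -{1}[v in x + v]scale1r -{1}ms.
    elim: {1 2}m => [|j IH]; first by rewrite mul0r scale0r addr0 subrr normr0 big_nil.
    rewrite (_ : iota 0 j.+1 = iota 0 j ++ [:: j]); last by rewrite -addn1 iotaD add0n.
    rewrite big_cat/= big_seq1.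
    have -> : x + (j.+1%:R * s) *: v = x + (j%:R * s) *: v + s *: v.
      by rewrite -addrA -scalerDl -natr1 mulrDl mul1r.
    rewrite addrC -[_ - w x](subrKA (w (x + (j%:R * s) *: v))).
    by apply: (le_trans (ler_normD _ _)); rewrite lerD2l.
rewrite Rintegral_sum//; last by move=> i; exact: cont_integrable.
apply: (@le_trans _ _ (\sum_(i <- iota 0 m) \int[leb]_(x in U) g x)).
  rewrite !big_seq; apply: ler_sum => i; rewrite mem_iota add0n => /= im.
  pose F x := (x - (i%:R * s) *: v \in D)%:R * g x.
  have mF : lmfun F.
    apply: lmfunM; last exact: cont_mfun.
    rewrite (_ : (fun x => _) = \1_[set x | D (x - (i%:R * s) *: v)]).
      by apply: measurable_indic; exact: shift_lmble.
    by apply/funext => x; rewrite indicE; congr (_ : bool)%:R; apply/idP/idP; rewrite !in_setE.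
  have -> : \int[leb]_(x in D) g (x + (i%:R * s) *: v) = \int[leb]_x F x.
    rewrite -(Rintegral_shift_ge0 ((i%:R * s) *: v))//; last by move=> x; rewrite mulr_ge0// normr_ge0.
    rewrite [RHS](@Rintegral_supp D).
      by apply: eq_Rintegral => x Dx; rewrite /F addrK Dx mul1r.
    by move=> x nD; rewrite /F addrK memNset// mul0r.
  have FU x : ~ U x -> F x = 0.
    move=> nU; rewrite /F; case: (boolP (_ \in D)) => [|_]; last by rewrite mul0r.
    rewrite in_setE => /DU h; exfalso; apply: nU; have := h (i%:R * s).
    rewrite subrK; apply; rewrite mulr_ge0 ?(ltW s0)//= -[X in _ <= X]ms ler_wpM2r ?(ltW s0)//.
    by rewrite ler_nat ltnW.
  have gi : rintegrable leb U g by exact: cont_integrable.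
  rewrite (Rintegral_supp FU); apply: le_Rintegral => //.
    change (rintegrable leb U F); apply: (@le_rintegrable _ _ R leb U F g) => //; first exact: measurable_funS mF.
    move=> x _; rewrite normrM (ger0_norm (normr_ge0 _ : 0 <= g x)) ger0_norm//.
    by rewrite ler_piMl ?normr_ge0//; case: (_ \in _).
  by move=> x _; rewrite ler_piMl ?normr_ge0//; case: (_ \in _).
rewrite big_const_seq count_predT size_iota iter_addr_0 -mulr_natl.
have h : \int[leb]_(x in U) g x <= _ := hdl s _; apply: (@le_trans _ _ (m%:R * (s * (\int[leb]_(x in U) `|dot v (grad w x)| + e)))).
  by rewrite ler_wpM2l// h// s0.
by rewrite mulrA ms mul1r.
Qed.

End lebesgue_integrals.

(** * Cutoffs and mollifiers *)

Section smooth_step.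
Context {R : realType}.
Implicit Types t h : R.

Lemma is_derive_quadratic (f : R -> R) (t d C : R) :
  (forall h, `|f (t + h) - f t - d * h| <= C * h ^+ 2) -> is_derive t 1 f d.
Proof.
move=> hf.
have C0 : 0 <= C by have := le_trans (normr_ge0 _) (hf 1); rewrite expr1n mulr1.
have cv : (fun h : R => h^-1 *: (f (h *: (1 : R) + t) - f t)) @ 0^' --> (d : R).
  apply/cvgrPdist_le => e e0; near=> h.
  have h0 : h != 0 by near: h; exact: nbhs_dnbhs_neq.
  have hC : `|h| <= e / (C + 1).
    near: h; apply: dnbhs0_le; rewrite divr_gt0//; lra.
  have -> : d - h^-1 *: (f (h *: (1 : R) + t) - f t) = - (h^-1 * (f (t + h) - f t - d * h)).
    by rewrite /GRing.scale/= mulr1 (addrC h t); field.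
  rewrite normrN normrM normfV mulrC ler_pdivrMr ?normr_gt0//.
  apply: (le_trans (hf h)); rewrite -real_normK ?num_real// expr2 mulrA ler_wpM2r//.
  move: hC; rewrite ler_pdivlMr ?ltr_wpDl// => hC; apply: le_trans hC.
  by rewrite mulrDr mulr1 mulrC lerDl.
exact: DeriveDef (cvgP _ cv) (cvg_lim (@Rhausdorff R) cv).
Unshelve. all: by end_near. Qed.

Definition sqrpos t : R := Num.max 0 t ^+ 2.

Lemma is_derive_sqrpos t : is_derive t 1 sqrpos (2 * Num.max 0 t).
Proof.
apply: (@is_derive_quadratic _ _ _ 1) => h; rewrite /sqrpos mul1r ler_norml !maxEle.
by case: (leP 0 t) => ?; case: (leP 0 (t + h)) => ?; apply/andP; split; nra.
Qed.

(* A C1 function equal to 0 on the negative reals and to 1 on [1, +oo[. *)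
Definition step t : R := 1 - sqrpos (1 - sqrpos t).

Definition dstep t : R := 2 * Num.max 0 (1 - sqrpos t) * (2 * Num.max 0 t).

Lemma is_derive_step t : is_derive t 1 step (dstep t).
Proof.
have d1 := is_derive_sqrpos t; have d2 := is_derive_sqrpos (1 - sqrpos t).
have d3 : is_derive t (1 : R) (fun u => 1 - sqrpos u) (0 - 2 * Num.max 0 t).
  exact: (is_deriveB (is_derive_cst (1 : R) t 1) d1).
have d4 : is_derive t (1 : R) (sqrpos \o (fun u => 1 - sqrpos u))
   (2 * Num.max 0 (1 - sqrpos t) * (0 - 2 * Num.max 0 t)).
  exact: (@is_derive1_comp R sqrpos (fun u => 1 - sqrpos u) t _ _ d2 d3).
have d5 : is_derive t (1 : R) (fun u => 1 - (sqrpos \o (fun u => 1 - sqrpos u)) u)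
   (0 - (2 * Num.max 0 (1 - sqrpos t) * (0 - 2 * Num.max 0 t))).
  exact: (is_deriveB (is_derive_cst (1 : R) t 1) d4).
apply: is_derive_eq d5 _; rewrite /dstep; ring.
Qed.

Lemma max0_continuous : continuous (fun t => Num.max 0 t).
Proof. by move=> t; apply: continuous_max; [exact: cvg_cst|exact: cvg_id]. Qed.

Lemma sqrpos_continuous : continuous sqrpos.
Proof.
move=> t; apply: differentiable_continuous; apply/derivable1_diffP.
by have [h _] := is_derive_sqrpos t; exact: h.
Qed.

Lemma dstep_continuous : continuous dstep.
Proof.
have c1 : continuous (fun t => Num.max 0 (1 - sqrpos t)).
  move=> t; apply: (@continuous_comp _ _ _ (fun t => 1 - sqrpos t) (fun t => Num.max 0 t)).
    by apply: continuousB; [exact: cvg_cst|exact: sqrpos_continuous].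
  exact: max0_continuous.
rewrite /dstep; apply: rcontM; apply: rcontM => //; try exact: cst_continuous.
exact: max0_continuous.
Qed.

Lemma step_le0 t : t <= 0 -> step t = 0.
Proof.
move=> t0; have m : Num.max 0 t = 0 by apply/max_idPl.
by rewrite /step /sqrpos m expr0n/= subr0 (max_r ler01) expr1n subrr.
Qed.

Lemma step_ge1 t : 1 <= t -> step t = 1.
Proof.
move=> t1; rewrite /step /sqrpos (max_r (_ : 0 <= t)) ?(le_trans _ t1)//.
by rewrite max_l ?expr0n ?subr0// subr_le0 exprn_ege1.
Qed.

Lemma step_itv t : 0 <= step t <= 1.
Proof.
have s0 : 0 <= sqrpos t by rewrite sqr_ge0.
rewrite /step /sqrpos -/(sqrpos t) maxEle; case: (leP 0 (1 - sqrpos t)) => h; nra.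
Qed.

Lemma dstep_itv t : 0 <= dstep t <= 2.
Proof.
rewrite /dstep /sqrpos !maxEle; case: (leP 0 t) => t0; last by rewrite expr0n/= subr0 ler01; nra.
(* On [[0, 1]] the function is [4 * t * (1 - t ^+ 2)], largest at [1 / sqrt 3]; the double root at
   the nearby rational [3 / 5] certifies a bound below 2. The value 2 is what later makes the
   complement of a truncation nondecreasing. *)
by case: (leP 0 (1 - t ^+ 2)) => h; [have := mulr_ge0 (sqr_ge0 (t - 3 / 5)) (_ : 0 <= t + 6 / 5); nra|nra].
Qed.

End smooth_step.

Section smooth_bumps.
Context {R : realType} {n : nat}.
Implicit Types (x y z v : 'rV[R]_n) (r : R).
Local Notation leb := (@leb R n).

Lemma C1_sqr x : C1 (fun z => dot (z - x) (z - x)).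
Proof.
have [] := @C1_of_grad R n (fun z => dot (z - x) (z - x)) (fun z => 2 *: (z - x)).
- move=> i; rewrite (_ : (fun _ => _) = (fun z : 'rV[R]_n => 2 * (z 0 i - x 0 i))); last first.
    by apply/funext => z; rewrite !mxE.
  apply: rcontM; first exact: cst_continuous.
  by apply: rcontD; [exact: coord_continuous|exact: cst_continuous].
- move=> z v; case: (@differentiable_dot R n (fun z => dot (z - x) (z - x)) z (2 *: (z - x))); last by split.
  move=> e e0; exists e => // h he.
  have -> : dot (z + h - x) (z + h - x) - dot (z - x) (z - x) - dot h (2 *: (z - x)) = enorm h ^+ 2.
    have -> : z + h - x = (z - x) + h by rewrite addrAC.
    by move: (z - x) => a; rewrite enorm_sqr dotZr dotDl !dotDr (dotC a h); ring.
  by rewrite expr2 normrM ger0_norm ?enorm_ge0// ler_wpM2r ?enorm_ge0// ltW.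
- by [].
Qed.

Lemma C1_step f : C1 f -> C1 (fun z : 'rV[R]_n => step (f z)).
Proof. by move=> cf; have [] := C1_comp (@is_derive_step R) (@dstep_continuous R) cf. Qed.

Lemma cutoff_exists x r : 0 < r -> exists eta : 'rV[R]_n -> R, [/\ C1 eta,
  forall z, 0 <= eta z <= 1, forall z, enorm (z - x) <= r / 2 -> eta z = 1 &
  forall z, r <= enorm (z - x) -> eta z = 0].
Proof.
(* [q] equals [4 / 3 * (1 - (enorm (z - x) / r) ^+ 2)]: it is 1 at distance [r / 2] and 0 at
   distance [r]. *)
move=> r0; pose q z := 4 / 3 + (- (4 / 3) / r ^+ 2) * dot (z - x) (z - x).
have cq : C1 q.
  have [c1 _] := C1Z (- (4 / 3) / r ^+ 2) (C1_sqr x).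
  by have [] := C1D (C1_cst (4 / 3)) c1.
have qE z : q z = 4 / 3 * (1 - (enorm (z - x) / r) ^+ 2).
  by rewrite /q -enorm_sqr; field; rewrite gt_eqF.
exists (fun z => step (q z)); split.
- exact: C1_step.
- by move=> z; exact: step_itv.
- move=> z hz; apply: step_ge1; rewrite qE.
  have h1 : enorm (z - x) / r <= 2^-1 by rewrite ler_pdivrMr// mulrC.
  have h2 : 0 <= enorm (z - x) / r by rewrite divr_ge0 ?enorm_ge0// ltW.
  nra.
- move=> z hz; apply: step_le0; rewrite qE.
  have h1 : 1 <= enorm (z - x) / r by rewrite ler_pdivlMr// mul1r.
  nra.
Qed.

Definition mollifier r (K : 'rV[R]_n -> R) := [/\ C1 K, forall z, 0 <= K z,
  forall z, K (- z) = K z, forall z, r <= enorm z -> K z = 0 & \int[leb]_z K z = 1].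

Lemma supp_rintegrable (D : set 'rV[R]_n) f : lmble D -> (forall x, ~ D x -> f x = 0) ->
  rintegrable leb D f -> rintegrable leb setT f.
Proof.
move=> mD f0 hf; rewrite /rintegrable (_ : EFin \o f = (EFin \o f) \_ D).
  by rewrite -integrable_mkcond.
apply/funext => x; rewrite patchE; case: ifPn => // /negP; rewrite in_setE => /f0 /= ->.
by [].
Qed.

Lemma closed_eball_bmeas x r : bmeas [set y | enorm (y - x) <= r].
Proof.
split; first exact/closed_lmble/closed_eball_closed.
apply: (@enorm_bounded _ _ _ (enorm x + r)%R) => y /= h.
by have := enormD (y - x) x; rewrite subrK; lra.
Qed.

Lemma cont_supp_integrable x r f : continuous f -> (forall z, r <= enorm (z - x) -> f z = 0) ->
  rintegrable leb setT f.
Proof.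
move=> cf f0; apply: (@supp_rintegrable [set y | enorm (y - x) <= r]).
- by case: (closed_eball_bmeas x r).
- by move=> z /= /negP; rewrite -ltNge => /ltW; exact: f0.
- by apply: cont_integrable => //; exact: closed_eball_bmeas.
Qed.

Lemma mollifier_exists r : 0 < r -> exists K, mollifier r K.
Proof.
move=> r0; have [eta [Ce e01 e1 e0]] := cutoff_exists 0 r0.
have [Ce' _ e01' e1' e0'] : [/\ C1 eta, True, forall z, 0 <= eta z <= 1,
    forall z, enorm z <= r / 2 -> eta z = 1 & forall z, r <= enorm z -> eta z = 0].
  by split => // z hz; [apply: e1|apply: e0]; rewrite subr0.
(* The product makes the kernel even, without any symmetry of [eta]. *)
pose k z := eta z * eta (- z).
have CN : C1 (fun z => eta (- z)).
  have [] := @C1_of_grad R n (fun z => eta (- z)) (fun z => - grad eta (- z)) => //.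
    move=> i; rewrite (_ : (fun _ => _) = (fun z => - grad eta (- z) 0 i)); last by apply/funext => z; rewrite mxE.
    apply: rcontN => z; apply: (@continuous_comp _ _ _ (fun z : 'rV[R]_n => - z) (fun z => grad eta z 0 i)).
      exact: opp_continuous.
    exact: grad_coord_cont.
  move=> z v; case: (@differentiable_dot R n (fun z => eta (- z)) z (- grad eta (- z))); last by split.
  move=> e eg0.
  have [d d0 hd] := C1_unif_diff Ce (eball_bounded (- z) 1) eg0.
  exists d => // h hh; rewrite opprD dotNr -dotNl -[enorm h]enormN; apply: hd; last by rewrite enormN.
  by rewrite /eball/= subrr enorm0.
have [Ck _] := C1M Ce CN; rewrite -/k in Ck.
have k0 z : 0 <= k z by have /andP[? _] := e01 z; have /andP[? _] := e01 (- z); rewrite mulr_ge0.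
have ks z : r <= enorm z -> k z = 0 by move=> /e0' h; rewrite /k h mul0r.
have ki : rintegrable leb setT k.
  by apply: (@cont_supp_integrable 0 r); [exact: C1_cont|move=> z; rewrite subr0; exact: ks].
have I0 : 0 < \int[leb]_z k z.
  pose B : set 'rV[R]_n := eball 0 (r / 2).
  have mB : lmble B by apply: open_lmble; exact: eball_open.
  have fB : (leb B < +oo)%E by exact/lebesgue_outer_bounded/eball_bounded.
  have pB : (0 < leb B)%E.
    by apply: lebesgue_outer_open_gt0; [exact: eball_open|exists 0; rewrite /B/eball/= subrr enorm0 divr_gt0].
  apply: (@lt_le_trans _ _ (\int[leb]_(z in B) 1)).
    by rewrite Rintegral_cst// mul1r fine_gt0// pB.
  apply: (@le_trans _ _ (\int[leb]_(z in B) k z)).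
    apply: le_Rintegral => //.
    - by apply: cont_integrable; [split => //; exact: eball_bounded|exact: cst_continuous].
    - exact: (rintegrableS measurableT).
    - move=> z; rewrite /B/eball/= subr0 => /ltW h.
      by rewrite /k !e1' ?enormN// mulr1.
  by apply: Rintegral_subset.
exists (fun z => (\int[leb]_z k z)^-1 * k z); split.
- by have [] := C1Z (\int[leb]_z k z)^-1 Ck.
- by move=> z; rewrite mulr_ge0// invr_ge0 ltW.
- by move=> z; rewrite /k opprK mulrC [eta _ * _]mulrC mulrC.
- by move=> z /ks ->; rewrite mulr0.
- by rewrite RintegralZl// mulVf// gt_eqF.
Qed.

End smooth_bumps.

Section convolution.
Context {R : realType} {n : nat}.
Implicit Types (x y z v : 'rV[R]_n) (D E : set 'rV[R]_n).
Local Notation leb := (@leb R n).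

Lemma bmeas_diff D E : bmeas D -> bmeas E -> bounded_set [set z | exists x y, [/\ E x, D y & z = y - x]].
Proof.
move=> [_ /bounded_enorm[M M0 hM]] [_ /bounded_enorm[M' M'0 hM']].
apply: (@enorm_bounded _ _ _ (M + M')%R) => _ [x [y [Ex Dy ->]]].
by apply: (le_trans (enormD _ _)); rewrite enormN lerD ?hM ?hM'.
Qed.

Lemma set1_bmeas x : bmeas [set x].
Proof.
split; first by apply: compact_lmble; exact: compact_set1.
by apply: (@enorm_bounded _ _ _ (enorm x)) => _ ->.
Qed.

Lemma rcont_shiftB x (k : 'rV[R]_n -> R) : continuous k -> continuous (fun y => k (y - x)).
Proof. by move=> ck; exact: rcont_shift. Qed.

Lemma rint_conv D f k x : bmeas D -> rintegrable leb D f -> continuous k ->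
  rintegrable leb D (fun y => f y * k (y - x)).
Proof.
move=> bD hf ck; have [M M0 hM] := continuous_bounded ck (bmeas_diff bD (set1_bmeas x)).
apply: (@rintegrableM _ _ _ _ _ _ _ M) => //; first exact: bD.1.
  by apply: cont_lmble_fun; exact: rcont_shiftB.
by move=> y Dy; apply: hM; exists x, y.
Qed.

Lemma conv_cont D f k : bmeas D -> rintegrable leb D f -> continuous k ->
  continuous (fun x => \int[leb]_(y in D) (f y * k (y - x))).
Proof.
move=> bD hf ck x; have mD := bD.1.
apply/(@cvgrPdist_le _ _ _ (nbhs x) (nbhs_filter x)) => e e0.
pose I := \int[leb]_(y in D) `|f y|; have I0 : 0 <= I by apply: Rintegral_ge0.
have e1 : 0 < e / (I + 1) by rewrite divr_gt0//; lra.
have [d d0 hd] := enorm_unif_continuous ck (bmeas_diff bD (set1_bmeas x)) e1.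
apply/nbhs_eball; exists d => // z; rewrite /eball/= => zd.
rewrite -RintegralB//; try exact: rint_conv.
apply: (le_trans (Rintegral_le_norm _ _)) => //.
  by apply: rintegrableB => //; exact: rint_conv.
apply: (@le_trans _ _ (\int[leb]_(y in D) (e / (I + 1) * `|f y|))).
  apply: le_Rintegral => //.
  - by apply: rintegrable_norm => //; apply: rintegrableB => //; exact: rint_conv.
  - by apply: rintegrableZ => //; exact: rintegrable_norm.
  - move=> y Dy; rewrite -mulrBr normrM mulrC ler_wpM2r//.
    rewrite distrC; apply: hd; first by exists x, y.
    by rewrite opprB addrC addrA subrK enormBC.
rewrite RintegralZl//; last exact: rintegrable_norm.
by rewrite -/I mulrAC ler_pdivrMr ?ltr_wpDl// mulrDr mulr1 lerDl ltW.
Qed.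

Lemma conv_C1 D f k : bmeas D -> rintegrable leb D f -> C1 k ->
  C1 (fun x => \int[leb]_(y in D) (f y * k (y - x))) /\
  forall v x, dot v (grad (fun x => \int[leb]_(y in D) (f y * k (y - x))) x) =
    - \int[leb]_(y in D) (f y * dot v (grad k (y - x))).
Proof.
move=> bD hf Ck; have mD := bD.1; have ck := C1_cont Ck.
pose w x := \int[leb]_(y in D) (f y * k (y - x)).
pose a x : 'rV[R]_n := \row_i - \int[leb]_(y in D) (f y * grad k (y - x) 0 i).
have cgi i : continuous (fun x => grad k x 0 i) by exact: grad_coord_cont.
have dota v x : dot v (a x) = - \int[leb]_(y in D) (f y * dot v (grad k (y - x))).
  rewrite /dot.
  under eq_Rintegral do rewrite mulr_sumr.
  rewrite Rintegral_sum//; last first.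
    move=> i; rewrite (_ : (fun y => _) = (fun y => v 0 i * (f y * grad k (y - x) 0 i))); last first.
      by apply/funext => y; rewrite mulrCA.
    by apply: rintegrableZ => //; exact: (rint_conv (k := fun x => grad k x 0 i)).
  rewrite -sumrN; apply: eq_bigr => i _; rewrite mxE mulrN; congr (- _).
  rewrite -RintegralZl//; last exact: (rint_conv (k := fun x => grad k x 0 i)).
  by apply: eq_Rintegral => y _; rewrite mulrCA.
have [] := @C1_of_grad R n w a.
- move=> i; rewrite (_ : (fun x => _) = (fun x => - \int[leb]_(y in D) (f y * grad k (y - x) 0 i))).
    by apply: rcontN; exact: (conv_cont bD hf (cgi i)).
  by apply/funext => x; rewrite mxE.
- move=> x v; case: (@differentiable_dot R n w x (a x)); last by split.
  move=> e e0; pose I := \int[leb]_(y in D) `|f y|; have I0 : 0 <= I by apply: Rintegral_ge0.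
  have e1 : 0 < e / (I + 1) by rewrite divr_gt0//; lra.
  have [d d0 hd] := C1_unif_diff Ck (bmeas_diff bD (set1_bmeas x)) e1.
  exists d => // h hh; rewrite dota opprK.
  have cdot : continuous (fun z => dot h (grad k z)).
    by rewrite (_ : (fun z => _) = (fun z => 'D_h k z)); [case: Ck => _; exact|apply/funext => z; rewrite C1_derive].
  have i1 := rint_conv (x + h) bD hf ck; have i2 := rint_conv x bD hf ck.
  have i3 := rint_conv x bD hf cdot.
  rewrite -RintegralB// -RintegralD//; last exact: rintegrableB.
  apply: (le_trans (Rintegral_le_norm _ _)) => //.
    by apply: rintegrableD => //; exact: rintegrableB.
  apply: (@le_trans _ _ (\int[leb]_(y in D) ((e / (I + 1) * enorm h) * `|f y|))).
    apply: le_Rintegral => //.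
    + by apply: rintegrable_norm => //; apply: rintegrableD => //; exact: rintegrableB.
    + by apply: rintegrableZ => //; exact: rintegrable_norm.
    + move=> y Dy; rewrite -mulrBr -mulrDr normrM mulrC ler_wpM2r//.
      have := hd (y - x) (- h) _ _; rewrite enormN dotNl opprK opprD addrA; apply => //.
      by exists x, y.
  rewrite RintegralZl//; last exact: rintegrable_norm.
  change (e / (I + 1) * enorm h * I <= e * enorm h).
  rewrite (mulrAC (e / (I + 1))) ler_wpM2r ?enorm_ge0//.
  by rewrite mulrAC ler_pdivrMr ?ltr_wpDl// mulrDr mulr1 lerDl ltW.
- by rewrite -/w => Cw gw; split => // v x; rewrite gw dota.
Qed.

End convolution.

Lemma leb_sigma_finite (R : realType) (n : nat) : sigma_finite setT (@leb R n).
Proof.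
exists (fun k : nat => eball 0 k%:R).
  apply/seteqP; split=> // x _; exists (Num.truncn (enorm x)).+1 => //.
  by rewrite /eball/= subr0 truncnS_gt.
move=> k; split; first by apply: open_lmble; exact: eball_open.
by apply: lebesgue_outer_bounded; exact: eball_bounded.
Qed.

HB.instance Definition _ (R : realType) (n : nat) :=
  @Measure_isSigmaFinite.Build _ _ R (@leb R n) (leb_sigma_finite R n).

Section measurable_coordinates.
Context d (T : measurableType d) {R : realType} {n : nat}.
Implicit Types (F : T -> 'rV[R]_n).

(** Stated for an arbitrary measurable source so that it covers products of two Caratheodory
    sigma-algebras: the preimage of a dyadic cube is a condition on each coordinate, and an open set
    is a countable union of cubes. *)
Lemma measurable_coord_open F (U : set 'rV[R]_n) :
  (forall i, measurable_fun setT (fun t => F t 0 i)) -> open U -> measurable (F @^-1` U).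
Proof.
move=> mF oU; rewrite -(open_dyadic_inner oU) preimage_bigcup.
apply: bigcupT_measurable => k; rewrite /dyadic_inner preimage_bigcup.
rewrite bigcup_mkcond; apply: countable_bigcupT_measurable => [|z]; first exact: countableP.
case: ifP => // _.
rewrite (_ : _ @^-1` _ = \bigcap_(i in [set: 'I_n])
   [set t | (z 0 i)%:~R <= 2 ^+ k * F t 0 i < (z 0 i + 1)%:~R]); last first.
  by apply/seteqP; split=> t; [move=> /dyadic_cubeP h i _; exact: h|move=> h; apply/dyadic_cubeP => i; exact: h].
apply: fin_bigcap_measurable => [|i _]; first exact: finite_finset.
have mc : measurable_fun setT (fun t => 2 ^+ k * F t 0 i).
  by apply: measurable_funM; [exact: measurable_cst|exact: mF].
have := mc measurableT `[(z 0 i)%:~R, (z 0 i + 1)%:~R[%classic (measurable_itv _).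
by rewrite setTI; congr measurable; apply/seteqP; split=> t /=; rewrite in_itv.
Qed.

Lemma measurable_coord_comp F (f : 'rV[R]_n -> R) :
  (forall i, measurable_fun setT (fun t => F t 0 i)) -> continuous f -> measurable_fun setT (f \o F).
Proof.
move=> mF cf mD; apply: (measurability _ (RGenOpens.measurableE R)) => // _ [_ [a [b ->]] <-].
rewrite setTI comp_preimage; apply: measurable_coord_open => //.
by apply: open_comp => // x _; exact: cf.
Qed.

End measurable_coordinates.

(** * Mollification in L1 *)

Section mollification.
Context {R : realType} {n : nat}.
Implicit Types (x y z v a : 'rV[R]_n) (D E U : set 'rV[R]_n) (f g k K phi : 'rV[R]_n -> R).
Local Notation leb := (@leb R n).
Local Notation cT := (caratheodory_type (@lebesgue_outer R n)).

Lemma lmfun_patch D f : lmble D -> measurable_fun (D : set cT) f -> lmfun (f \_ D).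
Proof. by move=> mD mf; apply/(measurable_restrictT _ mD). Qed.

Lemma measurable_sub_coord (i : 'I_n) : measurable_fun setT (fun p : cT * cT => (p.2 - p.1 : 'rV[R]_n) 0 i).
Proof.
rewrite (_ : (fun p : cT * cT => _) = (fun p : cT * cT => (p.2 : 'rV[R]_n) 0 i - (p.1 : 'rV[R]_n) 0 i)); last first.
  by apply/funext => p; rewrite !mxE.
apply: measurable_funB.
  exact: (measurableT_comp (coord_lmble_fun i) (@measurable_snd _ _ cT cT)).
exact: (measurableT_comp (coord_lmble_fun i) (@measurable_fst _ _ cT cT)).
Qed.

(** Fubini's theorem, after extending [f] and [phi] by 0 to the whole space. On differences of
    points of [D] and [E] the kernel is bounded, so the integrand is dominated by a product of
    integrable functions. *)
Lemma conv_adjoint D E f k phi (C : R) : bmeas D -> bmeas E -> rintegrable leb D f -> continuous k ->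
  measurable_fun (E : set cT) phi -> (forall x, E x -> `|phi x| <= C) ->
  \int[leb]_(x in E) (phi x * \int[leb]_(y in D) (f y * k (y - x))) =
  \int[leb]_(y in D) (f y * \int[leb]_(x in E) (phi x * k (y - x))).
Proof.
move=> bD bE hf ck mphi hC; have mD := bD.1; have mE := bE.1.
have [M M0 hM] := continuous_bounded ck (bmeas_diff bD bE).
pose p := phi \_ E; pose g := f \_ D.
have mp : lmfun p by exact: lmfun_patch.
have mg : lmfun g by apply: lmfun_patch => //; exact: rintegrable_mfun hf.
have pE x : ~ E x -> p x = 0 by move=> nE; rewrite /p patchE memNset.
have gD x : ~ D x -> g x = 0 by move=> nD; rewrite /g patchE memNset.
have pE' x : E x -> p x = phi x by move=> Ex; rewrite /p patchE mem_set.
have gD' x : D x -> g x = f x by move=> Dx; rewrite /g patchE mem_set.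
have gi : rintegrable leb setT g.
  by apply: (supp_rintegrable mD gD); apply: (eq_rintegrable mD _ hf) => x /gD' ->.
have phii : rintegrable leb E phi.
  apply: (@le_rintegrable _ _ _ _ _ _ (fun=> C)) => //.
  by apply: cont_integrable => //; exact: cst_continuous.
have pi : rintegrable leb setT p.
  by apply: (supp_rintegrable mE pE); apply: (eq_rintegrable mE _ phii) => x /pE' ->.
pose F (q : cT * cT) : R := p q.1 * (g q.2 * k (q.2 - q.1)).
have mF : measurable_fun setT F.
  apply: measurable_funM; first exact: (measurableT_comp mp (@measurable_fst _ _ cT cT)).
  apply: measurable_funM; first exact: (measurableT_comp mg (@measurable_snd _ _ cT cT)).
  exact: (measurable_coord_comp measurable_sub_coord ck).
have hFG q : `|F q| <= M * (`|p q.1| * `|g q.2|).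
  case: (pselect (E q.1)) => [Eq|/pE p0]; last by rewrite /F p0 mul0r normr0 mul0r mulr0.
  case: (pselect (D q.2)) => [Dq|/gD g0]; last by rewrite /F g0 mul0r mulr0 normr0 !mulr0.
  rewrite /F !normrM mulrA [leRHS]mulrC ler_wpM2l// ?mulr_ge0//.
  by apply: hM; exists q.1, q.2.
pose I := \int[leb]_y `|g y|.
have iF : (leb \x leb)%E.-integrable setT (EFin \o F).
  apply: (@le_integrable _ _ _ _ _ _ _ (fun q : cT * cT => (M * (`|p q.1| * `|g q.2|))%:E)) => //.
  - exact/measurable_EFinP.
  - by move=> q _ /=; rewrite lee_fin (le_trans (hFG q))// ler_norm.
  apply/integrable12ltyP.
    apply/measurable_EFinP; apply: measurable_funM; first exact: measurable_cst.
    apply: measurable_funM; first exact: (measurableT_comp (lmfun_norm mp) (@measurable_fst _ _ cT cT)).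
    exact: (measurableT_comp (lmfun_norm mg) (@measurable_snd _ _ cT cT)).
  rewrite /= (_ : (fun x => _) = (fun x => (M * I * `|p x|)%:E)); last first.
    apply/funext => x; rewrite /I.
    transitivity (\int[leb]_y ((M * `|p x|) * `|g y|)%:E)%E.
      by apply: eq_integral => y _; rewrite mulrA ger0_norm// !mulr_ge0// ltW.
    rewrite Rintegral_EFin//; last by apply: rintegrableZ => //; exact: rintegrable_norm.
    by rewrite RintegralZl//; [rewrite mulrAC|exact: rintegrable_norm].
  rewrite Rintegral_EFin ?ltry//.
  by apply: rintegrableZ => //; exact: rintegrable_norm.
have iy x : rintegrable leb setT (fun y => g y * k (y - x)).
  apply: (supp_rintegrable mD); first by move=> y /gD ->; rewrite mul0r.
  apply: (@rint_conv) => //.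
  by apply: (eq_rintegrable mD _ hf) => y /gD' ->.
have ix y : rintegrable leb setT (fun x => p x * k (y - x)).
  apply: (supp_rintegrable mE); first by move=> x /pE ->; rewrite mul0r.
  have pk : rintegrable leb E p.
    by apply: (eq_rintegrable mE _ phii) => x /pE' ->.
  have [M' M'0 hM'] := continuous_bounded ck (bmeas_diff (set1_bmeas y) bE).
  apply: (@rintegrableM _ _ _ _ _ _ _ M') => //.
    apply: cont_lmble_fun => x; apply: (@continuous_comp _ _ _ (fun x => y - x) k); last exact: ck.
    by apply: (@cvgB R 'rV[R]_n _ (nbhs x) (nbhs_filter x) (fun=> y) id); [exact: cvg_cst|exact: cvg_id].
  by move=> x Ex; apply: hM'; exists x, y.
have := Fubini iF; rewrite /fubini_F/=.
rewrite (_ : (fun x => _) = (fun x => (p x * \int[leb]_y (g y * k (y - x)))%:E)); last first.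
  apply/funext => x; transitivity (\int[leb]_y (p x * (g y * k (y - x)))%:E)%E => //.
  by rewrite Rintegral_EFin//; [rewrite RintegralZl//; exact: iy|exact: rintegrableZ].
rewrite (_ : (fun y => integral _ _ _) = (fun y => (g y * \int[leb]_x (p x * k (y - x)))%:E)); last first.
  apply/funext => y; rewrite (_ : (fun x => _) = (fun x => (g y * (p x * k (y - x)))%:E)).
    by rewrite Rintegral_EFin//; [rewrite RintegralZl//; exact: ix|exact: rintegrableZ].
  by apply/funext => x; rewrite /F/= mulrCA.
move=> /(congr1 fine) => h.
have e1 x : \int[leb]_y (g y * k (y - x)) = \int[leb]_(y in D) (f y * k (y - x)).
  rewrite (@Rintegral_supp _ _ D); last by move=> y /gD ->; rewrite mul0r.
  by apply: eq_Rintegral => y; rewrite in_setE => /gD' ->.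
have e2 y : \int[leb]_x (p x * k (y - x)) = \int[leb]_(x in E) (phi x * k (y - x)).
  rewrite (@Rintegral_supp _ _ E); last by move=> x /pE ->; rewrite mul0r.
  by apply: eq_Rintegral => x; rewrite in_setE => /pE' ->.
transitivity (\int[leb]_x (p x * \int[leb]_y (g y * k (y - x)))).
  rewrite (@Rintegral_supp _ _ E); last by move=> x /pE ->; rewrite mul0r.
  by apply: eq_Rintegral => x; rewrite in_setE => Ex; rewrite (pE' _ Ex) e1.
rewrite [LHS]h [LHS](@Rintegral_supp _ _ D); last by move=> y /gD ->; rewrite mul0r.
by apply: eq_Rintegral => y; rewrite in_setE => Dy; rewrite (gD' _ Dy) e2.
Qed.

Lemma mollifier_shift1 K r a x : mollifier r K -> \int[leb]_y K (y - x - a) = 1.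
Proof.
move=> [CK K0 _ Ks <-].
rewrite -(@Rintegral_shift_ge0 R n (- (x + a)) K (cont_mfun (C1_cont CK)) K0).
by apply: eq_Rintegral => y _; rewrite opprD addrA.
Qed.

Lemma mollifier_le1 K r a y E : lmble E -> mollifier r K -> \int[leb]_(x in E) K (y - x - a) <= 1.
Proof.
move=> mE mK; have [CK K0 Ke Ks K1] := mK; have cK := C1_cont CK.
have e x : K (y - x - a) = K (x - (y - a)) by rewrite -Ke; congr K; rewrite !opprB addrCA.
apply: (@le_trans _ _ (\int[leb]_(x in setT) K (x - (y - a)))); last first.
  by rewrite -(mollifier_shift1 0 (y - a) mK); under [leRHS]eq_Rintegral do rewrite subr0.
under eq_Rintegral do rewrite e.
apply: Rintegral_subset => //.
apply: (@cont_supp_integrable _ _ (y - a) r); first exact: rcont_shiftB.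
by move=> z; exact: Ks.
Qed.

Lemma cont_kernel K r a : mollifier r K -> continuous (fun z => K (z - a)).
Proof. by move=> [CK _ _ _ _]; apply: rcont_shiftB; exact: C1_cont. Qed.

Lemma conv_le_norm U f k x : bmeas U -> rintegrable leb U f -> continuous k -> (forall z, 0 <= k z) ->
  `|\int[leb]_(y in U) (f y * k (y - x))| <= \int[leb]_(y in U) (`|f y| * k (y - x)).
Proof.
move=> bU hf ck k0; apply: (le_trans (Rintegral_le_norm bU.1 (rint_conv x bU hf ck))).
by rewrite le_eqVlt; apply/orP; left; apply/eqP/eq_Rintegral => y _; rewrite normrM (ger0_norm (k0 _)).
Qed.

(** Pairing with the constant 1 moves the kernel to the other variable, where its integral over [U]
    is at most 1. *)
Lemma conv_contraction U f K r a : bmeas U -> rintegrable leb U f -> mollifier r K ->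
  \int[leb]_(x in U) `|\int[leb]_(y in U) (f y * K (y - x - a))| <= \int[leb]_(x in U) `|f x|.
Proof.
move=> bU hf mK; have [CK K0 Ke Ks K1] := mK; have mU := bU.1.
have ck := cont_kernel (a := a) mK.
have hf' := rintegrable_norm mU hf.
have cc g : rintegrable leb U g -> continuous (fun x => \int[leb]_(y in U) (g y * K (y - x - a))).
  by move=> hg; exact: (conv_cont bU hg ck).
apply: (@le_trans _ _ (\int[leb]_(x in U) (1 * \int[leb]_(y in U) (`|f y| * K (y - x - a))))).
  apply: le_Rintegral => //.
  - by apply: cont_integrable => //; apply: rcont_norm; exact: cc.
  - by apply: cont_integrable => //; apply: rcontM; [exact: cst_continuous|exact: cc].
  - by move=> x _; rewrite mul1r; exact: (conv_le_norm x bU hf ck).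
rewrite (@conv_adjoint U U (fun y => `|f y|) (fun z => K (z - a)) (fun=> 1) 1)//; last first.
  by move=> x _; rewrite normr1.
have h y : 0 <= \int[leb]_(x in U) (1 * K (y - x - a)) <= 1.
  under eq_Rintegral do rewrite mul1r.
  by rewrite Rintegral_ge0//= (mollifier_le1 a y mU mK).
apply: le_Rintegral => //; last first.
  by move=> y _; rewrite ler_piMr//; have /andP[] := h y.
change (rintegrable leb U (fun y => `|f y| * \int[leb]_(x in U) (1 * K (y - x - a)))).
apply: (@le_rintegrable _ cT R leb U _ (fun y => `|f y|)); [exact: mU| | |exact: hf'].
  apply: measurable_funM; first exact: (rintegrable_mfun hf').
  apply: cont_lmble_fun.
  have ck' : continuous (fun z => K (z + a)).
    by have := cont_kernel (a := - a) mK; under eq_fun do rewrite opprK.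
  have c1 : rintegrable leb U (fun=> 1) by apply: cont_integrable => //; exact: cst_continuous.
  rewrite (_ : (fun x0 => _) = (fun x => \int[leb]_(z in U) (1 * K (z - x + a)))).
    exact: (conv_cont bU c1 ck').
  apply/funext => y; apply: eq_Rintegral => x _.
  by congr (_ * _); rewrite -Ke; congr K; rewrite !opprB addrC.
by move=> y _; rewrite normrM normr_id ler_piMr//; have /andP[? ?] := h y; rewrite ger0_norm.
Qed.

Definition core U (r : R) : set 'rV[R]_n := [set y | eball y r `<=` U].

Lemma core_sub U r : 0 < r -> core U r `<=` U.
Proof. by move=> r0 x; apply; rewrite /eball/= subrr enorm0. Qed.

Lemma core_closed U r : closed (core U r).
Proof.
rewrite -[core U r]setCK; apply: open_closedC; rewrite openE => x /= xC.
have [y [yx yU]] : exists y, eball x r y /\ ~ U y.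
  apply: contrapT => h; apply: xC => y yx; apply: contrapT => nU.
  by apply: h; exists y.
apply/nbhs_eball; exists (r - enorm (y - x)); first by rewrite subr_gt0.
move=> z; rewrite /eball/= => zx cz; apply: yU; apply: cz.
rewrite /eball/=; have := enorm_triangle x y z; rewrite (enormBC x z); lra.
Qed.

Lemma core_bmeas U r : 0 < r -> bmeas U -> bmeas (core U r).
Proof.
move=> r0 bU; apply: bmeasS bU; last exact: core_sub.
by apply: closed_lmble; exact: core_closed.
Qed.

Lemma core_mass U f e : open U -> bmeas U -> rintegrable leb U f -> 0 < e ->
  exists2 r, 0 < r & \int[leb]_(x in U `\` core U r) `|f x| <= e.
Proof.
move=> oU bU hf e0; have mU := bU.1.
pose F (k : nat) := U `\` core U k.+1%:R^-1.
have mF (k : nat) : lmble (F k).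
  by apply: measurableD => //; apply: (core_bmeas _ bU).1; rewrite invr_gt0.
have [] := @Rintegral_dominated _ _ R leb U (fun k : nat => (fun x => `|f x|) \_ (F k)) (fun=> 0) (fun x => `|f x|) mU.
- move=> k; apply/(measurable_restrict _ (mF k) mU).
  by apply: measurable_funS (rintegrable_mfun (rintegrable_norm mU hf)) => //; exact: subIsetl.
- exact: measurable_cst.
- apply: aeW => x Ux; apply: cvg_near_cst.
  have /nbhs_eball[r r0 hr] := open_nbhs_nbhs (conj oU Ux).
  exists (Num.truncn r^-1) => // k /= hk; rewrite patchE memNset// => -[_]; apply.
  move=> y; rewrite /eball/= => yx; apply: hr; rewrite /eball/=; apply: (lt_le_trans yx).
  rewrite -[r]invrK lef_pV2 ?posrE ?invr_gt0//.
  by apply: ltW; apply: (lt_le_trans (truncnS_gt _)); rewrite ler_nat.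
- exact: rintegrable_norm.
- by move=> k x _; rewrite patchE; case: ifP; rewrite ?normr0//= normr_id.
move=> _ /(_ e e0)[k /(_ k (leqnn k))] h; exists k.+1%:R^-1; first by rewrite invr_gt0.
rewrite (_ : U `\` _ = U `&` F k); last by rewrite setIidr//; exact: subIsetl.
apply: le_trans h; rewrite Rintegral_mkcondr le_eqVlt; apply/orP; left; apply/eqP.
by apply: eq_Rintegral => x _; rewrite subr0 !patchE; case: ifP; rewrite ?normr0//= normr_id.
Qed.

(** Uniform in the kernel and in the small shift [a], because the approximation below translates
    every patch of the domain by its own vector. *)
Definition mollifiable U f := forall e, 0 < e -> exists2 dl, 0 < dl & forall K r a,
  mollifier r K -> r <= dl -> enorm a <= dl ->
  \int[leb]_(x in U) `|\int[leb]_(y in U) (f y * K (y - x - a)) - f x| <= e.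

Lemma conv_integrable U f K r a : bmeas U -> rintegrable leb U f -> mollifier r K ->
  rintegrable leb U (fun x => \int[leb]_(y in U) (f y * K (y - x - a)) - f x).
Proof.
move=> bU hf mK; apply: rintegrableB => //; first exact: bU.1.
by apply: cont_integrable => //; exact: (conv_cont bU hf (cont_kernel (a := a) mK)).
Qed.

Lemma mollifiableD U f g : bmeas U -> rintegrable leb U f -> rintegrable leb U g ->
  mollifiable U f -> mollifiable U g -> mollifiable U (fun x => f x + g x).
Proof.
move=> bU hf hg Qf Qg e e0; have mU := bU.1.
have e2 : 0 < e / 2 by rewrite divr_gt0.
have [d1 d10 h1] := Qf _ e2; have [d2 d20 h2] := Qg _ e2.
exists (Num.min d1 d2); first by rewrite lt_min d10.
move=> K r a mK; rewrite !le_min => /andP[r1 r2] /andP[a1 a2].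
have := h1 K r a mK r1 a1; have := h2 K r a mK r2 a2.
have i1 := conv_integrable a bU hf mK; have i2 := conv_integrable a bU hg mK.
have i3 := conv_integrable a bU (rintegrableD mU hf hg) mK.
move=> l2 l1; apply: (@le_trans _ _ (e / 2 + e / 2)); last by rewrite -splitr.
apply: le_trans (lerD l1 l2); rewrite -RintegralD//; try exact: rintegrable_norm.
apply: le_Rintegral => //.
- exact: rintegrable_norm.
- by apply: rintegrableD => //; exact: rintegrable_norm.
- move=> x _; apply: le_trans (ler_normD _ _).
  under eq_Rintegral do rewrite mulrDl.
  rewrite RintegralD//; try exact: (rint_conv x bU _ (cont_kernel (a := a) mK)).
  by rewrite opprD addrACA.
Qed.

Lemma mollifiableZ U f (c : R) : bmeas U -> rintegrable leb U f -> mollifiable U f ->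
  mollifiable U (fun x => c * f x).
Proof.
move=> bU hf Qf e e0; have mU := bU.1.
have ec : 0 < e / (`|c| + 1) by rewrite divr_gt0// ltr_wpDl.
have [d1 d10 h1] := Qf _ ec; exists d1 => // K r a mK rd ad.
have := h1 K r a mK rd ad; rewrite ler_pdivlMr ?ltr_wpDl// => /(le_trans _); apply.
have i1 := conv_integrable a bU hf mK.
apply: (@le_trans _ _ (`|c| * \int[leb]_(x in U) `|\int[leb]_(y in U) (f y * K (y - x - a)) - f x|)).
  rewrite -RintegralZl//; last exact: rintegrable_norm.
  rewrite le_eqVlt; apply/orP; left; apply/eqP/eq_Rintegral => x _; rewrite -normrM mulrBr.
  rewrite -RintegralZl//; last exact: (rint_conv x bU _ (cont_kernel (a := a) mK)).
  by congr (`|_ - _|); apply: eq_Rintegral => y _; rewrite mulrA.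
by rewrite mulrDr mulr1 mulrC lerDl; apply: Rintegral_ge0.
Qed.

Lemma mollifiable_approx U f : bmeas U -> rintegrable leb U f ->
  (forall e, 0 < e -> exists g, [/\ rintegrable leb U g, mollifiable U g & \int[leb]_(x in U) `|f x - g x| <= e]) ->
  mollifiable U f.
Proof.
move=> bU hf ap e e0; have mU := bU.1.
have e3 : 0 < e / 3 by rewrite divr_gt0.
have [g [hg Qg fg]] := ap _ e3.
have [d d0 hd] := Qg _ e3; exists d => // K r a mK rd ad.
have := hd K r a mK rd ad => h.
have hfg := rintegrableB mU hf hg.
have := conv_contraction a bU hfg mK => h'.
have i1 := conv_integrable a bU hf mK; have i2 := conv_integrable a bU hg mK.
have i3 : rintegrable leb U (fun x => \int[leb]_(y in U) ((f y - g y) * K (y - x - a))).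
  by apply: cont_integrable => //; exact: (conv_cont bU hfg (cont_kernel (a := a) mK)).
have i3' := rintegrable_norm mU i3; have i2' := rintegrable_norm mU i2; have i4 := rintegrable_norm mU hfg.
suff : \int[leb]_(x in U) `|\int[leb]_(y in U) (f y * K (y - x - a)) - f x| <=
  \int[leb]_(x in U) `|\int[leb]_(y in U) ((f y - g y) * K (y - x - a))| +
  \int[leb]_(x in U) `|\int[leb]_(y in U) (g y * K (y - x - a)) - g x| + \int[leb]_(x in U) `|f x - g x| by lra.
rewrite -RintegralD// -RintegralD//; last exact: rintegrableD.
apply: le_Rintegral => //.
- exact: rintegrable_norm.
- by apply: rintegrableD => //; exact: rintegrableD.
move=> x _; under [X in _ <= `|X| + _ + _]eq_Rintegral do rewrite mulrBl.
rewrite RintegralB//; try exact: (rint_conv x bU _ (cont_kernel (a := a) mK)).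
set A := \int[_]_(_ in _) _; set B := \int[_]_(_ in _) _.
have -> : A - f x = (A - B) + (B - g x) - (f x - g x) by lra.
by apply: (le_trans (ler_normB _ _)); rewrite lerD2r ler_normD.
Qed.

(** For small kernels and shifts the mollified indicator equals 1 on a core of [V], and its total
    mass does not exceed that of [V]. So what it puts outside the core is at most the measure of [V]
    minus its core, and the indicator does no worse. *)
Lemma mollifiable_open U V : open U -> bmeas U -> open V -> V `<=` U -> mollifiable U (\1_V : 'rV[R]_n -> R).
Proof.
move=> oU bU oV VU e e0; have mU := bU.1.
have bV : bmeas V by apply: bmeasS bU => //; exact: open_lmble.
have mV := bV.1.
have ci W : bmeas W -> rintegrable leb W (fun=> 1 : R) by move=> bW; apply: cont_integrable => //; exact: cst_continuous.
have e2 : 0 < e / 2 by rewrite divr_gt0.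
have [r r0 hr] := core_mass oV bV (ci _ bV) e2.
have bC := core_bmeas r0 bV; set C := core V r in hr bC.
have mC := bC.1; have CV : C `<=` V by exact: core_sub.
have CU := subset_trans CV VU.
have i1V : rintegrable leb U (\1_V : 'rV[R]_n -> R).
  apply: (@le_rintegrable _ cT R leb U _ (fun=> 1)) => //; last exact: ci.
  by move=> x _; rewrite indicE; case: (_ \in _); rewrite ?normr1 ?normr0.
exists (r / 4) => [|K r' a mK r'r ar]; first by rewrite divr_gt0.
have [CK K0 _ Ks K1] := mK; have ck := cont_kernel (a := a) mK.
pose w x := \int[leb]_(y in U) ((\1_V : 'rV[R]_n -> R) y * K (y - x - a)).
have wi : rintegrable leb U w by apply: cont_integrable => //; exact: (conv_cont bU i1V ck).
have w0 x : 0 <= w x by apply: Rintegral_ge0 => y _; rewrite mulr_ge0.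
have wC x : C x -> w x = 1.
  move=> Cx; rewrite -(mollifier_shift1 a x mK) /w.
  have KV y : ~ V y -> K (y - x - a) = 0.
    move=> nV; apply: Ks; rewrite leNgt; apply/negP => h; apply: nV; apply: Cx.
    rewrite /eball/=; have := enormD (y - x - a) a; rewrite subrK; lra.
  rewrite [RHS](@Rintegral_supp _ _ U); last by move=> y nU; apply: KV => /VU.
  apply: eq_Rintegral => y _; rewrite indicE; case: (boolP (y \in V)) => [_|/negP]; first by rewrite mul1r.
  by rewrite in_setE => /KV ->; rewrite mulr0.
have wI : \int[leb]_(x in U) w x <= \int[leb]_(x in V) 1.
  apply: (@le_trans _ _ (\int[leb]_(x in U) `|w x|)).
    by rewrite le_eqVlt; apply/orP; left; apply/eqP/eq_Rintegral => x _; rewrite ger0_norm.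
  apply: (le_trans (conv_contraction a bU i1V mK)).
  rewrite (Rintegral_setD mV mU VU); last exact: rintegrable_norm.
  have -> : \int[leb]_(x in U `\` V) `|(\1_V : 'rV[R]_n -> R) x| = 0.
    rewrite (@eq_Rintegral _ _ _ leb _ (fun=> 0)); first by rewrite Rintegral_cst ?mul0r//; exact: measurableD.
    by move=> x; rewrite in_setE => -[_ nV]; rewrite indicE memNset// normr0.
  rewrite addr0 le_eqVlt; apply/orP; left; apply/eqP/eq_Rintegral => x.
  by rewrite in_setE => Vx; rewrite indicE mem_set// normr1.
have mUC : lmble (U `\` C) by exact: measurableD.
have iUC f : rintegrable leb U f -> rintegrable leb (U `\` C) f by apply: rintegrableS => //; exact: subIsetl.
have split1 : \int[leb]_(x in V) (1 : R) = \int[leb]_(x in C) 1 + \int[leb]_(x in V `\` C) 1.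
  by rewrite -(Rintegral_setD mC mV CV)//; exact: ci.
have hr' : \int[leb]_(x in V `\` C) (1 : R) <= e / 2.
  by apply: le_trans hr; rewrite le_eqVlt; apply/orP; left; apply/eqP/eq_Rintegral => x _; rewrite normr1.
have hw := rintegrable_norm mU (rintegrableB mU wi i1V).
rewrite (Rintegral_setD mC mU CU hw).
have -> : \int[leb]_(x in C) `|w x - (\1_V : 'rV[R]_n -> R) x| = 0.
  rewrite (@eq_Rintegral _ _ _ leb _ (fun=> 0)); first by rewrite Rintegral_cst ?mul0r.
  by move=> x; rewrite in_setE => Cx; rewrite wC// indicE mem_set ?subrr ?normr0//; exact: CV.
rewrite add0r; apply: (@le_trans _ _ (\int[leb]_(x in U `\` C) w x + \int[leb]_(x in U `\` C) (\1_V : 'rV[R]_n -> R) x)).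
  rewrite -RintegralD//; try exact: iUC.
  apply: le_Rintegral => //; first exact: iUC.
    by apply: rintegrableD => //; exact: iUC.
  move=> x _; apply: (le_trans (ler_normB _ _)); rewrite (ger0_norm (w0 x)) lerD2l.
  by rewrite ger0_norm// indicE; case: (_ \in _).
have s2 := Rintegral_setD mC mU CU wi.
have s3 : \int[leb]_(x in C) w x = \int[leb]_(x in C) 1.
  by apply: eq_Rintegral => x; rewrite in_setE => /wC.
have s4 : \int[leb]_(x in U `\` C) (\1_V : 'rV[R]_n -> R) x = \int[leb]_(x in V `\` C) 1.
  have mVC : lmble (V `\` C) by exact: measurableD.
  rewrite (@Rintegral_setD _ _ _ leb (V `\` C))//; [|by apply: setSD|exact: iUC].
  have -> : \int[leb]_(x in (U `\` C) `\` (V `\` C)) (\1_V : 'rV[R]_n -> R) x = 0.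
    rewrite (@eq_Rintegral _ _ _ leb _ (fun=> 0)); first by rewrite Rintegral_cst ?mul0r//; exact: measurableD.
    by move=> x; rewrite in_setE => -[[_ nC] nV]; rewrite indicE memNset// => Vx; apply: nV.
  rewrite addr0; apply: eq_Rintegral => x; rewrite in_setE => -[Vx _].
  by rewrite indicE mem_set.
rewrite s4; move: wI split1 hr' s2 s3; clear.
move: (\int[leb]_(x in U) w x) (\int[leb]_(x in V) _) (\int[leb]_(x in C) w x).
move: (\int[leb]_(x in C) _) (\int[leb]_(x in V `\` C) _) (\int[leb]_(x in U `\` C) _) => ? ? ? ? ? ?; lra.
Qed.

(** The property is closed in L1 by contraction. It passes from open sets to measurable sets by
    outer regularity, then to simple functions by linearity, then to integrable functions by
    density. *)
Lemma mollifiable_all U f : open U -> bmeas U -> rintegrable leb U f -> mollifiable U f.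
Proof.
move=> oU bU hf; have mU := bU.1.
have i1 A : lmble A -> rintegrable leb U (\1_A : 'rV[R]_n -> R).
  move=> mA; apply: (@le_rintegrable _ cT R leb U _ (fun=> 1)) => //.
  - by move=> x _; rewrite indicE; case: (_ \in _); rewrite ?normr1 ?normr0.
  - by apply: cont_integrable => //; exact: cst_continuous.
have QA A : lmble A -> mollifiable U (\1_A : 'rV[R]_n -> R).
  move=> mA; apply: mollifiable_approx => //; first exact: i1.
  move=> e e0; have [V [oV AV hV]] := lebesgue_outer_open (A `&` U) e0.
  pose W := V `&` U; have oW : open W by exact: openI.
  have mW := open_lmble oW.
  exists (\1_W : 'rV[R]_n -> R); split; [exact: i1|by apply: mollifiable_open => //; exact: subIsetr|].
  pose B := A `&` U; have mB : lmble B by exact: measurableI.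
  have BW : B `<=` W by move=> x Bx; split; [exact: AV|by case: Bx].
  have WU : W `<=` U by exact: subIsetr.
  have bW : bmeas W by exact: bmeasS bU.
  rewrite (_ : \int[leb]_(x in U) _ = \int[leb]_(x in W `\` B) (1 : R)).
    rewrite Rintegral_cst ?mul1r//; last exact: measurableD.
    rewrite measureD//; last exact/lebesgue_outer_bounded/bW.2.
    rewrite (setIidr BW).
    have fB : leb B \is a fin_num.
      by rewrite ge0_fin_numE ?measure_ge0//; apply/lebesgue_outer_bounded; case: (bmeasS mB (subset_trans BW WU) bU).
    have fW : leb W \is a fin_num by rewrite ge0_fin_numE ?measure_ge0//; exact/lebesgue_outer_bounded/bW.2.
    rewrite fineB//.
    have : (leb W <= leb B + e%:E)%E.
      by apply: le_trans hV; apply: le_outer_measure; exact: subIsetl.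
    by rewrite -{1}(fineK fB) -{1}(fineK fW) -EFinD lee_fin; lra.
  have mWB : lmble (W `\` B) by exact: measurableD.
  have WBU : W `\` B `<=` U by move=> x [/WU].
  rewrite (Rintegral_setD mWB mU WBU); last first.
    by apply: rintegrable_norm => //; apply: rintegrableB => //; exact: i1.
  rewrite [X in _ + X](@eq_Rintegral _ _ _ leb _ (fun=> 0)).
    rewrite Rintegral_cst ?mul0r ?addr0//; last exact: measurableD.
    apply: eq_Rintegral => x; rewrite in_setE => -[[Vx Ux] nB].
    by rewrite !indicE (mem_set (conj Vx Ux : W x)) memNset ?sub0r ?normrN ?normr1// => Ax; apply: nB.
  move=> x; rewrite in_setE => -[Ux nWB]; rewrite !indicE.
  case: (pselect (W x)) => Wx.
    have Bx : B x by apply: contrapT => nB; apply: nWB.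
    by rewrite (mem_set Wx) (mem_set Bx.1) subrr normr0.
  rewrite (memNset Wx) memNset ?subrr ?normr0// => Ax; apply: Wx.
  by split => //; exact: AV.
have Qs (I : Type) (s : seq I) (c : I -> R) (A : I -> set cT) : (forall i, lmble (A i)) ->
    mollifiable U (fun x => \sum_(i <- s) (c i * (\1_(A i) : 'rV[R]_n -> R) x)).
  move=> mA; elim: s => [|i s IH].
    have := mollifiableZ 0 bU (i1 set0 measurable0) (QA set0 measurable0).
    by congr mollifiable; apply/funext => x; rewrite big_nil mul0r.
  rewrite (_ : (fun x => _) = (fun x => c i * (\1_(A i) : 'rV[R]_n -> R) x +
      \sum_(i <- s) (c i * (\1_(A i) : 'rV[R]_n -> R) x))); last by apply/funext => x; rewrite big_cons.
  apply: mollifiableD => //; last by apply: mollifiableZ => //; [exact: i1|exact: QA].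
  - by apply: rintegrableZ => //; exact: i1.
  - by apply: rintegrable_sum => // j; apply: rintegrableZ => //; exact: i1.
apply: mollifiable_approx => // e e0.
have [g_ [ig _ /fine_cvgP[_ /cvgrPdist_le /(_ e e0)[k _ hk]]]] := approximation_sfun_integrable mU hf.
exists (g_ k); split; first exact: ig.
  rewrite (_ : (g_ k : _ -> _) = (fun x => \sum_(i < #|`fset_set (range (g_ k))|)
      ((fset_set (range (g_ k)))`_i * (\1_(g_ k @^-1` [set (fset_set (range (g_ k)))`_i]) : 'rV[R]_n -> R) x))).
    by apply: Qs => i.
  by apply/funext => x; rewrite {1}fimfunEord.
have := hk k (leqnn k); rewrite /= sub0r normrN; apply: le_trans.
by apply: le_trans (ler_norm _).
Qed.

End mollification.

Section C1_fields.
Context {R : realType} {n : nat}.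
Implicit Types (x y z v a : 'rV[R]_n) (f w : 'rV[R]_n -> R) (phi : 'rV[R]_n -> 'rV[R]_n).
Local Notation leb := (@leb R n).

Lemma C1_sum (I : Type) (s : seq I) (P : pred I) (f : I -> 'rV[R]_n -> R) : (forall i, C1 (f i)) ->
  C1 (fun x => \sum_(i <- s | P i) f i x) /\
  grad (fun x => \sum_(i <- s | P i) f i x) = (fun x => \sum_(i <- s | P i) grad (f i) x).
Proof.
move=> Cf; elim: s => [|i s [Cs gs]].
  rewrite (_ : (fun x => _) = (fun=> 0)); last by apply/funext => x; rewrite big_nil.
  by split; [exact: C1_cst|apply/funext => x; rewrite grad_cst big_nil].
case Pi : (P i).
  rewrite (_ : (fun x => _) = (fun x => f i x + \sum_(i <- s | P i) f i x)); last first.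
    by apply/funext => x; rewrite big_cons Pi.
  have [h1 h2] := C1D (Cf i) Cs; split => //.
  by rewrite h2 gs; apply/funext => x; rewrite big_cons Pi.
rewrite (_ : (fun x => _) = (fun x => \sum_(i <- s | P i) f i x)); last first.
  by apply/funext => x; rewrite big_cons Pi.
by split => //; rewrite gs; apply/funext => x; rewrite big_cons Pi.
Qed.

Lemma C1_affine (c : R) b f : C1 f -> C1 (fun z => f (c *: z + b)) /\
  grad (fun z => f (c *: z + b)) = (fun z => c *: grad f (c *: z + b)).
Proof.
move=> Cf; have caff : continuous (fun z : 'rV[R]_n => c *: z + b).
  apply: continuous_rV => i; rewrite (_ : (fun z => _) = (fun z : 'rV[R]_n => c * z 0 i + b 0 i)).
    apply: rcontD; last exact: cst_continuous.
    by apply: rcontM; [exact: cst_continuous|exact: coord_continuous].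
  by apply/funext => z; rewrite !mxE.
apply: C1_of_grad => [i|z v].
  rewrite (_ : (fun _ => _) = (fun z => c * grad f (c *: z + b) 0 i)); last by apply/funext => z; rewrite mxE.
  apply: rcontM; first exact: cst_continuous.
  move=> z; apply: (@continuous_comp _ _ _ (fun z : 'rV[R]_n => c *: z + b) (fun z => grad f z 0 i)).
    exact: caff.
  exact: grad_coord_cont.
case: (@differentiable_dot R n (fun z => f (c *: z + b)) z (c *: grad f (c *: z + b))); last by split.
move=> e e0; have c1 : 0 < `|c| + 1 by rewrite ltr_wpDl.
have [d d0 hd] := C1_unif_diff Cf (eball_bounded (c *: z + b) 1) (divr_gt0 e0 c1).
exists (d / (`|c| + 1)) => [|h hh]; first by rewrite divr_gt0.
have hc : enorm (c *: h) <= (`|c| + 1) * enorm h by rewrite enormZ ler_wpM2r ?enorm_ge0// lerDl.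
have -> : c *: (z + h) + b = (c *: z + b) + c *: h by rewrite scalerDr addrAC.
rewrite dotZr -dotZl; apply: (le_trans (hd _ _ _ _)).
- by rewrite /eball/= subrr enorm0.
- by apply: (le_lt_trans hc); rewrite mulrC -ltr_pdivlMr.
- by rewrite mulrAC ler_pdivrMr// mulrAC -mulrA ler_wpM2l ?(ltW e0)// mulrC.
Qed.

Lemma C1_shift a f : C1 f -> C1 (fun z => f (z - a)) /\ grad (fun z => f (z - a)) = (fun z => grad f (z - a)).
Proof.
move=> Cf; have := C1_affine 1 (- a) Cf.
rewrite (_ : (fun z => f (1 *: z - a)) = (fun z => f (z - a))); last by apply/funext => z; rewrite scale1r.
by move=> [h1 ->]; split => //; apply/funext => z; rewrite !scale1r.
Qed.

Lemma C1_reflect a f : C1 f -> C1 (fun z => f (- z - a)) /\ grad (fun z => f (- z - a)) = (fun z => - grad f (- z - a)).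
Proof.
move=> Cf; have := C1_affine (-1) (- a) Cf.
rewrite (_ : (fun z => f (-1 *: z - a)) = (fun z => f (- z - a))); last by apply/funext => z; rewrite scaleN1r.
by move=> [h1 ->]; split => //; apply/funext => z; rewrite !scaleN1r.
Qed.

Lemma dot_delta (b : 'rV[R]_n) i : dot (delta_mx 0 i) b = b 0 i.
Proof.
rewrite /dot (bigD1 i)//= !mxE !eqxx mul1r big1 ?addr0// => j ji.
by rewrite mxE (negbTE ji) andbF mul0r.
Qed.

Lemma diff_coord (M V : 'rV[R]_n) i : 'd (fun N : 'rV[R]_n => N 0 i : R) M V = V 0 i.
Proof.
have [Cc gc] := @C1_coord R n i; have [dc _] := Cc.
by rewrite -deriveE// C1_derive// gc dotC dot_delta.
Qed.

Lemma dot0r x : dot x 0 = 0.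
Proof. by rewrite /dot big1// => i _; rewrite mxE mulr0. Qed.

Lemma rcont_sum (I : Type) (s : seq I) (f : I -> 'rV[R]_n -> R) : (forall i, continuous (f i)) ->
  continuous (fun x => \sum_(i <- s) f i x).
Proof.
move=> cf; elim: s => [|i s IH].
  by rewrite (_ : (fun x => _) = (fun=> 0)); [exact: cst_continuous|apply/funext => x; rewrite big_nil].
rewrite (_ : (fun x => _) = (fun x => f i x + \sum_(i <- s) f i x)); first exact: rcontD.
by apply/funext => x; rewrite big_cons.
Qed.

Lemma C1_field_coord phi i : C1 phi -> C1 (fun x => phi x 0 i) /\
  forall v x, 'D_v (fun x => phi x 0 i) x = ('D_v phi x) 0 i.
Proof.
move=> [dphi cphi].
have dE v x : differentiable (fun x => phi x 0 i) x /\ 'D_v (fun x => phi x 0 i) x = ('D_v phi x) 0 i.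
  have d1 : differentiable (fun N : 'rV[R]_n => N 0 i : R) (phi x) by exact: differentiable_coord.
  have d2 : differentiable ((fun N : 'rV[R]_n => N 0 i : R) \o phi) x by exact: differentiable_comp.
  split => //; rewrite deriveE// [in LHS](_ : (fun x => phi x 0 i) = (fun N : 'rV[R]_n => N 0 i : R) \o phi)//.
  rewrite diff_comp//= deriveE//.
  exact: diff_coord.
split; last by move=> v x; have [] := dE v x.
split=> [x|v]; first by have [] := dE 0 x.
rewrite (_ : 'D_v _ = (fun x => ('D_v phi x) 0 i)); last by apply/funext => x; have [] := dE v x.
move=> x; apply: (@continuous_comp _ _ _ (fun x => 'D_v phi x) (fun N : 'rV[R]_n => N 0 i)); first exact: cphi.
exact: coord_continuous.
Qed.

Lemma divergenceE phi x : C1 phi -> divergence phi x = \sum_i grad (fun x => phi x 0 i) x 0 i.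
Proof.
move=> Cp; apply: eq_bigr => i _; rewrite mxE.
by have [_ ->] := C1_field_coord i Cp.
Qed.

Lemma C1_field phi : (forall i, C1 (fun x => phi x 0 i)) -> C1 phi.
Proof.
move=> Cp; have dE v x : differentiable phi x /\ 'D_v phi x = \row_i dot v (grad (fun x => phi x 0 i) x).
  have E : phi = \sum_(i < n) (fun x => (phi x 0 i) *: (delta_mx 0 i : 'rV[R]_n)).
    apply/funext => y; rewrite fct_sumE {1}(row_sum_delta (phi y)).
    by apply: eq_bigr => i _.
  have di i : differentiable (fun x => phi x 0 i *: (delta_mx 0 i : 'rV[R]_n)) x.
    by apply: differentiableZl; have [h _] := Cp i; exact: h.
  have dphi : differentiable phi x by rewrite E; exact: differentiable_sum.
  split => //; apply/rowP => i; rewrite mxE -C1_derive//.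
  have d1 : differentiable (fun N : 'rV[R]_n => N 0 i : R) (phi x) by exact: differentiable_coord.
  have d2 : differentiable (fun x => phi x 0 i) x by have [h _] := Cp i; exact: h.
  rewrite [RHS]deriveE// (_ : (fun x => phi x 0 i) = (fun N : 'rV[R]_n => N 0 i : R) \o phi)//.
  rewrite diff_comp//= deriveE//.
  by rewrite diff_coord.
split=> [x|v]; first by have [] := dE 0 x.
rewrite (_ : (fun x => _) = (fun x => \row_i dot v (grad (fun x => phi x 0 i) x))); last by apply/funext => x; have [] := dE v x.
apply: continuous_rV => i; rewrite (_ : (fun x => _) = (fun x => 'D_v (fun x => phi x 0 i) x)).
  by have [_ h] := Cp i; exact: h.
by apply/funext => x; rewrite mxE C1_derive.
Qed.

Lemma grad_locally_cst w x (c r : R) : 0 < r -> (forall y, enorm (y - x) < r -> w y = c) -> grad w x = 0.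
Proof.
move=> r0 h; apply/rowP => i; rewrite !mxE.
case: (@differentiable_dot R n w x 0) => [e e0|_ ->].
  exists r => // k kr; rewrite !h ?subrr ?enorm0//; last by rewrite addrAC subrr add0r.
  by rewrite dot0r subrr normr0 mulr_ge0 ?enorm_ge0 ?(ltW e0).
exact: dot0r.
Qed.

Lemma grad_eq0_off_closed w (K : set 'rV[R]_n) x : closed K -> (forall y, ~ K y -> w y = 0) -> ~ K x -> grad w x = 0.
Proof.
move=> cK w0 Kx; have /nbhs_eball[r r0 h] := open_nbhs_nbhs (conj (closed_openC cK) Kx).
by apply: (grad_locally_cst r0) => y yr; apply: w0; exact: h.
Qed.

(** By translation invariance the increments of [f] along [s *: v] have integral 0, and the
    difference quotients converge uniformly on the bounded set [U]. *)
Lemma Rintegral_grad0 f v : C1 f -> (exists r, forall z, r <= enorm z -> f z = 0) ->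
  \int[leb]_z dot v (grad f z) = 0.
Proof.
move=> Cf [r f0]; pose U : set 'rV[R]_n := [set y | enorm (y - 0) <= r + enorm v].
have bU : bmeas U by exact: closed_eball_bmeas.
have f0' z : r <= enorm (z - 0) -> f z = 0 by rewrite subr0; exact: f0.
have fU z : ~ U z -> f z = 0.
  by move=> /negP; rewrite -ltNge subr0 => h; apply: f0; have := enorm_ge0 v; lra.
have cdot : continuous (fun z => dot v (grad f z)).
  by rewrite (_ : (fun z => _) = (fun z => 'D_v f z)); [case: Cf => _; exact|apply/funext => z; rewrite C1_derive].
have clU : closed U by exact: closed_eball_closed.
have gU z : ~ U z -> dot v (grad f z) = 0.
  by move=> /(grad_eq0_off_closed clU fU) ->; exact: dot0r.
rewrite (Rintegral_supp gU).
apply/eqP; rewrite -normr_le0; apply/ler_addgt0Pr => e e0; rewrite add0r.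
have [mU bUU] := bU; pose V := fine (leb U).
have V0 : 0 <= V by apply: fine_ge0; exact: measure_ge0.
have nv := enorm_ge0 v.
pose e' := e / ((V + 1) * (1 + enorm v)).
have e'0 : 0 < e' by rewrite divr_gt0// mulr_gt0//; lra.
have [d d0 hd] := C1_unif_diff Cf bUU e'0.
pose s := Num.min 1 (d / (1 + enorm v) / 2).
have s0 : 0 < s by rewrite lt_min ltr01 !divr_gt0//; lra.
have s1 : s <= 1 by rewrite ge_min lexx.
have sd : enorm (s *: v) < d.
  rewrite enormZ (ger0_norm (ltW s0)).
  have : s <= d / (1 + enorm v) / 2 by rewrite ge_min lexx orbT.
  rewrite ler_pdivlMr// ler_pdivlMr; last by lra.
  by nra.
have fi := cont_supp_integrable (C1_cont Cf) f0'.
have I0 : \int[leb]_z (f (z + s *: v) - f z) = 0.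
  by rewrite RintegralB// ?Rintegral_shift ?subrr//; exact: shift_rintegrable.
have fsU z : ~ U z -> f (z + s *: v) - f z = 0.
  move=> nU; rewrite (fU _ nU) subr0; apply: f0; move/negP: nU; rewrite -ltNge subr0 => h.
  have h2 : enorm (s *: v) <= enorm v by rewrite enormZ (ger0_norm (ltW s0)) ler_piMl.
  by have := enormD (z + s *: v) (- (s *: v)); rewrite addrK enormN; lra.
rewrite (Rintegral_supp fsU) in I0.
have ii1 : rintegrable leb U (fun z => s * dot v (grad f z)) by apply: rintegrableZ => //; exact: cont_integrable.
have ii2 : rintegrable leb U (fun z => f (z + s *: v) - f z).
  apply: cont_integrable => //; apply: rcontD; last by apply: rcontN; exact: C1_cont.
  by apply: rcont_shift; exact: C1_cont.
rewrite -(ler_pM2l s0) -{1}(ger0_norm (ltW s0)) -normrM -RintegralZl//; last exact: cont_integrable.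
rewrite -[X in `|X|]subr0 -I0 -RintegralB//.
apply: (le_trans (Rintegral_le_norm mU (rintegrableB mU ii1 ii2))).
apply: (@le_trans _ _ (\int[leb]_(z in U) (e' * (s * enorm v)))).
  apply: le_Rintegral => //.
  - by apply: rintegrable_norm => //; exact: rintegrableB.
  - by apply: cont_integrable => //; exact: cst_continuous.
  - by move=> z Uz; have := hd z (s *: v) Uz sd; rewrite distrC dotZl enormZ (ger0_norm (ltW s0)).
rewrite Rintegral_cst// -/V /e'.
have -> : e / ((V + 1) * (1 + enorm v)) * (s * enorm v) * V = s * (e * ((enorm v / (1 + enorm v)) * (V / (V + 1)))).
  by field; rewrite !gt_eqF//; lra.
rewrite ler_wpM2l ?(ltW s0)// ler_piMr ?(ltW e0)// mulr_ile1// ?divr_ge0//; try lra.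
  by rewrite ler_pdivrMr; lra.
by rewrite ler_pdivrMr; lra.
Qed.

End C1_fields.

(** * Total variation *)

Section total_variation.
Context {R : realType} {n : nat} (Om : set 'rV[R]_n).
Implicit Types (x y z v a : 'rV[R]_n) (f w u : 'rV[R]_n -> R) (phi : 'rV[R]_n -> 'rV[R]_n).
Local Notation leb := (@leb R n).
Hypotheses (oOm : open Om) (bOm : bmeas Om).

Definition tgrad (D : set 'rV[R]_n) w : R := \int[leb]_(x in D) enorm (grad w x).

Lemma tgrad_ge0 D w : 0 <= tgrad D w.
Proof. by apply: Rintegral_ge0 => x _; exact: enorm_ge0. Qed.

Lemma tgrad_integrable D w : bmeas D -> C1 w -> rintegrable leb D (fun x => enorm (grad w x)).
Proof. by move=> bD Cw; apply: cont_integrable => //; exact: enorm_grad_cont. Qed.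

Lemma divergence_cont phi : C1 phi -> continuous (divergence phi).
Proof.
move=> Cp; rewrite (_ : divergence phi = fun x => \sum_i grad (fun x => phi x 0 i) x 0 i); last first.
  by apply/funext => x; rewrite divergenceE.
by apply: rcont_sum => i; apply: grad_coord_cont; have [] := C1_field_coord i Cp.
Qed.

Lemma cont_dot_field phi w : C1 phi -> C1 w -> continuous (fun x => dot (phi x) (grad w x)).
Proof.
move=> Cp Cw; apply: rcont_sum => i.
apply: rcontM; last exact: grad_coord_cont.
by apply: C1_cont; have [] := C1_field_coord i Cp.
Qed.

(** The sum of the two integrands is the divergence of [w] times [phi], a compactly supported C1
    field, and each partial derivative integrates to 0. *)
Lemma integral_by_parts w phi : C1 w -> test_field Om phi ->
  \int[leb]_(x in Om) (w x * divergence phi x) = - \int[leb]_(x in Om) dot (phi x) (grad w x).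
Proof.
move=> Cw [Cp [K [cK KOm] pK] p1]; have mOm := bOm.1.
have clK : closed K by apply: compact_closed cK; exact: norm_hausdorff.
have C1i i : C1 (fun x => phi x 0 i) by have [] := C1_field_coord i Cp.
have i1 : rintegrable leb Om (fun x => w x * divergence phi x).
  by apply: cont_integrable => //; apply: rcontM; [exact: C1_cont|exact: divergence_cont].
have i2 : rintegrable leb Om (fun x => dot (phi x) (grad w x)).
  by apply: cont_integrable => //; exact: cont_dot_field.
apply/eqP; rewrite -addr_eq0 -RintegralD//; apply/eqP.
pose f i x := w x * phi x 0 i.
have Cf i : C1 (f i) by have [] := C1M Cw (C1i i).
have fK i x : ~ K x -> f i x = 0 by move=> /pK h; rewrite /f h mxE mulr0.
have fK' i x : ~ Om x -> dot (delta_mx 0 i) (grad (f i) x) = 0.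
  move=> nO; rewrite (grad_eq0_off_closed clK (fK i)); last by move=> /KOm.
  exact: dot0r.
have cfi i : continuous (fun x => dot (delta_mx 0 i) (grad (f i) x)).
  by rewrite (_ : (fun z => _) = (fun z => 'D_(delta_mx 0 i) (f i) z)); [case: (Cf i) => _; exact|apply/funext => z; rewrite C1_derive].
transitivity (\int[leb]_(x in Om) (\sum_(i < n) dot (delta_mx 0 i) (grad (f i) x))).
  apply: eq_Rintegral => x _; rewrite divergenceE// mulr_sumr /dot -big_split/=.
  apply: eq_bigr => i _; rewrite /f; have [_ ->] := C1M Cw (C1i i).
  by rewrite [RHS]dot_delta !mxE.
rewrite Rintegral_sum//; last by move=> i; exact: cont_integrable.
apply: big1 => i _; rewrite -(Rintegral_supp (fK' i)); apply: Rintegral_grad0 => //.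
have [M M0 hM] := bounded_enorm bOm.2; exists (M + 1) => z hz; apply: fK => /KOm/hM; lra.
Qed.

Lemma test_integrable u phi : rintegrable leb Om u -> test_field Om phi ->
  rintegrable leb Om (fun x => u x * divergence phi x).
Proof.
move=> hu [Cp _ _]; have cd := divergence_cont Cp.
have [M M0 hM] := continuous_bounded cd bOm.2.
by apply: (rintegrableM bOm.1 hu _ hM); exact: cont_lmble_fun.
Qed.

Lemma total_var_le u (A : R) : rintegrable leb Om u ->
  (forall phi, test_field Om phi -> \int[leb]_(x in Om) (u x * divergence phi x) <= A) ->
  (total_var Om u <= A%:E)%E.
Proof.
move=> hu h; apply: ge_ereal_sup => _ [phi tp <-].
by rewrite Rintegral_EFin ?lee_fin; [exact: h|exact: bOm.1|exact: test_integrable].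
Qed.

Lemma total_var_ge u phi : rintegrable leb Om u -> test_field Om phi ->
  ((\int[leb]_(x in Om) (u x * divergence phi x))%:E <= total_var Om u)%E.
Proof.
move=> hu tp; apply: ereal_sup_ubound; exists phi => //.
by rewrite Rintegral_EFin//; [exact: bOm.1|exact: test_integrable].
Qed.

End total_variation.

Section Rintegral_linearity.
Context d (T : measurableType d) {R : realType} (mu : {measure set T -> \bar R}).

Lemma Rint_scale (D : set T) (f : T -> R) (c : R) : measurable D -> rintegrable mu D f ->
  \int[mu]_(x in D) (c * f x) = c * \int[mu]_(x in D) f x.
Proof. by move=> mD hf; rewrite RintegralZl. Qed.

Lemma Rint_add (D : set T) (f g : T -> R) : measurable D -> rintegrable mu D f -> rintegrable mu D g ->
  \int[mu]_(x in D) (f x + g x) = \int[mu]_(x in D) f x + \int[mu]_(x in D) g x.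
Proof. by move=> mD hf hg; rewrite RintegralD. Qed.

Lemma Rint_sub (D : set T) (f g : T -> R) : measurable D -> rintegrable mu D f -> rintegrable mu D g ->
  \int[mu]_(x in D) (f x - g x) = \int[mu]_(x in D) f x - \int[mu]_(x in D) g x.
Proof. by move=> mD hf hg; rewrite RintegralB. Qed.

End Rintegral_linearity.

(** * Partitions of unity *)

Section partition_of_unity.
Context {R : realType} {n : nat}.
Implicit Types (x y z : 'rV[R]_n) (K : set 'rV[R]_n).

(** The functions are [eta j] times the product of the earlier [1 - eta k], so that their sum
    telescopes to 1 minus the product of all factors. That product vanishes wherever some cutoff
    equals 1, in particular on a neighbourhood of [K]. *)
Lemma partition_of_unity K (r : 'rV[R]_n -> R) : compact K -> (forall x, K x -> 0 < r x) ->
  exists m (c : 'I_m -> 'rV[R]_n) (psi : 'I_m -> 'rV[R]_n -> R), [/\ forall j, K (c j) /\ C1 (psi j),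
    forall j z, 0 <= psi j z, forall j z, r (c j) <= enorm (z - c j) -> psi j z = 0,
    forall z, \sum_j psi j z <= 1 &
    exists2 U, open U & K `<=` U /\ forall z, U z -> \sum_j psi j z = 1].
Proof.
move=> cK r0; have r20 x : K x -> 0 < r x / 2 by move=> /r0 h; rewrite divr_gt0.
have [s [sK cov]] := compact_eball_cover cK r20.
pose c (j : 'I_(size s)) := s`_j.
have Kc j : K (c j) by apply: sK; exact: mem_nth.
have /choice[eta0 heta] : forall j, exists e : 'rV[R]_n -> R, [/\ C1 e, forall z, 0 <= e z <= 1,
    forall z, enorm (z - c j) <= r (c j) / 2 -> e z = 1 & forall z, r (c j) <= enorm (z - c j) -> e z = 0].
  by move=> j; exact: (cutoff_exists (c j) (r0 _ (Kc j))).
pose eta (i : nat) (z : 'rV[R]_n) : R := if insub i is Some j then eta0 j z else 0.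
have Ceta i : C1 (eta i).
  rewrite /eta; case: insub => [j|]; last exact: C1_cst.
  by have [] := heta j.
have eta01 i z : 0 <= eta i z <= 1.
  rewrite /eta; case: insub => [j|]; last by rewrite lexx ler01.
  by have [_ h _ _] := heta j; exact: h.
have etaE (j : 'I_(size s)) z : eta j z = eta0 j z by rewrite /eta valK.
pose P i z := \prod_(k < i) (1 - eta k z).
have CP i : C1 (P i).
  elim: i => [|i IH].
    by rewrite (_ : P 0 = (fun=> 1)); [exact: C1_cst|apply/funext => z; rewrite /P big_ord0].
  rewrite (_ : P i.+1 = (fun z => P i z * (1 + - eta i z))); last by apply/funext => z; rewrite /P big_ord_recr.
  have [h1 _] := C1N (Ceta i); have [h2 _] := C1D (C1_cst 1) h1.
  by have [] := C1M IH h2.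
have P01 i z : 0 <= P i z.
  by apply: prodr_ge0 => k _; rewrite subr_ge0; have /andP[] := eta01 k z.
have tel i z : \sum_(k < i) (eta k z * P k z) = 1 - P i z.
  elim: i => [|i IH]; first by rewrite /P !big_ord0 subrr.
  by rewrite big_ord_recr IH /= /P big_ord_recr/= -/(P i z); ring.
exists (size s), c, (fun j z => eta j z * P j z); split.
- by move=> j; split; [exact: Kc|have [] := C1M (Ceta j) (CP j)].
- by move=> j z; rewrite mulr_ge0//; have /andP[] := eta01 j z.
- by move=> j z hz; have [_ _ _ h] := heta j; rewrite etaE h// mul0r.
- by move=> z; rewrite tel lerBlDr lerDl.
- exists (\bigcup_(j in [set: 'I_(size s)]) eball (c j) (r (c j) / 2)).
    by apply: bigcup_open => j _; exact: eball_open.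
  split=> [z /cov[x xs xz]|z [j _ jz]].
    have xi : (index x s < size s)%N by rewrite index_mem.
    by exists (Ordinal xi) => //; rewrite /c/= nth_index.
  rewrite tel (_ : P _ z = 0) ?subr0// /P (bigD1 j)//= etaE.
  have [_ _ h _] := heta j; rewrite h ?subrr ?mul0r//.
  exact: ltW.
Qed.

End partition_of_unity.

Lemma finite_pos_min (R : realType) (I : finType) (t : I -> R) : (forall i, 0 < t i) ->
  exists2 s, 0 < s & forall i, s <= t i.
Proof.
move=> t0; exists (\big[Num.min/1]_i t i); last by move=> i; exact: bigmin_le.
by apply/bigmin_gtP.
Qed.

Lemma enorm_sum (R : realType) n (I : Type) (s : seq I) (f : I -> 'rV[R]_n) :
  enorm (\sum_(i <- s) f i) <= \sum_(i <- s) enorm (f i).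
Proof.
elim: s => [|i s IH]; first by rewrite !big_nil enorm0.
by rewrite !big_cons (le_trans (enormD _ _))// lerD2l.
Qed.

(** * Strict approximation by C1 functions *)

Section smooth_approximation.
Context {R : realType} {n : nat} (Om : set 'rV[R]_n).
Implicit Types (x y z v a nu : 'rV[R]_n) (f w u : 'rV[R]_n -> R).
Local Notation leb := (@leb R n).
Local Notation cT := (caratheodory_type (@lebesgue_outer R n)).
Hypotheses (oOm : open Om) (bOm : bmeas Om).

(* Translating the part of [Om] near [x] by [s *: nu] moves it, together with a
   margin proportional to [s], inside [Om]. *)
Definition patch x (r : R) nu (c : R) := forall z s y, Om z -> enorm (z - x) < r -> 0 < s < r ->
  enorm (y - (z + s *: nu)) <= c * s -> Om y.

Hypothesis patchOm : forall x, closure Om x -> exists r nu c, [/\ 0 < r, 0 < c & patch x r nu c].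

Lemma mOm : lmble Om. Proof. exact: bOm.1. Qed.

Lemma bounded_closure_compact : compact (closure Om).
Proof.
have [M M0 hM] := bounded_enorm bOm.2.
apply: bounded_closed_compact; last exact: closed_closure.
apply: (@enorm_bounded _ _ _ M) => x.
rewrite -[M]/M; suff : closure Om `<=` [set y | enorm (y - 0) <= M] by move=> h /h /=; rewrite subr0.
rewrite ((closure_id _).1 (@closed_eball_closed R n 0 M)).
by apply: closure_subset => y /hM /=; rewrite subr0.
Qed.

(** The average of a field of norm at most 1 has norm at most 1, as pairing the average with itself
    shows. It keeps the constant 1 that test fields require. *)
Lemma dot_unit_le (p : 'rV[R]_n -> 'rV[R]_n) (Phi : 'rV[R]_n) (k : 'rV[R]_n -> R) :
  (forall i, rintegrable leb Om (fun x => p x 0 i * k x)) -> (forall x, enorm (p x) <= 1) ->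
  (forall x, 0 <= k x) -> rintegrable leb Om k -> \int[leb]_(x in Om) k x <= 1 ->
  (forall i, Phi 0 i = \int[leb]_(x in Om) (p x 0 i * k x)) -> enorm Phi <= 1.
Proof.
move=> ip p1 k0 ik k1 PhiE; have mO := mOm.
have [->|P0] := eqVneq (enorm Phi) 0; first exact: ler01.
have Pg : 0 < enorm Phi by rewrite lt_neqAle eq_sym P0 enorm_ge0.
rewrite -(ler_pM2l Pg) -expr2 enorm_sqr mulr1 /dot.
have -> : \sum_i Phi 0 i * Phi 0 i = \sum_i \int[leb]_(x in Om) (Phi 0 i * (p x 0 i * k x)).
  by apply: eq_bigr => i _; rewrite {2}PhiE -RintegralZl//; exact: ip.
rewrite -Rintegral_sum//; last by move=> i; exact: rintegrableZ.
apply: (@le_trans _ _ (\int[leb]_(x in Om) (enorm Phi * k x))).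
  apply: le_Rintegral => //.
  - by apply: rintegrable_sum => // i; exact: rintegrableZ.
  - exact: rintegrableZ.
  - move=> x _; rewrite (eq_bigr (fun i => k x * (Phi 0 i * p x 0 i))); last by move=> i _; ring.
    rewrite -mulr_sumr mulrC ler_wpM2r//.
    apply: le_trans (ler_norm _) _; apply: (le_trans (dot_le Phi (p x))).
    by rewrite ler_piMr// enorm_ge0.
by rewrite RintegralZl// ler_piMr// enorm_ge0.
Qed.

(** [w] is a sum of pieces [psi j * u], each translated inwards and mollified. Its gradient mass is
    bounded by duality: the normalized gradient [p] is transported by the adjoint operation to a
    field [Psi] admissible for [u]. The only defect is a commutator with the gradients of the
    [psi j], which tends to 0 because these gradients add up to 0. *)
Lemma smooth_approximation u (V e : R) : rintegrable leb Om u ->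
  (forall phi, test_field Om phi -> \int[leb]_(x in Om) (u x * divergence phi x) <= V) -> 0 < e ->
  exists w, [/\ C1 w, \int[leb]_(x in Om) `|w x - u x| <= e & tgrad Om w <= V + e].
Proof.
move=> hu hV e0; have mO := mOm.
have /choice[d0 hd0] : forall x, exists d : R * 'rV[R]_n * R, closure Om x ->
    [/\ 0 < d.1.1, 0 < d.2 & patch x d.1.1 d.1.2 d.2].
  move=> x; have [/patchOm[r [nu [c [? ? ?]]]]|nx] := pselect (closure Om x).
    by exists (r, nu, c).
  by exists (0, 0, 0).
pose r x := (d0 x).1.1; pose nu x := (d0 x).1.2; pose c x := (d0 x).2.
have r0 x : closure Om x -> 0 < r x / 2 by move=> /hd0[? _ _]; rewrite divr_gt0.
have [m [xc [psi [Cpsi psi0 psis psi1 [U1 oU1 [OmU1 psiU1]]]]]] := partition_of_unity bounded_closure_compact r0.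
have clx j : closure Om (xc j) by have [] := Cpsi j.
have Cp j : C1 (psi j) by have [] := Cpsi j.
have OmU x : Om x -> U1 x by move=> Ox; apply: OmU1; exact: subset_closure.
pose rr j := r (xc j); pose nn j := nu (xc j); pose cc j := c (xc j).
have pat j : [/\ 0 < rr j, 0 < cc j & patch (xc j) (rr j) (nn j) (cc j)] by exact: hd0.
have psib j : exists2 M, 0 < M & forall x, Om x -> `|psi j x| <= M by apply: continuous_bounded bOm.2; exact: C1_cont.
have iu (k : 'rV[R]_n -> R) : continuous k -> rintegrable leb Om (fun x => u x * k x).
  move=> ck; have [M M0 hM] := continuous_bounded ck bOm.2.
  by apply: (rintegrableM mO hu _ hM); exact: cont_lmble_fun.
have ia j : rintegrable leb Om (fun x => u x * psi j x) by apply: iu; exact: C1_cont.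
have ib j i : rintegrable leb Om (fun x => u x * grad (psi j) x 0 i) by apply: iu; exact: grad_coord_cont.
(* There are [m] errors in the L1 distance and [m * n] in the commutator; each is made at most
   [e / 2 / q]. *)
pose q := ((m%:R * (n%:R + 1)) + 1) : R.
have q0 : 0 < q by rewrite ltr_wpDl// mulr_ge0// addr_ge0.
have eq0 : 0 < e / 2 / q by rewrite !divr_gt0.
have /choice[da hda] : forall j, exists d, 0 < d /\ forall K rho a, mollifier rho K -> rho <= d -> enorm a <= d ->
   \int[leb]_(x in Om) `|\int[leb]_(y in Om) (u y * psi j y * K (y - x - a)) - u x * psi j x| <= e / 2 / q.
  by move=> j; have [d d00 h] := mollifiable_all oOm bOm (ia j) eq0; exists d.
have /choice[db hdb] : forall ji : 'I_m * 'I_n, exists d, 0 < d /\ forall K rho a, mollifier rho K -> rho <= d -> enorm a <= d ->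
   \int[leb]_(x in Om) `|\int[leb]_(y in Om) (u y * grad (psi ji.1) y 0 ji.2 * K (y - x - a)) - u x * grad (psi ji.1) x 0 ji.2| <= e / 2 / q.
  by move=> [j i]; have [d d00 h] := mollifiable_all oOm bOm (ib j i) eq0; exists d.
pose CC j := enorm (nn j) + cc j + 1.
have CCp j : 0 < CC j by have [_ ? _] := pat j; have := enorm_ge0 (nn j); rewrite /CC; lra.
have [c1 c10 hc1] : exists2 c1, 0 < c1 & forall j, c1 <= cc j.
  by apply: finite_pos_min => j; have [] := pat j.
have [s1 s10 hs1] : exists2 s1, 0 < s1 & forall j, s1 <= Num.min (rr j / (2 * CC j)) (da j / CC j).
  apply: finite_pos_min => j; have [? _ _] := pat j; have [? _] := hda j.
  by rewrite lt_min !divr_gt0// mulr_gt0.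
have [s2 s20 hs2] : exists2 s2, 0 < s2 & forall ji : 'I_m * 'I_n, s2 <= db ji / CC ji.1.
  by apply: finite_pos_min => ji; have [? _] := hdb ji; rewrite divr_gt0.
pose s := Num.min s1 s2; have s0 : 0 < s by rewrite lt_min s10.
have ss1 : s <= s1 by rewrite ge_min lexx.
have ss2 : s <= s2 by rewrite ge_min lexx orbT.
have sr j : s * CC j <= rr j / 2.
  have : s <= rr j / (2 * CC j) by rewrite (le_trans ss1)// (le_trans (hs1 j))// ge_min lexx.
  by rewrite ler_pdivlMr ?mulr_gt0//; lra.
have slt j : s < rr j.
  have [rj cj _] := pat j; apply: (@le_lt_trans _ _ (rr j / 2)); last by rewrite ltr_pdivrMr// ltr_pMr// ltr1n.
  apply: le_trans (sr j); rewrite ler_peMr ?(ltW s0)// /CC.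
  by have := enorm_ge0 (nn j); move: cj; clear; lra.
have sa j : s * CC j <= da j.
  have : s <= da j / CC j by rewrite (le_trans ss1)// (le_trans (hs1 j))// ge_min lexx orbT.
  by rewrite ler_pdivlMr.
have sb ji : s * CC ji.1 <= db ji by rewrite -ler_pdivlMr// (le_trans ss2).
(* Half of the patch margin is spent on mollifying and half on keeping the support of the dual field
   at distance [rho] from the complement of [Om]. *)
pose rho := c1 * s / 2; have rho0 : 0 < rho by rewrite divr_gt0// mulr_gt0.
have [K mK] := @mollifier_exists R n rho rho0; have [CK K0 Ke Ks KI] := mK.
pose a j := s *: nn j.
have aE j : enorm (a j) = s * enorm (nn j) by rewrite enormZ (ger0_norm (ltW s0)).
have rhoc j : rho <= s * CC j.
  have := hc1 j; have := enorm_ge0 (nn j); rewrite /rho /CC => h1 h2.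
  have : s * c1 <= s * cc j by rewrite ler_wpM2l// ltW.
  have : 0 <= s * enorm (nn j) by rewrite mulr_ge0// ltW.
  have : 0 <= s * c1 by rewrite mulr_ge0// ltW.
  by lra.
have ac j : enorm (a j) <= s * CC j.
  by rewrite aE ler_wpM2l ?(ltW s0)// /CC; have [_ ? _] := pat j; lra.
have supp j x y : Om x -> psi j y != 0 -> K (y - x - a j) != 0 -> core Om rho y.
  move=> Ox py Ky; have [rj cj pj] := pat j.
  have h1 : enorm (y - xc j) < rr j / 2.
    by rewrite ltNge; apply: contra py => /psis ->.
  have h2 : enorm (y - x - a j) < rho by rewrite ltNge; apply: contra Ky => /Ks ->.
  have hx : enorm (x - xc j) < rr j.
    have := enorm_triangle y x (xc j); have := enormD (y - x - a j) (a j); rewrite subrK enormBC aE.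
    have := sr j; have := hc1 j; have := enorm_ge0 (nn j).
    rewrite /CC /rho in h2 *; have : s * c1 <= s * cc j by rewrite ler_wpM2l// ltW.
    have : 0 < s * cc j by rewrite mulr_gt0.
    by move=> *; lra.
  move=> z; rewrite /eball/= => zy; apply: (pj x s z Ox hx).
    by rewrite s0 /= slt.
  have := enorm_triangle y z (x + a j); rewrite !opprD !addrA.
  have : s * c1 <= s * cc j by rewrite ler_wpM2l// ltW.
  by rewrite /rho in h2 zy; lra.
have CKa j : C1 (fun z => K (z - a j)) by have [] := C1_shift (a j) CK.
have gKa j : grad (fun z => K (z - a j)) = (fun z => grad K (z - a j)) by have [] := C1_shift (a j) CK.
have [wj wjE] : exists wj : 'I_m -> 'rV[R]_n -> R, forall j,
    wj j = fun x => \int[leb]_(y in Om) (u y * psi j y * K (y - x - a j)) by eexists => j.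
have Cwj j : C1 (wj j) by rewrite wjE; have [] := conv_C1 bOm (ia j) (CKa j).
have gwj j i x : grad (wj j) x 0 i = - \int[leb]_(y in Om) (u y * psi j y * grad K (y - x - a j) 0 i).
  have [_ h] := conv_C1 bOm (ia j) (CKa j); rewrite wjE -dot_delta h gKa; congr (- _).
  by apply: eq_Rintegral => y _; rewrite dot_delta.
pose w x := \sum_j wj j x.
have [Cw gw] := C1_sum (index_enum 'I_m) xpredT Cwj.
have sumpsi x : Om x -> \sum_j psi j x = 1 by move=> /OmU/psiU1.
have hq k : k <= q -> k * (e / 2 / q) <= e / 2.
  by move=> kq; rewrite mulrA ler_pdivrMr// mulrC ler_wpM2l//; lra.
exists w; split; first exact: Cw.
- have ii j : rintegrable leb Om (fun x => `|wj j x - u x * psi j x|).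
    by rewrite wjE; apply: rintegrable_norm => //; exact: (conv_integrable (a j) bOm (ia j) mK).
  apply: (@le_trans _ _ (\int[leb]_(x in Om) \sum_j `|wj j x - u x * psi j x|)).
    apply: le_Rintegral => //.
    + apply: rintegrable_norm => //; apply: rintegrableB => //.
      by apply: cont_integrable => //; exact: C1_cont.
    + exact: rintegrable_sum.
    + move=> x Ox; rewrite -{1}[u x]mulr1 -(sumpsi x Ox) mulr_sumr -sumrB.
      exact: ler_norm_sum.
  rewrite Rintegral_sum//; apply: (@le_trans _ _ (\sum_(j < m) e / 2 / q)).
    apply: ler_sum => j _; have [_ h] := hda j; rewrite wjE.
    exact: (h K rho (a j) mK (le_trans (rhoc j) (sa j)) (le_trans (ac j) (sa j))).
  rewrite sumr_const card_ord -[leLHS]mulr_natl; apply: (le_trans (hq m%:R _)); last by rewrite ler_pdivrMr// ler_peMr ?(ltW e0)// ler1n.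
  by rewrite /q mulrDr mulr1 -addrA addrCA lerDl addr_ge0// mulr_ge0.
pose t := e / 2 / (fine (leb Om) + 1).
have LO : 0 <= fine (leb Om) by apply: fine_ge0; exact: measure_ge0.
have t0 : 0 < t by rewrite !divr_gt0//; lra.
(* The unit gradient field, regularized so as to be continuous: [t] avoids a division by 0 and costs
   at most [t] at each point, that is [e / 2] over [Om]. *)
have [p pE] : exists p : 'rV[R]_n -> 'rV[R]_n, forall x, p x = (enorm (grad w x) + t)^-1 *: grad w x by eexists.
have nt x : 0 < enorm (grad w x) + t by rewrite ltr_wpDl// enorm_ge0.
have cp i : continuous (fun x => p x 0 i).
  rewrite (_ : (fun x => _) = (fun x => (enorm (grad w x) + t)^-1 * grad w x 0 i)); last by apply/funext => x; rewrite pE mxE.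
  apply: rcontM; last exact: grad_coord_cont.
  move=> x; apply: (@continuous_comp _ _ _ (fun x => enorm (grad w x) + t) (fun z : R => z^-1)).
    by apply: rcontD; [exact: enorm_grad_cont|exact: cst_continuous].
  by apply: inv_continuous; rewrite gt_eqF.
have p1 x : enorm (p x) <= 1.
  by rewrite pE enormZ normfV (ger0_norm (ltW (nt x))) mulrC ler_pdivrMr// mul1r lerDl ltW.
have pb i x : Om x -> `|p x 0 i| <= 1 by move=> _; apply: le_trans (p1 x); exact: coord_le_enorm.
have mp i : measurable_fun (Om : set cT) (fun x => p x 0 i) by exact: cont_lmble_fun.
have ckK j : continuous (fun z => K (z - a j)) by exact: (C1_cont (CKa j)).
have cgk j i : continuous (fun z => grad K (z - a j) 0 i) by apply: (rcont_shiftB (k := fun z => grad K z 0 i)); exact: grad_coord_cont.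
pose kk j z := K (- z - a j).
have [Ckk gkk] : (forall j, C1 (kk j)) /\ forall j, grad (kk j) = fun z => - grad K (- z - a j).
  by split=> j; have [] := C1_reflect (a j) CK.
have ip i : rintegrable leb Om (fun x => p x 0 i) by exact: cont_integrable.
have [Phi PhiD] : exists Phi : 'I_m -> 'I_n -> 'rV[R]_n -> R, forall j i y,
    Phi j i y = \int[leb]_(x in Om) (p x 0 i * K (y - x - a j)) by eexists.
have PhiE j i : Phi j i = (fun y => \int[leb]_(x in Om) (p x 0 i * kk j (x - y))).
  by apply/funext => y; rewrite PhiD; apply: eq_Rintegral => x _; rewrite /kk opprB.
have CPhi j i : C1 (Phi j i) by rewrite PhiE; have [] := conv_C1 bOm (ip i) (Ckk j).
have gPhi j i y : grad (Phi j i) y 0 i = \int[leb]_(x in Om) (p x 0 i * grad K (y - x - a j) 0 i).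
  rewrite PhiE; have [_ h] := conv_C1 bOm (ip i) (Ckk j); rewrite -dot_delta h gkk -mulN1r -RintegralZl//.
    by apply: eq_Rintegral => x _; rewrite dotNr dot_delta opprB mulrN mulN1r opprK.
  have := @rint_conv R n Om (fun x => p x 0 i) (fun z => dot (delta_mx 0 i) (- grad K (- z - a j))) y bOm (ip i).
  apply; rewrite (_ : (fun z => _) = (fun z => 'D_(delta_mx 0 i) (kk j) z)); first by have [_] := Ckk j; exact.
  by apply/funext => z; rewrite (C1_derive _ _ (Ckk j)) gkk.
have Phi1 j y : enorm (\row_i Phi j i y) <= 1.
  have ck2 : continuous (fun x => K (y - x - a j)).
    rewrite (_ : (fun x => _) = (fun x => kk j (x - y))); last by apply/funext => x; rewrite /kk opprB.
    exact: (rcont_shiftB (C1_cont (Ckk j))).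
  apply: (@dot_unit_le p _ (fun x => K (y - x - a j))) => //.
  - by move=> i; apply: cont_integrable => //; exact: rcontM.
  - exact: cont_integrable.
  - exact: (mollifier_le1 (a j) y mO mK).
  - by move=> i; rewrite mxE PhiD.
have psiPhi0 j i y : ~ core Om rho y -> psi j y * Phi j i y = 0.
  move=> ny; have [->|py] := eqVneq (psi j y) 0; first by rewrite mul0r.
  rewrite PhiD (@eq_Rintegral _ _ _ leb Om (fun=> 0)) ?Rintegral_cst// ?mul0r ?mulr0// => x.
  rewrite in_setE => Ox; have [->|Ky] := eqVneq (K (y - x - a j)) 0; first by rewrite mulr0.
  by exfalso; apply: ny; exact: supp py Ky.
(* [p] has no compact support, but [Psi] has: the kernels see only points of [Om], and the inward
   shifts push these into [core Om rho]. Its norm is at most 1 because the [psi j] sum to at most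
   1. *)
pose Psi y : 'rV[R]_n := \row_i - \sum_j psi j y * Phi j i y.
have CpP j i : C1 (fun y => psi j y * Phi j i y) by have [] := C1M (Cp j) (CPhi j i).
have CsP i : C1 (fun y => \sum_j psi j y * Phi j i y) by have [] := C1_sum (index_enum 'I_m) xpredT (CpP ^~ i).
have Psii i : (fun y => Psi y 0 i) = (fun y => - \sum_j psi j y * Phi j i y) by apply/funext => y; rewrite mxE.
have CPsi : C1 Psi by apply: C1_field => i; rewrite Psii; have [] := C1N (CsP i).
have divPsi y : divergence Psi y = - \sum_i \sum_j (psi j y * grad (Phi j i) y 0 i + Phi j i y * grad (psi j) y 0 i).
  rewrite divergenceE// -sumrN; apply: eq_bigr => i _; rewrite Psii; have [_ ->] := C1N (CsP i).
  rewrite mxE; congr (- _); have [_ ->] := C1_sum (index_enum 'I_m) xpredT (CpP ^~ i).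
  rewrite summxE; apply: eq_bigr => j _; have [_ ->] := C1M (Cp j) (CPhi j i).
  by rewrite !mxE.
have tPsi : test_field Om Psi.
  split=> // [|y].
    exists (core Om rho); first split.
    - apply: bounded_closed_compact; last exact: core_closed.
      by have [] := core_bmeas rho0 bOm.
    - exact: core_sub.
    - by move=> y ny; apply/rowP => i; rewrite !mxE big1 ?oppr0// => j _; exact: psiPhi0.
  have -> : Psi y = - \sum_j psi j y *: (\row_i Phi j i y).
    by apply/rowP => i; rewrite !mxE summxE; congr (- _); apply: eq_bigr => j _; rewrite !mxE.
  rewrite enormN; apply: (le_trans (enorm_sum _ _)); apply: le_trans (psi1 y).
  by apply: ler_sum => j _; rewrite enormZ ger0_norm// ler_piMr.
have iPhi j i : rintegrable leb Om (fun y => u y * (psi j y * grad (Phi j i) y 0 i)).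
  exact: (iu _ (rcontM (C1_cont (Cp j)) (grad_coord_cont (i := i) (CPhi j i)))).
have iPhi' j i : rintegrable leb Om (fun y => u y * (Phi j i y * grad (psi j) y 0 i)).
  exact: (iu _ (rcontM (C1_cont (CPhi j i)) (grad_coord_cont (i := i) (Cp j)))).
pose T1 := \int[leb]_(x in Om) dot (p x) (grad w x).
pose T2 := \sum_i \sum_j \int[leb]_(y in Om) (u y * (Phi j i y * grad (psi j) y 0 i)).
have cpg j i : continuous (fun x => p x 0 i * grad (wj j) x 0 i).
  exact: (rcontM (cp i) (grad_coord_cont (i := i) (Cwj j))).
(* The derivative of the products in [Psi] produces the main term, which is the pairing of [p] with
   the gradient of [w], and the commutator [T2]. *)
have T1E : T1 = \int[leb]_(y in Om) (u y * divergence Psi y) + T2.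
  have -> : T1 = \sum_i \sum_j - \int[leb]_(y in Om) (u y * (psi j y * grad (Phi j i) y 0 i)).
    transitivity (\int[leb]_(x in Om) \sum_i \sum_j (p x 0 i * grad (wj j) x 0 i)).
      apply: eq_Rintegral => x _; apply: eq_bigr => i _; rewrite -mulr_sumr; congr (_ * _).
      by rewrite /w gw summxE.
    rewrite Rintegral_sum//; last by move=> i; apply: rintegrable_sum => // j; exact: cont_integrable.
    apply: eq_bigr => i _; rewrite Rintegral_sum//; last by move=> j; exact: cont_integrable.
    apply: eq_bigr => j _.
    have := @conv_adjoint R n Om Om (fun y => u y * psi j y) (fun z => grad K (z - a j) 0 i) (fun x => p x 0 i) 1
      bOm bOm (ia j) (cgk j i) (mp i) (pb i).
    have h1 : \int[leb]_(x in Om) (p x 0 i * grad (wj j) x 0 i) = \int[leb]_(x in Om) (-1 * (p x 0 i * \int[leb]_(y in Om) (u y * psi j y * grad K (y - x - a j) 0 i))).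
      by apply: eq_Rintegral => x _; rewrite gwj mulrN mulN1r.
    have h2 : rintegrable leb Om (fun x => p x 0 i * \int[leb]_(y in Om) (u y * psi j y * grad K (y - x - a j) 0 i)).
      apply: cont_integrable => //; apply: rcontM; first exact: cp.
      exact: (conv_cont bOm (ia j) (cgk j i)).
    have h3 : \int[leb]_(y in Om) (u y * (psi j y * grad (Phi j i) y 0 i)) = \int[leb]_(y in Om) (u y * psi j y *
        \int[leb]_(x in Om) (p x 0 i * grad K (y - x - a j) 0 i)).
      by apply: eq_Rintegral => y _; rewrite gPhi mulrA.
    by move=> adj; rewrite h1 (Rint_scale _ mO h2) mulN1r adj h3.
  have -> : \int[leb]_(y in Om) (u y * divergence Psi y) =
     \sum_i \sum_j - (\int[leb]_(y in Om) (u y * (psi j y * grad (Phi j i) y 0 i)) +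
       \int[leb]_(y in Om) (u y * (Phi j i y * grad (psi j) y 0 i))).
    have ii j i : rintegrable leb Om (fun y => -1 * (u y * (psi j y * grad (Phi j i) y 0 i) + u y * (Phi j i y * grad (psi j) y 0 i))).
      by apply: rintegrableZ => //; exact: rintegrableD.
    transitivity (\int[leb]_(y in Om) \sum_i \sum_j (-1 * (u y * (psi j y * grad (Phi j i) y 0 i) + u y * (Phi j i y * grad (psi j) y 0 i)))).
      apply: eq_Rintegral => y _; rewrite divPsi mulrN mulr_sumr -sumrN; apply: eq_bigr => i _.
      by rewrite mulr_sumr -sumrN; apply: eq_bigr => j _; rewrite mulN1r mulrDr.
    rewrite Rintegral_sum//; last by move=> i; exact: rintegrable_sum.
    apply: eq_bigr => i _; rewrite Rintegral_sum//; apply: eq_bigr => j _.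
    by rewrite (Rint_scale _ mO (rintegrableD mO (iPhi j i) (iPhi' j i))) mulN1r (Rint_add mO (iPhi j i) (iPhi' j i)).
  rewrite /T2 -big_split/=; apply: eq_bigr => i _; rewrite -big_split/=; apply: eq_bigr => j _.
  by rewrite opprD subrK.
have [b bE] : exists b : 'I_m -> 'I_n -> 'rV[R]_n -> R, forall j i,
    b j i = (fun x => \int[leb]_(y in Om) (u y * grad (psi j) y 0 i * K (y - x - a j))) by eexists.
have cb j i : continuous (b j i) by rewrite bE; exact: (conv_cont bOm (ib j i) (ckK j)).
have grad0 i x : Om x -> \sum_j grad (psi j) x 0 i = 0.
  move=> /OmU Ux; have [_ gs] := C1_sum (index_enum 'I_m) xpredT Cp.
  have /nbhs_eball[dd dd0 hdd] := open_nbhs_nbhs (conj oU1 Ux).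
  have := grad_locally_cst dd0 (fun y yd => psiU1 y (hdd y yd)); rewrite gs => /(congr1 (fun v : 'rV[R]_n => v 0 i)).
  by rewrite summxE mxE.
have T2e : T2 <= e / 2.
  have ipu j i : rintegrable leb Om (fun x => p x 0 i * (u x * grad (psi j) x 0 i)).
    have := iu (fun x => p x 0 i * grad (psi j) x 0 i); rewrite (_ : (fun x => u x * _) = (fun x => p x 0 i * (u x * grad (psi j) x 0 i))).
      by apply; exact: (rcontM (cp i) (grad_coord_cont (i := i) (Cp j))).
    by apply/funext => x; rewrite mulrCA.
  have ibu j i : rintegrable leb Om (fun x => `|b j i x - u x * grad (psi j) x 0 i|).
    by rewrite bE; apply: rintegrable_norm => //; exact: (conv_integrable (a j) bOm (ib j i) mK).
  (* The unmollified commutator vanishes because the gradients of the partition of unity cancel on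
     [Om]; subtracting it leaves only mollification errors. *)
  have S0 : \sum_i \sum_j \int[leb]_(x in Om) (p x 0 i * (u x * grad (psi j) x 0 i)) = 0.
    apply: big1 => i _; rewrite -Rintegral_sum//.
    rewrite (@eq_Rintegral _ _ _ leb Om (fun=> 0)) ?Rintegral_cst// ?mul0r// => x; rewrite in_setE => Ox.
    by rewrite -!mulr_sumr grad0// !mulr0.
  rewrite -[leLHS]subr0 -S0 -sumrB.
  apply: (@le_trans _ _ (\sum_(i < n) \sum_(j < m) (e / 2 / q))); last first.
    rewrite !sumr_const !card_ord -[leLHS]mulrnA -[leLHS]mulr_natl; apply: hq.
    by rewrite natrM /q mulrDr mulr1 -addrA lerDl addr_ge0.
  apply: ler_sum => i _; rewrite -sumrB; apply: ler_sum => j _.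
  have := @conv_adjoint R n Om Om (fun y => u y * grad (psi j) y 0 i) (fun z => K (z - a j)) (fun x => p x 0 i) 1
      bOm bOm (ib j i) (ckK j) (mp i) (pb i).
  move=> adj; have -> : \int[leb]_(y in Om) (u y * (Phi j i y * grad (psi j) y 0 i)) = \int[leb]_(x in Om) (p x 0 i * b j i x).
    by rewrite bE [RHS]adj; apply: eq_Rintegral => y _; rewrite -PhiD mulrA mulrAC.
  have ipb : rintegrable leb Om (fun x => p x 0 i * b j i x) by exact: (cont_integrable bOm (rcontM (cp i) (cb j i))).
  move=> {adj}; rewrite -(Rint_sub mO ipb (ipu j i)).
  apply: (@le_trans _ _ (\int[leb]_(x in Om) `|b j i x - u x * grad (psi j) x 0 i|)).
    apply: (le_Rintegral mO (rintegrableB mO ipb (ipu j i)) (ibu j i)).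
    move=> x Ox; rewrite -mulrBr; apply: (le_trans (ler_norm _)).
    by rewrite normrM ler_piMl// pb.
  have [_ h] := hdb (j, i); rewrite bE.
  exact: (h K rho (a j) mK (le_trans (rhoc j) (sb (j, i))) (le_trans (ac j) (sb (j, i)))).
have T1g : tgrad Om w <= T1 + t * fine (leb Om).
  have cpw : continuous (fun x => dot (p x) (grad w x)).
    by apply: rcont_sum => i; apply: rcontM; [exact: cp|exact: grad_coord_cont].
  have ct : rintegrable leb Om (fun=> t) by apply: cont_integrable => //; exact: cst_continuous.
  rewrite /T1 -(Rintegral_cst leb mO t) -RintegralD//; last exact: cont_integrable.
  apply: le_Rintegral => //.
  - exact: tgrad_integrable.
  - by apply: rintegrableD => //; exact: cont_integrable.
  - move=> x _; rewrite pE dotZl -enorm_sqr; have g0 := enorm_ge0 (grad w x); have gt0 := nt x.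
    by rewrite -lerBlDr mulrC ler_pdivlMr//; nra.
have tL : t * fine (leb Om) <= e / 2.
  rewrite /t mulrAC ler_pdivrMr; last by lra.
  by rewrite mulrDr mulr1 lerDl; lra.
apply: (le_trans T1g); rewrite T1E; have := hV _ tPsi => hVP.
by rewrite [e in leRHS]splitr addrA lerD// lerD.
Qed.

End smooth_approximation.

Lemma integral_le_sum d (T : measurableType d) (R : realType) (mu : {measure set T -> \bar R})
    (S : set T) (f : T -> R) (m : nat) (c : nat -> R) (A : nat -> set T) :
  measurable S -> measurable_fun S f -> (forall x, S x -> 0 <= f x) -> (forall k, measurable (A k)) ->
  (forall k, 0 <= c k) -> (forall x, S x -> exists k, [/\ (k < m)%N, A k x & f x <= c k]) ->
  (\int[mu]_(x in S) (f x)%:E <= \sum_(k <- iota 0 m) (c k)%:E * mu (A k))%E.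
Proof.
move=> mS mf f0 mA c0 h.
apply: (@le_trans _ _ (\int[mu]_x \sum_(k <- iota 0 m) (c k * (\1_(A k) : T -> R) x)%:E)%E); last first.
  rewrite ge0_integral_sum//; last 2 first.
  - by move=> k; apply: measurable_scaled_indic.
  - by move=> k x _; rewrite lee_fin mulr_ge0.
  by apply: lee_sum => k _; rewrite integral_scaled_indic.
rewrite [leLHS]integral_mkcond; apply: ge0_le_integral => //.
- by move=> x _; rewrite patchE; case: ifP => //; rewrite in_setE lee_fin => /f0.
- by apply/(measurable_restrictT _ mS); apply/measurable_EFinP.
- by apply: emeasurable_sum => k; apply: measurable_scaled_indic.
- move=> x _; rewrite patchE; case: ifPn => [|_]; last first.
    by rewrite sume_ge0// => k _; rewrite lee_fin mulr_ge0.
  rewrite in_setE => /h[k [km Ak fk]].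
  rewrite sumEFin lee_fin (bigD1_seq k) ?iota_uniq ?mem_iota//=.
  rewrite indicE mem_set// mulr1.
  by apply: (le_trans fk); rewrite lerDl sumr_ge0// => j _; rewrite mulr_ge0.
Qed.

(** * Tubes and the boundary integral of C1 functions *)

Section tubes.
Context {R : realType} {n : nat}.
Implicit Types (x y z nu : 'rV[R]_n.+1) (S F O U : set 'rV[R]_n.+1) (w : 'rV[R]_n.+1 -> R).
Local Notation leb := (@leb R n.+1).
Local Notation haus := (@haus R n.+1 n).
Local Notation hT := (caratheodory_type (@hausdorff_outer R n.+1 n)).

(** The open interval of heights is exhausted by closed ones, which exhibits the tube as a countable
    union of compact sets. *)
Lemma compact_tube_lmble nu (C : set 'rV[R]_n.+1) tau : compact C -> lmble (tube nu C tau).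
Proof.
move=> cC; pose f (p : 'rV[R]_n.+1 * R) := p.1 + p.2 *: nu.
have cf : continuous f.
  apply: continuous_rV => i.
  rewrite (_ : (fun p => _) = (fun p : 'rV[R]_n.+1 * R => p.1 0 i + p.2 * nu 0 i)); last by apply/funext => p; rewrite !mxE.
  apply: rcontD.
    move=> p; apply: (@continuous_comp _ _ _ fst (fun z : 'rV[R]_n.+1 => z 0 i)); first exact: cvg_fst.
    exact: coord_continuous.
  by apply: rcontM; [move=> p; exact: cvg_snd|exact: cst_continuous].
have -> : tube nu C tau = \bigcup_m f @` (C `*` `[m.+1%:R^-1, tau - m.+1%:R^-1]%classic).
  apply/seteqP; split=> [z [x [s [Cx /andP[s0 st] ->]]]|_ [m _ [[x s] [Cx /= ss] <-]]].
    pose q := Num.min s (tau - s); have q0 : 0 < q by rewrite lt_min s0 subr_gt0.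
    have mq : (Num.truncn q^-1).+1%:R^-1 <= q.
      by rewrite -[leRHS]invrK lef_pV2 ?posrE ?invr_gt0// ltW// truncnS_gt.
    exists (Num.truncn q^-1) => //; exists (x, s) => //; split => //=.
    rewrite in_itv/= (le_trans mq) ?ge_min ?lexx//= lerBrDr addrC -lerBrDr.
    by rewrite (le_trans mq)// ge_min lexx orbT.
  move: ss; rewrite in_itv/= => /andP[h1 h2]; exists x, s; split => //.
  have m0 : 0 < m.+1%:R^-1 :> R by rewrite invr_gt0.
  by rewrite (lt_le_trans m0)//= (le_lt_trans h2)// ltrBlDr ltrDl.
apply: bigcupT_measurable => m; apply: compact_lmble; apply: continuous_compact.
  exact/continuous_subspaceT.
by apply: compact_setX => //; exact: segment_compact.
Qed.

Lemma tube_lmble nu F O tau : closed F -> bounded_set F -> open O -> lmble (tube nu (F `&` O) tau).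
Proof.
move=> cF bF oO.
have -> : tube nu (F `&` O) tau = \bigcup_m tube nu (F `&` core O m.+1%:R^-1) tau.
  apply/seteqP; split=> [z [x [s [[Fx Ox] st ->]]]|z [m _ [x [s [[Fx Ox] st ->]]]]].
    have /nbhs_eball[q q0 hq] := open_nbhs_nbhs (conj oO Ox).
    exists (Num.truncn q^-1) => //; exists x, s; split => //; split => // y yx; apply: hq.
    apply: (lt_le_trans yx); rewrite -[leRHS]invrK lef_pV2 ?posrE ?invr_gt0//.
    exact: ltW (truncnS_gt _).
  exists x, s; split => //; split => //; apply: core_sub Ox; by rewrite invr_gt0.
apply: bigcupT_measurable => m; apply: compact_tube_lmble.
have cFC : closed (F `&` core O m.+1%:R^-1) by apply: closedI => //; exact: core_closed.
apply: bounded_closed_compact => //.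
by have [M M0 h] := bounded_enorm bF; apply: (@enorm_bounded _ _ _ M) => x [/h].
Qed.

Lemma tube_bounded nu S tau : bounded_set S -> 0 < tau -> bounded_set (tube nu S tau).
Proof.
move=> /bounded_enorm[M M0 h] t0; apply: (@enorm_bounded _ _ _ (M + tau * enorm nu)) => _ [x [s [/h Sx /andP[s0 st] ->]]].
apply: (le_trans (enormD _ _)); rewrite lerD// enormZ (ger0_norm (ltW s0)).
by rewrite ler_wpM2r ?enorm_ge0// ltW.
Qed.

Definition flat S nu (M : R) := forall x y, S x -> S y -> enorm (x - y) <= M * enorm (normal_proj nu (x - y)).

Lemma flat_line S nu M x y (s t : R) : enorm nu = 1 -> flat S nu M -> S x -> S y -> x + s *: nu = y + t *: nu -> x = y.
Proof.
move=> nu1 fl Sx Sy e; have xy : x - y = (t - s) *: nu.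
  by rewrite scalerBl -[x](addrK (s *: nu)) e addrAC [y + _]addrC addrK.
have nn : dot nu nu = 1 by rewrite -enorm_sqr nu1 expr1n.
have := fl x y Sx Sy; rewrite xy /normal_proj dotZl nn mulr1 subrr enorm0 mulr0 => h.
by apply/eqP; rewrite -subr_eq0 xy (enorm_eq0 (_ : enorm ((t - s) *: nu) = 0))//; apply/eqP; rewrite eq_le h enorm_ge0.
Qed.

Lemma closed_open_hmble F O : closed F -> open O -> measurable (F `&` O : set hT).
Proof.
move=> cF oO; apply: measurableI.
  exact: (closed_cmble (@halfspace_hmble R n.+1 n)).
exact: (open_cmble (@halfspace_hmble R n.+1 n)).
Qed.

Lemma cont_hmfun w (D : set hT) : continuous w -> measurable_fun D w.
Proof. exact: (cont_cmble_fun (@halfspace_hmble R n.+1 n)). Qed.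

(** A line in the direction [nu] meets a flat set at most once, so it stays in the tube over an
    interval of heights shorter than [tau] and has at most [tau / s + 1] sample points there. *)
Lemma tube_sum (nu : 'rV[R]_n.+1) S tau (s : R) x (m : nat) M : enorm nu = 1 -> flat S nu M -> 0 < tau -> 0 < s ->
  (\sum_(i <- iota 0 m) (x - (i%:R * s) *: nu \in tube nu S tau)%:R / tau) * s <= 1 + tau^-1 * s.
Proof.
move=> nu1 fl t0 s0.
have : \sum_(i <- iota 0 m) ((x - (i%:R * s) *: nu \in tube nu S tau)%:R : R) <= tau / s + 1.
  apply: sum_bool_le => [|i j ij]; first by rewrite divr_ge0// ltW.
  rewrite !in_setE => -[a [p [Sa /andP[p0 pt] ea]]] [b [q [Sb /andP[q0 qt] eb]]].
  have xa : x = a + (p + i%:R * s) *: nu by rewrite scalerDl addrA -ea subrK.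
  have xb : x = b + (q + j%:R * s) *: nu by rewrite scalerDl addrA -eb subrK.
  have ab : a = b by exact: (flat_line nu1 fl Sa Sb (etrans (esym xa) xb)).
  move: xb; rewrite xa ab => /addrI/eqP; rewrite -subr_eq0 -scalerBl scaler_eq0 => /orP[|/eqP nu0]; last first.
    by move: nu1; rewrite nu0 enorm0 => /eqP; rewrite eq_sym oner_eq0.
  by rewrite subr_eq0 => /eqP e; rewrite ler_pdivlMr// natrB// mulrBl; lra.
move=> h; rewrite -mulr_suml mulrAC ler_pdivrMr//.
apply: (@le_trans _ _ ((tau / s + 1) * s)); first by rewrite ler_wpM2r// ltW.
by rewrite le_eqVlt; apply/orP; left; apply/eqP; field; rewrite !gt_eqF.
Qed.

(** The set is sliced by the levels of [|w|]. On each slice the Hausdorff measure is bounded by the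
    volume of a thin tube divided by [tau], and [w] hardly varies along it. Tubes over different
    slices are disjoint, which reassembles one integral over the whole tube, where the
    one-dimensional estimate along [nu] applies with [K = 1]. *)
Lemma trace_piece F O U nu (M h : R) w : closed F -> bounded_set F -> open O -> bmeas U -> C1 w ->
  enorm nu = 1 -> 0 < M -> 0 < h -> flat (F `&` O) nu M ->
  (forall y s, F y -> O y -> 0 < s <= h -> U (y + s *: nu)) ->
  (\int[haus]_(x in F `&` O) (`|w x|)%:E <=
   (M ^+ n * (\int[leb]_(x in U) `|dot nu (grad w x)| + (2 / h) * \int[leb]_(x in U) `|w x|))%:E)%E.
Proof.
move=> cF bF oO bU Cw nu1 M0 h0 fl SU; set S := F `&` O; have mU := bU.1.
have cw := C1_cont Cw; have cN := rcont_norm cw.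
have bS : bounded_set S by have [B B0 hB] := bounded_enorm bF; apply: (@enorm_bounded _ _ _ B) => x [/hB].
have [W W0 hW] := continuous_bounded cw bS.
set I1 := \int[leb]_(x in U) `|dot nu (grad w x)|; set I2 := \int[leb]_(x in U) `|w x|.
pose V := fine (leb U); have V0 : 0 <= V by apply: fine_ge0; exact: measure_ge0.
have MM : 0 <= M ^+ n by rewrite exprn_ge0// ltW.
have h2 : 0 < h / 2 by rewrite divr_gt0.
suff key e : 0 < e -> (\int[haus]_(x in S) (`|w x|)%:E <=
   (M ^+ n * (I1 + (2 / h) * I2 + 2 * e * ((2 / h) * V)))%:E)%E.
  apply/lee_addgt0Pr => e e0; pose e' := e / (M ^+ n * (2 * ((2 / h) * V)) + 1).
  have c0 : 0 <= M ^+ n * (2 * ((2 / h) * V)) by rewrite !mulr_ge0// invr_ge0 ltW.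
  have e'0 : 0 < e' by rewrite divr_gt0// ltr_wpDl.
  apply: (le_trans (key e' e'0)); rewrite -EFinD lee_fin.
  have : e' * (M ^+ n * (2 * ((2 / h) * V)) + 1) = e by rewrite divfK// gt_eqF// ltr_wpDl.
  move: c0; set c := M ^+ n * (2 * _) => c0 ee.
  have -> : M ^+ n * (I1 + 2 / h * I2 + 2 * e' * (2 / h * V)) = M ^+ n * (I1 + 2 / h * I2) + e' * c by rewrite /c; ring.
  by rewrite lerD2l -ee mulrDr mulr1 lerDl ltW.
move=> e0.
have [d d0 hd] := enorm_unif_continuous cw bS e0.
(* [d] controls the oscillation of [w] along the tube; [h / 2] leaves room for a further
   displacement of [h / 2] from any point of the tube while staying in [U]. *)
pose tau := Num.min (d / 2) (h / 2); have t0 : 0 < tau by rewrite lt_min !divr_gt0.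
have td : tau < d by rewrite gt_min ltr_pdivrMr// ltr_pMr// ltr1n.
have th : tau <= h / 2 by rewrite ge_min lexx orbT.
pose m := (Num.truncn (W / e)).+1.
have mW : W < m%:R * e by rewrite -ltr_pdivrMr// truncnS_gt.
(* The half-open levels are written as a closed set intersected with an open one, the form for which
   tubes are known to be measurable. *)
pose Fk (k : nat) := F `&` [set x | k%:R * e <= `|w x|].
pose Ok (k : nat) := O `&` [set x | `|w x| < (k%:R + 1) * e].
pose Sk k := Fk k `&` Ok k.
have cFk k : closed (Fk k).
  apply: closedI => //; rewrite (_ : [set x | _] = (fun x => `|w x|) @^-1` `[k%:R * e, +oo[%classic).
    by apply: closed_comp; [move=> ? _; exact: cN|exact: interval_closed].
  by apply/seteqP; split=> x /=; rewrite in_itv/= andbT.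
have oOk k : open (Ok k).
  apply: openI => //; rewrite (_ : [set x | _] = (fun x => `|w x|) @^-1` `]-oo, (k%:R + 1) * e[%classic).
    by apply: open_comp; [move=> ? _; exact: cN|exact: interval_open].
  by apply/seteqP; split=> x /=; rewrite in_itv.
have SkS k : Sk k `<=` S by move=> x [[? _] [? _]].
have bFk k : bounded_set (Fk k) by have [B B0 hB] := bounded_enorm bF; apply: (@enorm_bounded _ _ _ B) => x [/hB].
pose T := tube nu S tau; pose Tk k := tube nu (Sk k) tau.
have mT : lmble T by exact: tube_lmble.
have mTk k : lmble (Tk k) by exact: tube_lmble.
have bT : bmeas T by split => //; exact: tube_bounded.
have TkT k : Tk k `<=` T by move=> z [x [s [/SkS Sx st ->]]]; exists x, s.
have bTk k : bmeas (Tk k) by exact: bmeasS bT.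
have mS : measurable (S : set hT) by exact: closed_open_hmble.
have mSk k : measurable (Sk k : set hT) by exact: closed_open_hmble.
pose a x : R := (x \in T)%:R / tau.
have tube1 f : C1 f -> \int[leb]_(x in T) (a x * `|f x|) <=
    1 * (\int[leb]_(x in U) `|dot nu (grad f x)| + (h / 2)^-1 * \int[leb]_(x in U) `|f x|).
  move=> Cf; apply: (@Rintegral_tube R n.+1 a T U f nu tau^-1 1 (h / 2) Cf bT bU) => //.
  - apply: lmfunM; last exact: measurable_cst.
    rewrite (_ : (fun x => _) = (\1_T : _ -> R)); first exact: measurable_indic.
    by apply/funext => x; rewrite indicE.
  - move=> x; rewrite /a; case: (_ \in _); rewrite ?mul0r ?mul1r ?lexx ?andbT invr_ge0 ?(ltW t0)//.
  - by move=> x nT; rewrite /a memNset ?mul0r.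
  - move=> _ s [y [p [[Fy Oy] /andP[p0 pt] ->]]] /andP[s0 sh]; rewrite -addrA -scalerDl.
    by apply: SU => //; rewrite ltr_wpDr//=; lra.
  - by move=> x s k s0; exact: tube_sum fl t0 s0.
have aT x : T x -> a x = tau^-1 by move=> Tx; rewrite /a mem_set// mul1r.
have tubew f : C1 f -> tau^-1 * \int[leb]_(x in T) `|f x| <=
    \int[leb]_(x in U) `|dot nu (grad f x)| + 2 / h * \int[leb]_(x in U) `|f x|.
  move=> Cf; have := tube1 f Cf; rewrite mul1r invf_div; apply: le_trans.
  rewrite -Rint_scale//; last by apply: cont_integrable => //; apply: rcont_norm; exact: C1_cont.
  by rewrite le_eqVlt; apply/orP; left; apply/eqP/eq_Rintegral => x; rewrite in_setE => /aT ->.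
have LT : tau^-1 * fine (leb T) <= 2 / h * V.
  have := tubew _ (C1_cst 1); under [X in _ <= X + _]eq_Rintegral do rewrite grad_cst dot0r normr0.
  rewrite (Rintegral_cst _ mT) !(Rintegral_cst _ mU) normr1 mul0r add0r !mul1r; exact.
have Hk k : (haus (Sk k) <= (M ^+ n * tau^-1 * fine (leb (Tk k)))%:E)%E.
  have flk : flat (Sk k) nu M by move=> x y /SkS Sx /SkS Sy; exact: fl.
  have := hausdorff_flat M0 t0 nu1 flk; rewrite -lee_pdivlMr// => hk; apply: (le_trans hk).
  rewrite -[X in (_ * X * _)%E](@fineK _ (leb (Tk k))); last by rewrite ge0_fin_numE ?measure_ge0//; exact/lebesgue_outer_bounded/(bTk k).2.
  by rewrite -!EFinM lee_fin mulrAC.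
have ke0 k : 0 <= (k%:R + 1) * e by rewrite mulr_ge0 ?addr_ge0// ltW.
have level x : S x -> exists k, [/\ (k < m)%N, Sk k x & `|w x| <= (k%:R + 1) * e].
  move=> Sx; exists (Num.truncn (`|w x| / e)).
  have := truncn_itv (divr_ge0 (normr_ge0 (w x)) (ltW e0)).
  set k := Num.truncn _; rewrite -natr1 ler_pdivlMr// ltr_pdivrMr// => /andP[h3 h4].
  split; last exact: ltW.
  - by rewrite -(ltr_nat R) -(ltr_pM2r e0); apply: le_lt_trans mW; apply: le_trans h3 _; exact: hW.
  - by move: Sx => [Fx Ox].
have IS := @integral_le_sum _ hT R haus S (fun x => `|w x|) m _ Sk mS (cont_hmfun (D := S) cN) (fun x _ => normr_ge0 _) mSk ke0 level.
apply: (le_trans IS).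
(* One [e] for the width of the level and one for the oscillation along the tube. *)
apply: (@le_trans _ _ (\sum_(k <- iota 0 m) (M ^+ n * tau^-1 * \int[leb]_(x in Tk k) (`|w x| + 2 * e))%:E)%E).
  apply: lee_sum => k _.
  apply: (@le_trans _ _ (((k%:R + 1) * e)%:E * (M ^+ n * tau^-1 * fine (leb (Tk k)))%:E)%E).
    by apply: lee_wpmul2l; [rewrite lee_fin ke0|exact: Hk].
  rewrite -EFinM lee_fin mulrCA ler_wpM2l ?mulr_ge0 ?invr_ge0 ?(ltW t0)//.
  rewrite -Rintegral_cst//; apply: le_Rintegral => //.
  - by apply: cont_integrable => //; exact: cst_continuous.
  - by apply: cont_integrable => //; apply: rcontD => //; exact: cst_continuous.
  - move=> _ [x [s [[[Fx h3] [Ox _]] /andP[s0 st] ->]]].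
    have := hd x (x + s *: nu) (conj Fx Ox); rewrite addrAC subrr add0r enormZ nu1 mulr1 (ger0_norm (ltW s0)).
    move=> /(_ (lt_trans st td)) hw.
    have := ler_normB (w (x + s *: nu)) (w (x + s *: nu) - w x); rewrite opprB addrCA subrr addr0.
    by move: h3; rewrite /=; lra.
rewrite sumEFin lee_fin -mulr_sumr -[leLHS]mulrA ler_wpM2l//.
have iT : rintegrable leb T (fun x => `|w x| + 2 * e).
  by apply: cont_integrable => //; apply: rcontD => //; exact: cst_continuous.
apply: (@le_trans _ _ (tau^-1 * \int[leb]_(x in T) (`|w x| + 2 * e))).
  rewrite ler_wpM2l ?invr_ge0 ?(ltW t0)// -[leRHS]mul1r.
  apply: Rintegral_count => //.
    by move=> x _; rewrite addr_ge0// mulr_ge0// ltW.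
  move=> x _.
  have disj i j : x \in Tk i -> x \in Tk j -> i = j.
    rewrite !in_setE => -[y [p [Sy _ ey]]] [z [q [Sz _ ez]]].
    have yz : y = z by exact: (flat_line nu1 fl (SkS _ _ Sy) (SkS _ _ Sz) (etrans (esym ey) ez)).
    have [[_ a1] [_ a2]] := Sy; have [[_ a3] [_ a4]] := Sz; rewrite -yz /= in a1 a2 a3 a4.
    have b1 := le_lt_trans a1 a4; have b2 := le_lt_trans a3 a2.
    rewrite (ltr_pM2r e0) natr1 ltr_nat ltnS in b1; rewrite (ltr_pM2r e0) natr1 ltr_nat ltnS in b2.
    by apply/eqP; rewrite eqn_leq b1 b2.
  elim: (iota 0 m) (iota_uniq 0 m) => [|i r IH]; first by rewrite big_nil ler01.
  rewrite cons_uniq big_cons => /andP[ir ur]; case: (boolP (x \in Tk i)) => [xi|_]; last by rewrite add0r IH.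
  rewrite big_seq big1 ?addr0// => j jr; case: (boolP (x \in Tk j)) => // xj.
  by move: ir; rewrite (disj _ _ xi xj) jr.
rewrite Rint_add//; [|exact: cont_integrable|by apply: cont_integrable => //; exact: cst_continuous].
rewrite mulrDr Rintegral_cst//; apply: lerD; first exact: tubew.
by rewrite mulrCA ler_wpM2l// mulr_ge0// ltW.
Qed.

End tubes.

(** * Boundary integrals of C1 functions *)

Section boundary_trace.
Context {R : realType} {n : nat} (Om : set 'rV[R]_n.+1).
Implicit Types (x y z nu : 'rV[R]_n.+1) (w : 'rV[R]_n.+1 -> R) (V : set 'rV[R]_n.+1).
Local Notation leb := (@leb R n.+1).
Local Notation haus := (@haus R n.+1 n).
Local Notation hT := (caratheodory_type (@hausdorff_outer R n.+1 n)).
Hypotheses (oOm : open Om) (bOm : bmeas Om).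

Let Fr := frontier Om.

(** [V] is meant to contain the boundary points near which the normal oscillates too much; with
    these removed, [M] can be close to 1 even for a Lipschitz boundary. *)
Definition flat_chart V x (r : R) nu (M : R) := [/\ 0 < r, enorm nu = 1,
  flat ((Fr `\` V) `&` eball x r) nu M &
  forall y s, (Fr `\` V) y -> eball x r y -> 0 < s < r -> Om (y + s *: nu)].

Lemma frontier_closed : closed Fr.
Proof.
rewrite /Fr /frontier setDE; apply: closedI; first exact: closed_closure.
by apply: open_closedC; exact: open_interior.
Qed.

Lemma frontier_notin x : Fr x -> ~ Om x.
Proof. by move=> [_ nx] Ox; apply: nx; move: oOm; rewrite openE; exact. Qed.

Lemma frontier_compact : compact Fr.
Proof.
apply: subclosed_compact frontier_closed (bounded_closure_compact bOm) _.
by move=> x [].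
Qed.

Lemma frontier_bounded : bounded_set Fr.
Proof. by apply: compact_bounded; exact: frontier_compact. Qed.

(** Localizing by a partition of unity does not spoil the leading constant: the weights [psi j]
    multiply the gradient and sum to at most 1, while their own gradients fall on [w] itself and go
    into [C]. *)
Lemma collar_bound V (M rho : R) : open V -> 0 < M -> 0 < rho ->
  (forall x, Fr x -> exists r nu, flat_chart V x r nu M) ->
  exists2 C, 0 <= C & forall w, C1 w ->
   (\int[haus]_(x in Fr `\` V) (`|w x|)%:E <=
    (M ^+ n * tgrad (Om `\` core Om rho) w + C * \int[leb]_(x in Om) `|w x|)%:E)%E.
Proof.
move=> oV M0 rho0 charts; have mOm := bOm.1.
have /choice[ch hch] : forall x, exists d : R * 'rV[R]_n.+1, Fr x -> flat_chart V x d.1 d.2 M.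
  move=> x; have [/charts[r [nu h]]|nx] := pselect (Fr x); first by exists (r, nu).
  by exists (0, 0).
have r0 x : Fr x -> 0 < (ch x).1 by move=> /hch[].
have [m [xc [psi [Cpsi psi0 psis psi1 [U1 oU1 [FrU1 psiU1]]]]]] := partition_of_unity frontier_compact r0.
pose U := Om `\` core Om rho.
have mC : lmble (core Om rho) by exact: (core_bmeas rho0 bOm).1.
have mU : lmble U by exact: measurableD.
have UO : U `<=` Om by move=> x [].
have bU : bmeas U by exact: bmeasS bOm.
have cF : closed (Fr `\` V) by rewrite setDE; apply: closedI; [exact: frontier_closed|exact: open_closedC].
have bF : bounded_set (Fr `\` V).
  by have [B B0 hB] := bounded_enorm frontier_bounded; apply: (@enorm_bounded _ _ _ B) => x [/hB].
have MM : 0 <= M ^+ n by rewrite exprn_ge0// ltW.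
have mF : measurable (Fr `\` V : set hT).
  by have := closed_open_hmble cF openT; rewrite setIT.
have Cp j : C1 (psi j) by have [] := Cpsi j.
have /choice[g hg] : forall j, exists g, 0 < g /\ forall x, Om x -> enorm (grad (psi j) x) <= g.
  move=> j; have [g g0 h] := continuous_bounded (enorm_grad_cont (Cp j)) bOm.2; exists g; split => // x /h.
  by rewrite ger0_norm ?enorm_ge0.
(* Points pushed by at most [rho / 2] from the boundary are within [rho] of it, hence outside
   [core Om rho]; half of the chart radius makes the inequality on displacements strict. *)
pose h j := Num.min ((ch (xc j)).1 / 2) (rho / 2).
have h0 j : 0 < h j by rewrite lt_min !divr_gt0//; apply: r0; have [] := Cpsi j.
pose C := \sum_j (M ^+ n * (g j + 2 / h j)).
have c0 j : 0 <= M ^+ n * (g j + 2 / h j).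
  by rewrite mulr_ge0// addr_ge0// ?divr_ge0 ?(ltW (h0 j))//; have [/ltW] := hg j.
exists C => [|w Cw]; first exact: sumr_ge0.
have cw := C1_cont Cw.
have Cpw j : C1 (fun x => psi j x * w x) by have [] := C1M (Cp j) Cw.
have iw : rintegrable leb U (fun x => `|w x|) by apply: cont_integrable => //; exact: rcont_norm.
have ipg j : rintegrable leb U (fun x => psi j x * enorm (grad w x)).
  by apply: (cont_integrable bU (rcontM (C1_cont (Cp j)) (enorm_grad_cont Cw))).
have Iw0 : 0 <= \int[leb]_(x in Om) `|w x| by apply: Rintegral_ge0.
have IwU : \int[leb]_(x in U) `|w x| <= \int[leb]_(x in Om) `|w x|.
  by apply: Rintegral_subset => //; apply: cont_integrable => //; exact: rcont_norm.
have piece j : (\int[haus]_(x in Fr `\` V) (`|psi j x * w x|)%:E <=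
   (M ^+ n * \int[leb]_(x in U) (psi j x * enorm (grad w x)) + M ^+ n * (g j + 2 / h j) * \int[leb]_(x in Om) `|w x|)%:E)%E.
  have [xj Cj] := Cpsi j; have [rj nu1 fl tub] := hch _ xj.
  have SU y s : (Fr `\` V) y -> eball (xc j) (ch (xc j)).1 y -> 0 < s <= h j -> U (y + s *: (ch (xc j)).2).
    move=> Fy By /andP[s0 sh]; split.
      apply: tub => //; rewrite s0/= (le_lt_trans sh)// gt_min; apply/orP; left.
      by rewrite ltr_pdivrMr// ltr_pMr// ltr1n.
    move=> /(_ y) hy; apply: (frontier_notin Fy.1); apply: hy.
    rewrite /eball/= opprD addrA subrr sub0r enormN enormZ nu1 mulr1 (ger0_norm (ltW s0)).
    rewrite (le_lt_trans sh)// gt_min; apply/orP; right.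
    by rewrite ltr_pdivrMr// ltr_pMr// ltr1n.
  have := trace_piece cF bF (@eball_open R n.+1 (xc j) (ch (xc j)).1) bU (Cpw j) nu1 M0 (h0 j) fl SU => tp.
  rewrite (_ : (\int[haus]_(x in Fr `\` V) _)%E = (\int[haus]_(x in (Fr `\` V) `&` eball (xc j) (ch (xc j)).1) (`|psi j x * w x|)%:E)%E); last first.
    rewrite integral_mkcond [RHS]integral_mkcond; apply: eq_integral => x _; rewrite !patchE.
    case: (pselect ((Fr `\` V) x)) => Fx; last by rewrite memNset// memNset// => -[].
    rewrite mem_set//; case: (pselect (eball (xc j) (ch (xc j)).1 x)) => Bx; first by rewrite mem_set.
    rewrite memNset; last by move=> [].
    by rewrite psis ?mul0r ?normr0// leNgt; exact/negP.
  apply: (le_trans tp); rewrite lee_fin -[X in _ <= _ + X]mulrA -[leRHS]mulrDr ler_wpM2l//.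
  have ipw : rintegrable leb U (fun x => `|psi j x * w x|) by exact: (cont_integrable bU (rcont_norm (C1_cont (Cpw j)))).
  have psile x : psi j x <= 1.
    by apply: le_trans (psi1 x); rewrite (bigD1 j)//= lerDl sumr_ge0.
  have q0 : 0 <= 2 / h j by rewrite divr_ge0// ltW.
  have i1 : \int[leb]_(x in U) `|psi j x * w x| <= \int[leb]_(x in Om) `|w x|.
    apply: le_trans IwU; apply: (le_Rintegral mU ipw iw) => x _.
    by rewrite normrM (ger0_norm (psi0 j x)) ler_piMl.
  have [gj gjb] := hg j.
  have i2 : \int[leb]_(x in U) `|dot (ch (xc j)).2 (grad (fun x => psi j x * w x) x)| <=
      \int[leb]_(x in U) (psi j x * enorm (grad w x)) + g j * \int[leb]_(x in Om) `|w x|.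
    apply: (@le_trans _ _ (\int[leb]_(x in U) (psi j x * enorm (grad w x) + g j * `|w x|))).
      apply: le_Rintegral => //.
      - exact: (cont_integrable bU (cont_dot_grad (nu := (ch (xc j)).2) (Cpw j))).
      - by apply: rintegrableD => //; exact: rintegrableZ.
      - move=> x [Ox _]; have [_ ->] := C1M (Cp j) Cw.
        apply: (le_trans (dot_le _ _)); rewrite nu1 mul1r; apply: (le_trans (enormD _ _)).
        by rewrite !enormZ (ger0_norm (psi0 j x)) lerD2l mulrC ler_wpM2r// gjb.
    rewrite Rint_add//; last exact: rintegrableZ.
    by rewrite lerD2l Rint_scale// ler_wpM2l// ltW.
  apply: (le_trans (lerD i2 (ler_wpM2l q0 i1))).
  by rewrite -[leLHS]addrA lerD2l -mulrDl.
have mN (f : 'rV[R]_n.+1 -> R) : continuous f -> measurable_fun (Fr `\` V : set hT) (fun x => (`|f x|)%:E).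
  by move=> cf; apply/measurable_EFinP; apply: cont_hmfun; exact: rcont_norm.
apply: (@le_trans _ _ (\int[haus]_(x in Fr `\` V) \sum_(j < m) (`|psi j x * w x|)%:E)%E).
  apply: (@ge0_le_integral _ hT R haus _ mF) => [x _| | |x [Fx _]].
  - by rewrite lee_fin.
  - exact: mN.
  - by apply: emeasurable_sum => j; exact: (mN _ (C1_cont (Cpw j))).
  - rewrite sumEFin lee_fin -{1}[w x]mul1r -(psiU1 x (FrU1 x Fx)) mulr_suml.
    exact: ler_norm_sum.
rewrite (@ge0_integral_sum _ hT R haus _ mF _ (fun (j : 'I_m) x => (`|psi j x * w x|)%:E) (fun j => mN _ (C1_cont (Cpw j)))); last by move=> j x _; rewrite lee_fin.
apply: (le_trans (lee_sum _ (fun j _ => piece j))).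
rewrite sumEFin lee_fin big_split/= -mulr_suml lerD2r -mulr_sumr ler_wpM2l// -(Rintegral_sum _ mU ipg).
apply: (le_Rintegral mU (rintegrable_sum _ mU ipg) (tgrad_integrable bU Cw)) => x _.
by rewrite -mulr_suml ler_piMl ?enorm_ge0.
Qed.

End boundary_trace.

(** * Vitali coverings *)

Section vitali.
Context {R : realType} {n : nat}.
Implicit Types (x y z : 'rV[R]_n) (E D : set 'rV[R]_n) (r rho : 'rV[R]_n -> R).

Definition meets r x y := eball x (r x) `&` eball y (r y) !=set0.

(** Zorn's lemma, for families that dominate every ball they meet up to a factor 2. A maximal family
    meets all balls: otherwise a ball [x0] of more than half the largest remaining radius could be
    added. *)
Lemma vitali_maximal E r (b : R) : (forall x, E x -> 0 < r x <= b) ->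
  exists D, [/\ D `<=` E, forall x y, D x -> D y -> meets r x y -> x = y &
    forall x, E x -> exists y, [/\ D y, meets r x y & r x <= 2 * r y]].
Proof.
move=> r0; pose P D := [/\ D `<=` E, forall x y, D x -> D y -> meets r x y -> x = y &
  forall x, E x -> (exists2 y, D y & meets r x y) -> exists y, [/\ D y, meets r x y & r x <= 2 * r y]].
have [F FP tF|D [[DE Dd DM] maxD]] := @Zorn_bigcup _ P.
  split=> [x [X /FP[XE _ _]] /XE//|x y [X FX Xx] [Y FY Yy]|x Ex [y [X FX Xy] xy]].
  - have [/(_ _ Xx) Yx|/(_ _ Yy) Xy] := tF X Y FX FY.
      by have [_ h _] := FP _ FY; exact: h.
    by have [_ h _] := FP _ FX; exact: h.
  - have [_ _ h] := FP _ FX; have [|z [Xz xz rz]] := h x Ex; first by exists y.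
    by exists z; split => //; exists X.
exists D; split => // x Ex; apply: contrapT => nx.
pose W := [set z | E z /\ forall y, D y -> ~ meets r z y].
have Wx : W x.
  by split => // y Dy xy; apply: nx; apply: DM => //; exists y.
have hW : has_sup (r @` W).
  split; first by exists (r x), x.
  by exists b => _ [z [Ez _] <-]; have /andP[] := r0 z Ez.
have s0 : 0 < sup (r @` W).
  have /andP[rx _] := r0 x Ex; apply: lt_le_trans rx _.
  by apply: ub_le_sup; [case: hW|exists x].
have [_ [x0 [Ex0 Wx0] <-] rx0] := sup_adherent (divr_gt0 s0 (ltr0n _ 2)) hW.
have sx0 z : W z -> r z <= 2 * r x0.
  move=> Wz; have : r z <= sup (r @` W) by apply: ub_le_sup; [case: hW|exists z].
  by move: rx0; lra.
have m0 : meets r x0 x0.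
  by exists x0; split; rewrite /eball/= subrr enorm0; have /andP[] := r0 x0 Ex0.
apply: (maxD (D `|` [set x0])).
  split; first by move=> z; left.
  by move=> h; apply: (Wx0 x0 (h x0 (or_intror erefl)) m0).
split=> [z [/DE//|-> //]|y z [Dy|->] [Dz|->]// yz|z Ez [y [Dy|->]] zy].
- exact: Dd.
- exfalso; apply: (Wx0 y Dy); by case: yz => p [p1 p2]; exists p.
- by exfalso; apply: (Wx0 z Dz).
- by have [|y' [Dy' zy' ry']] := DM z Ez _; [exists y|exists y'; split => //; left].
- have [[p Dp zp]|nz] := pselect (exists2 p, D p & meets r z p).
    by have [|p' [Dp' zp' rp']] := DM z Ez _; [exists p|exists p'; split => //; left].
  exists x0; split; [by right|exact: zy|]; apply: sx0; split => // p Dp zp.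
  by apply: nz; exists p.
Qed.

(** The disjoint family is countable because each ball contains a dyadic cube around its centre, and
    disjoint balls contain distinct cubes. The factor 3 comes from [r x + r y <= 3 * r y]. *)
Lemma vitali_selection E r (b : R) : (forall x, E x -> 0 < r x <= b) ->
  exists y_ : nat -> option 'rV[R]_n, [/\ forall k y, y_ k = Some y -> E y,
    forall k l y z, y_ k = Some y -> y_ l = Some z -> meets r y z -> y = z /\ k = l &
    forall x, E x -> exists k y, y_ k = Some y /\ enorm (x - y) < 3 * r y].
Proof.
move=> r0; have [D [DE Dd DM]] := vitali_maximal r0.
have /choice[cd hcd] : forall y, exists kz : nat * 'rV[int]_n, D y -> dyadic_cube kz.1 kz.2 y /\ dyadic_cube kz.1 kz.2 `<=` eball y (r y).
  move=> y; have [Dy|nDy] := pselect (D y); last by exists (0%N, 0).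
  have /andP[ry _] := r0 y (DE _ Dy).
  have [k hk] := pow2_small (divr_gt0 ry (ltr0Sn R n)).
  exists (k, dyadic_floor k y) => _; split => //.
  by move=> z /(dyadic_cube_ball hk (erefl : dyadic_cube k (dyadic_floor k y) y)); exact: ball_eball.
pose code y := choice.pickle (cd y).
have inj y z : D y -> D z -> code y = code z -> y = z.
  move=> Dy Dz /(pcan_inj choice.pickleK) e; apply: Dd => //.
  have [h1 h2] := hcd y Dy; have [_ h3] := hcd z Dz; exists y; split; first exact: h2.
  by apply: h3; rewrite -e.
exists (fun k => if pselect (exists2 y, D y & code y = k) is left h then Some (sval (cid2 h)) else None); split.
- by move=> k y; case: pselect => // h [<-]; case: (cid2 h) => z /= /DE.
- move=> k l y z; case: pselect => // h [<-]; case: pselect => // h' [<-].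
  case: (cid2 h) => a /= Da <-; case: (cid2 h') => c /= Dc <- /(Dd _ _ Da Dc) ->.
  by [].
- move=> x Ex; have [y [Dy xy rxy]] := DM x Ex; exists (code y), y; split.
    case: pselect => [h|]; last by case; exists y.
    by case: (cid2 h) => z /= Dz /(inj _ _ Dz Dy) ->.
  have [p [px py]] := xy; rewrite /eball/= in px py.
  have := enorm_triangle p x y; rewrite (enormBC x p); lra.
Qed.

(** Stated for a mere outer measure [m], as it serves Lebesgue measure and Hausdorff contents. Only
    finite separated families have to be estimated, since the series over the selected balls is
    bounded through its partial sums. *)
Lemma vitali_bound (m : set 'rV[R]_n -> \bar R) E rho (A C Bd s0 : R) (k : nat) :
  m set0 = 0%E -> (forall X, 0 <= m X)%E -> {homo m : X Y / X `<=` Y >-> (X <= Y)%E} -> sigma_subadditive m ->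
  0 < A -> 0 <= C -> (forall x, E x -> 0 < rho x <= s0) ->
  (forall x, E x -> (m (eball x (3 * (A * rho x))) <= (C * rho x ^+ k)%:E)%E) ->
  (forall s : seq 'rV[R]_n, uniq s -> (forall x, x \in s -> E x) ->
    (forall x y, x \in s -> y \in s -> meets (fun x => A * rho x) x y -> x = y) ->
    \sum_(x <- s) rho x ^+ k <= Bd) ->
  (m E <= (C * Bd)%:E)%E.
Proof.
move=> m0 mge mle msub A0 C0 rho0 mball fin.
have r0 x : E x -> 0 < A * rho x <= A * s0.
  by move=> /rho0/andP[h1 h2]; rewrite mulr_gt0//= ler_wpM2l// ltW.
have [y_ [yE yd ycov]] := vitali_selection r0.
pose X i := if y_ i is Some y then eball y (3 * (A * rho y)) else set0.
apply: (@le_trans _ _ (m (\bigcup_i X i))).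
  by apply: mle => x /ycov[i [y [yi xy]]]; exists i => //; rewrite /X yi.
apply: (le_trans (msub X)); apply: lime_le; first exact: is_cvg_nneseries.
apply: nearW => p; rewrite big_mkord.
pose s := pmap y_ (iota 0 p).
apply: (@le_trans _ _ (\sum_(x <- s) (C * rho x ^+ k)%:E)%E).
  rewrite -(big_mkord xpredT (fun i => m (X i))) /index_iota subn0 /s.
  elim: (iota 0 p) => [|i r IH]; first by rewrite !big_nil.
  rewrite big_cons/= /X; case e : (y_ i) => [y|]/=; last by rewrite m0 add0e.
  by rewrite big_cons; apply: leeD => //; apply: mball; exact: yE e.
rewrite sumEFin lee_fin -mulr_sumr ler_wpM2l//; apply: fin.
- rewrite /s; elim: (iota 0 p) (iota_uniq 0 p) => [//|i r IH] /=/andP[ir ur].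
  case e : (y_ i) => [y|]/=; last exact: IH.
  rewrite IH// andbT mem_pmap; apply/negP => /mapP[j jr /esym ej].
  have Ey := yE _ _ e; have /andP[ry _] := r0 y Ey.
  have [|_ ij] := yd i j y y e ej; last by rewrite -ij (negbTE ir) in jr.
  by exists y; rewrite /eball/= subrr enorm0.
- by move=> x; rewrite mem_pmap => /mapP[i _ /esym/yE].
- move=> x y; rewrite !mem_pmap => /mapP[i _ /esym ei] /mapP[j _ /esym ej] xy.
  by have [] := yd i j x y ei ej xy.
Qed.

End vitali.

(** * Weak-type estimate at the boundary *)

Section weak_type.
Context {R : realType} {n : nat} (Om : set 'rV[R]_n.+1).
Implicit Types (x y z nu : 'rV[R]_n.+1) (w f : 'rV[R]_n.+1 -> R).
Local Notation leb := (@leb R n.+1).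
Local Notation haus := (@haus R n.+1 n).
Hypotheses (oOm : open Om) (bOm : bmeas Om).

(** Good radii must be available at every scale, because the contents that define Hausdorff measure
    restrict the covering diameters to each [d]; the bound on finite families does not depend on
    [d]. *)
Lemma hausdorff_vitali (A : R) : 0 < A -> exists2 C, 0 <= C &
  forall (E : set 'rV[R]_n.+1) (good : 'rV[R]_n.+1 -> R -> Prop) (Bd d0 : R), 0 < d0 ->
  (forall x d, E x -> 0 < d -> exists rho, 0 < rho < d /\ good x rho) ->
  (forall (s : seq 'rV[R]_n.+1) rho, uniq s -> (forall x, x \in s -> [/\ E x, 0 < rho x < d0 & good x (rho x)]) ->
    (forall x y, x \in s -> y \in s -> meets (fun x => A * rho x) x y -> x = y) ->
    \sum_(x <- s) rho x ^+ n <= Bd) ->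
  (hausdorff_outer n E <= (C * Bd)%:E)%E.
Proof.
move=> A0; pose al := fine (lebesgue_outer (eball (0 : 'rV[R]_n) 1)).
have al0 : 0 <= al by apply: fine_ge0; exact: outer_measure_ge0.
have alE : lebesgue_outer (eball (0 : 'rV[R]_n) 1) = al%:E.
  by rewrite fineK// ge0_fin_numE ?outer_measure_ge0// lebesgue_outer_bounded//; exact: eball_bounded.
exists (al * (3 * A) ^+ n) => [|E good Bd d0 d00 gE fin]; first by rewrite mulr_ge0// exprn_ge0// mulr_ge0// ltW.
apply: hausdorff_outer_le => d dp.
(* The selected balls are enlarged to radius [3 * (A * rho x)], so that their diameters stay below
   [d]. *)
pose s0 := Num.min d0 (d / (6 * A)).
have s00 : 0 < s0 by rewrite lt_min d00 divr_gt0// mulr_gt0.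
have /choice[rho hrho] : forall x, exists rho, E x -> 0 < rho < s0 /\ good x rho.
  move=> x; have [Ex|nE] := pselect (E x); last by exists 0.
  by have [rho h] := gE x s0 Ex s00; exists rho.
have w0 := @hausdorff_weight_ge0 R n.+1 n d.
apply: (@vitali_bound R n.+1 (hausdorff_delta n d) E rho A _ Bd s0 n) => //.
- exact: (cover_outer0 id w0).
- by move=> X; exact: (cover_outer_ge0 id w0).
- exact: le_cover_outer.
- exact: (cover_outer_sigma_subadditive id w0).
- by rewrite mulr_ge0// exprn_ge0// mulr_ge0// ltW.
- by move=> x /hrho[/andP[h1 /ltW h2] _]; rewrite h1.
- move=> x Ex; have [/andP[h1 h2] _] := hrho x Ex.
  pose q := 3 * (A * rho x); have q0 : 0 <= q by rewrite !mulr_ge0// ltW.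
  apply: (le_trans (cover_outer_le1 (c := id) (j := eball x q) w0 _)) => //.
  have dq : (diam (eball x q) <= (2 * q)%:E)%E.
    apply: diam_le => y z; rewrite /eball/= => yx zx.
    by have := enorm_triangle x y z; rewrite (enormBC x z); lra.
  have qd : 2 * q <= d.
    have : rho x < d / (6 * A) by rewrite (lt_le_trans h2)// ge_min lexx orbT.
    by rewrite ltr_pdivlMr ?mulr_gt0// /q; lra.
  rewrite /hausdorff_weight (le_trans dq) ?lee_fin// alE -EFinM lee_fin -mulrA ler_wpM2l//.
  rewrite -exprMn; have h : fine (diam (eball x q)) / 2 <= 3 * A * rho x.
    rewrite -mulrA -/q ler_pdivrMr// mulrC.
    have dge : (0 <= diam (eball x q))%E by apply: le_trans (diam_ge (x := x) (y := x) _ _); rewrite ?lee_fin ?enorm_ge0// /eball/= subrr enorm0 !mulr_gt0.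
    by rewrite -lee_fin fineK// ge0_fin_numE// (le_lt_trans dq)// ltry.
  have [f0|f0] := leP 0 (fine (diam (eball x q)) / 2); first by rewrite lerXn2r// nnegrE (le_trans f0).
  exfalso; move: f0; apply/negP; rewrite -leNgt divr_ge0// fine_ge0//.
  by apply: le_trans (diam_ge (x := x) (y := x) _ _); rewrite ?lee_fin ?enorm_ge0// /eball/= subrr enorm0 !mulr_gt0.
- move=> s us sE sd; apply: fin => // x xs; have [/andP[h1 h2] gx] := hrho x (sE x xs).
  by split => //; [exact: sE|rewrite h1 (lt_le_trans h2)// ge_min lexx].
Qed.

(* Inside a patch, a line in the direction [nu] leaves the neighbourhood of a
   boundary point after a length comparable to its distance to it, so that it
   cannot meet two balls whose dilates are disjoint. *)
Lemma weak_type_finite x0 (r : R) nu (c rho1 : R) : patch Om x0 r nu c -> 0 < r -> 0 < c -> enorm nu = 1 -> 0 < rho1 ->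
  exists h d0, [/\ 0 < h, 0 < d0 & forall (s : seq 'rV[R]_n.+1) rho w, C1 w -> uniq s ->
   (forall x, x \in s -> [/\ frontier Om x, enorm (x - x0) < r / 4 & 0 < rho x < d0]) ->
   (forall x y, x \in s -> y \in s -> meets (fun x => (1 + c^-1) * rho x) x y -> x = y) ->
   \sum_(p <- s) (rho p)^-1 * \int[leb]_(x in Om `&` eball p (rho p)) `|w x| <=
     c^-1 * (tgrad (Om `\` core Om rho1) w + h^-1 * \int[leb]_(x in Om) `|w x|)].
Proof.
move=> pat r0 c0 nu1 r10; have mOm := bOm.1.
(* These keep every ball within [r / 2] of [x0], so that the patch applies to displacements between
   them, and every displaced point within [rho1] of the boundary, that is in the collar. *)
pose h := Num.min (r / 2) (rho1 / 2); pose d0 := Num.min (r / 8) (rho1 / 2).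
have h0 : 0 < h by rewrite lt_min !divr_gt0.
have d00 : 0 < d0 by rewrite lt_min !divr_gt0.
have hr : h <= r / 2 by rewrite ge_min lexx.
have hr1 : h <= rho1 / 2 by rewrite ge_min lexx orbT.
have dr : d0 <= r / 8 by rewrite ge_min lexx.
have dr1 : d0 <= rho1 / 2 by rewrite ge_min lexx orbT.
exists h, d0; split => // s rho w Cw us sP sd.
have ci : 0 < c^-1 by rewrite invr_gt0.
pose B p := Om `&` eball p (rho p).
have oB p : open (B p) by apply: openI => //; exact: eball_open.
pose D := \bigcup_(p in [set p | p \in s]) B p.
have DO : D `<=` Om by move=> x [p _ []].
have mD : lmble D by apply: open_lmble; apply: bigcup_open => p _; exact: oB.
have bD : bmeas D by exact: bmeasS bOm.
have mB p : lmble (B p) by exact: open_lmble.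
have bB p : bmeas (B p) by apply: bmeasS bOm => // x [].
pose U := Om `\` core Om rho1.
have mU : lmble U by apply: measurableD => //; exact: (core_bmeas r10 bOm).1.
have bU : bmeas U by apply: bmeasS bOm => // x [].
have Bs x p : p \in s -> B p x -> enorm (x - x0) < r / 2.
  move=> ps [_ xp]; have [_ h1 /andP[_ h2]] := sP p ps; rewrite /eball/= in xp.
  by have := enorm_triangle p x x0; lra.
(* The centre [q] is a boundary point, so the patch property forbids
   [enorm (q - (x + t *: nu)) <= c * t], whence [t <= rho q / c]. Then [x] lies in the dilate of the
   ball at [q] by [1 + c^-1], and the separation of the dilates forces [p = q]. *)
have key x t p q : p \in s -> q \in s -> B p x -> 0 < t -> B q (x + t *: nu) -> p = q /\ t <= rho q / c.
  move=> ps qs Bx t0 By; have xr := Bs _ _ ps Bx; have yr := Bs _ _ qs By.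
  have tr : t < r.
    have : enorm ((x + t *: nu) - x) = t by rewrite addrAC subrr add0r enormZ nu1 mulr1 ger0_norm// ltW.
    have := enorm_triangle x0 (x + t *: nu) x; rewrite (enormBC x0 x); lra.
  have [fq _ /andP[rq _]] := sP q qs.
  have [fp _ /andP[rp _]] := sP p ps.
  have ctq : c * t < enorm (q - (x + t *: nu)).
    rewrite ltNge; apply/negP => hq; apply: (frontier_notin oOm fq).
    by apply: (pat x t q Bx.1 _ _ hq); [lra|rewrite t0].
  have [_ yq] := By; rewrite /eball/= enormBC in yq.
  have tq : t < rho q / c by rewrite ltr_pdivlMr// mulrC (lt_trans ctq).
  split; last exact: ltW.
  apply: sd => //; exists x; split; rewrite /eball/=.
    by have [_ xp] := Bx; apply: lt_trans xp _; rewrite ltr_pMl// ltrDl.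
  have := enorm_triangle (x + t *: nu) x q; rewrite opprD addrA subrr sub0r enormN enormZ nu1 mulr1 (ger0_norm (ltW t0)).
  rewrite enormBC in yq; rewrite mulrDl mul1r mulrC => /le_lt_trans; apply.
  by rewrite mulrC addrC ltrD// mulrC.
have same x p q : p \in s -> q \in s -> B p x -> B q x -> p = q.
  move=> ps qs [_ xp] [_ xq]; have [_ _ /andP[rq _]] := sP q qs; have [_ _ /andP[rp _]] := sP p ps.
  apply: sd => //; exists x; split; rewrite /eball/=.
    by apply: lt_trans xp _; rewrite ltr_pMl// ltrDl.
  by apply: lt_trans xq _; rewrite ltr_pMl// ltrDl.
(* On a line along [nu] only one ball can contribute, over a length at most [rho p / c]; the weight
   [1 / rho p] makes this contribution at most [c^-1], whatever the radius. *)
pose a x := \sum_(p <- s) (x \in B p)%:R / rho p.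
have aE x p : p \in s -> B p x -> a x = (rho p)^-1.
  move=> ps Bx; rewrite /a (bigD1_seq p)//= mem_set// mul1r big_seq_cond big1 ?addr0// => q /andP[qs qp].
  rewrite memNset ?mul0r// => Bq; move: qp; rewrite (same x p q ps qs Bx Bq) eqxx //.
have a0 x : ~ D x -> a x = 0.
  by move=> nD; rewrite /a big_seq big1// => p ps; rewrite memNset ?mul0r// => Bp; apply: nD; exists p.
pose A := \sum_(p <- s) (rho p)^-1.
have rA p : p \in s -> (rho p)^-1 <= A.
  move=> ps; rewrite /A (bigD1_seq p)//= lerDl big_seq_cond sumr_ge0// => q /andP[qs _].
  by have [_ _ /andP[/ltW rq _]] := sP q qs; rewrite invr_ge0.
have A0 : 0 <= A by rewrite /A big_seq sumr_ge0// => q qs; have [_ _ /andP[/ltW rq _]] := sP q qs; rewrite invr_ge0.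
have ma : lmfun a.
  apply: measurable_sum => p.
  apply: measurable_funM; last exact: measurable_cst.
  rewrite (_ : (fun x => _) = (\1_(B p) : _ -> R)); first exact: measurable_indic.
  by apply/funext => x; rewrite indicE.
have aA x : 0 <= a x <= A.
  have [[p ps Bx]|nD] := pselect (D x); last by rewrite a0// lexx.
  rewrite (aE _ _ ps Bx) rA// andbT.
  by have [_ _ /andP[/ltW rq _]] := sP p ps; rewrite invr_ge0.
have DU x t : D x -> 0 <= t <= h -> U (x + t *: nu).
  move=> [p ps Bx] /andP[t0 th]; have [Ox xp] := Bx.
  have [fp _ /andP[rp rp0]] := sP p ps; split.
    move: t0; rewrite le_eqVlt => /orP[/eqP <-|t0]; first by rewrite scale0r addr0.
    apply: (pat x t _ Ox).
    - by have := Bs _ _ ps Bx; lra.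
    - by rewrite t0/=; lra.
    - by rewrite subrr enorm0 mulr_ge0// ltW.
  move=> /(_ p) hp; apply: (frontier_notin oOm fp); apply: hp; rewrite /eball/= in xp *.
  have := enorm_triangle x p (x + t *: nu).
  have -> : enorm (x - (x + t *: nu)) = t by rewrite opprD addrA subrr sub0r enormN enormZ nu1 mulr1 ger0_norm.
  by rewrite (enormBC p x); lra.
have cnt x t m : 0 < t -> (\sum_(i <- iota 0 m) a (x - (i%:R * t) *: nu)) * t <= c^-1 + A * t.
  move=> t0.
  have [/hasP[i0 i0m /asboolP[p ps Bp]]|/hasPn nD] := boolP (has (fun i => `[< D (x - (i%:R * t) *: nu) >]) (iota 0 m)); last first.
    rewrite big_seq big1 ?mul0r; first by rewrite addr_ge0// ?(ltW ci)// mulr_ge0// ltW.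
    by move=> i im; apply: a0 => Di; have := nD i im => /asboolP.
  have rp : 0 < rho p by have [_ _ /andP[]] := sP p ps.
  have allp i : D (x - (i%:R * t) *: nu) -> B p (x - (i%:R * t) *: nu).
    move=> [q qs Bq]; suff -> : p = q by [].
    have [ii|ii|ii] := ltngtP i i0.
    - have [] := key (x - (i0%:R * t) *: nu) ((i0%:R - i%:R) * t) p q ps qs Bp => //.
      + by rewrite mulr_gt0// subr_gt0 ltr_nat.
      + by rewrite -addrA -scaleNr -scalerDl (_ : - (i0%:R * t) + (i0%:R - i%:R) * t = - (i%:R * t)) ?scaleNr//; ring.
    - have [] := key (x - (i%:R * t) *: nu) ((i%:R - i0%:R) * t) q p qs ps Bq => //.
      + by rewrite mulr_gt0// subr_gt0 ltr_nat.
      + by rewrite -addrA -scaleNr -scalerDl (_ : - (i%:R * t) + (i%:R - i0%:R) * t = - (i0%:R * t)) ?scaleNr//; ring.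
    - by apply: (same _ _ _ ps qs) Bq; rewrite ii.
  have ai i : a (x - (i%:R * t) *: nu) = (x - (i%:R * t) *: nu \in B p)%:R / rho p.
    have [Di|nD] := pselect (D (x - (i%:R * t) *: nu)).
      by have Bi := allp i Di; rewrite (aE _ _ ps Bi) mem_set// mul1r.
    by rewrite a0// memNset ?mul0r// => Bi; apply: nD; exists p.
  rewrite (eq_bigr _ (fun i _ => ai i)) -mulr_suml.
  have : \sum_(i <- iota 0 m) ((x - (i%:R * t) *: nu \in B p)%:R : R) <= rho p / c / t + 1.
    apply: sum_bool_le => [|i j ij]; first by rewrite !divr_ge0// ltW.
    rewrite !in_setE => Bi Bj; rewrite ler_pdivlMr//.
    move: ij; rewrite leq_eqVlt => /orP[/eqP ->|ij].
      by rewrite subnn mul0r divr_ge0// ltW.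
    rewrite natrB ?(ltnW ij)//.
    have [] := key (x - (j%:R * t) *: nu) ((j%:R - i%:R) * t) p p ps ps Bj => //.
    + by rewrite mulr_gt0// subr_gt0 ltr_nat.
    + by rewrite -addrA -scaleNr -scalerDl (_ : - (j%:R * t) + (j%:R - i%:R) * t = - (i%:R * t)) ?scaleNr//; ring.
  move=> hs; rewrite -mulrA; apply: (le_trans (ler_wpM2r _ hs)).
    by rewrite mulr_ge0 ?invr_ge0// ltW.
  have -> : (rho p / c / t + 1) * ((rho p)^-1 * t) = c^-1 + (rho p)^-1 * t by field; rewrite !gt_eqF.
  by rewrite lerD2l ler_wpM2r ?(ltW t0)// rA.
have tb := Rintegral_tube Cw bD bU ma aA a0 (ltW ci) h0 DU cnt.
have cN : continuous (fun x => `|w x|) by apply: rcont_norm; exact: C1_cont.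
have iN E : bmeas E -> rintegrable leb E (fun x => `|w x|) by move=> bE; exact: cont_integrable.
have iwB p : rintegrable leb D (fun x => (x \in B p)%:R / rho p * `|w x|).
  rewrite (_ : (fun x => _) = (fun x => `|w x| * ((x \in B p)%:R / rho p))); last by apply/funext => x; rewrite mulrC.
  apply: (@rintegrableM _ _ _ leb D _ _ `|(rho p)^-1|); [exact: mD|exact: iN| |].
    apply: measurable_funM; last exact: measurable_cst.
    rewrite (_ : (fun x => _) = (\1_(B p) : _ -> R)); first exact: measurable_indic.
    by apply/funext => x; rewrite indicE.
  by move=> x _; rewrite normrM ler_piMl//; case: (_ \in _); rewrite ?normr1 ?normr0.
apply: (@le_trans _ _ (\int[leb]_(x in D) (a x * `|w x|))).
  rewrite (@eq_Rintegral _ _ _ leb D (fun x => \sum_(p <- s) ((x \in B p)%:R / rho p * `|w x|)) (fun x => a x * `|w x|)); last first.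
    by move=> x _; rewrite /a mulr_suml.
  rewrite (Rintegral_sum s mD iwB) !big_seq; apply: ler_sum => p ps.
  have BD : B p `<=` D by move=> x Bx; exists p.
  rewrite (Rintegral_setD (mB p) mD BD (iwB p)).
  rewrite -(Rint_scale _ (mB p) (iN _ (bB p))) (@eq_Rintegral _ _ _ leb (B p) (fun x => (x \in B p)%:R / rho p * `|w x|)).
    rewrite lerDl; apply: Rintegral_ge0 => x _; rewrite !mulr_ge0// invr_ge0.
    by have [_ _ /andP[/ltW]] := sP p ps.
  by move=> x Bx; rewrite Bx mul1r.
apply: (le_trans tb); rewrite ler_wpM2l ?(ltW ci)//; apply: lerD.
  apply: (le_Rintegral mU (cont_integrable bU (cont_dot_grad (nu := nu) Cw)) (tgrad_integrable bU Cw)) => x _.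
  by apply: (le_trans (dot_le _ _)); rewrite nu1 mul1r.
rewrite ler_wpM2l ?invr_ge0 ?(ltW h0)//.
by apply: Rintegral_subset => //; [exact: iN|move=> x []].
Qed.

End weak_type.

(** * Completeness of L1 *)

Section L1_complete.
Context d (T : measurableType d) {R : realType} (mu : {measure set T -> \bar R}).
Implicit Types (D E : set T) (f g : T -> R).

Lemma Rintegral_null D f : measurable D -> measurable_fun D f -> mu D = 0%E -> \int[mu]_(x in D) f x = 0.
Proof.
move=> mD mf D0; rewrite /Rintegral; suff -> : (\int[mu]_(x in D) (f x)%:E = 0)%E by [].
by apply: null_set_integral => //; exact/measurable_EFinP.
Qed.

(** Riesz-Fischer. The subsequence is part of the conclusion, together with its pointwise
    convergence almost everywhere. *)
Lemma L1_complete D (f_ : nat -> T -> R) : measurable D -> (forall k, rintegrable mu D (f_ k)) ->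
  (forall e, 0 < e -> exists K, forall k l, (K <= k)%N -> (K <= l)%N -> \int[mu]_(x in D) `|f_ k x - f_ l x| <= e) ->
  exists f phi, [/\ rintegrable mu D f, forall i : nat, (i <= phi i)%N,
    {ae mu, forall x, D x -> f_ (phi i) x @[i --> \oo] --> f x} &
    forall e, 0 < e -> exists K, forall k, (K <= k)%N -> \int[mu]_(x in D) `|f_ k x - f x| <= e].
Proof.
move=> mD fi cau.
have e0 (i : nat) : 0 < (2^-1) ^+ i :> R by rewrite exprn_gt0.
have /choice[K hK] := fun i => cau _ (e0 i).
(* The sum dominates every threshold up to [K i] and makes [phi] monotone. *)
pose phi i := (i + \sum_(j < i.+1) K j)%N.
have phi1 i : (i <= phi i)%N by rewrite leq_addr.
have phiK i : (K i <= phi i)%N by rewrite /phi big_ord_recr/= addnA leq_addl.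
have phiS i : (phi i <= phi i.+1)%N by rewrite /phi [X in (_ <= _ + X)%N]big_ord_recr/= addSn addnA leqW// leq_addr.
pose g i x := `|f_ (phi i.+1) x - f_ (phi i) x|.
have g0 i x : 0 <= g i x by exact: normr_ge0.
have gi i : rintegrable mu D (g i) by apply: rintegrable_norm => //; exact: rintegrableB.
have g2 i : \int[mu]_(x in D) g i x <= (2^-1) ^+ i.
  by apply: hK => //; apply: leq_trans (phiK i) (phiS i).
pose G x := (\sum_(0 <= i <oo) (g i x)%:E)%E.
have mG : measurable_fun D G.
  apply: ge0_emeasurable_sum => [i x _ _|i _]; first by rewrite lee_fin g0.
  by apply/measurable_EFinP; exact: rintegrable_mfun (gi i).
have G0 x : (0 <= G x)%E by apply: nneseries_ge0 => i _ _; rewrite lee_fin g0.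
have GI : (\int[mu]_(x in D) G x <= 2%:E)%E.
  rewrite integral_nneseries//; last 2 first.
  - by move=> i; apply/measurable_EFinP; exact: rintegrable_mfun (gi i).
  - by move=> i x _; rewrite lee_fin g0.
  apply: lime_le; first by apply: is_cvg_nneseries => i _ _; apply: integral_ge0 => x _; rewrite lee_fin g0.
  apply: nearW => p; rewrite (eq_bigr (fun i => (\int[mu]_(x in D) g i x)%:E)); last by move=> i _; rewrite Rintegral_EFin.
  rewrite sumEFin lee_fin; apply: (@le_trans _ _ (\sum_(0 <= i < p) (2^-1) ^+ i)).
    by apply: ler_sum => i _; exact: g2.
  suff -> : \sum_(0 <= i < p) (2^-1) ^+ i = 2 - 2 * (2^-1) ^+ p :> R by rewrite gerBl mulr_ge0// ltW.
  elim: p => [|p IH]; first by rewrite big_nil expr0 mulr1 subrr.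
  by rewrite big_nat_recr//= IH exprS; lra.
have Gi : mu.-integrable D G.
  apply/integrableP; split => //; under eq_integral do rewrite gee0_abs//.
  exact: le_lt_trans GI (ltry _).
pose Gd := D `&` [set x | G x \is a fin_num].
have mGd : measurable Gd by exact: emeasurable_fin_num.
have GdD : Gd `<=` D by move=> x [].
have mN : measurable (D `\` Gd) by exact: measurableD.
have N0 : mu (D `\` Gd) = 0%E.
  have [N [mN' N0 sub]] := integrable_ae mD Gi.
  apply/eqP; rewrite eq_le measure_ge0 andbT -N0; apply: le_measure; [exact/mem_set|exact/mem_set|].
  by move=> x [Dx nG]; apply: sub => /= /(_ Dx) Gx; apply: nG.
have dec i x : `|f_ (phi i) x| <= `|f_ (phi 0%N) x| + \sum_(0 <= j < i) g j x.
  elim: i => [|i IH]; first by rewrite big_nil addr0.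
  rewrite big_nat_recr//= addrA; apply: (@le_trans _ _ (`|f_ (phi i) x| + g i x)); last by rewrite lerD2r.
  by rewrite /g -{1}(subrK (f_ (phi i) x) (f_ (phi i.+1) x)) addrC ler_normD.
have gG i x : Gd x -> \sum_(0 <= j < i) g j x <= fine (G x).
  move=> [_ Gx]; rewrite -lee_fin fineK// -sumEFin.
  by apply: nneseries_lim_ge => j _ _; rewrite lee_fin g0.
have cv x : Gd x -> cvgn (fun i => f_ (phi i) x).
  move=> Gx; have c1 : cvgn (series (fun i => g i x)).
    apply: nondecreasing_is_cvgn.
      by apply/nondecreasing_seqP => i; rewrite /series/= big_nat_recr//= lerDl.
    by exists (fine (G x)) => _ [i _ <-]; exact: gG.
  have c2 : cvgn (series (fun i => f_ (phi i.+1) x - f_ (phi i) x)) by exact: normed_cvg.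
  have -> : (fun i => f_ (phi i) x) = (fun i => f_ (phi 0%N) x + series (fun i => f_ (phi i.+1) x - f_ (phi i) x) i).
    apply/funext => i; rewrite /series/= telescope_sumr//.
    by rewrite addrC subrK.
  by apply: is_cvgD => //; exact: is_cvg_cst.
(* Off [Gd] the terms are replaced by 0, so that the limit exists everywhere and [f] is measurable
   on all of [D]. *)
pose f (x : T) : R := limn (fun i => (f_ (phi i) \_ Gd) x : R).
have cvf x : Gd x -> f_ (phi i) x @[i --> \oo] --> f x.
  move=> Gx; rewrite /f; under [X in limn X]eq_fun do rewrite patchE mem_set//.
  exact: cv.
have mf : measurable_fun Gd f.
  apply: (measurable_fun_cvg (h := fun i => f_ (phi i))); last exact: cvf.
  by move=> i; apply: measurable_funS (rintegrable_mfun (fi (phi i))).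
have mfN : measurable_fun (D `\` Gd) f.
  apply: (@eq_measurable_fun _ _ _ _ _ (fun=> 0 : R)); last exact: measurable_cst.
  move=> x; rewrite in_setE => -[_ nG]; rewrite /f.
  have -> : (fun i => (f_ (phi i) \_ Gd) x : R) = (fun=> 0) by apply/funext => i; rewrite patchE memNset.
  by apply/esym; exact: (lim_cst (@Rhausdorff R)).
have mfD : measurable_fun D f.
  by rewrite -(setDUK GdD); apply/measurable_funU.
have domi : rintegrable mu Gd (fun x => `|f_ (phi 0%N) x| + fine (G x)).
  apply: rintegrableD => //.
    by apply: (rintegrableS mD) => //; exact: rintegrable_norm.
  have : mu.-integrable Gd G by apply: integrableS Gi.
  apply: eq_integrable => // x; rewrite in_setE => -[_ Gx] /=.
  by rewrite fineK// ge0_fin_numE.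
have [fiG fcG] := @Rintegral_dominated _ _ R mu Gd (fun i => f_ (phi i)) f _ mGd
  (fun i => measurable_funS mD GdD (rintegrable_mfun (fi (phi i)))) mf (aeW _ cvf) domi
  (fun i x Gx => le_trans (dec i x) (lerD (lexx _) (gG i x Gx))).
have fD : rintegrable mu D f.
  apply/integrableP; split; first exact/measurable_EFinP.
  have mabs : measurable_fun D (fun x => `|(EFin \o f) x|%E).
    by apply: measurableT_comp => //; exact/measurable_EFinP.
  rewrite (ge0_negligible_integral mN mD mabs (fun x _ => abse_ge0 _) N0).
  by rewrite setDD setIidr//; case/integrableP: fiG.
exists f, phi; split => //.
- exists (D `\` Gd); split => // x /= h; apply: contrapT => nx; apply: h => Dx.
  by apply: cvf; apply: contrapT => nG; apply: nx.
- move=> e ep; have e2 : 0 < e / 2 by rewrite divr_gt0.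
  have [K1 h1] := cau _ e2; have [K2 h2] := fcG _ e2.
  exists K1 => k kK; pose i := maxn K1 K2.
  have kf := rintegrableB mD (fi k) fD.
  have b1 := h1 k (phi i) kK (leq_trans (leq_maxl _ _) (phi1 i)).
  have b2 := h2 i (leq_maxr _ _).
  have b3 : \int[mu]_(x in D) `|f_ (phi i) x - f x| = \int[mu]_(x in Gd) `|f_ (phi i) x - f x|.
    rewrite (Rintegral_setD mGd mD GdD (rintegrable_norm mD (rintegrableB mD (fi _) fD))).
    rewrite [X in _ + X]Rintegral_null ?addr0//.
    by apply: measurable_funS (rintegrable_mfun (rintegrable_norm mD (rintegrableB mD (fi (phi i)) fD))).
  rewrite -b3 in b2; rewrite [e]splitr; apply: le_trans (lerD b1 b2).
  rewrite -Rint_add//; try by apply: rintegrable_norm => //; exact: rintegrableB.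
  apply: le_Rintegral => //; first exact: rintegrable_norm.
    by apply: rintegrableD => //; apply: rintegrable_norm => //; exact: rintegrableB.
  by move=> x _; rewrite -{1}(subrK (f_ (phi i) x) (f_ k x)) -addrA ler_normD.
Qed.

End L1_complete.

(** * Gradient mass outside a compact core *)

Section concentration.
Context {R : realType} {n : nat} (Om : set 'rV[R]_n).
Implicit Types (x y z nu : 'rV[R]_n) (w u f : 'rV[R]_n -> R).
Local Notation leb := (@leb R n).
Hypotheses (oOm : open Om) (bOm : bmeas Om).

Lemma compact_core (K : set 'rV[R]_n) : compact K -> K `<=` Om -> exists2 r, 0 < r & K `<=` core Om r.
Proof.
move=> cK KO; have /choice[r hr] : forall x, exists r, K x -> 0 < r /\ eball x r `<=` Om.
  move=> x; have [/KO Ox|nK] := pselect (K x); last by exists 0.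
  by have /nbhs_eball[r r0 h] := open_nbhs_nbhs (conj oOm Ox); exists r.
have r20 x : K x -> 0 < r x / 2 by move=> /hr[r0 _]; rewrite divr_gt0.
have [s [sK cov]] := compact_eball_cover cK r20.
have [q q0 hq] : exists2 q, 0 < q & forall i : 'I_(size s), q <= r s`_i / 2.
  by apply: finite_pos_min => i; apply: r20; apply: sK; exact: mem_nth.
exists q => // x /cov[y ys xy] z zx; have [_] := hr y (sK y ys); apply.
have yi : (index y s < size s)%N by rewrite index_mem.
have := hq (Ordinal yi); rewrite /= nth_index// => qr.
rewrite /eball/= in xy zx *; have := enorm_triangle x z y; lra.
Qed.

Lemma eball_part_lmble x rho : lmble (Om `&` eball x rho).
Proof. by apply: measurableI; [exact: bOm.1|]; apply: open_lmble; exact: eball_open. Qed.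

Lemma tgrad_split r w : 0 < r -> C1 w -> tgrad Om w = tgrad (core Om r) w + tgrad (Om `\` core Om r) w.
Proof.
move=> r0 Cw; apply: Rintegral_setD; [exact: (core_bmeas r0 bOm).1|exact: bOm.1|exact: core_sub|].
exact: tgrad_integrable.
Qed.

(** The support of [phi] lies in a core, so after integration by parts the pairing of [phi] with [w]
    is at most the gradient mass of [w] in that core. What remains outside is bounded by the excess
    of the total; replacing [w] by [u] in the pairing costs [C], a bound of the divergence, times
    the L1 distance. *)
Lemma test_field_core phi : test_field Om phi -> exists r C, [/\ 0 < r, 0 <= C & forall w u, C1 w -> rintegrable leb Om u ->
  tgrad (Om `\` core Om r) w <= tgrad Om w - \int[leb]_(x in Om) (u x * divergence phi x) + C * \int[leb]_(x in Om) `|w x - u x|].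
Proof.
move=> tp; have [Cp [K [cK KO] pK] p1] := tp; have mO := bOm.1.
have [r r0 Kr] := compact_core cK KO.
have cd := divergence_cont Cp; have [C C0 hC] := continuous_bounded cd bOm.2.
exists r, C; split => // [|w u Cw hu]; first exact: ltW.
have bC := core_bmeas r0 bOm; have mC := bC.1.
have cdot : continuous (fun x => dot (phi x) (grad w x)) by exact: cont_dot_field.
have h1 : \int[leb]_(x in Om) (w x * divergence phi x) <= tgrad (core Om r) w.
  rewrite integral_by_parts// (Rintegral_setD mC mO (core_sub r0)); last exact: cont_integrable.
  rewrite [X in _ + X](@eq_Rintegral _ _ _ leb _ (fun=> 0)); last first.
    move=> x; rewrite in_setE => -[_ nC]; rewrite pK; first by rewrite dotC dot0r.
    by move=> /Kr.
  rewrite Rintegral_cst ?mul0r ?addr0//; last exact: measurableD.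
  apply: le_trans (ler_norm _) _; rewrite normrN.
  apply: (le_trans (Rintegral_le_norm mC (cont_integrable bC cdot))).
  apply: (le_Rintegral mC (rintegrable_norm mC (cont_integrable bC cdot)) (tgrad_integrable bC Cw)) => x _.
  by apply: (le_trans (dot_le _ _)); rewrite ler_piMl// enorm_ge0.
have iu := test_integrable bOm hu tp.
have iw := test_integrable bOm (cont_integrable bOm (C1_cont Cw)) tp.
have iwu : rintegrable leb Om (fun x => w x - u x) by apply: rintegrableB => //; apply: cont_integrable => //; exact: C1_cont.
have h2 : \int[leb]_(x in Om) (u x * divergence phi x) - \int[leb]_(x in Om) (w x * divergence phi x) <= C * \int[leb]_(x in Om) `|w x - u x|.
  rewrite -(Rint_sub mO iu iw) -Rint_scale//; last exact: rintegrable_norm.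
  apply: (le_Rintegral mO (rintegrableB mO iu iw)) => [|x Ox].
    by apply: rintegrableZ => //; exact: rintegrable_norm.
  rewrite -mulrBl mulrC; apply: (le_trans (ler_norm _)); rewrite normrM distrC.
  by rewrite ler_wpM2r// hC.
rewrite (tgrad_split r0 Cw); move: h1 h2; lra.
Qed.

Lemma tgradB D w f : bmeas D -> C1 w -> C1 f -> tgrad D (fun x => w x - f x) <= tgrad D w + tgrad D f.
Proof.
move=> bD Cw Cf; have mD := bD.1; have [CN gN] := C1N Cf; have [CB gB] := C1D Cw CN.
have iw := tgrad_integrable bD Cw; have i_f := tgrad_integrable bD Cf.
rewrite /tgrad -(Rint_add mD iw i_f).
apply: (le_Rintegral mD (tgrad_integrable bD CB) (rintegrableD mD iw i_f)) => x _.
by rewrite gB gN (le_trans (enormD _ _))// enormN.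
Qed.

End concentration.

(** * Traces *)

Section boundary_limit.
Context {R : realType} {n : nat} (Om : set 'rV[R]_n.+1).
Implicit Types (x y z nu : 'rV[R]_n.+1) (w u f : 'rV[R]_n.+1 -> R) (lam eta c d rho : R).
Local Notation leb := (@leb R n.+1).
Local Notation haus := (@haus R n.+1 n).
Local Notation hT := (caratheodory_type (@hausdorff_outer R n.+1 n)).
Hypotheses (oOm : open Om) (bOm : bmeas Om).
Let Fr := frontier Om.
Let mO := bOm.1.

Lemma hausdorff_outer0_negligible (N : set 'rV[R]_n.+1) : hausdorff_outer n N = 0%E -> haus.-negligible N.
Proof.
move=> N0; exists N; split => //; apply: le_caratheodory_measurable => X.
rewrite [X in (X + _)%E](_ : _ = 0%E); first by rewrite add0e; apply: le_outer_measure; exact: subIsetl.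
by apply/eqP; rewrite eq_le outer_measure_ge0 andbT -N0; apply: le_outer_measure; exact: subIsetr.
Qed.

Lemma is_traceP u x c : rintegrable leb Om u -> (is_trace Om u x c <->
  forall lam, 0 < lam -> exists2 d, 0 < d & forall rho, 0 < rho < d ->
    \int[leb]_(y in Om `&` eball x rho) `|u y - c| <= lam * rho ^+ n.+1).
Proof.
move=> iu; pose I rho := \int[leb]_(y in Om `&` eball x rho) `|u y - c|.
have iuc rho : rintegrable leb (Om `&` eball x rho) (fun y => `|u y - c|).
  apply: rintegrable_norm; first exact: eball_part_lmble.
  apply: (rintegrableS mO); [exact: eball_part_lmble|exact: subIsetl|].
  by apply: rintegrableB => //; apply: cont_integrable => //; exact: cst_continuous.
have IE rho : ((rho ^- n.+1)%:E * \int[leb]_(y in Om `&` eball x rho) (`|u y - c|)%:E)%E = (rho ^- n.+1 * I rho)%:E.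
  by rewrite Rintegral_EFin//; exact: eball_part_lmble.
have I0 rho : 0 <= I rho by apply: Rintegral_ge0.
rewrite /is_trace; under eq_fun do rewrite IE; split => [/fine_cvgP[_ h] lam lam0|h].
  have /cvgrPdist_le/(_ _ lam0)[d/= d0 hd] := h; exists d => // rho /andP[r0 rd].
  have := hd rho; rewrite /= sub0r normrN sub0r normrN !ger0_norm ?mulr_ge0 ?invr_ge0 ?exprn_ge0 ?(ltW r0)//.
  by move=> /(_ rd r0) hI; rewrite (mulrC lam) -ler_pdivrMl ?exprn_gt0.
apply: cvg_EFin; first exact: nearW.
apply/cvgrPdist_le => e /h[d d0 hd]; near=> rho.
have r0 : 0 < rho by near: rho; exact: nbhs_right_gt.
have rd : rho < d by near: rho; exact: nbhs_right_lt.
rewrite /= sub0r normrN ger0_norm ?mulr_ge0 ?invr_ge0 ?exprn_ge0 ?(ltW r0)//.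
by rewrite ler_pdivrMl ?exprn_gt0// mulrC hd// r0.
Unshelve. all: by end_near. Qed.

Let b1 : R := fine (lebesgue_outer (eball (0 : 'rV[R]_n.+1) 1)).

Lemma fine_leb_eball x rho : 0 < rho -> fine (leb (eball x rho)) = b1 * rho ^+ n.+1.
Proof. by move=> r0; rewrite /leb/= lebesgue_outer_eball// lebesgue_outer_eball1_fin. Qed.

(** The patch property places a ball of radius [c * s] inside [Om], within distance comparable to
    [s] of [x]. So [Om] occupies a fixed fraction of small balls about [x], and two different
    constants cannot both be approached in the mean. *)
Lemma is_trace_unique u x r nu c a b : rintegrable leb Om u -> Fr x -> 0 < r -> 0 < c -> enorm nu = 1 ->
  patch Om x r nu c -> is_trace Om u x a -> is_trace Om u x b -> a = b.
Proof.
move=> iu Fx r0 c0 nu1 P /(is_traceP _ _ iu) ha /(is_traceP _ _ iu) hb.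
have b10 : 0 < b1 by rewrite -lte_fin -lebesgue_outer_eball1_fin; exact: lebesgue_outer_eball1_gt0.
have c20 : 0 < 2 + c by rewrite addr_gt0.
suff: `|a - b| <= 0 by rewrite normr_le0 subr_eq0 => /eqP.
apply/ler_addgt0Pr => e e0; rewrite add0r.
(* With this value [2 * lam * rho ^+ n.+1], for [rho = (2 + c) * s], is [e] times the volume of the
   ball of radius [c * s]. *)
pose lam := e * (b1 * c ^+ n.+1) / (2 * (2 + c) ^+ n.+1).
have lam0 : 0 < lam by rewrite !(mulr_gt0, exprn_gt0, invr_gt0).
have [d1 d10 h1] := ha lam lam0; have [d2 d20 h2] := hb lam lam0.
pose s := Num.min r (Num.min d1 d2 / (2 + c)) / 2.
have s0 : 0 < s by rewrite divr_gt0// lt_min r0 divr_gt0// lt_min d10.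
have sr : s < r by rewrite /s ltr_pdivrMr// (le_lt_trans (y := r)) ?ge_min ?lexx// ltr_pMr// ltr1n.
have [q0 q1 q2] : [/\ 0 < (2 + c) * s, (2 + c) * s < d1 & (2 + c) * s < d2].
  have : (2 + c) * s < Num.min d1 d2.
    rewrite mulrC -ltr_pdivlMr// /s ltr_pdivrMr// (le_lt_trans (y := Num.min d1 d2 / (2 + c))) ?ge_min ?lexx ?orbT//.
    by rewrite ltr_pMr ?ltr1n// divr_gt0// lt_min d10.
  by rewrite lt_min => /andP[? ?]; split => //; rewrite mulr_gt0.
have [z [Oz zx]] : exists z, Om z /\ enorm (z - x) < s.
  have [/(_ (eball x s))[|z []]] := Fx; first by apply/nbhs_eball; exists s.
  by move=> Oz xz _; exists z.
pose B := eball (z + s *: nu) (c * s); pose rho := (2 + c) * s; pose D := Om `&` eball x rho.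
have mB : lmble B by apply: open_lmble; exact: eball_open.
have mD : lmble D by exact: eball_part_lmble.
have cs0 : 0 < c * s by rewrite mulr_gt0.
have BD : B `<=` D.
  move=> y; rewrite /B/D/eball/= => yB; split.
    by apply: (P z s y) => //; rewrite ?s0// ?(lt_trans zx)// ltW.
  have h := enorm_triangle (z + s *: nu) y x; have h' := enormD (z - x) (s *: nu).
  rewrite enormZ nu1 mulr1 gtr0_norm// addrAC in h'.
  by rewrite /rho (mulrDl _ _ s); lra.
have ic t : rintegrable leb D (fun y => `|u y - t|).
  apply: rintegrable_norm => //; apply: (rintegrableS mO) => //; first exact: subIsetl.
  by apply: rintegrableB => //; apply: cont_integrable => //; exact: cst_continuous.
have bD : bmeas D by apply: (bmeasS mD _ bOm); exact: subIsetl.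
have icst (E : set 'rV[R]_n.+1) t : bmeas E -> rintegrable leb E (fun=> t).
  by move=> bE; apply: cont_integrable => //; exact: cst_continuous.
have k1 : `|a - b| * (b1 * (c * s) ^+ n.+1) <= 2 * lam * rho ^+ n.+1.
  rewrite -(fine_leb_eball (z + s *: nu)) // -(Rintegral_cst leb mB).
  apply: (le_trans (Rintegral_subset mB mD (icst D _ bD) _ BD)) => //.
  apply: (@le_trans _ _ (\int[leb]_(y in D) (`|u y - a| + `|u y - b|))).
    apply: (le_Rintegral mD (icst D _ bD) (rintegrableD mD (ic a) (ic b))) => y _.
    by rewrite -(normrN (u y - a)) opprB (le_trans _ (ler_normD _ _))// addrA subrK.
  rewrite (Rint_add mD (ic a) (ic b)) -mulrA (mulr_natl _ 2) mulr2n lerD//.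
    by apply: h1; rewrite q0.
  by apply: h2; rewrite q0.
have k2 : 2 * lam * rho ^+ n.+1 = e * (b1 * (c * s) ^+ n.+1).
  rewrite /lam /rho !(exprMn _ (_ : R) s); field.
  by rewrite expf_neq0// gt_eqF.
by move: k1; rewrite k2 ler_pM2r// mulr_gt0// exprn_gt0.
Qed.

Let bmS (D : set 'rV[R]_n.+1) : lmble D -> D `<=` Om -> bmeas D := fun mD sD => bmeasS mD sD bOm.
Let iC w : C1 w -> rintegrable leb Om w := fun Cw => cont_integrable bOm (C1_cont Cw).

Lemma frontier_hmble : measurable (Fr : set hT).
Proof. by rewrite -(setIT Fr); apply: closed_open_hmble; [exact: frontier_closed|exact: openT]. Qed.

Variable M0 : R.
Hypotheses (M00 : 0 < M0) (charts0 : forall x, Fr x -> exists r nu, flat_chart Om set0 x r nu M0).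

Lemma haus_C1_integrable w : C1 w -> rintegrable haus Fr w.
Proof.
move=> Cw; have [C C0 hC] := collar_bound oOm bOm open0 M00 ltr01 charts0.
have := hC w Cw; rewrite setD0 => h; apply/integrableP; split; last exact: le_lt_trans h (ltry _).
by apply/measurable_EFinP; apply: cont_hmfun; exact: C1_cont.
Qed.

Lemma collar_boundR V M rho : open V -> 0 < M -> 0 < rho ->
  (forall x, Fr x -> exists r nu, flat_chart Om V x r nu M) ->
  exists2 C, 0 <= C & forall w, C1 w -> \int[haus]_(x in Fr `\` V) `|w x| <=
    M ^+ n * tgrad (Om `\` core Om rho) w + C * \int[leb]_(x in Om) `|w x|.
Proof.
move=> oV M1 r0 ch; have [C C0 hC] := collar_bound oOm bOm oV M1 r0 ch; exists C => // w Cw.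
have mFV : measurable (Fr `\` V : set hT).
  rewrite setDE; rewrite -(setIT (_ `&` _)); apply: closed_open_hmble; last exact: openT.
  by apply: closedI; [exact: frontier_closed|exact: open_closedC].
have iw : rintegrable haus (Fr `\` V) w.
  by apply: (rintegrableS frontier_hmble mFV) (haus_C1_integrable Cw); exact: subDsetl.
by have := hC w Cw; rewrite (Rintegral_EFin mFV (rintegrable_norm mFV iw)) lee_fin.
Qed.

Hypothesis patchFr : forall x, Fr x -> exists r nu c, [/\ 0 < r, 0 < c, enorm nu = 1 & patch Om x r nu c].
Variables (u : 'rV[R]_n.+1 -> R) (w_ : nat -> 'rV[R]_n.+1 -> R).
Hypotheses (iu : rintegrable leb Om u) (Cw : forall k, C1 (w_ k)).
Hypothesis wu : forall eta, 0 < eta -> exists K, forall k, (K <= k)%N -> \int[leb]_(x in Om) `|w_ k x - u x| <= eta.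
Hypothesis conc : forall eta, 0 < eta -> exists2 rho, 0 < rho & exists K, forall k l, (K <= k)%N -> (K <= l)%N ->
  tgrad (Om `\` core Om rho) (fun x => w_ k x - w_ l x) <= eta.

Let CwB k l : C1 (fun x => w_ k x - w_ l x) := (C1D (Cw k) (C1N (Cw l)).1).1.
Let iwu k : rintegrable leb Om (fun x => `|w_ k x - u x|) := rintegrable_norm mO (rintegrableB mO (iC (Cw k)) iu).
Let iwB k l : rintegrable leb Om (fun x => `|w_ k x - w_ l x|) := rintegrable_norm mO (iC (CwB k l)).

Lemma L1_cauchy eta : 0 < eta -> exists K, forall k l, (K <= k)%N -> (K <= l)%N ->
  \int[leb]_(x in Om) `|w_ k x - w_ l x| <= eta.
Proof.
move=> e0; have [K hK] := wu (divr_gt0 e0 (ltr0n R 2)); exists K => k l /hK hk /hK hl.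
apply: (@le_trans _ _ (\int[leb]_(x in Om) (`|w_ k x - u x| + `|w_ l x - u x|))).
  apply: (le_Rintegral mO (iwB k l) (rintegrableD mO (iwu k) (iwu l))) => x _.
  by rewrite (distrC (w_ l x)) (le_trans _ (ler_normD _ _))// addrA subrK.
by rewrite (Rint_add mO (iwu k) (iwu l)); move: hk hl; lra.
Qed.

(** No constant close to 1 is required here: the collar gradients of the differences are themselves
    small, so the crude charts with [M0] are enough. *)
Lemma haus_cauchy eta : 0 < eta -> exists K, forall k l, (K <= k)%N -> (K <= l)%N ->
  \int[haus]_(x in Fr) `|w_ k x - w_ l x| <= eta.
Proof.
move=> e0; have Mn : 0 < M0 ^+ n by rewrite exprn_gt0.
have [rho r0 [K1 h1]] := conc (divr_gt0 e0 (mulr_gt0 (ltr0n R 2) Mn)).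
have [C C0 hC] := collar_boundR open0 M00 r0 charts0.
have C10 : 0 < 2 * (C + 1) by rewrite mulr_gt0// ltr_wpDl.
have [K2 h2] := L1_cauchy (divr_gt0 e0 C10).
exists (maxn K1 K2) => k l; rewrite !geq_max => /andP[k1 k2] /andP[l1 l2].
have := hC _ (CwB k l); rewrite setD0 => /le_trans; apply; rewrite [leRHS]splitr lerD//.
  by rewrite mulrC -ler_pdivlMr// (le_trans (h1 k l k1 l1))// invfM mulrA.
apply: (@le_trans _ _ ((C + 1) * (eta / (2 * (C + 1))))).
  by apply: ler_pM (h2 k l k2 l2) => //; [exact: Rintegral_ge0|rewrite lerDl].
by rewrite le_eqVlt; apply/orP; left; apply/eqP; field; rewrite gt_eqF// ltr_wpDl.
Qed.

Section local.
Variables (x0 nu0 : 'rV[R]_n.+1) (r c : R).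
Hypotheses (r0 : 0 < r) (c0 : 0 < c) (nu1 : enorm nu0 = 1) (P0 : patch Om x0 r nu0 c).

Let bad lam (m : nat) := [set x | [/\ Fr x, enorm (x - x0) < r / 4 & forall d, 0 < d ->
  exists rho, 0 < rho < d /\ lam * rho ^+ n.+1 < \int[leb]_(y in Om `&` eball x rho) `|w_ m y - u y|]].

(** The weak-type estimate is available for C1 functions only, while [bad] concerns [w_ m - u]. For
    a fixed finite family of balls [u] is replaced by [w_ l] and [l] tends to infinity; the
    resulting bound no longer depends on the family. *)
Lemma bad_small lam eta : 0 < lam -> 0 < eta -> exists K, forall m, (K <= m)%N -> (hausdorff_outer n (bad lam m) <= eta%:E)%E.
Proof.
move=> lam0 eta0; have A0 : 0 < 1 + c^-1 by rewrite addr_gt0// invr_gt0.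
have [C C0 hC] := @hausdorff_vitali R n (1 + c^-1) A0.
have C10 : 0 < C + 1 by rewrite ltr_wpDl.
(* Chosen so that [(C + 1) * Bd = eta] for the bound [Bd] below. *)
pose e1 := eta * lam * c / (2 * (C + 1)).
have e10 : 0 < e1 by rewrite divr_gt0 ?mulr_gt0.
have [r1 r10 [K1 h1]] := conc e10.
have [h [d0 [h0 d00 wt]]] := weak_type_finite oOm bOm P0 r0 c0 nu1 r10.
have [K2 h2] := L1_cauchy (mulr_gt0 h0 e10).
exists (maxn K1 K2) => m; rewrite geq_max => /andP[m1 m2].
pose Bd := lam^-1 * (c^-1 * (e1 + e1)).
have Bd0 : 0 <= Bd by rewrite /Bd !mulr_ge0 ?invr_ge0 ?addr_ge0// ltW.
have CB : C * Bd <= eta.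
  apply: (@le_trans _ _ ((C + 1) * Bd)); first by rewrite ler_wpM2r// lerDl.
  by rewrite le_eqVlt; apply/orP; left; apply/eqP; rewrite /Bd /e1; field; rewrite !gt_eqF.
apply: (le_trans _ (_ : (C * Bd)%:E <= _)%E); last by rewrite lee_fin.
apply: (hC _ (fun x rho => lam * rho ^+ n.+1 < \int[leb]_(y in Om `&` eball x rho) `|w_ m y - u y|) Bd d0 d00).
  by move=> x d [_ _] /[apply].
move=> s rho us hs disj; pose S1 := \sum_(p <- s) (rho p)^-1.
have rp p : p \in s -> 0 < rho p by move=> /hs[_ /andP[]].
have S10 : 0 <= S1 by rewrite /S1 big_seq sumr_ge0// => p /rp; rewrite invr_ge0; exact: ltW.
(* The factor [S1] depends on the family of balls but not on [l], so the last term can be made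
   arbitrarily small. *)
have key l : (maxn K1 K2 <= l)%N -> lam * \sum_(x <- s) rho x ^+ n <= c^-1 * (e1 + e1) + S1 * \int[leb]_(x in Om) `|w_ l x - u x|.
  rewrite geq_max => /andP[l1 l2].
  apply: (@le_trans _ _ (\sum_(p <- s) (rho p)^-1 * \int[leb]_(x in Om `&` eball p (rho p)) `|w_ m x - w_ l x| + S1 * \int[leb]_(x in Om) `|w_ l x - u x|)).
    rewrite /S1 mulr_sumr mulr_suml -big_split/= big_seq [leRHS]big_seq; apply: ler_sum => p ps.
    have [_ /andP[p0 _] gp] := hs p ps.
    rewrite -mulrDr ler_pdivlMl// mulrCA -exprS (le_trans (ltW gp))//.
    have mB := eball_part_lmble bOm p (rho p); have sB : Om `&` eball p (rho p) `<=` Om by exact: subIsetl.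
    have iS f : rintegrable leb Om f -> rintegrable leb (Om `&` eball p (rho p)) f by exact: rintegrableS.
    apply: (le_trans (le_Rintegral mB (iS _ (iwu m)) (rintegrableD mB (iS _ (iwB m l)) (iS _ (iwu l))) _)).
      by move=> y _; rewrite (le_trans _ (ler_normD _ _))// addrA subrK.
    rewrite (Rint_add mB (iS _ (iwB m l)) (iS _ (iwu l))) lerD2l.
    exact: Rintegral_subset.
  rewrite lerD2r; apply: (le_trans (wt s rho _ (CwB m l) us _ disj)).
    by move=> x /hs[[? ? _] ? _].
  rewrite ler_wpM2l ?invr_ge0 ?(ltW c0)// lerD ?h1// ler_pdivrMl//; exact: h2.
rewrite /Bd -ler_pdivrMl ?invr_gt0// invrK; apply/ler_addgt0Pr => e e0.
have S11 : 0 < S1 + 1 by rewrite ltr_wpDl.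
have [K3 h3] := wu (divr_gt0 e0 S11).
have := key (maxn (maxn K1 K2) K3) (leq_maxl _ _); move/le_trans; apply; rewrite lerD2l.
apply: (@le_trans _ _ ((S1 + 1) * (e / (S1 + 1)))); last by rewrite mulrCA divff ?mulr1// gt_eqF.
by apply: ler_pM (h3 _ (leq_maxr _ _)) => //; [exact: Rintegral_ge0|rewrite lerDl].
Qed.

Variable T : 'rV[R]_n.+1 -> R.
Hypotheses (iT : rintegrable haus Fr T)
  (wT : forall eta, 0 < eta -> exists K, forall k, (K <= k)%N -> \int[haus]_(x in Fr) `|w_ k x - T x| <= eta).

(** Near a boundary point [x], [u - T x] splits into [u - w_ m], the oscillation of [w_ m] and
    [w_ m x - T x]. The first is small on average off [bad], the second by continuity and the third
    off a set controlled by Markov's inequality. The exceptional sets have arbitrarily small measure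
    for a fixed tolerance, hence measure 0. *)
Lemma local_trace : haus.-negligible [set x | [/\ Fr x, enorm (x - x0) < r / 4 & ~ is_trace Om u x (T x)]].
Proof.
pose B lam := [set x | [/\ Fr x, enorm (x - x0) < r / 4 & ~ exists2 d, 0 < d & forall rho, 0 < rho < d ->
    \int[leb]_(y in Om `&` eball x rho) `|u y - T x| <= lam * rho ^+ n.+1]].
apply: (@negligibleS _ _ _ haus (\bigcup_k B k.+1%:R^-1)).
  move=> x [Fx xr nT]; apply: contrapT => nB; apply: nT; apply/(is_traceP _ _ iu) => lam lam0.
  have klam : (Num.truncn lam^-1).+1%:R^-1 <= lam.
    by rewrite -[leRHS]invrK lef_pV2 ?posrE ?invr_gt0// ltW// truncnS_gt.
  have [d d0 hd] : exists2 d, 0 < d & forall rho, 0 < rho < d ->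
    \int[leb]_(y in Om `&` eball x rho) `|u y - T x| <= (Num.truncn lam^-1).+1%:R^-1 * rho ^+ n.+1.
    by apply: contrapT => h; apply: nB; exists (Num.truncn lam^-1).
  exists d => // rho hr; apply: (le_trans (hd rho hr)); rewrite ler_wpM2r// exprn_ge0//.
  by case/andP: hr => /ltW.
apply: negligible_bigcup => k; apply: hausdorff_outer0_negligible.
set lam := k.+1%:R^-1; have lam0 : 0 < lam :> R by rewrite invr_gt0.
apply/eqP; rewrite eq_le outer_measure_ge0 andbT; apply/lee_addgt0Pr => eta eta0; rewrite add0e.
have b10 : 0 < b1 by rewrite -lte_fin -lebesgue_outer_eball1_fin; exact: lebesgue_outer_eball1_gt0.
(* The three contributions add up to [lam1 * (1 + 2 * b1) * rho ^+ n.+1]. *)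
pose lam1 := lam / (1 + 2 * b1); have db0 : 0 < 1 + 2 * b1 by rewrite addr_gt0// mulr_gt0.
have l10 : 0 < lam1 by rewrite divr_gt0.
have [K1 h1] := bad_small l10 (divr_gt0 eta0 (ltr0n R 2)).
have [K2 h2] := wT (mulr_gt0 l10 (divr_gt0 eta0 (ltr0n R 2))).
pose m := maxn K1 K2; have {}h1 := h1 m (leq_maxl _ _); have {}h2 := h2 m (leq_maxr _ _).
pose Y : set 'rV[R]_n.+1 := Fr `&` [set x | (lam1%:E <= (`|w_ m x - T x|)%:E)%E].
have iwT : rintegrable haus Fr (fun x => `|w_ m x - T x|).
  by apply: (rintegrable_norm frontier_hmble); apply: (rintegrableB frontier_hmble) iT; exact: haus_C1_integrable.
have hY : (hausdorff_outer n Y <= (eta / 2)%:E)%E.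
  have Y0 := @ge0_markov _ hT R haus Fr (fun x => (`|w_ m x - T x|)%:E) lam1 frontier_hmble.
  have {}Y0 : (lam1%:E * hausdorff_outer n Y <= (lam1 * (eta / 2))%:E)%E.
    apply: (le_trans (Y0 _ _ l10)); [by case/integrableP: iwT|by move=> x _; rewrite lee_fin|].
    by rewrite (Rintegral_EFin frontier_hmble iwT) lee_fin.
  by rewrite -(@lee_pmul2l _ lam1%:E)// -EFinM.
rewrite [leRHS](_ : _ = (eta / 2)%:E + (eta / 2)%:E)%E; last by rewrite -EFinD -splitr.
apply: (@le_trans _ _ (hausdorff_outer n (bad lam1 m) + hausdorff_outer n Y)%E); last by rewrite leeD.
apply: (le_trans _ (outer_measureU2 _ _ _)); apply: le_outer_measure => x [Fx xr nd].
apply: contrapT => /not_orP[nb nY]; apply: nd.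
have {nY}Yx : `|w_ m x - T x| <= lam1.
  by rewrite leNgt; apply/negP => h; apply: nY; split => //=; rewrite lee_fin ltW.
have [d d0 hd] : exists2 d, 0 < d & forall rho, 0 < rho < d ->
    \int[leb]_(y in Om `&` eball x rho) `|w_ m y - u y| <= lam1 * rho ^+ n.+1.
  apply: contrapT => h; apply: nb; split => // d d0; apply: contrapT => h'; apply: h; exists d => // rho hr.
  by rewrite leNgt; apply/negP => h''; apply: h'; exists rho.
have [d' d'0 hd'] : exists2 d', 0 < d' & eball x d' `<=` [set y | `|w_ m x - w_ m y| <= lam1].
  apply/nbhs_eball; have cw : continuous (w_ m) by exact: C1_cont.
  by move: (cw x) => /(@cvgrPdist_le _ _ _ (nbhs x) (nbhs_filter x))/(_ _ l10).
exists (Num.min d d') => [|rho]; first by rewrite lt_min d0.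
rewrite lt_min => /andP[p0 /andP[pd pd']].
have mB := eball_part_lmble bOm x rho; have sB : Om `&` eball x rho `<=` Om by exact: subIsetl.
have bB := bmS mB sB.
have icst t : rintegrable leb (Om `&` eball x rho) (fun=> t) by apply: cont_integrable => //; exact: cst_continuous.
have iS f : rintegrable leb Om f -> rintegrable leb (Om `&` eball x rho) f by exact: rintegrableS.
have iuT : rintegrable leb (Om `&` eball x rho) (fun y => `|u y - T x|).
  by apply: (rintegrable_norm mB); apply: (rintegrableB mB) (icst _); exact: iS.
apply: (le_trans (le_Rintegral mB iuT (rintegrableD mB (iS _ (iwu m)) (icst (2 * lam1))) _)).
  move=> y [Oy yx]; have yx' : `|w_ m x - w_ m y| <= lam1 by apply: hd'; exact: lt_trans yx pd'.
  have -> : u y - T x = - (w_ m y - u y) + (- (w_ m x - w_ m y) + (w_ m x - T x)) by ring.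
  rewrite (le_trans (ler_normD _ _))// normrN lerD2l (le_trans (ler_normD _ _))// normrN.
  by rewrite (mulr_natl _ 2) mulr2n lerD.
rewrite (Rint_add mB (iS _ (iwu m)) (icst _)) (Rintegral_cst leb mB).
have h4 : \int[leb]_(y in Om `&` eball x rho) `|w_ m y - u y| <= lam1 * rho ^+ n.+1 by apply: hd; rewrite p0.
have h5 : fine (leb (Om `&` eball x rho)) <= b1 * rho ^+ n.+1.
  rewrite -(fine_leb_eball x p0); apply: fine_le; last by apply: le_outer_measure; exact: subIsetr.
  - by rewrite ge0_fin_numE// lebesgue_outer_bounded//; exact: bB.2.
  - by rewrite ge0_fin_numE// lebesgue_outer_bounded//; exact: eball_bounded.
have -> : lam * rho ^+ n.+1 = lam1 * rho ^+ n.+1 + 2 * lam1 * (b1 * rho ^+ n.+1) by rewrite /lam1; field; rewrite gt_eqF.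
by rewrite lerD// ler_wpM2l// mulr_ge0// ltW.
Qed.

End local.

(** [T] is obtained by completeness as the limit of the boundary values of the approximations. It
    satisfies [is_trace] almost everywhere, and uniqueness identifies it there with the value picked
    by [xget]. *)
Theorem trace_limit : exists T, [/\ rintegrable haus Fr T,
  (\int[haus]_(x in Fr) (`|trace Om u x|)%:E = (\int[haus]_(x in Fr) `|T x|)%:E)%E &
  forall eta, 0 < eta -> exists K, forall k, (K <= k)%N -> \int[haus]_(x in Fr) `|w_ k x - T x| <= eta].
Proof.
have [T [phi [iT _ _ wT]]] := L1_complete frontier_hmble (fun k => haus_C1_integrable (Cw k)) haus_cauchy.
exists T; split => //.
have /choice[r hr] : forall x, exists r, Fr x -> exists nu c, [/\ 0 < r, 0 < c, enorm nu = 1 & patch Om x r nu c].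
  by move=> x; have [/patchFr[r h]|nF] := pselect (Fr x); [exists r|exists 0].
have r40 x : Fr x -> 0 < r x / 4 by move=> /hr[nu [c [h _ _ _]]]; rewrite divr_gt0.
have [s [sF cov]] := compact_eball_cover (frontier_compact bOm) r40.
have ae : ae_eq haus Fr (EFin \o (fun x => `|T x|)) (EFin \o (fun x => `|trace Om u x|)).
  apply: (@negligibleS _ _ _ haus (\bigcup_k [set x | [/\ Fr x, enorm (x - nth 0 s k) < r (nth 0 s k) / 4,
      (k < size s)%N & ~ is_trace Om u x (T x)]])).
    move=> x /= /not_implyP[Fx nT]; have [y ys xy] := cov x Fx; exists (index y s) => //=.
    rewrite nth_index// index_mem; split => // tr; apply: nT; congr (_%:E); congr (`|_|).
    have [nu [c [p1 p2 p3 p4]]] := hr x Fx.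
    by rewrite /trace; apply/esym; apply: xget_unique => [|b tb]; [exact: tr|exact: is_trace_unique iu Fx p1 p2 p3 p4 tb tr].
  apply: negligible_bigcup => k; have [ks|ks] := ltnP k (size s).
    have [nu [c [p1 p2 p3 p4]]] := hr _ (sF _ (mem_nth 0 ks)).
    by apply: negligibleS (local_trace p1 p2 p3 p4 iT wT) => x [].
  by apply: (@negligibleS _ _ _ haus set0) => [x []|] //; exact: negligible_set0.
have iT' := rintegrable_norm frontier_hmble iT.
have [mT _] := integrableP _ _ _ iT'.
(* The measurability of the trace itself comes from its almost everywhere equality with [T] and the
   completeness of Caratheodory measures. *)
have mt := ae_measurable_fun (@measure_is_complete_caratheodory _ _ (@hausdorff_outer R n.+1 n)) ae mT.
rewrite -(Rintegral_EFin frontier_hmble iT').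
by apply/esym; apply: ae_eq_integral => //; exact: frontier_hmble.
Qed.

End boundary_limit.

(** A bounded real sequence is Cauchy along an ultrafilter. This replaces diagonal extraction: one
    ultrafilter serves all points, patches and tolerances at once. *)
Lemma ultra_bounded (R : realType) (U : set_system nat) (f : nat -> R) (M e : R) : UltraFilter U ->
  (forall k, `|f k| <= M) -> 0 < e -> exists2 A, U A & forall k l, A k -> A l -> `|f k - f l| <= e.
Proof.
move=> UU fM e0; have pF : ProperFilter (f @ U) by exact: fmap_proper_filter.
have [|p [_ pc]] := @segment_compact R (- M) M (f @ U) pF.
  by apply: (@filterS _ U _ setT) => [k _|]; [rewrite /= in_itv/= -ler_norml|exact: filterT].
pose A := [set k | `|f k - p| < e / 2]; have [UA|UA] := in_ultra_setVsetC A UU.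
  exists A => // k l kA lA; have h := ler_distD p (f k) (f l); rewrite (distrC p) in h.
  by apply: (le_trans h); rewrite ltW// [ltRHS]splitr ltrD.
exfalso; have [_ [[k nAk <-]]] := pc (f @` (~` A)) (ball p (e / 2))
  (filterS (fun k h => ex_intro2 _ _ k h erefl) UA) (nbhsx_ballx _ _ (divr_gt0 e0 (ltr0n R 2))).
by rewrite /ball/= => h; apply: nAk; rewrite /A/= distrC.
Qed.

Lemma ultra_all (I : eqType) (U : set_system nat) (s : seq I) (P : I -> set nat -> Prop) : Filter U ->
  (forall i A B, P i A -> B `<=` A -> P i B) -> (forall i, i \in s -> exists2 A, U A & P i A) ->
  exists2 A, U A & forall i, i \in s -> P i A.
Proof.
move=> FU mono; elim: s => [_|i s IH h]; first by exists setT; [exact: filterT|].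
have [B UB hB] := IH (fun j js => h j (mem_behead (s := i :: s) js)).
have [A UA hA] := h i (mem_head _ _); exists (A `&` B); first exact: filterI.
by move=> j; rewrite inE => /orP[/eqP ->|/hB k]; [apply: mono hA _|apply: mono k _] => x [].
Qed.

(** * Compactness *)

Section L1_compactness.
Context {R : realType} {n : nat} (Om : set 'rV[R]_n).
Implicit Types (x y z nu : 'rV[R]_n) (w u f : 'rV[R]_n -> R).
Local Notation leb := (@leb R n).
Local Notation cT := (caratheodory_type (@lebesgue_outer R n)).
Hypotheses (oOm : open Om) (bOm : bmeas Om).
Let mO := bOm.1.

Lemma Rintegral_cover D (I : eqType) (s : seq I) (E : I -> set 'rV[R]_n) f : lmble D -> D `<=` Om ->
  rintegrable leb Om f -> (forall x, 0 <= f x) -> (forall i, lmble (E i)) ->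
  (forall x, D x -> exists2 i, i \in s & E i x) ->
  \int[leb]_(x in D) f x <= \sum_(i <- s) \int[leb]_(x in Om `&` E i) f x.
Proof.
move=> mD DO jf f0 mE; elim: s D mD DO => [|i s IH] D mD DO cov.
  rewrite (_ : D = set0) ?Rintegral_set0 ?big_nil//.
  by apply/seteqP; split => // x /cov[].
have mDE : lmble (D `&` E i) by exact: measurableI.
have mDD : lmble (D `\` E i) by exact: measurableD.
have iD : rintegrable leb D f by exact: rintegrableS jf.
rewrite big_cons (Rintegral_setD mDE mD (@subIsetl _ D (E i)) iD).
rewrite setDIr setDv set0U lerD//.
  apply: Rintegral_subset => //; [exact: measurableI| |exact: setSI].
  by apply: rintegrableS jf => //; exact: measurableI.
apply: IH => //; first by move=> x [/DO].
by move=> x [Dx nE]; have [j] := cov x Dx; rewrite inE => /orP[/eqP ->//|js Ej]; exists j.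
Qed.

(* Averaging over a ball centered at [x + s *: nu] instead of [x] keeps the
   segments from [x] inside a patch, also for [x] close to the boundary. *)
Lemma shift_average x0 (r : R) nu (c s : R) K w : patch Om x0 r nu c -> 0 < c -> 0 < s < r ->
  mollifier (c * s) K -> C1 w ->
  \int[leb]_(x in Om `&` eball x0 r) `|\int[leb]_(y in Om) (w y * K (y - x - s *: nu)) - w x| <=
  s * (enorm nu + c) * tgrad Om w.
Proof.
move=> P c0 /andP[s0 sr] mK Cw; have [CK K0 Ke Ks K1] := mK.
set E := Om `&` eball x0 r; have mE : lmble E by exact: eball_part_lmble.
have sE : E `<=` Om by exact: subIsetl.
have bE : bmeas E by exact: bmeasS bOm.
have cw := C1_cont Cw; have cK := C1_cont CK; have cs0 : 0 < c * s by rewrite mulr_gt0.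
have seg x z t : E x -> enorm z < c * s -> 0 <= t <= 1 -> Om (x + t *: (s *: nu + z)).
  move=> [Ox xr] zs /andP[]; rewrite le_eqVlt => /orP[/eqP <- _|t0 t1]; first by rewrite scale0r addr0.
  apply: (P x (t * s)) => //; first by rewrite mulr_gt0//= (le_lt_trans _ sr)// ler_piMl// ltW.
  rewrite scalerDr scalerA opprD addrACA subrr add0r addrAC subrr add0r enormZ gtr0_norm// mulrCA ler_wpM2l// ltW//.
pose G x z := `|w (x + (s *: nu + z)) - w x| * K z.
have cG x : continuous (G x).
  apply: rcontM cK; apply: rcont_norm; apply: rcontD; last exact: cst_continuous.
  rewrite (_ : (fun y => _) = (fun y => w (y + (x + s *: nu)))); last by apply/funext => y; rewrite addrA addrC.
  exact: rcont_shift.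
have iG x : rintegrable leb setT (G x).
  apply: (@cont_supp_integrable _ _ 0 (c * s)) => // z; rewrite subr0 => /Ks; rewrite /G => ->.
  by rewrite mulr0.
have pt x : E x -> `|\int[leb]_(y in Om) (w y * K (y - x - s *: nu)) - w x| <= \int[leb]_z G x z.
  move=> Ex; pose g y := w y * K (y - (x + s *: nu)).
  have cg : continuous g by apply: rcontM => //; exact: rcont_shiftB.
  have ig : rintegrable leb setT g.
    apply: (@cont_supp_integrable _ _ (x + s *: nu) (c * s)) => // z /Ks; rewrite /g => ->.
    by rewrite mulr0.
  have -> : \int[leb]_(y in Om) (w y * K (y - x - s *: nu)) = \int[leb]_y g (y + (x + s *: nu)).
    rewrite Rintegral_shift// -(Rintegral_supp (D := Om)) => [|y nO]; last first.
      rewrite /g Ks ?mulr0// leNgt; apply/negP => h; apply: nO.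
      by have := seg x _ 1 Ex h; rewrite scale1r addrA -(addrA y) -opprD addrC subrK; apply; rewrite ler01 lexx.
    by under eq_Rintegral do rewrite -addrA -opprD.
  have iK : rintegrable leb setT K.
    by apply: (@cont_supp_integrable _ _ 0 (c * s)) => // z; rewrite subr0; exact: Ks.
  have -> : w x = \int[leb]_z (w x * K z) by rewrite Rint_scale// K1 mulr1.
  rewrite -(Rint_sub measurableT (shift_rintegrable _ ig) (rintegrableZ _ measurableT iK)).
  have ii : rintegrable leb setT (fun z => g (z + (x + s *: nu)) - w x * K z).
    exact: (rintegrableB measurableT (shift_rintegrable _ ig) (rintegrableZ _ measurableT iK)).
  apply: (le_trans (Rintegral_le_norm measurableT ii)).
  apply: (le_Rintegral measurableT (rintegrable_norm measurableT ii) (iG x)) => z _.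
  by rewrite /g /G addrK -mulrBl normrM (ger0_norm (K0 z)) (addrC z) addrA.
pose F (q : cT * cT) : \bar R := (\1_E q.1 * G q.1 q.2)%:E.
have F0 q : (0 <= F q)%E by rewrite lee_fin !mulr_ge0// indicE.
have mF : measurable_fun setT F.
  have mc (i : 'I_n) : measurable_fun setT (fun p : cT * cT => ((p.1 : 'rV[R]_n) + (s *: nu + p.2)) 0 i).
    rewrite (_ : (fun p : cT * cT => _) = (fun p : cT * cT => (p.1 : 'rV[R]_n) 0 i + (s * nu 0 i + (p.2 : 'rV[R]_n) 0 i))); last first.
      by apply/funext => p; rewrite !mxE.
    apply: measurable_funD; first exact: (measurableT_comp (coord_lmble_fun i) (@measurable_fst _ _ cT cT)).
    apply: measurable_funD; first exact: measurable_cst.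
    exact: (measurableT_comp (coord_lmble_fun i) (@measurable_snd _ _ cT cT)).
  apply/measurable_EFinP; apply: measurable_funM.
    exact: (measurableT_comp (measurable_indic mE) (@measurable_fst _ _ cT cT)).
  apply: measurable_funM; last exact: (measurableT_comp (cont_mfun cK) (@measurable_snd _ _ cT cT)).
  apply: measurableT_comp => //; apply: measurable_funB; first exact: (measurable_coord_comp mc cw).
  exact: (measurableT_comp (cont_mfun cw) (@measurable_fst _ _ cT cT)).
set B := s * (enorm nu + c) * tgrad Om w.
have B0 : 0 <= B by rewrite /B !mulr_ge0 ?tgrad_ge0// ?addr_ge0 ?enorm_ge0// ltW.
have inner z : (\int[leb]_x F (x, z) <= (B * K z)%:E)%E.
  have [zs|zs] := ltP (enorm z) (c * s); last first.
    by rewrite integral0_eq ?Ks ?mulr0// => x _; rewrite /F /G /= Ks// !mulr0.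
  have iz : rintegrable leb E (fun x => `|w (x + (s *: nu + z)) - w x|).
    apply: cont_integrable bE _; apply: rcont_norm; apply: rcontD; last exact: rcontN.
    exact: rcont_shift.
  rewrite (_ : \int[leb]_x F (x, z) = \int[leb]_(x in E) (K z * `|w (x + (s *: nu + z)) - w x|)%:E)%E; last first.
    rewrite [RHS]integral_mkcond; apply: eq_integral => x _; rewrite /F /= patchE indicE.
    by case: ifP => _; rewrite ?mul1r ?mul0r// mulrC.
  rewrite Rintegral_EFin//; last exact: rintegrableZ.
  rewrite lee_fin Rint_scale// mulrC ler_wpM2r//.
  apply: (le_trans (Rintegral_translate Cw bE bOm _)) => [x t Ex ht|]; first exact: seg.
  have bb x : `|dot (s *: nu + z) (grad w x)| <= s * (enorm nu + c) * enorm (grad w x).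
    rewrite (le_trans (dot_le _ _))// ler_wpM2r ?enorm_ge0// (le_trans (enormD _ _))//.
    by rewrite enormZ gtr0_norm// mulrDr lerD2l mulrC ltW.
  rewrite /B -(Rint_scale _ mO (tgrad_integrable bOm Cw)).
  apply: (le_Rintegral mO _ (rintegrableZ _ mO (tgrad_integrable bOm Cw))) => //.
  by apply: cont_integrable bOm _; exact: cont_dot_grad.
have iK : rintegrable leb setT K.
  by apply: (@cont_supp_integrable _ _ 0 (c * s)) => // z; rewrite subr0; exact: Ks.
have step1 : (\int[leb]_x \int[leb]_z F (x, z) <= B%:E)%E.
  have -> : (\int[leb]_x \int[leb]_z F (x, z) = \int[leb]_z \int[leb]_x F (x, z))%E.
    exact: (@fubini_tonelli _ _ cT cT R leb leb F mF F0).
  apply: (@le_trans _ _ (\int[leb]_z (B * K z)%:E)%E).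
    apply: (@ge0_le_integral _ cT R leb setT measurableT).
    - by move=> z _; apply: integral_ge0 => x _; exact: F0.
    - exact: (@measurable_fun_fubini_tonelli_G _ _ cT cT R leb F mF F0).
    - by apply/measurable_EFinP; apply: measurable_funM; [exact: measurable_cst|exact: cont_mfun].
    - by move=> z _; exact: inner.
  by rewrite Rintegral_EFin//; [rewrite Rint_scale// K1 mulr1|exact: rintegrableZ].
have icE : continuous (fun x => `|\int[leb]_(y in Om) (w y * K (y - x - s *: nu)) - w x|).
  apply: rcont_norm; apply: rcontD; last exact: rcontN.
  by apply: (conv_cont bOm _ (cont_kernel (a := s *: nu) mK)); exact: cont_integrable.
rewrite -lee_fin -Rintegral_EFin//; last exact: cont_integrable.
apply: (le_trans _ step1); rewrite integral_mkcond; apply: (@ge0_le_integral _ cT R leb setT measurableT).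
- by move=> x _; rewrite patchE; case: ifP => _; rewrite ?lee_fin.
- apply/(measurable_restrictT _ mE); apply/measurable_EFinP.
  exact: cont_lmble_fun.
- exact: (@measurable_fun_fubini_tonelli_F _ _ cT cT R leb F mF F0).
- move=> x _; rewrite patchE; case: ifP => [/set_mem Ex|_]; last by apply: integral_ge0 => z _; exact: F0.
  rewrite (_ : \int[leb]_z F (x, z) = \int[leb]_z (G x z)%:E)%E.
    by rewrite (Rintegral_EFin measurableT (iG x)) lee_fin pt.
  by apply: eq_integral => z _; rewrite /F /= indicE mem_set// mul1r.
Qed.

(** Arzela-Ascoli along the ultrafilter. The convolutions are bounded and equicontinuous on the
    compact closure of [Om], so uniform closeness follows from closeness at finitely many points. *)
Lemma conv_ultra (U : set_system nat) k (w_ : nat -> 'rV[R]_n -> R) (C e : R) : UltraFilter U -> continuous k ->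
  (forall i, rintegrable leb Om (w_ i)) -> (forall i, \int[leb]_(x in Om) `|w_ i x| <= C) -> 0 < e ->
  exists2 A, U A & forall i j, A i -> A j -> forall x, Om x ->
    `|\int[leb]_(y in Om) (w_ i y * k (y - x)) - \int[leb]_(y in Om) (w_ j y * k (y - x))| <= e.
Proof.
move=> UU ck iw wC e0; pose W i x := \int[leb]_(y in Om) (w_ i y * k (y - x)).
have C0 : 0 <= C by apply: le_trans (wC 0%N); exact: Rintegral_ge0.
have C10 : 0 < 3 * (C + 1) by rewrite mulr_gt0// ltr_wpDl.
have cK := bounded_closure_compact bOm.
have bcl : bmeas (closure Om) by split; [exact: compact_lmble|exact: compact_bounded].
have bB := bmeas_diff bOm bcl.
have [M M0 hM] := continuous_bounded ck bB.
have [d d0 hd] := enorm_unif_continuous ck bB (divr_gt0 e0 C10).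
have est i (h : 'rV[R]_n -> R) (B : R) : continuous h -> (forall y, Om y -> `|h y| <= B) -> 0 <= B ->
    `|\int[leb]_(y in Om) (w_ i y * h y)| <= C * B.
  move=> ch hB B0; have iwh : rintegrable leb Om (fun y => w_ i y * h y).
    by apply: (rintegrableM mO (iw i) _ hB); exact: cont_lmble_fun.
  apply: (le_trans (Rintegral_le_norm mO iwh)); apply: (@le_trans _ _ (B * \int[leb]_(y in Om) `|w_ i y|)).
    rewrite -(Rint_scale _ mO (rintegrable_norm mO (iw i))).
    apply: (le_Rintegral mO (rintegrable_norm mO iwh) (rintegrableZ _ mO (rintegrable_norm mO (iw i)))) => y Oy.
    by rewrite normrM mulrC ler_wpM2r// hB.
  by rewrite mulrC ler_wpM2r.
have Wb i x : closure Om x -> `|W i x| <= C * M.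
  move=> cx; apply: (est i (fun y => k (y - x))); [exact: rcont_shiftB|move=> y Oy|exact: ltW].
  by apply: hM; exists x, y.
have We i x x' : closure Om x -> enorm (x' - x) < d -> `|W i x - W i x'| <= e / 3.
  move=> cx xd; rewrite /W -(Rint_sub mO); [|exact: rint_conv..].
  under eq_Rintegral do rewrite -mulrBr.
  apply: (@le_trans _ _ (C * (e / (3 * (C + 1))))); last first.
    apply: (@le_trans _ _ ((C + 1) * (e / (3 * (C + 1))))); last first.
      by rewrite le_eqVlt; apply/orP; left; apply/eqP; field; rewrite gt_eqF// ltr_wpDl.
    by rewrite ler_wpM2r ?lerDl// ltW// divr_gt0.
  apply: (est i (fun y => k (y - x) - k (y - x'))); last by rewrite ltW// divr_gt0.
    by apply: rcontD; [exact: rcont_shiftB|apply: rcontN; exact: rcont_shiftB].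
  move=> y Oy; rewrite distrC; apply: hd; first by exists x, y.
  by rewrite opprB addrC addrA subrK enormBC.
have [s [sK cov]] := compact_eball_cover (r := fun=> d) cK (fun _ _ => d0).
have [A UA hA] := ultra_all (U := U) (s := s) (P := fun x A => forall i j, A i -> A j -> `|W i x - W j x| <= e / 3) _
  (fun x A B h AB i j Bi Bj => h i j (AB i Bi) (AB j Bj))
  (fun x xs => ultra_bounded UU (fun i => Wb i x (sK x xs)) (divr_gt0 e0 (ltr0n R 3))).
exists A => // i j Ai Aj x Ox; have [y ys xy] := cov x (subset_closure Ox); rewrite -/(W i x) -/(W j x).
have h1 := We i y x (sK y ys) xy; have h2 := We j y x (sK y ys) xy; have h3 := hA y ys i j Ai Aj.
have -> : W i x - W j x = - (W i y - W i x) + ((W i y - W j y) + (W j y - W j x)) by ring.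
rewrite (le_trans (ler_normD _ _))// normrN.
by have := ler_normD (W i y - W j y) (W j y - W j x); move: h1 h2 h3; lra.
Qed.

Hypothesis patchOm : forall x, closure Om x -> exists r nu c, [/\ 0 < r, 0 < c & patch Om x r nu c].

(** On each patch the functions are uniformly close in L1 to their shifted averages, by the gradient
    bound, and these averages are uniformly Cauchy along the ultrafilter. A subsequence is extracted
    only at the end. *)
Lemma C1_L1_compact (w_ : nat -> 'rV[R]_n -> R) (C : R) : (forall i, C1 (w_ i)) ->
  (forall i, \int[leb]_(x in Om) `|w_ i x| <= C) -> (forall i, tgrad Om (w_ i) <= C) ->
  exists phi : nat -> nat, (forall i, (i <= phi i)%N) /\
    forall e, 0 < e -> exists K, forall k l, (K <= k)%N -> (K <= l)%N ->
      \int[leb]_(x in Om) `|w_ (phi k) x - w_ (phi l) x| <= e.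
Proof.
move=> Cw wC gC; have [U [UU oU]] := ultraFilterLemma (F := nbhs \oo) _.
have C0 : 0 <= C by apply: le_trans (wC 0%N); exact: Rintegral_ge0.
have iw i : rintegrable leb Om (w_ i) by apply: cont_integrable bOm _; exact: C1_cont.
have iwB i j : rintegrable leb Om (fun x => `|w_ i x - w_ j x|).
  by apply: (rintegrable_norm mO); exact: (rintegrableB mO (iw i) (iw j)).
have local x0 r nu c e : 0 < r -> 0 < c -> patch Om x0 r nu c -> 0 < e -> exists2 A, U A &
    forall i j, A i -> A j -> \int[leb]_(x in Om `&` eball x0 r) `|w_ i x - w_ j x| <= e.
  move=> r0 c0 P e0; set E := Om `&` eball x0 r.
  have mE : lmble E by exact: eball_part_lmble.
  have bE : bmeas E by apply: (bmeasS mE _ bOm); exact: subIsetl.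
  have nc : 0 < enorm nu + c by rewrite ltr_wpDl// enorm_ge0.
  have nC0 : 0 < 4 * ((enorm nu + c) * (C + 1)) by rewrite !mulr_gt0// ltr_wpDl.
  (* The two averaging errors then take [e / 4] each and leave [e / 2] for the distance between the
     averages. *)
  pose s := Num.min (r / 2) (e / (4 * ((enorm nu + c) * (C + 1)))).
  have s0 : 0 < s by rewrite lt_min !divr_gt0.
  have sr : s < r by rewrite (le_lt_trans (y := r / 2)) ?ge_min ?lexx// ltr_pdivrMr// ltr_pMr// ltr1n.
  have sC : s * (enorm nu + c) * C <= e / 4.
    apply: (@le_trans _ _ (s * (4 * ((enorm nu + c) * (C + 1))) / 4)).
      rewrite mulrCA (mulrAC 4) mulfV// mul1r -mulrA ler_wpM2l ?(ltW s0)// ler_wpM2l ?(ltW nc)//.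
      by rewrite lerDl.
    by rewrite ler_wpM2r// -ler_pdivlMr// ge_min lexx orbT.
  have [K mK] := @mollifier_exists R n (c * s) (mulr_gt0 c0 s0).
  pose v := fine (leb E); have v0 : 0 <= v by rewrite fine_ge0.
  have v10 : 0 < 2 * (v + 1) by rewrite mulr_gt0// ltr_wpDl.
  have ck := cont_kernel (a := s *: nu) mK.
  have [A UA hA] := conv_ultra UU ck iw wC (divr_gt0 e0 v10).
  exists A => // i j Ai Aj; pose W i x := \int[leb]_(y in Om) (w_ i y * K (y - x - s *: nu)).
  have av l : \int[leb]_(x in E) `|W l x - w_ l x| <= e / 4.
    apply: (le_trans (shift_average P c0 _ mK (Cw l))); first by rewrite s0.
    by apply: le_trans sC; rewrite ler_wpM2l// mulr_ge0// ltW.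
  have iA l : rintegrable leb E (fun x => `|W l x - w_ l x|).
    apply: cont_integrable bE _; apply: rcont_norm; apply: rcontD; first exact: (conv_cont bOm (iw l) ck).
    by apply: rcontN; exact: C1_cont.
  have icst t : rintegrable leb E (fun=> t) by apply: cont_integrable bE _; exact: cst_continuous.
  have iwE : rintegrable leb E (fun x => `|w_ i x - w_ j x|).
    by apply: (rintegrableS mO mE _ (iwB i j)); exact: subIsetl.
  have iS := rintegrableD mE (iA i) (iA j).
  apply: (le_trans (le_Rintegral mE iwE (rintegrableD mE iS (icst (e / (2 * (v + 1))))) _)).
    move=> x [Ox _]; have := hA i j Ai Aj x Ox; rewrite -/(W i x) -/(W j x) => h.
    have -> : w_ i x - w_ j x = - (W i x - w_ i x) + (W j x - w_ j x) + (W i x - W j x) by ring.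
    by rewrite (le_trans (ler_normD _ _))// lerD// (le_trans (ler_normD _ _))// normrN.
  rewrite (Rint_add mE iS (icst _)) (Rint_add mE (iA i) (iA j)) (Rintegral_cst leb mE) -/v.
  have : e / (2 * (v + 1)) * v <= e / 2.
    apply: (@le_trans _ _ (e / (2 * (v + 1)) * (v + 1))); first by rewrite ler_wpM2l ?lerDl// ltW// divr_gt0.
    by rewrite le_eqVlt; apply/orP; left; apply/eqP; field; rewrite gt_eqF// ltr_wpDl.
  by move: (av i) (av j); lra.
have global e : 0 < e -> exists2 A, U A & forall i j, A i -> A j -> \int[leb]_(x in Om) `|w_ i x - w_ j x| <= e.
  move=> e0; have /choice[r hr] : forall x, exists r, closure Om x -> exists nu c, [/\ 0 < r, 0 < c & patch Om x r nu c].
    by move=> x; have [/patchOm[r h]|nF] := pselect (closure Om x); [exists r|exists 0].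
  have r0 x : closure Om x -> 0 < r x by move=> /hr[nu [c []]].
  have [s [sF cov]] := compact_eball_cover (bounded_closure_compact bOm) r0.
  have s10 : 0 < (size s).+1%:R :> R by [].
  have [|A UA hA] := ultra_all (U := U) (s := s) (P := fun x A => forall i j, A i -> A j ->
    \int[leb]_(y in Om `&` eball x (r x)) `|w_ i y - w_ j y| <= e / (size s).+1%:R) _
    (fun x A B h AB i j Bi Bj => h i j (AB i Bi) (AB j Bj)).
    by move=> x /sF/hr[nu [c [p1 p2 p3]]]; apply: local p1 p2 p3 _; exact: divr_gt0.
  exists A => // i j Ai Aj.
  apply: (le_trans (Rintegral_cover (s := s) (E := fun x => eball x (r x)) mO _ (iwB i j) _ _ _)) => //.
  - by move=> x; apply: open_lmble; exact: eball_open.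
  - by move=> x Ox; have [y ys xy] := cov x (subset_closure Ox); exists y.
  apply: (@le_trans _ _ (\sum_(x <- s) e / (size s).+1%:R)).
    by rewrite big_seq [leRHS]big_seq; apply: ler_sum => x xs; exact: hA.
  rewrite big_const_seq iter_addr_0 count_predT -[leLHS]mulr_natr -mulrA ler_piMr ?(ltW e0)//.
  by rewrite mulrC ler_pdivrMr// mul1r ler_nat.
have /choice[A hA] : forall m, exists A, U A /\ forall i j, A i -> A j -> \int[leb]_(x in Om) `|w_ i x - w_ j x| <= m.+1%:R^-1.
  by move=> m; have [|A UA h] := global m.+1%:R^-1; [rewrite invr_gt0|exists A].
have UB m : U [set k | forall j, (j <= m)%N -> A j k].
  elim: m => [|m IH].
    by apply: filterS (hA 0%N).1 => k h j; rewrite leqn0 => /eqP ->.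
  apply: filterS (filterI IH (hA m.+1).1) => k [h1 h2] j.
  by rewrite leq_eqVlt => /orP[/eqP -> //|]; rewrite ltnS => /h1.
(* Finitely many members of the ultrafilter and a tail of the integers have a common point, since
   the ultrafilter refines the filter at infinity. *)
have /choice[phi hphi] : forall m, exists k, (m <= k)%N /\ forall j, (j <= m)%N -> A j k.
  move=> m; have Um : U [set k | (m <= k)%N] by apply: oU; exists m.
  by have [k [h1 h2]] := filter_ex (filterI Um (UB m)); exists k.
exists phi; split=> [i|e e0]; first by have [] := hphi i.
exists (Num.truncn e^-1) => k l kK lK.
apply: (@le_trans _ _ (Num.truncn e^-1).+1%:R^-1).
  by apply: (hA (Num.truncn e^-1)).2; [exact: (hphi k).2|exact: (hphi l).2].
by rewrite -[leRHS]invrK lef_pV2 ?posrE ?invr_gt0// ltW// truncnS_gt.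
Qed.

End L1_compactness.

Lemma pow_near1 (R : realType) (n : nat) (d : R) : 0 < d -> exists2 M, 1 < M & M ^+ n <= 1 + d.
Proof.
move=> d0; have : (fun x : R => x ^+ n) x @[x --> (1 : R)] --> (1 : R) ^+ n by exact: exprn_continuous.
rewrite expr1n => /cvgrPdist_le/(_ _ d0)[e /= e0 he]; exists (1 + e / 2); first by rewrite ltrDl divr_gt0.
have := he (1 + e / 2); rewrite /= opprD addrA subrr sub0r normrN gtr0_norm ?divr_gt0// distrC => h.
rewrite -lerBlDl (le_trans (ler_norm _))// h// ltr_pdivrMr// ltr_pMr// ltr1n//.
Qed.

Section arithmetic.
Context {R : realType}.
Implicit Types (e g G : R).

Lemma collar_arith (a t1 t2 g1 g2 V P X Y e : R) : a <= t1 + t2 -> t1 <= g1 - P + X -> t2 <= g2 - P + Y ->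
  g1 <= V + e -> V - e <= P -> X <= e -> Y <= e -> a <= g2 - V + 5 * e.
Proof. by lra. Qed.

Lemma deficit_arith (t g V P X e : R) : 0 <= t -> t <= g - P + X -> V - e <= P -> X <= e -> V - g <= 2 * e.
Proof. by lra. Qed.

(** [kap] stands for [|b| * M ^+ n], [g] and [Bz] for the two parts of the energy of an
    approximating function, [V] and [BT] for those of the limit. *)
Lemma energy_arith (kap e G V g A BT Bz : R) : 0 <= kap -> kap <= 1 + e / (G + 1) -> 0 < e -> e <= 1 -> 0 <= G -> g <= G ->
  0 <= V -> V - g <= 2 * e -> g + Bz <= A + e -> BT - Bz <= kap * (g - V + 5 * e) + 4 * e -> V + BT <= A + 17 * e.
Proof.
move=> k0 hk e0 e1 G0 Gk V0 Vg Ek cmp; have G10 : 0 < G + 1 by rewrite ltr_wpDl.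
have eG : e / (G + 1) <= e by rewrite ler_pdivrMr// ler_peMr ?(ltW e0)// lerDr.
have eG2 : e / (G + 1) * G <= e by rewrite mulrAC ler_pdivrMr// ler_wpM2l ?(ltW e0)// lerDl.
have k2 : kap * (5 * e) <= 2 * (5 * e).
  rewrite ler_wpM2r ?mulr_ge0 ?(ltW e0)//; apply: (le_trans hk).
  by rewrite (_ : 2 = 1 + 1 :> R)// lerD2l (le_trans eG).
(* [V - g] is at most [2 * e], but may be very negative. That is harmless if [kap <= 1]; otherwise
   [kap - 1 <= e / (G + 1)] and the bound [G] on [g] keeps the product small. *)
have k3 : (1 - kap) * (V - g) <= 2 * e.
  have [kp|kp] := leP kap 1.
    have h1 : (1 - kap) * (V - g) <= (1 - kap) * (2 * e) by rewrite ler_wpM2l// subr_ge0.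
    have h2 : 0 <= kap * (2 * e) by rewrite mulr_ge0// mulr_ge0// ltW.
    by move: h1 h2; rewrite (mulrBl (2 * e)) mul1r; clear; lra.
  have h1 : (kap - 1) * (g - V) <= (kap - 1) * G.
    by rewrite ler_wpM2l ?subr_ge0 ?(ltW kp)//; move: Gk V0; clear; lra.
  have h2 : (kap - 1) * G <= e / (G + 1) * G by rewrite ler_wpM2r//; move: hk; clear; lra.
  have -> : (1 - kap) * (V - g) = (kap - 1) * (g - V) by ring.
  by move: h1 h2 eG2 e0; clear; lra.
have h : V - g + kap * (g - V + 5 * e) = (1 - kap) * (V - g) + kap * (5 * e) by ring.
by move: k2 k3 h Ek cmp; clear; lra.
Qed.

End arithmetic.

(** * Lower semicontinuity *)

Section semicontinuity.
Context {R : realType} {n : nat} (Om : set 'rV[R]_n.+1).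
Implicit Types (x y nu : 'rV[R]_n.+1) (w z u f T : 'rV[R]_n.+1 -> R).
Local Notation leb := (@leb R n.+1).
Local Notation haus := (@haus R n.+1 n).
Local Notation hT := (caratheodory_type (@hausdorff_outer R n.+1 n)).
Hypotheses (oOm : open Om) (bOm : bmeas Om).
Let Fr := frontier Om.
Let mO := bOm.1.
Let mFr : measurable (Fr : set hT) := frontier_hmble Om.
Hypothesis patchOm : forall x, closure Om x -> exists r nu c, [/\ 0 < r, 0 < c & patch Om x r nu c].
Hypothesis patchFr : forall x, Fr x -> exists r nu c, [/\ 0 < r, 0 < c, enorm nu = 1 & patch Om x r nu c].
Variable M0 : R.
Hypotheses (M00 : 0 < M0) (charts0 : forall x, Fr x -> exists r nu, flat_chart Om set0 x r nu M0).

Lemma total_var_real u : (total_var Om u < +oo)%E -> rintegrable leb Om u -> exists V : R, [/\ total_var Om u = V%:E, 0 <= V,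
  forall phi, test_field Om phi -> \int[leb]_(x in Om) (u x * divergence phi x) <= V &
  forall e, 0 < e -> exists2 phi, test_field Om phi & V - e <= \int[leb]_(x in Om) (u x * divergence phi x)].
Proof.
move=> TVy iu; have t0 : test_field Om (fun=> 0 : 'rV[R]_n.+1).
  split=> [||x]; last by rewrite enorm0.
    by apply: C1_field => i; under eq_fun do rewrite mxE; exact: C1_cst.
  by exists set0 => //; split; [exact: compact0|exact: sub0set].
have TV0 : (0 <= total_var Om u)%E.
  apply: le_trans (total_var_ge bOm iu t0); rewrite lee_fin (@eq_Rintegral _ _ _ leb _ (fun=> 0)).
    by rewrite Rintegral_cst// mul0r.
  move=> x _; rewrite /divergence big1 ?mulr0// => i _.
  by rewrite (_ : (fun=> 0) = cst 0)// derive_cst mxE.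
have TVE : total_var Om u = (fine (total_var Om u))%:E by rewrite fineK// ge0_fin_numE.
have TVf : total_var Om u \is a fin_num by rewrite ge0_fin_numE.
exists (fine (total_var Om u)); split => //; first by rewrite fine_ge0.
  by move=> phi tp; rewrite -lee_fin -TVE; exact: total_var_ge.
move=> e e0; have [_ [phi tp <-] h] := ub_ereal_sup_adherent e0 TVf; exists phi => //.
move: h; rewrite Rintegral_EFin//; last exact: test_integrable.
by rewrite -/(total_var Om u) TVE -EFinB lte_fin => /ltW.
Qed.

(** [T] plays the role of the trace, but only the integral of its absolute value is tied to [trace],
    since nothing else enters [J]. *)
Definition bv_approx u (V : R) T (w_ : nat -> 'rV[R]_n.+1 -> R) := [/\ rintegrable haus Fr T,
  (\int[haus]_(x in Fr) (`|trace Om u x|)%:E = (\int[haus]_(x in Fr) `|T x|)%:E)%E, forall k, C1 (w_ k) &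
  forall e, 0 < e -> exists K, forall k, (K <= k)%N -> [/\ \int[leb]_(x in Om) `|w_ k x - u x| <= e,
    tgrad Om (w_ k) <= V + e & \int[haus]_(x in Fr) `|w_ k x - T x| <= e]].

Lemma bv_approx_exists u : (total_var Om u < +oo)%E -> rintegrable leb Om u -> exists V T (w_ : nat -> 'rV[R]_n.+1 -> R),
  total_var Om u = V%:E /\ bv_approx u V T w_.
Proof.
move=> TVy iu; have [V [TVE V0 Vge Vad]] := total_var_real TVy iu.
have ik (k : nat) : 0 < k.+1%:R^-1 :> R by rewrite invr_gt0.
have /choice[w_ hw] := fun k : nat => smooth_approximation oOm bOm patchOm iu Vge (ik k).
have Cw k : C1 (w_ k) by have [] := hw k.
have small e : 0 < e -> exists K, forall k, (K <= k)%N -> (k.+1%:R^-1 : R) <= e.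
  move=> e0; exists (Num.truncn e^-1) => k Kk; rewrite -[leRHS]invrK lef_pV2 ?posrE ?invr_gt0//.
  by rewrite (le_trans (ltW (truncnS_gt _)))// ler_nat ltnS.
have wu e : 0 < e -> exists K, forall k, (K <= k)%N -> \int[leb]_(x in Om) `|w_ k x - u x| <= e.
  by move=> /small[K hK]; exists K => k /hK; have [_ h _] := hw k; exact: le_trans.
have wg e : 0 < e -> exists K, forall k, (K <= k)%N -> tgrad Om (w_ k) <= V + e.
  move=> /small[K hK]; exists K => k /hK hk; have [_ _ h] := hw k.
  by apply: (le_trans h); rewrite lerD2l.
have conc e : 0 < e -> exists2 rho, 0 < rho & exists K, forall k l, (K <= k)%N -> (K <= l)%N ->
    tgrad (Om `\` core Om rho) (fun x => w_ k x - w_ l x) <= e.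
  (* For each of the two functions three errors of [e / 6] occur: the excess over [V], the defect of
     the test field and the L1 distance times [C]. *)
  move=> e0; have e6 : 0 < e / 6 by rewrite divr_gt0.
  have [phi tp hp] := Vad _ e6.
  have [rho [C [r0 C0 hC]]] := test_field_core oOm bOm tp; exists rho => //.
  have C10 : 0 < C + 1 by rewrite ltr_wpDl.
  have [K1 h1] := wu _ (divr_gt0 e6 C10); have [K2 h2] := wg _ e6.
  exists (maxn K1 K2) => k l; rewrite !geq_max => /andP[k1 k2] /andP[l1 l2].
  have bD : bmeas (Om `\` core Om rho).
    by apply: (bmeasS _ _ bOm); [apply: measurableD => //; exact: (core_bmeas r0 bOm).1|exact: subDsetl].
  apply: (le_trans (tgradB bD (Cw k) (Cw l))).
  have one j : (K1 <= j)%N -> (K2 <= j)%N -> tgrad (Om `\` core Om rho) (w_ j) <= e / 2.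
    move=> j1 j2; have hd : C * \int[leb]_(x in Om) `|w_ j x - u x| <= e / 6.
      apply: (@le_trans _ _ ((C + 1) * (e / 6 / (C + 1)))); last by rewrite mulrC divfK// gt_eqF.
      by apply: ler_pM (h1 j j1) => //; [exact: Rintegral_ge0|rewrite lerDl].
    by move: (hC _ _ (Cw j) iu) (h2 j j2) hp hd; lra.
  by rewrite [leRHS]splitr lerD// one.
have [T [iT trE wT]] := trace_limit oOm bOm M00 charts0 patchFr iu Cw wu conc.
exists V, T, w_; split => //; split => // e e0.
have [K1 h1] := wu e e0; have [K2 h2] := wg e e0; have [K3 h3] := wT e e0.
exists (maxn K1 (maxn K2 K3)) => k; rewrite !geq_max => /and3P[k1 k2 k3].
by split; [exact: h1|exact: h2|exact: h3].
Qed.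

Variable b : R.
Hypotheses (b_gt : -1 < b) (b_le : b <= 1).
Hypothesis charts : forall M eta, 1 < M -> 0 < eta -> exists V, [/\ open V, 0 <= b \/ V = set0,
  (hausdorff_outer n (Fr `&` V) <= eta%:E)%E & forall x, Fr x -> exists r nu, flat_chart Om V x r nu M].

Definition energy w : R := tgrad Om w + b * \int[haus]_(x in Fr) `|w x|.

Let ihC : forall w, C1 w -> rintegrable haus Fr w := haus_C1_integrable oOm bOm M00 charts0.
Let normb : `|b| <= 1.
Proof. by rewrite ler_norml b_le andbT ltW. Qed.

(** The two signs of [b] use opposite triangle inequalities. For [b >= 0] the integral of [|z|] over
    the exceptional part has a favourable sign and is dropped; that of [|T|] remains, as no uniform
    control of [z] on [V] is available. *)
Lemma boundary_compare T w z V : rintegrable haus Fr T -> C1 w -> C1 z -> open V -> 0 <= b \/ V = set0 ->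
  b * \int[haus]_(x in Fr) `|T x| - b * \int[haus]_(x in Fr) `|z x| <=
  `|b| * (\int[haus]_(x in Fr) `|w x - T x| + \int[haus]_(x in Fr `\` V) `|w x - z x| +
          \int[haus]_(x in Fr `&` V) `|T x|).
Proof.
move=> iT Cw Cz oV bV; have mI : measurable (Fr `&` V : set hT) by apply: closed_open_hmble => //; exact: frontier_closed.
have mD : measurable (Fr `\` V : set hT) by rewrite -[Fr `\` V]set0U -(setDv Fr) -setDIr; exact: measurableD.
have split_ f : rintegrable haus Fr f -> \int[haus]_(x in Fr) f x = \int[haus]_(x in Fr `&` V) f x + \int[haus]_(x in Fr `\` V) f x.
  by move=> jf; rewrite (Rintegral_setD mI mFr (@subIsetl _ Fr V) jf) setDIr setDv set0U.
have iz := ihC Cz; have iw := ihC Cw.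
have S f D : measurable (D : set hT) -> D `<=` Fr -> rintegrable haus Fr f -> rintegrable haus D f.
  by move=> mDD DF; exact: rintegrableS.
have nT := rintegrable_norm mFr iT; have nz := rintegrable_norm mFr iz.
have nwT := rintegrable_norm mFr (rintegrableB mFr iw iT).
have nwz := rintegrable_norm mFr (rintegrableB mFr iw iz).
have sD : Fr `\` V `<=` Fr by exact: subDsetl.
have SD f : rintegrable haus Fr f -> rintegrable haus (Fr `\` V) f by exact: S.
have tri f g : rintegrable haus Fr f -> rintegrable haus Fr g ->
    \int[haus]_(x in Fr `\` V) `|f x| - \int[haus]_(x in Fr `\` V) `|g x| <= \int[haus]_(x in Fr `\` V) (`|w x - f x| + `|w x - g x|).
  move=> jf jg; have [nf ng] := (SD _ (rintegrable_norm mFr jf), SD _ (rintegrable_norm mFr jg)).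
  rewrite -(Rint_sub mD nf ng); apply: (le_Rintegral mD (rintegrableB mD nf ng)) => [|x _].
    by apply: (rintegrableD mD); apply: SD; apply: (rintegrable_norm mFr); exact: rintegrableB.
  rewrite -(normrN (w x - f x)) opprB (le_trans (lerB_dist _ _))//.
  by rewrite (le_trans _ (ler_normD _ _))// addrA subrK.
have h1 := tri T z iT iz; have h2 := tri z T iz iT.
rewrite (Rint_add mD (SD _ nwT) (SD _ nwz)) in h1; rewrite (Rint_add mD (SD _ nwz) (SD _ nwT)) in h2.
have h3 : \int[haus]_(x in Fr `\` V) `|w x - T x| <= \int[haus]_(x in Fr) `|w x - T x| by exact: Rintegral_subset.
have h4 : 0 <= \int[haus]_(x in Fr `&` V) `|T x| by exact: Rintegral_ge0.
have h5 : 0 <= \int[haus]_(x in Fr `&` V) `|z x| by exact: Rintegral_ge0.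
rewrite (split_ _ nT) (split_ _ nz) -mulrBr; have [b0|b0] := leP 0 b.
  by rewrite ger0_norm// ler_wpM2l//; move: h1 h3 h4 h5; lra.
case: bV => [h|V0]; first by move: b0; rewrite ltNge h.
have e0 f : \int[haus]_(x in Fr `&` V) f x = 0 by rewrite V0 setI0 Rintegral_set0.
rewrite ltr0_norm// !e0 !add0r addr0 mulNr -mulrN ler_wnM2l//; first exact: ltW.
by move: h2 h3; lra.
Qed.

Lemma energy_coercive : exists c1 c2, [/\ 0 < c1, 0 <= c2 & forall w, C1 w ->
  c1 * tgrad Om w <= energy w + c2 * \int[leb]_(x in Om) `|w x|].
Proof.
have [b0|b0] := leP 0 b.
  exists 1, 0; split => // w Cw; rewrite mul1r mul0r addr0 lerDl mulr_ge0//.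
  exact: Rintegral_ge0.
have nb : 0 < 1 + b by rewrite -ltrBlDl sub0r.
(* With [M ^+ n <= 2 + b] the boundary term leaves the fraction [1 + b * (2 + b) = (1 + b) ^+ 2] of
   the gradient mass, which is positive. *)
have [M M1 hM] := @pow_near1 R n (1 + b) nb.
have [V [oV [b0'|V0] _ ch]] := charts M1 ltr01; first by move: b0; rewrite ltNge b0'.
rewrite V0 in ch; have M0' : 0 < M by exact: lt_trans M1.
have [C C0 hC] := collar_boundR oOm bOm M00 charts0 open0 M0' ltr01 ch.
exists ((1 + b) ^+ 2), C; split => // [|w Cw]; first by rewrite exprn_gt0.
have := hC w Cw; rewrite setD0.
have bD : bmeas (Om `\` core Om 1).
  by apply: (bmeasS _ _ bOm); [apply: measurableD => //; exact: (core_bmeas ltr01 bOm).1|exact: subDsetl].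
have ts : tgrad (Om `\` core Om 1) w <= tgrad Om w.
  apply: (Rintegral_subset bD.1 mO (tgrad_integrable bOm Cw)) => [x _|]; [exact: enorm_ge0|exact: subDsetl].
have t0 := tgrad_ge0 Om w; have t1 := tgrad_ge0 (Om `\` core Om 1) w.
have k1 : M ^+ n * tgrad (Om `\` core Om 1) w <= (2 + b) * tgrad Om w.
  by apply: ler_pM => //; [rewrite exprn_ge0// ltW|move: hM; lra].
move=> h; have {}h := le_trans h (lerD k1 (lexx _)); rewrite /energy.
set B := \int[haus]_(x in Fr) `|w x| in h *; set t := tgrad Om w in t0 h *.
set I := \int[leb]_(x in Om) `|w x| in h *; have I0 : 0 <= C * I by rewrite mulr_ge0//; exact: Rintegral_ge0.
have k3 : b * ((2 + b) * t + C * I) <= b * B by rewrite ler_wnM2l// ltW.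
have k4 : - (C * I) <= b * (C * I) by rewrite -mulN1r ler_wpM2r// ltW.
have -> : (1 + b) ^+ 2 * t = t + b * ((2 + b) * t) by ring.
by move: k3; rewrite mulrDr; move: k4; lra.
Qed.

Lemma energy_tgrad_bound (A D : R) : exists2 G, 0 <= G & forall w, C1 w -> energy w <= A ->
  \int[leb]_(x in Om) `|w x| <= D -> tgrad Om w <= G.
Proof.
have [c1 [c2 [c10 c20 h]]] := energy_coercive.
exists ((`|A| + c2 * `|D|) / c1) => [|w Cw hA hD]; first by rewrite divr_ge0 ?addr_ge0 ?mulr_ge0// ltW.
rewrite ler_pdivlMr// mulrC (le_trans (h w Cw))// lerD// ?(le_trans hA) ?ler_norm//.
by rewrite ler_wpM2l// (le_trans hD)// ler_norm.
Qed.

(** Absolute continuity of the integral of [|T|], through a nearby C1 function that is bounded on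
    the frontier. *)
Lemma integral_small_sets T w (e : R) : rintegrable haus Fr T -> C1 w -> 0 < e ->
  \int[haus]_(x in Fr) `|w x - T x| <= e / 2 -> exists2 eta, 0 < eta & forall D, measurable (D : set hT) -> D `<=` Fr ->
  (hausdorff_outer n D <= eta%:E)%E -> \int[haus]_(x in D) `|T x| <= e.
Proof.
move=> iT Cw e0 hT'; have [N N0 hN] := continuous_bounded (C1_cont Cw) (frontier_bounded bOm).
exists (e / (2 * N)) => [|D mD DF hD]; first by rewrite divr_gt0// mulr_gt0.
have nT := rintegrable_norm mFr iT; have nwT := rintegrable_norm mFr (rintegrableB mFr (ihC Cw) iT).
have HD : haus D \is a fin_num by rewrite ge0_fin_numE ?outer_measure_ge0// (le_lt_trans hD)// ltry.
have icst : rintegrable haus D (fun=> N).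
  by apply/integrableP; split; [exact: measurable_cst|rewrite integral_cst// lte_mul_pinfty// ltey_eq HD].
have S f : rintegrable haus Fr f -> rintegrable haus D f by exact: rintegrableS.
apply: (le_trans (le_Rintegral mD (S _ nT) (rintegrableD mD (S _ nwT) icst) _)) => [x Dx|].
  have {1}-> : T x = - (w x - T x) + w x by ring.
  by rewrite (le_trans (ler_normD _ _))// normrN lerD2l; apply: hN; exact: DF.
rewrite (Rint_add mD (S _ nwT) icst) (Rintegral_cst haus mD) [leRHS]splitr lerD//.
  by apply: le_trans hT'; apply: Rintegral_subset.
rewrite mulrC -ler_pdivlMr// -mulrA -invfM -lee_fin fineK//.
Qed.

(* Strict approximations of [u] and the [z_ k] can only differ near the boundary,
   up to the total variation lost in the limit; [collar_boundR] with a constant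
   close to 1 compares their traces there. *)
Theorem energy_lsc u (z_ : nat -> 'rV[R]_n.+1 -> R) (A : R) : rintegrable leb Om u -> (forall k, C1 (z_ k)) ->
  (forall e, 0 < e -> exists K, forall k, (K <= k)%N -> \int[leb]_(x in Om) `|z_ k x - u x| <= e) ->
  (forall e, 0 < e -> exists K, forall k, (K <= k)%N -> energy (z_ k) <= A + e) ->
  (total_var Om u < +oo)%E /\ forall (V : R) T (w_ : nat -> 'rV[R]_n.+1 -> R), total_var Om u = V%:E -> bv_approx u V T w_ ->
    V + b * \int[haus]_(x in Fr) `|T x| <= A.
Proof.
move=> iu Cz zu zA; have iC w : C1 w -> rintegrable leb Om w by move=> Cw; apply: cont_integrable bOm _; exact: C1_cont.
have iB w : C1 w -> rintegrable leb Om (fun x => `|w x - u x|).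
  by move=> Cw; apply: (rintegrable_norm mO); exact: (rintegrableB mO (iC w Cw) iu).
(* Bounded energy and bounded mass give a bound [G] on the gradient masses, which also measures how
   close to 1 the constant [M] has to be. *)
have [G G0 hG] := energy_tgrad_bound (A + 1) (1 + \int[leb]_(x in Om) `|u x|).
have [K1 h1] := zu 1 ltr01; have [K2 h2] := zA 1 ltr01; pose K0 := maxn K1 K2.
have zG k : (K0 <= k)%N -> tgrad Om (z_ k) <= G.
  rewrite geq_max => /andP[k1 k2]; apply: hG (Cz k) (h2 k k2) _.
  apply: le_trans (lerD (h1 k k1) (lexx _)); rewrite -(Rint_add mO (iB _ (Cz k)) (rintegrable_norm mO iu)).
  apply: (le_Rintegral mO (rintegrable_norm mO (iC _ (Cz k))) (rintegrableD mO (iB _ (Cz k)) (rintegrable_norm mO iu))) => x _.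
  by rewrite (le_trans _ (ler_normD _ _))// subrK.
split.
  apply: (le_lt_trans (total_var_le bOm (A := G) iu _)); last exact: ltry.
  move=> phi tp; have [rho [C [r0 C0 hC]]] := test_field_core oOm bOm tp.
  apply/ler_addgt0Pr => e e0; have C10 : 0 < C + 1 by rewrite ltr_wpDl.
  have [K hK] := zu _ (divr_gt0 e0 C10); pose k := maxn K0 K.
  have hk := hC _ _ (Cz k) iu; have gk := zG k (leq_maxl _ _).
  have t0 := tgrad_ge0 (Om `\` core Om rho) (z_ k).
  have hd : C * \int[leb]_(x in Om) `|z_ k x - u x| <= e.
    apply: (@le_trans _ _ ((C + 1) * (e / (C + 1)))); last by rewrite mulrC divfK// gt_eqF.
    by apply: ler_pM (hK k (leq_maxr _ _)) => //; [exact: Rintegral_ge0|rewrite lerDl].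
  by move: hk gk t0 hd; lra.
move=> V T w_ TVE [iT _ Cw hw].
have TVy : (total_var Om u < +oo)%E by rewrite TVE ltry.
have [V' [V'E V0 _ Vad]] := total_var_real TVy iu.
have VV : V' = V by apply: EFin_inj; rewrite -V'E.
rewrite VV in V0 Vad.
suff main e : 0 < e -> e <= 1 -> V + b * \int[haus]_(x in Fr) `|T x| <= A + 17 * e.
  apply/ler_addgt0Pr => e e0; have m0 : 0 < Num.min 1 (e / 17) by rewrite lt_min ltr01 divr_gt0.
  apply: (le_trans (main _ m0 _)); first by rewrite ge_min lexx.
  by rewrite lerD2l mulrC -ler_pdivlMr// ge_min lexx orbT.
move=> e0 e1; have G10 : 0 < G + 1 by rewrite ltr_wpDl.
have [M M1 hM] := @pow_near1 R n _ (divr_gt0 e0 G10).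
have M0' : 0 < M by exact: lt_trans M1.
have [phi tp hp] := Vad e e0; have [rho [C [r0 C0 hC]]] := test_field_core oOm bOm tp.
(* The order of the choices matters: [eta] depends on [T] alone, then [V1] on [eta], then [C'] on
   [V1] and the collar; only afterwards are [k] and [l] taken large. *)
have [L0 hL0] := hw _ (divr_gt0 e0 (ltr0n R 2)); have [_ _ hT0] := hL0 L0 (leqnn _).
have [eta eta0 heta] := integral_small_sets iT (Cw L0) e0 hT0.
have [V1 [oO bO hO ch]] := charts M1 eta0.
have [C' C'0 hC'] := collar_boundR oOm bOm M00 charts0 oO M0' r0 ch.
(* A common majorant of [C] and [C'], so that one requirement of L1 closeness to within [e / CC]
   covers both uses. *)
pose CC := C + C' + 1; have CC0 : 0 < CC by rewrite ltr_wpDl// addr_ge0.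
have [K3 h3] := zu _ (divr_gt0 e0 CC0); have [K4 h4] := zA e e0; have [L1 hL1] := hw _ (divr_gt0 e0 CC0).
have [L2 hL2] := hw e e0.
pose k := maxn K0 (maxn K3 K4); pose l := maxn L1 L2.
have [dl _ _] := hL1 l (leq_maxl _ _); have [_ gl tl] := hL2 l (leq_maxr _ _).
have kK0 : (K0 <= k)%N by exact: leq_maxl.
have kK3 : (K3 <= k)%N by rewrite /k !leq_max leqnn orbT.
have kK4 : (K4 <= k)%N by rewrite /k !leq_max leqnn !orbT.
have dk := h3 k kK3; have Ek := h4 k kK4; have Gk := zG k kK0.
have bT : \int[haus]_(x in Fr `&` V1) `|T x| <= e.
  by apply: heta => //; apply: closed_open_hmble => //; exact: frontier_closed.
have cmp := boundary_compare iT (Cw l) (Cz k) oO bO.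
have Cd (d : R) (D : R) : 0 <= D -> D <= C + C' -> 0 <= d -> d <= e / CC -> D * d <= e.
  move=> D0 DC d0 hd; apply: (@le_trans _ _ (CC * (e / CC))); last by rewrite mulrC divfK// gt_eqF.
  by apply: ler_pM => //; rewrite /CC (le_trans DC)// lerDl.
have dl0 : 0 <= \int[leb]_(x in Om) `|w_ l x - u x| by exact: Rintegral_ge0.
have dk0 : 0 <= \int[leb]_(x in Om) `|z_ k x - u x| by exact: Rintegral_ge0.
have q1 := Cd _ _ C0 (_ : C <= C + C') dl0 dl; rewrite lerDl in q1; have {}q1 := q1 C'0.
have q2 := Cd _ _ C0 (_ : C <= C + C') dk0 dk; rewrite lerDl in q2; have {}q2 := q2 C'0.
have q3 := Cd _ _ C'0 (_ : C' <= C + C') dl0 dl; rewrite lerDr in q3; have {}q3 := q3 C0.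
have q4 := Cd _ _ C'0 (_ : C' <= C + C') dk0 dk; rewrite lerDr in q4; have {}q4 := q4 C0.
have [Cwz _] := C1D (Cw l) (C1N (Cz k)).1.
have bD : bmeas (Om `\` core Om rho).
  by apply: (bmeasS _ _ bOm); [apply: measurableD => //; exact: (core_bmeas r0 bOm).1|exact: subDsetl].
have tlk := tgradB bD (Cw l) (Cz k).
have tcl := hC _ _ (Cw l) iu; have tck := hC _ _ (Cz k) iu.
have D1 := hC' _ Cwz.
have dkl : \int[leb]_(x in Om) `|w_ l x - z_ k x| <= \int[leb]_(x in Om) `|w_ l x - u x| + \int[leb]_(x in Om) `|z_ k x - u x|.
  rewrite -(Rint_add mO (iB _ (Cw l)) (iB _ (Cz k))).
  apply: (le_Rintegral mO (rintegrable_norm mO (iC _ Cwz)) (rintegrableD mO (iB _ (Cw l)) (iB _ (Cz k)))) => x _.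
  by rewrite (distrC (z_ k x)) (le_trans _ (ler_normD _ _))// addrA subrK.
have {}D1 : \int[haus]_(x in Fr `\` V1) `|w_ l x - z_ k x| <= M ^+ n * (tgrad Om (z_ k) - V + 5 * e) + 2 * e.
  apply: (le_trans D1); rewrite lerD//.
    by rewrite ler_wpM2l ?exprn_ge0 ?(ltW M0')//; exact: collar_arith tlk tcl tck gl hp q1 q2.
  apply: (le_trans (ler_wpM2l C'0 dkl)); rewrite mulrDr (mulr_natl e 2) mulr2n.
  by rewrite lerD.
have Vg := deficit_arith (tgrad_ge0 (Om `\` core Om rho) (z_ k)) tck hp q2.
have hk : `|b| * M ^+ n <= 1 + e / (G + 1) by apply: le_trans hM; rewrite ler_piMl// exprn_ge0// ltW.
have k0 : 0 <= `|b| * M ^+ n by rewrite mulr_ge0// exprn_ge0// ltW.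
have {}cmp : b * \int[haus]_(x in Fr) `|T x| - b * \int[haus]_(x in Fr) `|z_ k x| <=
    `|b| * M ^+ n * (tgrad Om (z_ k) - V + 5 * e) + 4 * e.
  apply: (le_trans cmp); apply: (@le_trans _ _ (`|b| * (M ^+ n * (tgrad Om (z_ k) - V + 5 * e) + 4 * e))).
    rewrite ler_wpM2l// (_ : 4 * e = e + 2 * e + e - 0) ?subr0; last by ring.
    by rewrite addrA lerD// (addrC e) addrA (addrC _ e) lerD.
  by rewrite mulrDr mulrA lerD2l ler_piMl// mulr_ge0// ltW.
exact: energy_arith k0 hk e0 e1 G0 Gk V0 Vg Ek cmp.
Qed.

End semicontinuity.

Lemma mid_sub (R : realFieldType) (a b c : R) : 2^-1 * (a + b) - c = 2^-1 * (a - c) + 2^-1 * (b - c).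
Proof. by field. Qed.

Lemma parallelogram_arith (R : realFieldType) (A B C a b c d s e : R) : d = A + B - C -> A = 2 * a -> B = 2 * b -> C = 4 * c -> a <= s + e / 8 ->
  b <= s + e / 8 -> s - e / 8 <= c -> d <= e.
Proof. by move=> -> -> -> ->; lra. Qed.

(** * C1 approximation of Lipschitz functions *)

Section lipschitz_functions.
Context {R : realType} {n : nat}.
Implicit Types (a b x y z v : 'rV[R]_n) (h : 'rV[R]_n -> R).
Local Notation leb := (@leb R n).

(** The Lipschitz bound is tested on a small step in the direction of the gradient, where the
    first-order term is the full norm. *)
Lemma lipschitz_at_grad h x (d L : R) : C1 h -> 0 < d -> 0 <= L ->
  (forall y, enorm (y - x) < d -> `|h y - h x| <= L * enorm (y - x)) -> enorm (grad h x) <= L.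
Proof.
move=> Ch d0 L0 hL; apply/ler_addgt0Pr => e e0; pose v := grad h x.
have [d' d'0 hd] := C1_unif_diff Ch (set1_bmeas x).2 e0.
have [v0|v0] := eqVneq (enorm v) 0; first by rewrite -/v v0 addr_ge0// ltW.
have vp : 0 < enorm v by rewrite lt_neqAle eq_sym v0 enorm_ge0.
pose t := Num.min d d' / (2 * enorm v).
have t0 : 0 < t by rewrite divr_gt0 ?lt_min ?d0// mulr_gt0.
have tv : enorm (t *: v) = Num.min d d' / 2 by rewrite enormZ gtr0_norm// /t; field; rewrite gt_eqF.
have td : enorm (t *: v) < Num.min d d' by rewrite tv ltr_pdivrMr// ltr_pMr ?ltr1n// lt_min d0.
have [td1 td2] : enorm (t *: v) < d /\ enorm (t *: v) < d' by move: td; rewrite lt_min => /andP.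
have := hd x (t *: v) erefl td2; have := hL (x + t *: v); rewrite addrC addKr => /(_ td1).
rewrite addrC dotZl -enorm_sqr enormZ (gtr0_norm t0) => h1 h2.
have : t * enorm v ^+ 2 <= L * (t * enorm v) + e * (t * enorm v).
  by move: h1 h2; rewrite !ler_norml => /andP[_ h1] /andP[h2 _]; move: h1 h2; clear; lra.
by rewrite -mulrDl expr2 mulrA (mulrC (L + e)) ler_pM2l// mulr_gt0.
Qed.

Variables (g : 'rV[R]_n -> R) (L : R).
Hypotheses (L0 : 0 <= L) (gL : forall a b, `|g a - g b| <= L * enorm (a - b)).

Lemma lipschitz_cont : continuous g.
Proof.
move=> x; apply/(@cvgrPdist_le _ _ _ (nbhs x) (nbhs_filter x)) => e e0; have L10 : 0 < L + 1 by rewrite ltr_wpDl.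
apply/nbhs_eball; exists (e / (L + 1)); first exact: divr_gt0.
move=> y yx /=; apply: (le_trans (gL x y)); rewrite enormBC.
apply: (@le_trans _ _ ((L + 1) * (e / (L + 1)))); last by rewrite mulrC divfK// gt_eqF.
by apply: ler_pM => //; [exact: enorm_ge0|rewrite lerDl|exact: ltW].
Qed.

(** A convex class, with the same Lipschitz constant as [g]: the midpoint of two members is a
    member, which the parallelogram identity requires. *)
Definition near_lipschitz (D : set 'rV[R]_n) (d : R) h := [/\ C1 h, forall x, D x -> `|h x - g x| <= d &
  forall x y, D x -> D y -> `|h x - h y| <= L * enorm (x - y)].

Lemma near_lipschitz_exists a0 (r d : R) : 0 < d -> exists h, near_lipschitz (eball a0 r) d h.
Proof.
move=> d0; have L10 : 0 < L + 1 by rewrite ltr_wpDl.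
pose rr := d / (L + 1); have rr0 : 0 < rr by exact: divr_gt0.
have [K [CK K0 Ke Ks K1]] := @mollifier_exists R n rr rr0.
pose D := [set y | enorm (y - a0) <= r + rr]; have bD : bmeas D by exact: closed_eball_bmeas.
have cg := lipschitz_cont; have cK := C1_cont CK.
have [Ch _] := conv_C1 bD (cont_integrable bD cg) CK.
have iK (p : 'rV[R]_n -> R) : continuous p -> rintegrable leb setT (fun z => p z * K z).
  move=> cp; apply: (@cont_supp_integrable _ _ 0 rr); first exact: rcontM.
  by move=> z; rewrite subr0 => /Ks ->; rewrite mulr0.
have avg (p q : 'rV[R]_n -> R) (c : R) : continuous p -> continuous q -> (forall z, enorm z < rr -> `|p z - q z| <= c) ->
    `|\int[leb]_z (p z * K z) - \int[leb]_z (q z * K z)| <= c.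
  move=> cp cq pq; have i1 := iK _ cp; have i2 := iK _ cq.
  have cc : continuous ((fun=> c) : 'rV[R]_n -> R) by exact: cst_continuous.
  have i3 := iK _ cc; have i12 := rintegrableB measurableT i1 i2.
  rewrite -(Rint_sub measurableT i1 i2); apply: (le_trans (Rintegral_le_norm measurableT i12)).
  have -> : c = \int[leb]_z (c * K z).
    rewrite Rint_scale ?K1 ?mulr1//; apply: (@cont_supp_integrable _ _ 0 rr) => // z.
    by rewrite subr0; exact: Ks.
  apply: (le_Rintegral measurableT (rintegrable_norm measurableT i12) i3) => z _.
  rewrite -mulrBl normrM (ger0_norm (K0 z)); have [zr|/Ks ->] := ltP (enorm z) rr; last by rewrite !mulr0.
  by rewrite ler_wpM2r// pq.
have hE x : eball a0 r x -> \int[leb]_(y in D) (g y * K (y - x)) = \int[leb]_z (g (z + x) * K z).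
  move=> xr; rewrite -(Rintegral_supp (D := D)) => [|y nD]; last first.
    rewrite Ks ?mulr0// leNgt; apply/negP => yx; apply: nD; rewrite /D/=.
    by have := enorm_triangle x y a0; move: xr yx; rewrite /eball/=; lra.
  have ii : rintegrable leb setT (fun y => g y * K (y - x)).
    apply: (@cont_supp_integrable _ _ x rr); first by apply: rcontM => //; exact: rcont_shiftB.
    by move=> z /Ks ->; rewrite mulr0.
  by rewrite -(Rintegral_shift x ii); apply: eq_Rintegral => z _; rewrite addrK.
exists (fun x => \int[leb]_(y in D) (g y * K (y - x))); split => // [x xr|x y xr yr].
  rewrite hE//; have -> : g x = \int[leb]_z (g x * K z).
    rewrite Rint_scale ?K1 ?mulr1//; apply: (@cont_supp_integrable _ _ 0 rr) => // z.
    by rewrite subr0; exact: Ks.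
  apply: avg => [||z zr]; [exact: rcont_shift|exact: cst_continuous|].
  apply: (le_trans (gL _ _)); rewrite addrK; apply: (@le_trans _ _ ((L + 1) * rr)); last first.
    by rewrite mulrC divfK// gt_eqF.
  by apply: ler_pM => //; [exact: enorm_ge0|rewrite lerDl|exact: ltW].
rewrite !hE//; apply: avg => [||z zr]; [exact: rcont_shift|exact: rcont_shift|].
by apply: (le_trans (gL _ _)); rewrite opprD addrACA subrr add0r.
Qed.

Section energy_minimization.
Variables (a0 : 'rV[R]_n) (r : R).
Let D := eball a0 r.

Lemma eball_bmeas : bmeas D.
Proof. by split; [apply: open_lmble; exact: eball_open|exact: eball_bounded]. Qed.

Let bD := eball_bmeas.
Let mD := bD.1.

Definition dirichlet h : R := \int[leb]_(x in D) dot (grad h x) (grad h x).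

Lemma dot_cont (p q : 'rV[R]_n -> 'rV[R]_n) : continuous p -> continuous q -> continuous (fun x => dot (p x) (q x)).
Proof.
move=> cp cq; apply: rcont_sum => i; have cc (k : 'rV[R]_n -> 'rV[R]_n) : continuous k -> continuous (fun x => k x 0 i).
  by move=> ck x; apply: (@continuous_comp _ _ _ k (fun y : 'rV[R]_n => y 0 i)); [exact: ck|exact: coord_continuous].
by apply: rcontM; exact: cc.
Qed.

Lemma dirichlet_integrable h k : C1 h -> C1 k -> rintegrable leb D (fun x => dot (grad h x) (grad k x)).
Proof. by move=> Ch Ck; apply: (cont_integrable bD); apply: dot_cont; exact: grad_cont. Qed.

Lemma near_lipschitz_grad d h x : near_lipschitz D d h -> D x -> enorm (grad h x) <= L.
Proof.
move=> [Ch _ hL] Dx; have /nbhs_eball[q q0 hq] := open_nbhs_nbhs (conj (eball_open (x := a0) (r := r)) Dx).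
by apply: (lipschitz_at_grad Ch q0 L0) => y /hq yD; exact: hL.
Qed.

(* Uniform approximations of [g] with almost minimal Dirichlet energy have
   almost the same gradients, by the parallelogram identity. *)
Lemma near_minimizers e : 0 < e -> exists h_ : nat -> 'rV[R]_n -> R, (forall k, near_lipschitz D k.+1%:R^-1 (h_ k)) /\
  forall k l, dirichlet (fun x => h_ k x - h_ l x) <= e.
Proof.
move=> e0; pose S d := [set dirichlet h | h in near_lipschitz D d].
have Sn d : 0 < d -> S d !=set0 by move=> /(near_lipschitz_exists a0 r)[h hh]; exists (dirichlet h), h.
have Sb d : has_lbound (S d) by exists 0 => _ [h _ <-]; apply: Rintegral_ge0 => x _; exact: dot_ge0.
have e80 : 0 < e / 8 by rewrite divr_gt0.
(* The infimal energy grows as [d] decreases and is bounded by the integral of [L ^+ 2]. At a [d0]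
   where it is within [e / 8] of its supremum, every finer approximation with energy near that
   supremum is almost minimal in the class of [d0], and so is every midpoint. *)
pose Q := [set inf (S d) | d in [set d : R | 0 < d]].
have Qs : has_sup Q.
  split; first by exists (inf (S 1)), 1 => /=.
  exists (\int[leb]_(x in D) L ^+ 2) => _ [d /= d0 <-].
  have [h hh] := near_lipschitz_exists a0 r d0; have [Ch _ _] := hh.
  apply: (le_trans (ge_inf (Sb d) _)); first by exists h.
  apply: (le_Rintegral mD (dirichlet_integrable Ch Ch)) => [|x Dx].
    by apply: (cont_integrable bD); exact: cst_continuous.
  by rewrite -enorm_sqr lerXn2r ?nnegrE ?enorm_ge0//; exact: near_lipschitz_grad hh Dx.
have [_ [d0 /= d00 <-] hd0] := sup_adherent e80 Qs.
have ex (k : nat) : exists h, [/\ near_lipschitz D k.+1%:R^-1 h, near_lipschitz D d0 h & dirichlet h <= sup Q + e / 8].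
  have m0 : 0 < Num.min d0 k.+1%:R^-1 by rewrite lt_min d00 invr_gt0 ltr0n.
  have [_ [h [Ch hd hL] <-] hE] := inf_adherent e80 (conj (Sn _ m0) (Sb _)).
  exists h; split.
  - by split => // x /hd/le_trans; apply; rewrite ge_min lexx orbT.
  - by split => // x /hd/le_trans; apply; rewrite ge_min lexx.
  - by rewrite (le_trans (ltW hE))// lerD2r; apply: ub_le_sup; [exact: Qs.2|exists (Num.min d0 k.+1%:R^-1)].
have /choice[h_ hh] := ex; exists h_; split=> [k|k l]; first by have [] := hh k.
have [_ [Ck dk Lk] Ek] := hh k; have [_ [Cl dl Ll] El] := hh l.
have [Cs gs] := C1D Ck Cl; have [Ca ga] := C1Z 2^-1 Cs; have [CB gB] := C1D Ck (C1N Cl).1.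
have avgN : near_lipschitz D d0 (fun x => 2^-1 * (h_ k x + h_ l x)).
  split => // [x Dx|x y Dx Dy].
    rewrite mid_sub (le_trans (ler_normD _ _))// !normrM ger0_norm// -mulrDr.
    by rewrite ler_pdivrMl// (mulr_natl _ 2) mulr2n lerD// ?dk ?dl.
  rewrite -mulrBr normrM ger0_norm// ler_pdivrMl// opprD addrACA (le_trans (ler_normD _ _))//.
  by rewrite (mulr_natl _ 2) mulr2n lerD// ?Lk ?Ll.
have Ea : sup Q - e / 8 <= dirichlet (fun x => 2^-1 * (h_ k x + h_ l x)).
  by apply: (le_trans (ltW hd0)); apply: (ge_inf (Sb d0)); exists (fun x => 2^-1 * (h_ k x + h_ l x)).
have i1 := rintegrableZ 2 mD (dirichlet_integrable Ck Ck); have i2 := rintegrableZ 2 mD (dirichlet_integrable Cl Cl).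
have i3 := rintegrableZ 4 mD (dirichlet_integrable Ca Ca).
have par : dirichlet (fun x => h_ k x - h_ l x) = \int[leb]_(x in D) (2 * dot (grad (h_ k) x) (grad (h_ k) x)) +
    \int[leb]_(x in D) (2 * dot (grad (h_ l) x) (grad (h_ l) x)) - \int[leb]_(x in D)
    (4 * dot (grad (fun x => 2^-1 * (h_ k x + h_ l x)) x) (grad (fun x => 2^-1 * (h_ k x + h_ l x)) x)).
  rewrite -(Rint_add mD i1 i2) -(Rint_sub mD (rintegrableD mD i1 i2) i3); apply: eq_Rintegral => x _.
  rewrite gB ga gs (C1N Cl).2 dotZl dotZr !(dotDl, dotDr, dotNl, dotNr) (dotC (grad (h_ l) x) (grad (h_ k) x)).
  by field.
exact: parallelogram_arith par (Rint_scale 2 mD (dirichlet_integrable Ck Ck))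
  (Rint_scale 2 mD (dirichlet_integrable Cl Cl)) (Rint_scale 4 mD (dirichlet_integrable Ca Ca)) Ek El Ea.
Qed.

Lemma near_lipschitz_tgrad e : 0 < e -> exists h_ : nat -> 'rV[R]_n -> R, (forall k, near_lipschitz D k.+1%:R^-1 (h_ k)) /\
  forall k l, tgrad D (fun x => h_ k x - h_ l x) <= e.
Proof.
move=> e0; pose v := fine (leb D); have v0 : 0 <= v by rewrite fine_ge0.
have v10 : 0 < v + 1 by rewrite ltr_wpDl.
pose t := e / (v + 1); have t0 : 0 < t by exact: divr_gt0.
have [h_ [hh hE]] := near_minimizers (mulr_gt0 e0 t0); exists h_; split => // k l.
have [Ck _ _] := hh k; have [Cl _ _] := hh l; have [CB _] := C1D Ck (C1N Cl).1.
set f := (fun x => h_ k x - h_ l x) in CB *.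
have i1 : rintegrable leb D (fun=> t / 2) by apply: (cont_integrable bD); exact: cst_continuous.
have i2 := rintegrableZ (2 * t)^-1 mD (dirichlet_integrable CB CB).
apply: (@le_trans _ _ (\int[leb]_(x in D) (t / 2 + (2 * t)^-1 * dot (grad f x) (grad f x)))).
  apply: (le_Rintegral mD (tgrad_integrable bD CB) (rintegrableD mD i1 i2)) => x _.
  (* AM-GM *)
  rewrite -enorm_sqr -subr_ge0; set q := enorm _.
  have -> : t / 2 + (2 * t)^-1 * q ^+ 2 - q = (2 * t)^-1 * (q - t) ^+ 2 by field; rewrite gt_eqF.
  by rewrite mulr_ge0 ?sqr_ge0// invr_ge0 mulr_ge0// ltW.
rewrite (Rint_add mD i1 i2) (Rint_scale _ mD (dirichlet_integrable CB CB)) (Rintegral_cst leb mD) -/v.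
have h1 : t / 2 * v <= e / 2.
  rewrite mulrAC ler_wpM2r// /t mulrAC ler_pdivrMr// ler_wpM2l ?(ltW e0)//.
  by rewrite lerDl.
have h2 : (2 * t)^-1 * dirichlet f <= e / 2.
  have -> : e / 2 = (2 * t)^-1 * (e * t) by field; rewrite gt_eqF.
  by apply: ler_wpM2l; [rewrite invr_ge0 mulr_ge0// ltW|exact: hE].
by rewrite [leRHS]splitr lerD.
Qed.

End energy_minimization.

Lemma Rintegral_disjoint (I : eqType) (s : seq I) (E : I -> set 'rV[R]_n) (f : 'rV[R]_n -> R) U : lmble U ->
  rintegrable leb U f -> (forall x, 0 <= f x) -> (forall i, lmble (E i)) -> uniq s ->
  (forall i, i \in s -> E i `<=` U) -> (forall i j x, i \in s -> j \in s -> E i x -> E j x -> i = j) ->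
  \sum_(i <- s) \int[leb]_(x in E i) f x <= \int[leb]_(x in U) f x.
Proof.
move=> mU jf f0 mE; elim: s U mU jf => [|i s IH] U mU jf; first by rewrite big_nil => *; exact: Rintegral_ge0.
move=> /= /andP[nis us] EU dis; have iU := EU i (mem_head _ _).
have mUD : lmble (U `\` E i) by exact: measurableD.
rewrite big_cons (Rintegral_setD (mE i) mU iU jf) lerD2l; apply: IH => //.
- by apply: rintegrableS jf => //; exact: subDsetl.
- move=> j js x Ejx; split; first by apply: (EU j) Ejx; rewrite inE js orbT.
  by move=> Eix; move: nis; rewrite (dis i j x (mem_head _ _) _ Eix Ejx) ?js// inE js orbT.
- by move=> j k x js ks; apply: dis; rewrite inE ?js ?ks orbT.
Qed.

(* A substitute for Rademacher's theorem. *)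
Lemma lipschitz_C1_approx a0 (r e eta : R) : 0 < r -> 0 < e -> e <= 1 -> 0 < eta -> exists h O',
  [/\ C1 h, open O', (lebesgue_outer O' <= eta%:E)%E &
  forall a b, eball a0 r a -> ~ O' a -> eball a0 r b -> `|(g b - h b) - (g a - h a)| <= e * enorm (b - a)].
Proof.
move=> r0 e0 e1 eta0; have L10 : 0 < 8 * (L + 1) by rewrite mulr_gt0// ltr_wpDl.
(* Moving an endpoint by [th * rho] changes [f] by at most [2 * (L + 1) * th * rho], a quarter of
   [e * rho]. *)
pose th := e / (8 * (L + 1)); have th0 : 0 < th by exact: divr_gt0.
have th1 : th <= 1.
  by rewrite /th ler_pdivrMr// mul1r (le_trans e1)// (le_trans (y := 8))// ?ler1n// ler_peMr// lerDr.
pose b1 : R := fine (lebesgue_outer (eball (0 : 'rV[R]_n) 1)).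
have b10 : 0 < b1 by rewrite -lte_fin -lebesgue_outer_eball1_fin; exact: lebesgue_outer_eball1_gt0.
have bE x rho : 0 < rho -> fine (leb (eball x rho)) = b1 * rho ^+ n.
  by move=> p0; rewrite /leb/= lebesgue_outer_eball// lebesgue_outer_eball1_fin.
(* A translation increment of at least [e * rho / 4] over a ball of radius [th * rho], divided by
   the length [rho] of the translation, contributes [c * rho ^+ n]. *)
pose c := e / 4 * (b1 * th ^+ n); have c0 : 0 < c by rewrite !mulr_gt0// exprn_gt0.
pose Cv := b1 * 6 ^+ n; have Cv0 : 0 < Cv by rewrite mulr_gt0// exprn_gt0.
(* The Vitali bound [Cv * (e2 / c)] on the bad set is then [eta / 2]; the factor [6 ^+ n] in [Cv]
   comes from tripling balls of radius [2 * rho]. *)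
pose e2 := c * (eta / 2) / Cv; have e20 : 0 < e2 by rewrite divr_gt0// mulr_gt0// divr_gt0.
(* Large enough to contain the balls of radius [2 * rho a <= 4 * r] about points of the ball of
   radius [r]. *)
pose D := eball a0 (6 * r); have bD : bmeas D := eball_bmeas a0 (6 * r); have mD := bD.1.
have [h_ [hh hT]] := near_lipschitz_tgrad a0 (6 * r) e20.
pose h := h_ 0%N; have [Ch _ Lh] := hh 0%N.
pose f x := g x - h x.
have fL x y : D x -> D y -> `|f x - f y| <= 2 * (L + 1) * enorm (x - y).
  move=> Dx Dy; have -> : f x - f y = (g x - g y) - (h x - h y) by rewrite /f; ring.
  apply: (le_trans (ler_normB _ _)); apply: (le_trans (lerD (gL x y) (Lh x y Dx Dy))).
  by have := enorm_ge0 (x - y); set q := enorm _ => q0; rewrite -mulrDl ler_wpM2r//; clear -L0 gL; lra.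
pose Bad := [set a | eball a0 r a /\ exists2 b, eball a0 r b & e * enorm (b - a) < `|f b - f a|].
have /choice[q hq] : forall a, exists b, Bad a -> eball a0 r b /\ e * enorm (b - a) < `|f b - f a|.
  by move=> a; have [[_ [b b1' b2]]|nB] := pselect (Bad a); [exists b|exists 0].
pose rho a := enorm (q a - a).
have rhoP a : Bad a -> 0 < rho a <= 2 * r.
  move=> Ba; have [qr qf] := hq a Ba; have [ar _] := Ba; apply/andP; split.
    rewrite lt_neqAle enorm_ge0 andbT eq_sym; apply/eqP => /enorm_eq0/subr0_eq qa.
    by move: qf; rewrite qa !subrr enorm0 mulr0 normr0 ltxx.
  have := enorm_triangle a0 (q a) a; rewrite (enormBC a0 a); move: qr ar; rewrite /eball/= /rho; clear -L0 gL; lra.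
have sub2 a : Bad a -> eball a (2 * rho a) `<=` D.
  move=> Ba y; have /andP[_ p2] := rhoP a Ba; have [ar _] := Ba.
  have := enorm_triangle a y a0; move: ar; rewrite /eball/= /D /eball/=; move: p2 r0; clear -L0 gL; lra.
(* At a bad point [g - h] jumps by more than [e * rho]. Once [h_ l] is close enough to [g], the C1
   function [h_ l - h] inherits a fixed part of this jump on a whole small ball, so its gradient
   must carry mass near [a]. *)
have one a l : Bad a -> 8 * l.+1%:R^-1 <= e * rho a ->
    c * rho a ^+ n <= \int[leb]_(x in eball a (2 * rho a)) enorm (grad (fun x => h_ l x - h x) x).
  move=> Ba hl; have [qr qf] := hq a Ba; have /andP[p0 p2] := rhoP a Ba.
  have [Cl dl _] := hh l; pose F x := h_ l x - h x; have [CF _] := C1D Cl (C1N Ch).1; rewrite -/F in CF.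
  pose E := eball a (th * rho a); pose U := eball a (2 * rho a); pose v := q a - a.
  have bEb : bmeas E := eball_bmeas a _; have bU : bmeas U := eball_bmeas a _.
  have thr : th * rho a <= rho a by exact: (ler_piMl (ltW p0) th1).
  have seg x t : E x -> 0 <= t <= 1 -> U (x + t *: v).
    move=> Ex /andP[t0 t1]; rewrite /U/eball/= addrAC (le_lt_trans (enormD _ _))// enormZ ger0_norm//.
    have : t * enorm v <= rho a by rewrite ler_piMl// enorm_ge0.
    by move: Ex thr; rewrite /E/eball/= -/(rho a) /v; clear -L0 gL; lra.
  have tr := Rintegral_translate CF bEb bU seg.
  have lower : c * rho a ^+ n * rho a <= \int[leb]_(x in E) `|F (x + v) - F x|.
    have -> : c * rho a ^+ n * rho a = e * rho a / 4 * fine (leb E).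
      have -> : fine (leb E) = b1 * (th ^+ n * rho a ^+ n).
        by rewrite (bE a _ (mulr_gt0 th0 p0)); congr (_ * _); exact: exprMn.
      by rewrite /c; ring.
    rewrite -(Rintegral_cst leb bEb.1); apply: (le_Rintegral bEb.1) => [||x Ex].
    - by apply: (cont_integrable bEb); exact: cst_continuous.
    - apply: (cont_integrable bEb); apply: rcont_norm; apply: rcontD; last by apply: rcontN; exact: C1_cont.
      by apply: rcont_shift; exact: C1_cont.
    have Ux : D x by apply: (sub2 a Ba); have := seg x 0 Ex; rewrite scale0r addr0; apply; rewrite lexx ler01.
    have Uv : D (x + v) by apply: (sub2 a Ba); have := seg x 1 Ex; rewrite scale1r; apply; rewrite lexx ler01.
    have Da : D a by apply: (sub2 a Ba); rewrite /eball/= subrr enorm0 mulr_gt0.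
    have Dq : D (q a).
      by apply: (sub2 a Ba); rewrite /eball/= -/(rho a) ltr_pMl// ltr1n.
    have k1 := fL (x + v) (q a) Uv Dq; have k2 := fL x a Ux Da.
    have k3 := dl (x + v) Uv; have k4 := dl x Ux.
    have xa : 2 * (L + 1) * enorm (x - a) <= e * rho a / 4.
      have -> : e * rho a / 4 = 2 * (L + 1) * (th * rho a) by rewrite /th; field; rewrite gt_eqF// ltr_wpDl.
      by rewrite ler_wpM2l ?mulr_ge0 ?addr_ge0// ltW.
    have vE : x + v - q a = x - a by rewrite /v addrA addrAC addrK.
    rewrite vE in k1; move: qf; rewrite -/(rho a) => qf.
    (* Of the jump [e * rho], two approximation errors take an eighth each and two displacements a
       quarter each; a quarter remains for [F]. *)
    have dec : f (q a) - f a = (F (x + v) - F x) - (h_ l (x + v) - g (x + v)) + (h_ l x - g x)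
        - (f (x + v) - f (q a)) + (f x - f a) by rewrite /f /F; ring.
    move: qf k1 k2 k3 k4 xa hl; rewrite dec; clear -L0 gL.
    set A := F (x + v) - F x; move: (h_ l (x + v) - g (x + v)) (h_ l x - g x) (f (x + v) - f (q a)) (f x - f a) => B1 B2 B3 B4.
    set P := 2 * (L + 1) * _; set Q := e * rho a => h1 h2 h3 h4 h5 h6 h7.
    have := ler_normD (A - B1 + B2 - B3) B4; have := ler_normB (A - B1 + B2) B3; have := ler_normD (A - B1) B2.
    have := ler_normB A B1; move: h1 h2 h3 h4 h5 h6 h7; move: l.+1%:R^-1 => z; lra.
  have upper : \int[leb]_(x in U) `|dot v (grad F x)| <= rho a * \int[leb]_(x in U) enorm (grad F x).
    rewrite -(Rint_scale _ bU.1 (tgrad_integrable bU CF)).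
    apply: (le_Rintegral bU.1 _ (rintegrableZ _ bU.1 (tgrad_integrable bU CF))) => [|x _]; last exact: dot_le.
    by apply: (cont_integrable bU); exact: cont_dot_grad.
  by have := le_trans (le_trans lower tr) upper; rewrite mulrC ler_pM2l.
have hBad : (lebesgue_outer Bad <= (eta / 2)%:E)%E.
  have -> : eta / 2 = Cv * (e2 / c) by rewrite /e2; field; rewrite !gt_eqF.
  apply: (@vitali_bound R n lebesgue_outer Bad rho 2 Cv (e2 / c) (2 * r) n) => //.
  - by move=> X; exact: outer_measure_ge0.
  - exact: le_outer_measure.
  - exact: ltW.
  - move=> x Bx; have /andP[p0 _] := rhoP x Bx.
    rewrite lebesgue_outer_eball ?mulr_gt0// lebesgue_outer_eball1_fin -EFinM lee_fin -/b1 /Cv.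
    rewrite (_ : 3 * (2 * rho x) = 6 * rho x); last by ring.
    by rewrite (_ : (6 * rho x) ^+ n = 6 ^+ n * rho x ^+ n) ?mulrA//; exact: exprMn.
  - move=> s us sB dis; rewrite ler_pdivlMr// mulrC mulr_sumr.
    (* The index [l] may depend on the finite family, because the gradient bound [hT] is uniform in
       it. *)
    have [l hl] : exists l, forall x, x \in s -> 8 * l.+1%:R^-1 <= e * rho x.
      elim: s sB {us dis} => [|x s IH] sB; first by exists 0%N.
      have [l hl] := IH (fun y ys => sB y (mem_behead (s := x :: s) ys)).
      have /andP[p0 _] := rhoP x (sB x (mem_head _ _)).
      have ep : 0 < e * rho x by exact: mulr_gt0.
      exists (maxn l (Num.truncn (8 / (e * rho x)))) => y.
      rewrite inE => /orP[/eqP ->|ys]; last first.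
        by apply: le_trans (hl y ys); rewrite ler_wpM2l// lef_pV2 ?posrE// ler_nat ltnS leq_maxl.
      rewrite mulrC ler_pdivrMl// mulrC -ler_pdivrMl// mulrC (le_trans (ltW (truncnS_gt _)))//.
      by rewrite ler_nat ltnS leq_maxr.
    have [Cl _ _] := hh l; have [CF _] := C1D Cl (C1N Ch).1.
    apply: (le_trans _ (hT l 0%N)); apply: (@le_trans _ _ (\sum_(x <- s) \int[leb]_(y in eball x (2 * rho x)) enorm (grad (fun z => h_ l z - h z) y))).
      by rewrite big_seq [leRHS]big_seq; apply: ler_sum => x xs; apply: one; [exact: sB|exact: hl].
    apply: Rintegral_disjoint => //.
    - exact: tgrad_integrable.
    - by move=> x; exact: enorm_ge0.
    - by move=> x; apply: open_lmble; exact: eball_open.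
    - by move=> x xs; apply: sub2; exact: sB.
    - by move=> x y z xs ys zx zy; apply: dis => //; exists z.
have [W [oW BW lW]] := lebesgue_outer_open Bad (divr_gt0 eta0 (ltr0n R 2)).
exists h, W; split => //.
  by apply: (le_trans lW); rewrite [in leRHS](splitr eta) EFinD leeD2r.
move=> a b ar naW br; rewrite leNgt; apply/negP => hlt; apply: naW; apply: BW; split => //.
by exists b.
Qed.

End lipschitz_functions.

Lemma C1_strict_diff (R : realType) (n : nat) (g : 'rV[R]_n -> R) a0 (e : R) : C1 g -> 0 < e ->
  exists2 rho, 0 < rho & forall a b, enorm (a - a0) < rho -> enorm (b - a0) < rho ->
    `|g b - g a - dot (grad g a0) (b - a)| <= e * enorm (b - a).
Proof.
move=> Cg e0; have cg : continuous (fun x => enorm (grad g x - grad g a0)).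
  move=> x; apply: (@continuous_comp _ _ _ (fun x => grad g x - grad g a0) (@enorm R n)); last exact: enorm_continuous.
  by apply: (@continuous_comp _ _ _ (grad g) (fun y => y - grad g a0)); [exact: grad_cont|exact: subr_continuous].
have /nbhs_eball[rho r0 hr] : nbhs a0 [set x | enorm (grad g x - grad g a0) <= e].
  move: (cg a0) => /(@cvgrPdist_le _ _ _ (nbhs a0) (nbhs_filter a0))/(_ _ e0); apply: filterS => x /=.
  by rewrite subrr enorm0 sub0r normrN ger0_norm ?enorm_ge0.
exists rho => // a b ar br; have [t /andP[t0 t1] ht] := C1_mean_value a (b - a) Cg.
have ab : a + (b - a) = b by rewrite addrC subrK.
rewrite ab in ht; rewrite ht dotC -dotBl.
apply: (le_trans (dot_le _ _)); rewrite ler_wpM2r ?enorm_ge0//; apply: hr; rewrite /eball/=.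
have -> : a + t *: (b - a) - a0 = (1 - t) *: (a - a0) + t *: (b - a0).
  by apply/rowP => j; rewrite !mxE; ring.
rewrite (le_lt_trans (enormD _ _))// !enormZ !ger0_norm ?subr_ge0//.
have [->|tn] := eqVneq t 0; first by rewrite subr0 mul1r mul0r addr0.
have tp : 0 < t by rewrite lt_neqAle eq_sym tn.
have h1 : (1 - t) * enorm (a - a0) <= (1 - t) * rho by rewrite ler_wpM2l ?subr_ge0// ltW.
have h2 : t * enorm (b - a0) < t * rho by rewrite ltr_pM2l.
by have := ler_ltD h1 h2; rewrite -mulrDl subrK mul1r.
Qed.

Lemma flat_chartS (R : realType) (n : nat) (Om V V' : set 'rV[R]_n.+1) x (r M M' : R) nu : V `<=` V' -> M <= M' ->
  flat_chart Om V x r nu M -> flat_chart Om V' x r nu M'.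
Proof.
move=> VV MM [r0 nu1 fl push]; split => // [y z [[Fy nVy] yx] [[Fz nVz] zx]|y s [Fy nVy]]; last first.
  by apply: push; split => // /VV.
apply: (le_trans (fl y z _ _)); [by split => //; split => // /VV..|].
by rewrite ler_wpM2r// enorm_ge0.
Qed.

(** * Charts of the boundary *)

Section graph_chart.
Context {R : realType} {n : nat} (Om : set 'rV[R]_n.+1).
Implicit Types (x y z d : 'rV[R]_n.+1) (a b p : 'rV[R]_n).
Hypothesis oOm : open Om.
Variables (x0 : 'rV[R]_n.+1) (r : R) (Q : 'M[R]_n.+1) (i : 'I_n.+1) (g : 'rV[R]_n -> R).
Let A x : 'rV[R]_n := col' i (x *m Q).
Let h x : R := (x *m Q) 0 i.
Hypotheses (r0 : 0 < r) (QQ : Q *m Q^T = 1%:M) (graph : forall y, eball x0 r y -> (Om y <-> g (A y) < h y)).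
Let Fr := frontier Om.

Let AD x y : A (x + y) = A x + A y. Proof. by apply/rowP => j; rewrite /A mulmxDl !mxE. Qed.
Let AZ (t : R) x : A (t *: x) = t *: A x. Proof. by apply/rowP => j; rewrite /A -scalemxAl !mxE. Qed.
Let AN x : A (- x) = - A x. Proof. by apply/rowP => j; rewrite /A mulNmx !mxE. Qed.
Let hD x y : h (x + y) = h x + h y. Proof. by rewrite /h mulmxDl mxE. Qed.
Let hZ (t : R) x : h (t *: x) = t * h x. Proof. by rewrite /h -scalemxAl mxE. Qed.
Let hN x : h (- x) = - h x. Proof. by rewrite /h mulNmx mxE. Qed.

Let dot_split x y : dot x y = dot (A x) (A y) + h x * h y.
Proof.
rewrite -(dot_mulmx _ _ QQ) /dot (bigD1_ord i)//= addrC; congr (_ + _).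
by apply: eq_bigr => j _; rewrite /A !mxE.
Qed.

Let enorm_A x : enorm (A x) <= enorm x.
Proof. by rewrite !enormE ler_wsqrtr// (dot_split x x) lerDl -expr2 sqr_ge0. Qed.

Let norm_h x : `|h x| <= enorm x.
Proof. by rewrite enormE -sqrtr_sqr ler_wsqrtr// (dot_split x x) -expr2 lerDr dot_ge0. Qed.

Let enorm_le x : enorm x <= enorm (A x) + `|h x|.
Proof.
rewrite -(@ler_pXn2r _ 2)// ?nnegrE ?addr_ge0 ?enorm_ge0// enorm_sqr (dot_split x x) sqrrD enorm_sqr.
by rewrite real_normK ?num_real// -expr2 -addrA lerD2l lerDr mulrn_wge0// mulr_ge0 ?enorm_ge0.
Qed.

(** The inverse of [y |-> (A y, h y)]: the point with given horizontal part and height in the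
    rotated coordinates. *)
Definition graph_point a (t : R) : 'rV[R]_n.+1 := (\row_k oapp (fun j => a 0 j) t (unlift i k)) *m Q^T.

Let A_point a t : A (graph_point a t) = a.
Proof.
apply/rowP => j; rewrite /A /graph_point -mulmxA (orthogonal_trmx QQ) mulmx1 !mxE.
by rewrite liftK.
Qed.

Let h_point a t : h (graph_point a t) = t.
Proof. by rewrite /h /graph_point -mulmxA (orthogonal_trmx QQ) mulmx1 mxE unlift_none. Qed.

Let point_A y : graph_point (A y) (h y) = y.
Proof.
apply/eqP; rewrite -subr_eq0; apply/eqP; apply: dot_eq0.
by rewrite dot_split !AD !AN !hD !hN A_point h_point !subrr dot0r mulr0 addr0.
Qed.

Variable L : R.
Hypotheses (L0 : 0 <= L) (gL : forall a b, enorm (a - A x0) < r -> enorm (b - A x0) < r -> `|g a - g b| <= L * enorm (a - b)).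

Let A_ball y : eball x0 r y -> enorm (A y - A x0) < r.
Proof. by move=> yx; rewrite -AN -AD (le_lt_trans (enorm_A _)). Qed.

Lemma frontier_graph y : Fr y -> eball x0 r y -> h y = g (A y).
Proof.
move=> Fy yx; apply/eqP; rewrite eq_le; apply/andP; split.
  by rewrite leNgt; apply/negP => /(graph yx); exact: frontier_notin.
rewrite leNgt; apply/negP => hlt; pose gap := g (A y) - h y; have g0 : 0 < gap by rewrite subr_gt0.
pose t := Num.min (r - enorm (y - x0)) (gap / (1 + L)).
have L1 : 0 < 1 + L by rewrite ltr_pwDl.
have t0 : 0 < t by rewrite lt_min subr_gt0 yx divr_gt0.
have [clO _] := Fy; have [z [Oz zy]] : Om `&` eball y t !=set0 by apply: clO; apply/nbhs_eball; exists t.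
rewrite /eball/= lt_min in zy; case/andP: zy => zy1 zy2.
have zx : eball x0 r z by rewrite /eball/=; have := enorm_triangle y z x0; move: zy1; lra.
have := (graph zx).1 Oz; apply/negP; rewrite -leNgt.
have k1 := gL (A_ball yx) (A_ball zx); have k2 := enorm_A (z - y); have k3 := norm_h (z - y).
rewrite !AD !AN !hD !hN in k2 k3; rewrite (enormBC (A y)) in k1.
have k4 : L * enorm (A z - A y) <= L * enorm (z - y) by rewrite ler_wpM2l.
have k5 : (1 + L) * enorm (z - y) <= gap by rewrite mulrC -ler_pdivlMr// ltW.
move: k1 k3 k4 k5; rewrite /gap !ler_norml => /andP[_ k1] /andP[_ k3]; rewrite mulrDl mul1r; lra.
Qed.

Let nu0 := graph_point 0 1.

Let enorm_nu0 : enorm nu0 = 1.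
Proof. by rewrite enormE dot_split A_point h_point dot0r add0r mul1r sqrtr1. Qed.

(** An upward move by [s] raises the height by [s]. An error of [s / (1 + L)] lowers it by at most
    that amount and raises the graph by at most [L] times as much, which together never exceed
    [s]. *)
Lemma patch_graph : patch Om x0 (r / 4) nu0 (1 + L)^-1.
Proof.
move=> z s y Oz zx /andP[s0 sr] hy; have L1 : 0 < 1 + L by rewrite ltr_pwDl.
have cs : (1 + L)^-1 * s <= s by rewrite ler_piMl ?(ltW s0)// invf_le1// lerDl.
have r4 : r / 4 <= r by rewrite ler_pdivrMr// ler_peMr ?(ltW r0)// ler1n.
have zr : eball x0 r z by rewrite /eball/= (lt_le_trans zx).
have yr : eball x0 r y.
  rewrite /eball/=; have := enorm_triangle (z + s *: nu0) y x0; have := enormD (z - x0) (s *: nu0).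
  rewrite enormZ enorm_nu0 mulr1 gtr0_norm// addrAC; move: zx hy cs sr r0; lra.
apply/(graph yr); have /(graph zr) gz := Oz.
have k1 := gL (A_ball yr) (A_ball zr); have k2 := enorm_A (y - (z + s *: nu0)); have k3 := norm_h (y - (z + s *: nu0)).
rewrite !AD !AN !AD AZ A_point scaler0 addr0 in k2; rewrite hD hN hD hZ h_point mulr1 in k3.
have k4 : L * enorm (A y - A z) <= L * ((1 + L)^-1 * s) by rewrite ler_wpM2l// (le_trans k2).
have k5 : (1 + L)^-1 * s + L * ((1 + L)^-1 * s) = s by field; rewrite gt_eqF.
have k6 := le_trans k3 hy.
move: k1 k6; rewrite !ler_norml => /andP[_ k1] /andP[k6 _]; move: k1 k4 k5 k6 gz; lra.
Qed.

Lemma flat_chart_graph x1 : enorm (x1 - x0) < r / 2 -> flat_chart Om set0 x1 (r / 4) nu0 (1 + L).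
Proof.
move=> x1r; have L1 : 0 < 1 + L by rewrite ltr_pwDl.
have inr y : eball x1 (r / 4) y -> eball x0 r y.
  by rewrite /eball/= => yx; have := enorm_triangle x1 y x0; move: yx x1r r0; lra.
split => //; first by rewrite divr_gt0.
  move=> y z [[Fy _] yx] [[Fz _] zx]; have [yr zr] := (inr y yx, inr z zx).
  apply: (le_trans (enorm_le _)); rewrite mulrDl mul1r.
  have Ap : A (normal_proj nu0 (y - z)) = A (y - z) by rewrite /normal_proj AD AN AZ A_point scaler0 subr0.
  have k1 : enorm (A (y - z)) <= enorm (normal_proj nu0 (y - z)) by rewrite -Ap.
  rewrite lerD//; apply: (le_trans _ (ler_wpM2l L0 k1)).
  rewrite hD hN (frontier_graph Fy yr) (frontier_graph Fz zr) AD AN.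
  by apply: gL; exact: A_ball.
move=> y s [Fy _] yx /andP[s0 sr]; have yr := inr y yx.
have zr : eball x0 r (y + s *: nu0).
  rewrite /eball/=; have := enorm_triangle x1 (y + s *: nu0) x0; have := enormD (y - x1) (s *: nu0).
  rewrite enormZ enorm_nu0 mulr1 gtr0_norm// addrAC; move: yx x1r sr; rewrite /eball/=; lra.
apply/(graph zr); rewrite AD AZ A_point scaler0 addr0 hD hZ h_point mulr1 -(frontier_graph Fy yr).
by rewrite ltrDl.
Qed.

Let sq p : R := Num.sqrt (1 + dot p p).
(** The unit upward normal of the hyperplane of slope [p], that is [(-p, 1)] divided by its length
    [sq p]. *)
Let nu p := graph_point (- (sq p)^-1 *: p) (sq p)^-1.

(** If the graph is within slope error [e] of the hyperplane of slope [p], chords have normal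
    component at most [e] times their length, whence flatness with [M * (1 - e) >= 1]. Moving along
    [nu p] enters [Om] because [e * enorm p < 1 + dot p p]. The hypothesis is one-sided: only the
    base point [y] has to lie on the frontier off [V]. *)
Lemma flat_chart_slope V x1 (r1 : R) p (e M : R) : 0 < r1 -> enorm (x1 - x0) + 2 * r1 <= r -> 0 <= e -> e < 1 -> 1 <= M * (1 - e) ->
  (forall y z, Fr y -> ~ V y -> eball x1 r1 y -> eball x1 (2 * r1) z ->
    `|g (A z) - g (A y) - dot p (A z - A y)| <= e * enorm (A z - A y)) ->
  exists nu, flat_chart Om V x1 r1 nu M.
Proof.
move=> r10 x1r e0 e1 Me gp; pose s := sq p; have pp := dot_ge0 p; exists (nu p).
have s2 : s ^+ 2 = 1 + dot p p by rewrite sqr_sqrtr// addr_ge0.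
have s1 : 1 <= s by rewrite -[leLHS]sqrtr1 ler_wsqrtr// lerDl.
have s0 : 0 < s by exact: lt_le_trans s1.
have s1' : s^-1 <= 1 by rewrite invf_le1.
have M0 : 0 <= M.
  have e1' : 0 < 1 - e by rewrite subr_gt0.
  by rewrite -(@pmulr_lge0 _ (1 - e))// (le_trans _ Me).
have dn x : dot x (nu p) = s^-1 * (h x - dot p (A x)).
  by rewrite dot_split A_point h_point dotZr (dotC (A x)) mulNr mulrBr addrC (mulrC (h x)).
have nu1 : enorm (nu p) = 1.
  rewrite enormE dn A_point h_point dotZr -/s [X in Num.sqrt X](_ : _ = 1) ?sqrtr1//.
  by rewrite mulNr opprK -[X in X + _]mulr1 -mulrDr mulrA -s2 -expr2 exprVn mulVf// expf_neq0// gt_eqF.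
have inr y t : t <= 2 * r1 -> eball x1 t y -> eball x0 r y.
  rewrite /eball/= => t2 yx; have := enorm_triangle x1 y x0; move: yx x1r t2; lra.
have r12 : r1 <= 2 * r1 by rewrite (mulr_natl r1 2) mulr2n lerDl ltW.
split => //.
  move=> y z [[Fy nVy] yx] [[Fz nVz] zx]; have [yr zr] := (inr y _ r12 yx, inr z _ r12 zx).
  have yx2 : eball x1 (2 * r1) y by rewrite /eball/= (lt_le_trans yx).
  set d := y - z; set N := normal_proj (nu p) d.
  have k1 : `|dot d (nu p)| <= e * enorm d.
    rewrite dn normrM gtr0_norm ?invr_gt0// (le_trans (ler_piMl (normr_ge0 _) s1'))//.
    rewrite /d hD hN (frontier_graph Fy yr) (frontier_graph Fz zr) AD AN.
    by apply: (le_trans (gp z y Fz nVz zx yx2)); rewrite ler_wpM2l// -AN -AD.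
  have k2 : enorm d <= enorm N + `|dot d (nu p)|.
    have {1}-> : d = N + dot d (nu p) *: nu p by rewrite /N /normal_proj subrK.
    by rewrite (le_trans (enormD _ _))// enormZ nu1 mulr1.
  have k3 : (1 - e) * enorm d <= enorm N by rewrite mulrBl mul1r lerBlDr (le_trans k2)// lerD2l.
  apply: (@le_trans _ _ (M * (1 - e) * enorm d)); first by rewrite ler_peMl ?enorm_ge0.
  by rewrite -mulrA ler_wpM2l.
move=> y t [Fy nVy] yx /andP[t0 tr]; have yr := inr y _ r12 yx.
have zx : eball x1 (2 * r1) (y + t *: nu p).
  rewrite /eball/=; have := enormD (y - x1) (t *: nu p).
  rewrite enormZ nu1 mulr1 gtr0_norm// addrAC; move: yx tr; rewrite /eball/=; lra.
have zr := inr _ _ (lexx _) zx; apply/(graph zr).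
have := gp y _ Fy nVy yx zx; rewrite AD AZ A_point (addrC (A y)) addrK scalerA dotZr enormZ.
have ts : 0 < t / s by rewrite divr_gt0.
rewrite mulrN mulNr opprK normrN -/s (gtr0_norm ts) => k1.
rewrite hD hZ h_point (frontier_graph Fy yr) -/s.
have k2 : e * (t / s * enorm p) <= t / s * enorm p by apply: (ler_piMl _ (ltW e1)); rewrite mulr_ge0 ?enorm_ge0// ltW.
have k3 : t / s * enorm p < t / s * dot p p + t / s.
  rewrite -[X in _ + X]mulr1 -mulrDr ltr_pM2l// -enorm_sqr.
  have : 0 <= (enorm p - 2^-1) ^+ 2 by exact: sqr_ge0.
  by rewrite sqrrB; set q := enorm p; lra.
rewrite -ltrBlDl; apply: le_lt_trans (_ : _ <= t / s * enorm p - t / s * dot p p) _; last by rewrite ltrBlDl.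
by rewrite lerBrDr (le_trans _ k2)// (le_trans (ler_norm _) k1).
Qed.

Lemma C1_flat_chart (M : R) : C1 g -> 1 < M -> Fr x0 -> exists r1 nu, flat_chart Om set0 x0 r1 nu M.
Proof.
move=> Cg M1 F0; have M0 : 0 < M by exact: lt_trans M1.
have e0 : 0 < 1 - M^-1 by rewrite subr_gt0 invf_lt1.
have [rho rho0 hr] := C1_strict_diff (A x0) Cg e0.
pose r1 := Num.min r rho / 2; have r10 : 0 < r1 by rewrite divr_gt0// lt_min r0.
have r12 : 2 * r1 = Num.min r rho by rewrite /r1; field.
have [|||||nu2 hnu] := @flat_chart_slope set0 x0 r1 (grad g (A x0)) (1 - M^-1) M r10; last by exists r1, nu2.
- by rewrite subrr enorm0 add0r r12 ge_min lexx.
- exact: ltW.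
- by rewrite ltrBlDr ltrDl invr_gt0.
- by rewrite subKr mulfV// gt_eqF.
- move=> y z _ _ yx zx; apply: hr; rewrite -AN -AD (le_lt_trans (enorm_A _))//.
    apply: (lt_le_trans yx); rewrite (le_trans (y := 2 * r1))//; last by rewrite r12 ge_min lexx orbT.
    by rewrite (mulr_natl r1 2) mulr2n lerDl ltW.
  by apply: (lt_le_trans zx); rewrite r12 ge_min lexx orbT.
Qed.

(** [V] lies over the set [W] off which [g] differs from a C1 function [k] by a function with small
    increments; the slopes of the charts are gradients of [k]. The part of the frontier in [V] is a
    Lipschitz image of a subset of [W], hence small. *)
Lemma lipschitz_flat_chart (M eta : R) : (forall a b, `|g a - g b| <= L * enorm (a - b)) -> 1 < M -> 0 < eta ->
  exists V, [/\ open V, (hausdorff_outer n (Fr `&` V) <= eta%:E)%E & forall x1, Fr x1 -> enorm (x1 - x0) < r / 2 ->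
    exists r1 nu, flat_chart Om V x1 r1 nu M].
Proof.
move=> gLg M1 eta0; have M0 : 0 < M by exact: lt_trans M1.
pose e := 1 - M^-1; have e0 : 0 < e by rewrite subr_gt0 invf_lt1.
have e1 : e < 1 by rewrite /e ltrBlDr ltrDl invr_gt0.
have e20 : 0 < e / 2 by rewrite divr_gt0.
have e21 : e / 2 <= 1 by rewrite ler_pdivrMr// mul1r (le_trans (ltW e1))// ler1n.
have L1 : 0 < (1 + L) ^+ n by rewrite exprn_gt0// ltr_pwDl.
(* One half of [e] goes to the increments of [g - k], the other to the nonlinearity of [k]; the
   measure of [W] allows for the Lipschitz factor [(1 + L) ^+ n] of the graph map. *)
have [k [W [Ck oW lW kW]]] := lipschitz_C1_approx L0 gLg (A x0) r0 e20 e21 (divr_gt0 eta0 L1).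
pose V := [set y | eball x0 r y /\ W (A y)]; exists V; split.
- rewrite openE => y [yx Wy]; have /nbhs_eball[q q0 hq] := open_nbhs_nbhs (conj oW Wy).
  apply/nbhs_eball; exists (Num.min q (r - enorm (y - x0))); first by rewrite lt_min q0 subr_gt0.
  move=> z; rewrite /eball/= lt_min => /andP[zq zr]; split.
    by rewrite /eball/=; have := enorm_triangle y z x0; move: zr; lra.
  by apply: hq; rewrite /eball/= -AN -AD (le_lt_trans (enorm_A _)).
- pose G a := graph_point a (g a); pose S := A @` (Fr `&` V).
  apply: (@le_trans _ _ (hausdorff_outer n (G @` S))).
    apply: le_outer_measure => y [Fy [yx Wy]]; exists (A y); first by exists y.
    by rewrite /G -(frontier_graph Fy yx) point_A.
  have GL a b : S a -> S b -> enorm (G a - G b) <= (1 + L) * enorm (a - b).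
    move=> _ _; apply: (le_trans (enorm_le _)); rewrite AD AN hD hN !A_point !h_point mulrDl mul1r lerD2l.
    exact: gLg.
  apply: (le_trans (hausdorff_outer_lipschitz_image _ GL)); first by rewrite ltr_pwDl.
  apply: (@le_trans _ _ (((1 + L) ^+ n)%:E * (eta / (1 + L) ^+ n)%:E)%E); last by rewrite -EFinM mulrC divfK// gt_eqF.
  rewrite lee_pmul2l//; apply: le_trans lW; apply: le_outer_measure => _ [y [_ [_ Wy]] <-] //.
- move=> x1 F1 x1r; have [rho rho0 hr] := C1_strict_diff (A x1) Ck e20.
  pose r1 := Num.min (r / 4) (rho / 2); have r10 : 0 < r1 by rewrite lt_min !divr_gt0.
  have r1r : 2 * r1 <= r / 2.
    have : r1 <= r / 4 by rewrite ge_min lexx.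
    by lra.
  have r1p : 2 * r1 <= rho by rewrite mulrC -ler_pdivlMr// ge_min lexx orbT.
  have r12 : r1 <= 2 * r1 by rewrite (mulr_natl r1 2) mulr2n lerDl ltW.
  have [|||||nu2 hnu] := @flat_chart_slope V x1 r1 (grad k (A x1)) e M r10; last by exists r1, nu2.
  + by move: x1r r1r; lra.
  + exact: ltW.
  + exact: e1.
  + by rewrite /e subKr mulfV// gt_eqF.
  + have inr y : eball x1 (2 * r1) y -> eball x0 r y.
      by rewrite /eball/= => yx; have := enorm_triangle x1 y x0; move: yx x1r r1r; lra.
    move=> y z Fy nV yx zx; have yx2 : eball x1 (2 * r1) y by rewrite /eball/= (lt_le_trans yx).
    have [yr zr] := (inr y yx2, inr z zx).
    have nW : ~ W (A y) by move=> Wy; apply: nV.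
    have k1 := kW (A y) (A z) (A_ball yr) nW (A_ball zr).
    have inA w : eball x1 (2 * r1) w -> enorm (A w - A x1) < rho.
      by move=> wx; rewrite -AN -AD (le_lt_trans (enorm_A _))// (lt_le_trans wx).
    have k2 := hr (A y) (A z) (inA y yx2) (inA z zx).
    have -> : g (A z) - g (A y) - dot (grad k (A x1)) (A z - A y) =
      (g (A z) - k (A z) - (g (A y) - k (A y))) + (k (A z) - k (A y) - dot (grad k (A x1)) (A z - A y)) by ring.
    rewrite (le_trans (ler_normD _ _))//; apply: (le_trans (lerD k1 k2)).
    by rewrite -mulrDl -splitr.
Qed.

End graph_chart.

(** * Charts from the regularity of the boundary *)

Section boundary_charts.
Context {R : realType} {n : nat} (Om : set 'rV[R]_n.+1).
Hypotheses (oOm : open Om) (bOm : bmeas Om).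
Let Fr := frontier Om.

Lemma lipschitz_enorm (g : 'rV[R]_n -> R) : lipschitz g -> exists2 L, 0 <= L & forall a b, `|g a - g b| <= L * enorm (a - b).
Proof.
move=> [M [_ hM]]; pose L := Num.max 0 M + 1; have L0 : 0 <= L by rewrite addr_ge0// le_max lexx.
exists L => // a b; have ML : M < L by rewrite /L (le_lt_trans (y := Num.max 0 M)) ?le_max ?lexx ?orbT// ltrDl.
by apply: (le_trans (hM L ML (a, b) _)) => //=; rewrite ler_wpM2l// norm_le_enorm.
Qed.

Lemma C1_local_lipschitz (g : 'rV[R]_n -> R) a0 (r : R) : C1 g -> exists2 L, 0 <= L &
  forall a b, enorm (a - a0) < r -> enorm (b - a0) < r -> `|g a - g b| <= L * enorm (a - b).
Proof.
move=> Cg; have [L L0 hL] := continuous_bounded (enorm_grad_cont Cg) (eball_bounded a0 r).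
exists L => [|a b ar br]; first exact: ltW.
have [t /andP[t0 t1] ht] := C1_mean_value b (a - b) Cg.
have ab : b + (a - b) = a by rewrite addrC subrK.
rewrite ab in ht; rewrite ht.
apply: (le_trans (dot_le _ _)); rewrite mulrC ler_wpM2r ?enorm_ge0//.
have := hL (b + t *: (a - b)); rewrite ger0_norm ?enorm_ge0//; apply; rewrite /eball/=.
have -> : b + t *: (a - b) - a0 = (1 - t) *: (b - a0) + t *: (a - a0) by apply/rowP => j; rewrite !mxE; ring.
rewrite (le_lt_trans (enormD _ _))// !enormZ !ger0_norm ?subr_ge0//.
have [->|tn] := eqVneq t 0; first by rewrite subr0 mul1r mul0r addr0.
have tp : 0 < t by rewrite lt_neqAle eq_sym tn.
have h1 : (1 - t) * enorm (b - a0) <= (1 - t) * r by rewrite ler_wpM2l ?subr_ge0// ltW.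
have h2 : t * enorm (a - a0) < t * r by rewrite ltr_pM2l.
by have := ler_ltD h1 h2; rewrite -mulrDl subrK mul1r.
Qed.

Lemma boundary_patches (P : ('rV[R]_(n.+1.-1) -> R) -> Prop) : (forall g : 'rV[R]_n -> R, P g -> lipschitz g \/ C1 g) -> graph_boundary P Om ->
  forall x, Fr x -> exists r nu c, [/\ 0 < r, 0 < c, enorm nu = 1 & patch Om x r nu c].
Proof.
move=> PLC gb x Fx; have [r [Q [i [g [r0 QQ Pg hg]]]]] := gb x Fx.
have [L L0 gL] : exists2 L, 0 <= L & forall a b, enorm (a - col' i (x *m Q)) < r -> enorm (b - col' i (x *m Q)) < r ->
    `|g a - g b| <= L * enorm (a - b).
  have [/lipschitz_enorm[L L0 h]|Cg] := PLC g Pg; [by exists L|exact: C1_local_lipschitz].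
exists (r / 4), (graph_point Q i 0 1), (1 + L)^-1; split; last exact: (patch_graph r0 QQ hg L0 gL).
- by rewrite divr_gt0.
- by rewrite invr_gt0 ltr_pwDl.
- have xx : enorm (x - x) < r / 2 by rewrite subrr enorm0 divr_gt0.
  by have [_ -> _ _] := flat_chart_graph oOm r0 QQ hg L0 gL xx.
Qed.

Lemma closure_patches (Pb : forall x, Fr x -> exists r nu c, [/\ 0 < r, 0 < c, enorm nu = 1 & patch Om x r nu c]) :
  forall x, closure Om x -> exists r nu c, [/\ 0 < r, 0 < c & patch Om x r nu c].
Proof.
move=> x cx; have [Ox|nO] := pselect (Om x); last first.
  by have [|r [nu [c [h1 h2 _ h3]]]] := Pb x; [split => // /interior_subset|exists r, nu, c].
have /nbhs_eball[r r0 hr] := open_nbhs_nbhs (conj oOm Ox).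
exists (r / 2), 0, 1; split; [by rewrite divr_gt0|by []|].
move=> z s y Oz zx /andP[s0 sr]; rewrite scaler0 addr0 mul1r => yz; apply: hr.
by rewrite /eball/=; have := enorm_triangle z y x; move: zx yz sr; lra.
Qed.

Lemma C1_flat_charts (M : R) : C1_boundary Om -> 1 < M -> forall x, Fr x -> exists r nu, flat_chart Om set0 x r nu M.
Proof.
move=> gb M1 x Fx; have [r [Q [i [g [r0 QQ Cg hg]]]]] := gb x Fx.
have [L L0 gL] := C1_local_lipschitz (col' i (x *m Q)) r Cg.
exact: (C1_flat_chart oOm r0 QQ hg L0 gL).
Qed.

Lemma lipschitz_flat_charts0 : lipschitz_boundary Om -> exists2 M, 0 < M & forall x, Fr x -> exists r nu, flat_chart Om set0 x r nu M.
Proof.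
move=> gb; have /choice[d hd] : forall x, exists d : R * R, Fr x -> [/\ 0 < d.1, 0 <= d.2 & forall x1, enorm (x1 - x) < d.1 ->
    exists r nu, flat_chart Om set0 x1 r nu (1 + d.2)].
  move=> x; have [Fx|nF] := pselect (Fr x); last by exists (0, 0).
  have [r [Q [i [g [r0 QQ Lg hg]]]]] := gb x Fx; have [L L0 gL] := lipschitz_enorm Lg.
  exists (r / 2, L) => _; split => //=; first by rewrite divr_gt0.
  move=> x1 x1r; exists (r / 4), (graph_point Q i 0 1).
  by apply: (flat_chart_graph oOm r0 QQ hg L0) => // a b _ _; exact: gL.
have d0 x : Fr x -> 0 < (d x).1 by move=> /hd[].
have [s [sF cov]] := compact_eball_cover (frontier_compact bOm) d0.
(* The sum serves as a crude common bound for the finitely many constants. *)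
pose M := 1 + \sum_(x <- s) `|(d x).2|; exists M => [|x Fx]; first by rewrite ltr_pwDl// sumr_ge0.
have [y ys xy] := cov x Fx; have [_ _ /(_ x xy)[r [nu h]]] := hd y (sF y ys); exists r, nu.
apply: flat_chartS h => //; rewrite lerD2l (le_trans (ler_norm _))//.
by rewrite (big_rem y ys)/= lerDl sumr_ge0.
Qed.

Lemma lipschitz_flat_charts (M eta : R) : lipschitz_boundary Om -> 1 < M -> 0 < eta -> exists V, [/\ open V,
  (hausdorff_outer n (Fr `&` V) <= eta%:E)%E & forall x, Fr x -> exists r nu, flat_chart Om V x r nu M].
Proof.
move=> gb M1 eta0; have /choice[d hd] : forall x, exists d : R, Fr x -> 0 < d /\ forall eta, 0 < eta -> exists V,
    [/\ open V, (hausdorff_outer n (Fr `&` V) <= eta%:E)%E & forall x1, Fr x1 -> enorm (x1 - x) < d ->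
    exists r1 nu, flat_chart Om V x1 r1 nu M].
  move=> x; have [Fx|nF] := pselect (Fr x); last by exists 0.
  have [r [Q [i [g [r0 QQ Lg hg]]]]] := gb x Fx; have [L L0 gL] := lipschitz_enorm Lg.
  exists (r / 2) => _; split; first by rewrite divr_gt0.
  by move=> e e0; apply: (lipschitz_flat_chart oOm r0 QQ hg L0).
have d0 x : Fr x -> 0 < d x by move=> /hd[].
have [s [sF cov]] := compact_eball_cover (frontier_compact bOm) d0.
suff [V [oV hV ch]] : exists V, [/\ open V, (hausdorff_outer n (Fr `&` V) <= eta%:E)%E & forall x, x \in s ->
    forall x1, Fr x1 -> enorm (x1 - x) < d x -> exists r1 nu, flat_chart Om V x1 r1 nu M].
  by exists V; split => // x Fx; have [y ys xy] := cov x Fx; exact: ch ys _ Fx xy.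
(* Each chart of the finite cover receives half of the remaining allowance [eta]; enlarging [V] does
   not destroy the charts already found. *)
elim: s sF eta eta0 {cov} => [|x s IH] sF eta eta0.
  exists set0; split => //.
  by rewrite setI0 outer_measure0 lee_fin ltW.
have e2 : 0 < eta / 2 by rewrite divr_gt0.
have [V1 [oV1 h1 c1]] := (hd x (sF x (mem_head _ _))).2 _ e2.
have [V2 [oV2 h2 c2]] := IH (fun y ys => sF y (mem_behead (s := x :: s) ys)) _ e2.
exists (V1 `|` V2); split; first exact: openU.
  rewrite setIUr (splitr eta) EFinD; apply: (le_trans (outer_measureU2 _ _ _)); exact: leeD.
move=> y; rewrite inE => /orP[/eqP ->|ys] x1 F1 x1y.
  by have [r1 [nu h]] := c1 x1 F1 x1y; exists r1, nu; apply: flat_chartS h => //; exact: subsetUl.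
by have [r1 [nu h]] := c2 y ys x1 F1 x1y; exists r1, nu; apply: flat_chartS h => //; exact: subsetUr.
Qed.

End boundary_charts.

Lemma Rintegral_dist d (T : measurableType d) (R : realType) (mu : {measure set T -> \bar R}) (D : set T) (f g : T -> R) :
  measurable D -> rintegrable mu D f -> rintegrable mu D g ->
  `|\int[mu]_(x in D) `|f x| - \int[mu]_(x in D) `|g x| | <= \int[mu]_(x in D) `|f x - g x|.
Proof.
move=> mD jf jg; have nf := rintegrable_norm mD jf; have ng := rintegrable_norm mD jg.
have i1 := rintegrableB mD nf ng.
rewrite -(Rint_sub mD nf ng); apply: (le_trans (Rintegral_le_norm mD i1)).
apply: (le_Rintegral mD (rintegrable_norm mD i1) (rintegrable_norm mD (rintegrableB mD jf jg))) => x _.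
exact: ler_dist_dist.
Qed.

Lemma mul_dist_le (R : realDomainType) (a x y e : R) : `|x - y| <= e -> a * x <= a * y + `|a| * e.
Proof.
move=> h; rewrite -lerBlDl -mulrBr (le_trans (ler_norm _))// normrM.
by rewrite ler_wpM2l.
Qed.

Lemma defect_arith (R : realFieldType) (Ew Ed lv lw ld q p : R) : 0 <= q -> Ew <= lv + q -> lv <= lw + q -> ld <= Ed ->
  p = 3 * q -> Ew - Ed <= lw - ld + p.
Proof. by move=> q0 h1 h2 h3 ->; lra. Qed.

Section step_truncation.
Context {R : realType}.

Lemma step_lipschitz (s t : R) : `|step s - step t| <= 2 * `|s - t|.
Proof.
wlog st : s t / t <= s.
  by move=> h; have [/h//|/ltW/h] := leP t s; rewrite distrC (distrC t).
have [|c _ ->] := MVT_segment (df := dstep) st (fun x _ => is_derive_step x).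
  apply: continuous_subspaceT => x; apply: differentiable_continuous.
  by apply/derivable1_diffP; have [] := is_derive_step x.
by rewrite normrM ler_wpM2r//; have /andP[h1 h2] := dstep_itv c; rewrite ger0_norm.
Qed.

Lemma step_le2 (t : R) : 0 <= t -> step t <= 2 * t.
Proof.
move=> t0; have := step_lipschitz t 0; rewrite (step_le0 (lexx 0)) !subr0 (ger0_norm t0).
by apply: le_trans; exact: ler_norm.
Qed.

(* A C1 approximation of the positive part, truncated at height [h / 2]; both
   [trunc h] and [id - trunc h] are nondecreasing. *)
Definition trunc (h s : R) : R := h / 2 * step (h^-1 * s).

Lemma trunc_split (h s : R) : 0 < h -> `|trunc h s| + `|s - trunc h s| = `|s|.
Proof.
move=> h0; rewrite /trunc; have h2 : 0 < h / 2 by rewrite divr_gt0.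
have [s0|s0] := leP s 0; first by rewrite step_le0 ?mulr0 ?normr0 ?subr0 ?add0r// mulr_ge0_le0// invr_ge0 ltW.
have /andP[k0 _] := step_itv (h^-1 * s).
have k1 : h / 2 * step (h^-1 * s) <= s.
  have hs : 0 <= h^-1 * s by rewrite mulr_ge0 ?invr_ge0 ?(ltW h0) ?(ltW s0).
  have k := step_le2 hs.
  apply: (le_trans (ler_wpM2l (ltW h2) k)).
  by rewrite le_eqVlt; apply/orP; left; apply/eqP; field; rewrite gt_eqF.
rewrite !ger0_norm ?subr_ge0 ?mulr_ge0 ?(ltW h2) ?(ltW s0) ?(ltW h0)//.
by rewrite addrC subrK.
Qed.

(** The gradient of [w] is shared between the two parts in the proportions [dstep / 2] and
    [1 - dstep / 2], both nonnegative because [dstep] lies between 0 and 2; hence the norms add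
    without loss. *)
Lemma C1_trunc n (h : R) (w : 'rV[R]_n -> R) : 0 < h -> C1 w -> [/\ C1 (fun x => trunc h (w x)),
  C1 (fun x => w x - trunc h (w x)) &
  forall x, enorm (grad (fun x => trunc h (w x)) x) + enorm (grad (fun x => w x - trunc h (w x)) x) = enorm (grad w x)].
Proof.
move=> h0 Cw; have [Ch gh] := C1Z h^-1 Cw.
have [Cs gs] := C1_comp is_derive_step dstep_continuous Ch.
have [Ct gt] := C1Z (h / 2) Cs; have [Cd gd] := C1D Cw (C1N Ct).1; split => // x.
have -> : grad (fun x => trunc h (w x)) x = (dstep (h^-1 * w x) / 2) *: grad w x.
  by rewrite gt gs gh !scalerA; congr (_ *: _); field; rewrite gt_eqF.
have -> : grad (fun x => w x - trunc h (w x)) x = (1 - dstep (h^-1 * w x) / 2) *: grad w x.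
  rewrite gd (C1N Ct).2 gt gs gh !scalerA scalerBl scale1r; congr (_ - _ *: _).
  by field; rewrite gt_eqF.
have /andP[d0 d2] := dstep_itv (h^-1 * w x).
rewrite !enormZ !ger0_norm -?mulrDl ?subrKC ?mul1r// ?divr_ge0// ?subr_ge0 ?ler_pdivrMr// ?mul1r//.
Qed.

End step_truncation.

(** * Minimizers *)

Section minimization.
Context {R : realType} {n : nat} (Om : set 'rV[R]_n.+1).
Implicit Types (x y nu : 'rV[R]_n.+1) (w z u v f T : 'rV[R]_n.+1 -> R).
Local Notation leb := (@leb R n.+1).
Local Notation haus := (@haus R n.+1 n).
Local Notation hT := (caratheodory_type (@hausdorff_outer R n.+1 n)).
Local Notation cT := (caratheodory_type (@lebesgue_outer R n.+1)).
Hypotheses (oOm : open Om) (bOm : bmeas Om) (Om0 : Om !=set0).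
Let Fr := frontier Om.
Let mO := bOm.1.
Let mFr : measurable (Fr : set hT) := frontier_hmble Om.
Hypothesis patchFr : forall x, Fr x -> exists r nu c, [/\ 0 < r, 0 < c, enorm nu = 1 & patch Om x r nu c].
Let patchOm := closure_patches oOm patchFr.
Variables (M0 beta : R).
Hypotheses (M00 : 0 < M0) (charts0 : forall x, Fr x -> exists r nu, flat_chart Om set0 x r nu M0).
Hypothesis beta_gt : -1 < beta.
Let b := Num.min beta 1.
Hypothesis charts : forall M eta, 1 < M -> 0 < eta -> exists V, [/\ open V, 0 <= b \/ V = set0,
  (hausdorff_outer n (Fr `&` V) <= eta%:E)%E & forall x, Fr x -> exists r nu, flat_chart Om V x r nu M].
Let b_gt : -1 < b. Proof. by rewrite lt_min beta_gt (lt_trans _ ltr01)// ltrN10. Qed.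
Let b_le : b <= 1. Proof. by rewrite ge_min lexx orbT. Qed.
Let normb : `|b| <= 1. Proof. by rewrite ler_norml b_le andbT ltW. Qed.
Let En w := energy Om b w.
Let mass u := \int[leb]_(x in Om) `|u x|.
Let bmass T := \int[haus]_(x in Fr) `|T x|.

Let iC w : C1 w -> rintegrable leb Om w.
Proof. by move=> Cw; apply: cont_integrable bOm _; exact: C1_cont. Qed.
Let ihC w : C1 w -> rintegrable haus Fr w.
Proof. exact: (haus_C1_integrable oOm bOm M00 charts0). Qed.
Let mass_ge0 u : 0 <= mass u. Proof. exact: Rintegral_ge0. Qed.

Let leb_gt0 : 0 < fine (leb Om).
Proof.
have h := lebesgue_outer_open_gt0 oOm Om0; have h' := lebesgue_outer_bounded bOm.2.
by rewrite fine_gt0// h.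
Qed.

Lemma energyZ (c : R) w : 0 <= c -> C1 w -> En (fun x => c * w x) = c * En w /\ mass (fun x => c * w x) = c * mass w.
Proof.
move=> c0 Cw; have [_ gw] := C1Z c Cw; split.
  rewrite /En /energy mulrDr mulrCA; congr (_ + b * _).
    rewrite /tgrad -(Rint_scale c mO (tgrad_integrable bOm Cw)); apply: eq_Rintegral => x _.
    by rewrite gw enormZ ger0_norm.
  rewrite -(Rint_scale c mFr (rintegrable_norm mFr (ihC Cw))); apply: eq_Rintegral => x _.
  by rewrite normrM ger0_norm.
rewrite /mass -(Rint_scale c mO (rintegrable_norm mO (iC Cw))); apply: eq_Rintegral => x _.
by rewrite normrM ger0_norm.
Qed.

Lemma energyN w : C1 w -> En (fun x => - w x) = En w.
Proof.
move=> Cw; have t1 : tgrad Om (fun x => - w x) = tgrad Om w.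
  by apply: eq_Rintegral => x _; rewrite (C1N Cw).2 enormN.
have t2 : bmass (fun x => - w x) = bmass w by apply: eq_Rintegral => x _; rewrite normrN.
by rewrite /En /energy t1; congr (_ + b * _).
Qed.

Let ratios := [set En w / mass w | w in [set w | C1 w /\ 0 < mass w]].
(** The infimum over C1 functions only, finite by coercivity. It is compared with [J] on BV from
    below by strict approximation and is attained by a limit, so it equals [Lambda]. *)
Let lam := inf ratios.

Let energy_lower : exists2 c, 0 <= c & forall w, C1 w -> - c * mass w <= En w.
Proof.
have [c1 [c2 [c10 c20 h]]] := energy_coercive oOm bOm M00 charts0 b_gt charts.
exists c2 => // w Cw; rewrite mulNr lerNl -subr_ge0 opprK addrC (le_trans _ (h w Cw))//.
by rewrite mulr_ge0 ?tgrad_ge0// ltW.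
Qed.

Let has_inf_ratios : has_inf ratios.
Proof.
split.
  exists (En (fun=> 1) / mass (fun=> 1)), (fun=> 1) => //; split; first exact: C1_cst.
  by rewrite /mass normr1 (Rintegral_cst leb mO) mul1r leb_gt0.
have [c c0 h] := energy_lower; exists (- c) => _ [w [Cw w0] <-].
by rewrite ler_pdivlMr// h.
Qed.

Lemma lam_energy w : C1 w -> lam * mass w <= En w.
Proof.
move=> Cw; have [w0|w0] := leP (mass w) 0.
  have m0 : mass w = 0 by apply/eqP; rewrite eq_le w0 mass_ge0.
  by have [c c0 h] := energy_lower; have := h w Cw; rewrite m0 !mulr0.
by rewrite -ler_pdivlMr//; apply: (ge_inf has_inf_ratios.2); exists w.
Qed.

Lemma bv_approx_energy u (V : R) T (w_ : nat -> 'rV[R]_n.+1 -> R) : rintegrable leb Om u -> bv_approx Om u V T w_ ->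
  forall e, 0 < e -> exists K, forall k, (K <= k)%N -> [/\ En (w_ k) <= V + b * bmass T + e,
    lam * mass u <= lam * mass (w_ k) + e & lam * mass (w_ k) <= lam * mass u + e].
Proof.
move=> iu [iT _ Cw hw] e e0; have c0 : 0 < 2 + `|lam| by rewrite ltr_pwDl.
have [K hK] := hw _ (divr_gt0 e0 c0); exists K => k /hK[h1 h2 h3]; set e' := e / _ in h1 h2 h3.
have ee : (2 + `|lam|) * e' = e by rewrite mulrC divfK// gt_eqF.
have e'0 : 0 <= e' by rewrite ltW// divr_gt0.
have d1 := le_trans (Rintegral_dist mO (iC (Cw k)) iu) h1; rewrite -/(mass _) -/(mass _) in d1.
have d2 := le_trans (Rintegral_dist mFr (ihC (Cw k)) iT) h3; rewrite -/(bmass _) -/(bmass _) in d2.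
have k1 : `|lam| * e' <= e by rewrite -ee ler_wpM2r// lerDr.
split; first last.
- by apply: (le_trans (mul_dist_le lam d1)); rewrite lerD2l.
- by rewrite distrC in d1; apply: (le_trans (mul_dist_le lam d1)); rewrite lerD2l.
have k2 : `|b| * e' <= e' by rewrite ler_piMl.
have k3 : 2 * e' <= e by rewrite -ee ler_wpM2r// lerDl.
rewrite /En /energy; have k4 := le_trans (mul_dist_le b d2) (lerD (lexx (b * bmass T)) k2).
apply: (le_trans (lerD h2 k4)); rewrite addrACA lerD2l (le_trans _ k3)//.
by rewrite (mulr_natl e' 2) mulr2n.
Qed.

Lemma lam_bv u (V : R) T (w_ : nat -> 'rV[R]_n.+1 -> R) : rintegrable leb Om u -> bv_approx Om u V T w_ ->
  lam * mass u <= V + b * bmass T.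
Proof.
move=> iu h; have [_ _ Cw _] := h; apply/ler_addgt0Pr => e e0.
have [K hK] := bv_approx_energy iu h (divr_gt0 e0 (ltr0n R 2)).
have [h1 h2 _] := hK K (leqnn _); have h3 := lam_energy (Cw K).
by rewrite (splitr e) addrA (le_trans h2)// lerD2r (le_trans h3).
Qed.

Lemma J_bv u (V : R) T (w_ : nat -> 'rV[R]_n.+1 -> R) : rintegrable leb Om u -> total_var Om u = V%:E ->
  bv_approx Om u V T w_ -> 0 < mass u -> J Om beta u = ((V + b * bmass T) / mass u)%:E.
Proof.
move=> iu TV [_ tr _ _] m0; rewrite /J TV; have -> : (\int[haus]_(x in frontier Om) (`|trace Om u x|)%:E = (bmass T)%:E)%E by exact: tr.
by rewrite (Rintegral_EFin mO (rintegrable_norm mO iu)) -/(mass u) inver gt_eqF.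
Qed.

Lemma nonzero_mass u : rintegrable leb Om u -> nonzero Om u <-> 0 < mass u.
Proof.
move=> iu; have [mu' _] := integrableP _ _ _ iu.
have key : mass u = 0 <-> ae_eq leb Om (EFin \o u) (cst 0%E).
  rewrite -(ae_eq_integral_abs leb mO mu') /mass; under eq_integral do rewrite abse_EFin.
  by rewrite (Rintegral_EFin mO (rintegrable_norm mO iu)); split => [->//|[]].
split=> [nz|m0 ae]; last first.
  suff m00 : mass u = 0 by move: m0; rewrite m00 ltxx.
  by apply/key; move: ae; apply: negligibleS; apply: subsetC => x /= h Ox; rewrite h.
rewrite lt_neqAle mass_ge0 andbT eq_sym; apply/eqP => /key ae; apply: nz.
by move: ae; apply: negligibleS; apply: subsetC => x /= h Ox; apply: EFin_inj; exact: h.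
Qed.

Lemma J_ge u : in_BV Om u -> nonzero Om u -> (lam%:E <= J Om beta u)%E.
Proof.
move=> [iu TVy] /(nonzero_mass iu) m0.
have [V [T [w_ [TV h]]]] := bv_approx_exists oOm bOm patchOm patchFr M00 charts0 TVy iu.
by rewrite (J_bv iu TV h m0) lee_fin ler_pdivlMr// (lam_bv iu h).
Qed.

(** Lower semicontinuity bounds the energy of the limit from above by [lam * mass u], and [lam_bv]
    bounds it from below by the same number. *)
Lemma minimizing_limit u (z_ : nat -> 'rV[R]_n.+1 -> R) : rintegrable leb Om u -> 0 < mass u -> (forall k, C1 (z_ k)) ->
  (forall e, 0 < e -> exists K, forall k, (K <= k)%N -> \int[leb]_(x in Om) `|z_ k x - u x| <= e) ->
  (forall e, 0 < e -> exists K, forall k, (K <= k)%N -> En (z_ k) <= lam * mass u + e) ->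
  [/\ in_BV Om u, nonzero Om u & J Om beta u = lam%:E].
Proof.
move=> iu m0 Cz zu zA; have [TVy lsc] := energy_lsc oOm bOm M00 charts0 b_gt b_le charts iu Cz zu zA.
have nz : nonzero Om u by apply/(nonzero_mass iu).
split => //; have [V [T [w_ [TV h]]]] := bv_approx_exists oOm bOm patchOm patchFr M00 charts0 TVy iu.
have VE : V + b * bmass T = lam * mass u.
  by apply/eqP; rewrite eq_le (lam_bv iu h) andbT; exact: lsc TV h.
by rewrite (J_bv iu TV h m0) VE mulfK// gt_eqF.
Qed.

Lemma C1_minimizing_sequence : exists z_ : nat -> 'rV[R]_n.+1 -> R, [/\ forall k, C1 (z_ k), forall k, mass (z_ k) = 1 &
  forall e, 0 < e -> exists K, forall k, (K <= k)%N -> En (z_ k) <= lam + e].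
Proof.
have ik (k : nat) : 0 < k.+1%:R^-1 :> R by rewrite invr_gt0.
have /choice[z_ hz] : forall k : nat, exists z, [/\ C1 z, mass z = 1 & En z <= lam + k.+1%:R^-1].
  move=> k; have [_ [w [Cw w0] <-] hw] := inf_adherent (ik k) has_inf_ratios.
  have c0 : 0 <= (mass w)^-1 by rewrite invr_ge0 ltW.
  have [e1 e2] := energyZ c0 Cw; exists (fun x => (mass w)^-1 * w x); split; first exact: (C1Z _ Cw).1.
    by rewrite e2 mulVf// gt_eqF.
  by rewrite e1 mulrC ltW.
exists z_; split=> [k|k|e e0]; [by have [] := hz k|by have [] := hz k|].
exists (Num.truncn e^-1) => k kK; have [_ _ h] := hz k; rewrite (le_trans h)// lerD2l.
rewrite -[leRHS]invrK lef_pV2 ?posrE ?invr_gt0// (le_trans (ltW (truncnS_gt _)))//.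
by rewrite ler_nat ltnS.
Qed.

Let minimizes u := [/\ in_BV Om u, nonzero Om u & J Om beta u = lam%:E].

(** The opposite of [u] is carried along because the positivity set of [u] may be null; that of
    [- u] then is not. *)
Lemma minimizer_pair : exists u, [/\ minimizes u, minimizes (fun x => - u x) & ~ {ae leb, forall x, Om x -> u x = 0}].
Proof.
have [z_ [Cz mz Ez]] := C1_minimizing_sequence.
have [K1 hK1] := Ez 1 ltr01.
have [G G0 hG] := energy_tgrad_bound oOm bOm M00 charts0 b_gt charts (lam + 1) 1.
(* The initial terms are skipped so that the gradient bound holds along the whole sequence. *)
pose y_ k := z_ (K1 + k)%N.
have gy k : tgrad Om (y_ k) <= G by apply: (hG _ (Cz _)); [exact: (hK1 _ (leq_addr _ _))|rewrite -/(mass _) mz].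
have [phi [phi_ge cau]] : exists phi : nat -> nat, (forall i, (i <= phi i)%N) /\
    forall e, 0 < e -> exists K, forall k l, (K <= k)%N -> (K <= l)%N ->
      \int[leb]_(x in Om) `|y_ (phi k) x - y_ (phi l) x| <= e.
  have y1 k : C1 (y_ k) by exact: Cz.
  have y2 k : \int[leb]_(x in Om) `|y_ k x| <= 1 + G by rewrite -/(mass _) mz lerDl.
  have y3 k : tgrad Om (y_ k) <= 1 + G by rewrite (le_trans (gy k))// lerDr.
  exact: (C1_L1_compact bOm patchOm y1 y2 y3).
have [u [_ [iu _ _ cv]]] := L1_complete mO (fun k => iC (Cz (K1 + phi k)%N)) cau.
pose x_ k := z_ (K1 + phi k)%N; have xu : forall e, 0 < e -> exists K, forall k, (K <= k)%N -> \int[leb]_(x in Om) `|x_ k x - u x| <= e := cv.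
have Ex e : 0 < e -> exists K, forall k, (K <= k)%N -> En (x_ k) <= lam + e.
  move=> /Ez[K hK]; exists K => k kK; apply: hK; rewrite (leq_trans kK)// (leq_trans (phi_ge k))//.
  exact: leq_addl.
have m1 : mass u = 1.
  apply/eqP; rewrite -subr_eq0 -normr_le0; apply/ler_addgt0Pr => e /xu[K hK]; rewrite add0r distrC.
  by rewrite -(mz (K1 + phi K)%N); apply: (le_trans (Rintegral_dist mO (iC (Cz _)) iu) (hK K (leqnn _))).
have iNu := rintegrableN mO iu.
have mN1 : mass (fun x => - u x) = 1 by rewrite -m1; apply: eq_Rintegral => x _; rewrite normrN.
have CN k : C1 (fun x => - x_ k x) by have [] := C1N (Cz (K1 + phi k)%N).
have EN k : En (fun x => - x_ k x) = En (x_ k) by exact: energyN (Cz _).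
have Mu : minimizes u.
  by apply: (minimizing_limit (z_ := x_)) => //; [rewrite m1|move=> k; exact: Cz|rewrite m1 mulr1].
exists u; split => //; last by case: Mu.
apply: (minimizing_limit (z_ := fun k x => - x_ k x)) => //; [by rewrite mN1| |].
  move=> e /xu[K hK]; exists K => k /hK; congr (_ <= _); apply: eq_Rintegral => x _.
  by rewrite -opprD normrN.
by rewrite mN1 mulr1 => e /Ex[K hK]; exists K => k /hK; rewrite EN.
Qed.

Lemma Lambda_lam : Lambda Om beta = lam%:E.
Proof.
have [u [[BVu nzu Ju] _ _]] := minimizer_pair; apply/eqP; rewrite eq_le; apply/andP; split.
  by rewrite -Ju; apply: ereal_inf_lbound; exists u.
by apply: le_ereal_inf_tmp => _ [w [BVw nzw] <-]; exact: J_ge.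
Qed.

(** The indicator of the positivity set is shown to be an L1 limit of C1 functions whose energies
    approach [lam] times its mass. They are rescaled truncations of strict approximations of [v],
    and minimality of the limit gives finite perimeter as well. *)
Lemma superlevel v : in_BV Om v -> nonzero Om v -> J Om beta v = lam%:E -> ~ {ae leb, forall x, Om x -> v x <= 0} ->
  let E := Om `&` [set x | 0 < v x] in admissible Om E /\ Rquot Om beta E = lam%:E.
Proof.
move=> [iv TVy] nz Jv nae E; have m0 := (nonzero_mass iv).1 nz.
have [V [T [w_ [TV hw]]]] := bv_approx_exists oOm bOm patchOm patchFr M00 charts0 TVy iv.
have VE : V + b * bmass T = lam * mass v.
  have Jv' := Jv; rewrite (J_bv iv TV hw m0) in Jv'; have := congr1 (fun q => q * mass v) (EFin_inj Jv').
  by rewrite divfK// gt_eqF.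
have [_ _ Cw hw'] := hw.
have mE : lmble E.
  have -> : E = Om `&` v @^-1` `]0, +oo[ by apply/seteqP; split => x [Ox]; rewrite /= in_itv/= andbT.
  exact: (rintegrable_mfun iv mO (measurable_itv _)).
have bE : bmeas E by apply: (bmeasS mE _ bOm); exact: subIsetl.
pose chi : 'rV[R]_n.+1 -> R := \1_E.
have ichi : rintegrable leb Om chi.
  apply: (@le_rintegrable _ cT R leb Om _ (fun=> 1) mO); first exact: measurable_indic.
    by move=> x _; rewrite /chi indicE; case: (_ \in _); rewrite ?normr1 ?normr0.
  by apply: cont_integrable bOm _; exact: cst_continuous.
have lE0 : (0 < leb E)%E.
  rewrite lt_neqAle outer_measure_ge0 andbT; apply/eqP => E0; apply: nae; exists E; split => //.
  by move=> x /= /not_implyP[Ox /negP]; rewrite -ltNge.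
have mchi : mass chi = fine (leb E).
  rewrite /mass (@eq_Rintegral _ _ _ leb _ chi); last by move=> x _; rewrite /chi indicE ger0_norm.
  by rewrite /Rintegral /chi integral_indic// (setIidl (@subIsetl _ Om _)).
have mchi0 : 0 < mass chi.
  by rewrite mchi fine_gt0// lE0 (lebesgue_outer_bounded bE.2).
(* For [v x > 0] the argument eventually exceeds 1, and for [v x <= 0] the value is always 0: the
   limit is exactly the indicator of the strict superlevel set. *)
pose s_ (k : nat) x := step (k.+1%:R * v x).
have ms k : measurable_fun (Om : set cT) (s_ k).
  have cs : continuous (@step R).
    by move=> x; apply: differentiable_continuous; apply/derivable1_diffP; have [] := is_derive_step x.
  apply: (measurableT_comp (continuous_measurable_fun cs)); apply: measurable_funM; first exact: measurable_cst.
  exact: rintegrable_mfun iv.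
have s01 k x : `|s_ k x| <= 1 by have /andP[h0 h1] := step_itv (k.+1%:R * v x); rewrite ger0_norm.
have sc : {ae leb, forall x, Om x -> s_ k x @[k --> \oo] --> chi x}.
  apply: (@negligibleS _ _ _ leb set0) (negligible_set0 _) => x /=; apply => Ox.
  apply: cvg_near_cst; have [vx|vx] := leP (v x) 0.
    apply: nearW => k; rewrite /s_ step_le0 ?mulr_ge0_le0// /chi indicE memNset// => -[_] /=.
    by rewrite ltNge vx.
  exists (Num.truncn (v x)^-1) => // k /= kK; rewrite /s_ /chi indicE mem_set// step_ge1//.
  rewrite -ler_pdivrMr// mul1r (le_trans (ltW (truncnS_gt _)))//.
  by rewrite ler_nat ltnS.
have i1 : rintegrable leb Om (fun=> 1 : R) by apply: cont_integrable bOm _; exact: cst_continuous.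
have [_ schi] := Rintegral_dominated mO ms (rintegrable_mfun ichi) sc i1 (fun k x _ => s01 k x).
have isk k : rintegrable leb Om (s_ k) by apply: (le_rintegrable mO (ms k) (fun x _ => s01 k x) i1).
have ik (k : nat) : 0 < k.+1%:R^-1 :> R by rewrite invr_gt0.
(* The truncation height [k.+1%:R^-1] is fixed first and the approximation [w_ l] of [v] is chosen
   according to it, since rescaling magnifies the errors. *)
have /choice[l hl] : forall k : nat, exists l, let z x := step (k.+1%:R * w_ l x) in [/\ C1 z,
    \int[leb]_(x in Om) `|z x - s_ k x| <= k.+1%:R^-1 & En z <= lam * mass z + k.+1%:R^-1].
  move=> k; pose h : R := k.+1%:R^-1; have h0 : 0 < h by exact: ik.
  (* Three errors of this size add up to [h / 2 * h], which the factor [2 / h] of the rescaling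
     turns into [h]. *)
  have e0 : 0 < h / 2 * h / 3 by rewrite !mulr_gt0.
  have [K1 h1] := bv_approx_energy iv hw e0; have [K2 h2] := hw' _ e0.
  pose l := maxn K1 K2; have [a1 a2 a3] := h1 l (leq_maxl _ _); have [a4 _ _] := h2 l (leq_maxr _ _).
  exists l => z; have [Ct Cd gtd] := C1_trunc h0 (Cw l).
  pose t x := trunc h (w_ l x); pose d x := w_ l x - t x.
  have zt : z = (fun x => (2 / h) * t x).
    apply/funext => x; rewrite /z /t /trunc [in RHS](_ : h^-1 * w_ l x = k.+1%:R * w_ l x); last by rewrite /h invrK.
    by rewrite mulrA (_ : 2 / h * (h / 2) = 1) ?mul1r//; field; rewrite gt_eqF.
  have h20 : 0 <= 2 / h by rewrite divr_ge0// ltW.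
  have [Ez mz] := energyZ h20 Ct; rewrite -/t -zt in Ez mz.
  have Cz : C1 z by rewrite zt; exact: (C1Z (2 / h) Ct).1.
  have sumE : En t + En d = En (w_ l).
    rewrite /En /energy addrACA -mulrDr; congr (_ + b * _).
      rewrite /tgrad -(Rint_add mO (tgrad_integrable bOm Ct) (tgrad_integrable bOm Cd)).
      by apply: eq_Rintegral => x _; exact: gtd.
    rewrite -(Rint_add mFr (rintegrable_norm mFr (ihC Ct)) (rintegrable_norm mFr (ihC Cd))).
    by apply: eq_Rintegral => x _; exact: trunc_split.
  have sumM : mass t + mass d = mass (w_ l).
    rewrite /mass -(Rint_add mO (rintegrable_norm mO (iC Ct)) (rintegrable_norm mO (iC Cd))).
    by apply: eq_Rintegral => x _; exact: trunc_split.
  split => //.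
    have iz : rintegrable leb Om (fun x => `|z x - s_ k x|).
      by apply: (rintegrable_norm mO); exact: (rintegrableB mO (iC Cz) (isk k)).
    have iwv := rintegrable_norm mO (rintegrableB mO (iC (Cw l)) iv).
    apply: (@le_trans _ _ ((2 / h) * \int[leb]_(x in Om) `|w_ l x - v x|)).
      rewrite -(Rint_scale _ mO iwv); apply: (le_Rintegral mO iz (rintegrableZ _ mO iwv)) => x _.
      rewrite (le_trans (step_lipschitz _ _))// -mulrBr normrM ger0_norm// /h invrK.
      by rewrite mulrA.
    apply: (le_trans (ler_wpM2l h20 a4)).
    have -> : 2 / h * (h / 2 * h / 3) = h / 3 by field; rewrite gt_eqF.
    by rewrite ler_pdivrMr// ler_peMr ?ler1n// ltW.
  rewrite Ez mz mulrCA -/h.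
  (* The complement [d] cannot have energy below [lam] times its mass, so all of the small excess of
     [w_ l] bounds that of the truncation [t]. *)
  have low := lam_energy Cd; rewrite -/d in low.
  have key : En t <= lam * mass t + h / 2 * h.
    have -> : En t = En (w_ l) - En d by rewrite -sumE addrK.
    have mt : lam * mass t = lam * mass (w_ l) - lam * mass d by rewrite -sumM mulrDr addrK.
    rewrite mt; rewrite VE in a1; have h3 : h / 2 * h = 3 * (h / 2 * h / 3) by field.
    exact: defect_arith (ltW e0) a1 a2 low h3.
  have -> : 2 / h * (lam * mass t) + h = 2 / h * (lam * mass t + h / 2 * h) by field; rewrite gt_eqF.
  by rewrite ler_wpM2l.
pose z_ (k : nat) x := step (k.+1%:R * w_ (l k) x).
have Cz k : C1 (z_ k) by have [] := hl k.
have small e : 0 < e -> exists K, forall k, (K <= k)%N -> (k.+1%:R^-1 : R) <= e.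
  move=> e0; exists (Num.truncn e^-1) => k Kk; rewrite -[leRHS]invrK lef_pV2 ?posrE ?invr_gt0//.
  by rewrite (le_trans (ltW (truncnS_gt _)))// ler_nat ltnS.
have zchi e : 0 < e -> exists K, forall k, (K <= k)%N -> \int[leb]_(x in Om) `|z_ k x - chi x| <= e.
  move=> e0; have e20 : 0 < e / 2 by rewrite divr_gt0.
  have [K1 h1] := small _ e20; have [K2 h2] := schi _ e20; exists (maxn K1 K2) => k.
  rewrite geq_max => /andP[/h1 k1 /h2 k2]; have [_ k3 _] := hl k.
  have i2 := rintegrable_norm mO (rintegrableB mO (iC (Cz k)) (isk k)).
  have i3 := rintegrable_norm mO (rintegrableB mO (isk k) ichi).
  have i4 := rintegrable_norm mO (rintegrableB mO (iC (Cz k)) ichi).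
  apply: (le_trans (le_Rintegral mO i4 (rintegrableD mO i2 i3) _)) => [x _|].
    by rewrite (le_trans _ (ler_normD _ _))// addrA subrK.
  by rewrite (Rint_add mO i2 i3) [leRHS]splitr lerD// (le_trans k3).
have Ez e : 0 < e -> exists K, forall k, (K <= k)%N -> En (z_ k) <= lam * mass chi + e.
  move=> e0; have L0 : 0 < `|lam| + 1 by rewrite ltr_wpDl.
  have e20 : 0 < e / 2 by rewrite divr_gt0.
  have [K1 h1] := small _ e20; have [K2 h2] := zchi _ (divr_gt0 e20 L0); exists (maxn K1 K2) => k.
  rewrite geq_max => /andP[/h1 k1 /h2 k2]; have [_ _ k3] := hl k.
  apply: (le_trans k3); rewrite [in leRHS](splitr e) addrA lerD//.
  have d1 := le_trans (Rintegral_dist mO (iC (Cz k)) ichi) k2.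
  apply: (le_trans (mul_dist_le lam d1)); rewrite lerD2l.
  apply: (@le_trans _ _ ((`|lam| + 1) * (e / 2 / (`|lam| + 1)))); last by rewrite mulrC divfK// gt_eqF.
  by rewrite ler_wpM2r ?lerDl// ltW// divr_gt0.
have [BVc nzc Jc] := minimizing_limit ichi mchi0 Cz zchi Ez.
by split => //; split => //; [exact: subIsetl|exact: BVc.2].
Qed.

Lemma minimization :
  [/\ exists u, is_minimizer Om beta u, Lambda Om beta = ell Om beta &
      forall v, is_minimizer Om beta v -> ~ {ae leb, forall x, Om x -> v x <= 0} ->
        exists t : R, let E := Om `&` [set x | t < v x] in admissible Om E /\ Lambda Om beta = Rquot Om beta E].
Proof.
have [u [Mu MNu nzu]] := minimizer_pair; have [BVu nu Ju] := Mu; have [BVN nN JN] := MNu.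
split.
- by exists u; split => //; rewrite Lambda_lam.
- apply/eqP; rewrite eq_le; apply/andP; split.
    rewrite Lambda_lam; apply: le_ereal_inf_tmp => _ [E [EO mE E0 TVE] <-].
    have iE : rintegrable leb Om (\1_E : 'rV[R]_n.+1 -> R).
      apply: (@le_rintegrable _ cT R leb Om _ (fun=> 1) mO); first exact: measurable_indic.
        by move=> x _; rewrite indicE; case: (_ \in _); rewrite ?normr1 ?normr0.
      by apply: cont_integrable bOm _; exact: cst_continuous.
    apply: J_ge; first by split.
    move=> [N [mN N0 hN]]; move: E0; rewrite ltNge => /negP; apply.
    rewrite -N0; apply: le_outer_measure => x Ex; apply: hN => /= h.
    by move: (h (EO x Ex)); rewrite indicE mem_set// => /eqP; rewrite oner_eq0.
  (* If [u] is nonpositive almost everywhere, [- u] supplies the set: both cannot be nonpositive, as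
     [u] would vanish. *)
  rewrite Lambda_lam; have [ae|nae] := pselect {ae leb, forall x, Om x -> u x <= 0}; last first.
    have [adm <-] := superlevel BVu nu Ju nae; apply: ereal_inf_lbound.
    by exists (Om `&` [set x | 0 < u x]).
  have [|adm <-] := superlevel BVN nN JN.
    move=> ae'; apply: nzu; have := negligibleU ae ae'; apply: negligibleS => x /= /not_implyP[Ox ux].
    have [u0|u0] := leP (u x) 0; [right|left] => hx; have := hx Ox.
      by rewrite oppr_le0 => u0'; apply: ux; apply/eqP; rewrite eq_le u0.
    by [].
  by apply: ereal_inf_lbound; exists (Om `&` [set x | 0 < - u x]).
- move=> v [BVv nv Jv] nae; rewrite Lambda_lam in Jv *; exists 0.
  by have [h1 h2] := superlevel BVv nv Jv nae; split.
Qed.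

End minimization.

Theorem theorem3p2 (R : realType) (N : nat) (beta : R) (Omega : set 'rV[R]_N)
    (hN : (2 <= N)%N) (hbeta : -1 < beta)
    (Omega_neq0 : Omega !=set0) (Omega_open : open Omega)
    (Omega_bounded : bounded_set Omega) (Omega_connected : connected Omega)
    (Omega_lipschitz : 0 <= beta -> lipschitz_boundary Omega)
    (Omega_C1 : beta < 0 -> C1_boundary Omega) :
  [/\ exists u, is_minimizer Omega beta u,
      Lambda Omega beta = ell Omega beta &
      forall v, is_minimizer Omega beta v ->
        ~ {ae leb, forall x, Omega x -> v x <= 0} ->
        exists t : R,
          let E := Omega `&` [set x | t < v x] in
          admissible Omega E /\ Lambda Omega beta = Rquot Omega beta E].
Proof.
case: N Omega hN Omega_neq0 Omega_open Omega_bounded Omega_connected Omega_lipschitz Omega_C1 => // n Om _ O0 oO bO _ lO cO.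
have bOm : bmeas Om by split => //; exact: open_lmble.
have [b0|b0] := leP 0 beta.
  have LO := lO b0; have [M0 M00 ch0] := lipschitz_flat_charts0 oO bOm LO.
  apply: (minimization oO bOm O0 _ M00 ch0 hbeta).
    exact: (boundary_patches oO (fun g Pg => or_introl Pg) LO).
  move=> M eta M1 eta0; have [V [oV hV ch]] := lipschitz_flat_charts oO bOm LO M1 eta0.
  by exists V; split => //; left; rewrite le_min b0 ler01.
have CO := cO b0; have ch M : 1 < M -> forall x, frontier Om x -> exists r nu, flat_chart Om set0 x r nu M.
  exact: C1_flat_charts.
(* The value 2 is one admissible choice above 1 for the crude charts; those with [M] close to 1 are
   supplied separately, with empty exceptional set. *)
apply: (minimization oO bOm O0 _ (ltr0n R 2) (ch 2 (ltr1n R 2)) hbeta).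
  exact: (boundary_patches oO (fun g Pg => or_intror Pg) CO).
move=> M eta M1 eta0; exists set0; split; [exact: open0|by right| |exact: ch].
by rewrite setI0 outer_measure0 lee_fin ltW.
Qed.
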